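(* Let $T>0$ and let $\sigma:[0,T]\times\mathscr{P}_2\to\mathbb{R}^d\otimes\mathbb{R}^d$ be measurable such that $\sigma$ is invertible with $\|\sigma\|_\infty+\|\sigma^{-1}\|_\infty<\infty$. Let $b:[0,T]\times\mathbb{R}^d\times\mathscr{P}\to\mathbb{R}^d$ and $B:[0,T]\times\mathscr{C}\times\mathscr{P}\to\mathbb{R}^d$ be measurable with $\|b\|_\infty+\|B\|_\infty<\infty$, and suppose there exist a constant $K>1$ and $\phi\in\mathscr{D}$ such that for any $t\in[0,T]$, $x,y\in\mathbb{R}^d$, $\mu,\nu\in\mathscr{P}_2$, $\xi,\bar\xi\in\mathscr{C}$, $$|b(t,x,\mu)-b(t,y,\nu)|\le\phi(|x-y|)+K\mathbb{W}_2(\mu,\nu),$$ $$|B(t,\xi,\mu)-B(t,\bar\xi,\nu)|\le K\big(\|\xi-\bar\xi\|_{\mathscr{C}}+\mathbb{W}_2(\mu,\nu)\big).$$ Let $P_t$ be associated, as described in the context, with the SDE $$\mathrm{d}X(t)=B(t,X_t,\mathscr{L}_{X_t})\,\mathrm{d}t+b(t,X(t),\mathscr{L}_{X_t})\,\mathrm{d}t+\sigma(t,\mathscr{L}_{X_t})\,\mathrm{d}W(t),\qquad t\in[0,T].$$ Then there exists a constant $C>0$ such that, with $$\beta(t,\eta,r):=\|\sigma^{-1}\|_\infty^2\left(C\frac{|\eta(-r)|^2}{t-r}+C\int_{-r}^0|\eta'(s)|^2\,\mathrm{d}s+Ct\,\phi^2\big(C\|\eta\|_{\mathscr{C}}\big)+Ct\|\eta\|_{\mathscr{C}}^2\right),$$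 for any $p>1$, $t\in(r,T]$, $\mu_0\in\mathscr{P}_2$, $\eta\in C^1([-r,0],\mathbb{R}^d)$ and $f\in\mathscr{B}_b^+(\mathscr{C})$, $$(P_tf)^p(\mu_0)\le\big(P_tf^p(\eta+\cdot)\big)(\mu_0)\times\exp\left[\frac{p}{2(p-1)}\beta(t,\eta,r)\right].$$ Moreover, for any $t\in(r,T]$, $\mu_0\in\mathscr{P}_2$, $\eta\in C^1([-r,0],\mathbb{R}^d)$ and $f\in\mathscr{B}_b^+(\mathscr{C})$ with $f\ge1$, $$(P_t\log f)(\mu_0)\le\log\big(P_tf(\eta+\cdot)\big)(\mu_0)+\beta(t,\eta,r).$$
   Context: Fix $r>0$. $\mathscr{C}=C([-r,0];\mathbb{R}^d)$ with the norm $\|\xi\|_{\mathscr{C}}=\sup_{s\in[-r,0]}|\xi(s)|$. For a continuous path $f$ on $[-r,\infty)$ the segment $f_t\in\mathscr{C}$ is $f_t(s)=f(t+s)$, $s\in[-r,0]$; $X_t$ denotes the segment of the process $X$ at time $t$, and $X(t)$ its value at $t$. $\mathscr{L}_\xi$ denotes the law of $\xi$. $W(t)$ is a $d$-dimensional Brownian motion on a complete filtered probability space $(\Omega,\{\mathscr{F}_t\}_{t\ge0},\mathbb{P})$. $\|\cdot\|_\infty$ is the uniform norm. $\mathscr{P}$ is the set of all probability measures on $\mathscr{C}$, $\mathscr{P}_2=\{\mu\in\mathscr{P}:\mu(\|\cdot\|_{\mathscr{C}}^2)<\infty\}$, and $$\mathbb{W}_2(\mu,\nu)=\inf_{\pi\in\mathbf{C}(\mu,\nu)}\Big(\int_{\mathscr{C}\times\mathscr{C}}\|\xi-\eta\|_{\mathscr{C}}^2\,\pi(\mathrm{d}\xi,\mathrm{d}\eta)\Big)^{1/2},$$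 where $\mathbf{C}(\mu,\nu)$ is the set of couplings of $\mu$ and $\nu$. $\mathscr{D}$ is the set of increasing functions $\phi:[0,\infty)\to[0,\infty)$ such that $\phi^2$ is concave and $\int_0^1\frac{\phi(s)}{s}\,\mathrm{d}s<\infty$. $\mathscr{B}_b(\mathscr{C})$ is the set of bounded measurable real functions on $\mathscr{C}$, and $\mathscr{B}_b^+(\mathscr{C})$ its nonnegative elements. For $\mu_0\in\mathscr{P}_2$, $X_t(\mu_0)$ denotes the segment at time $t$ of the solution of the SDE with $\mathscr{L}_{X_0}=\mu_0$, and $(P_tf)(\mu_0)=\mathbb{E}f(X_t(\mu_0))$ for $f\in\mathscr{B}_b(\mathscr{C})$, $t\in[0,T]$; it is understood that the SDE is well posed for initial laws in $\mathscr{P}_2$ (with $\mathscr{L}_{X_t}\in\mathscr{P}_2$), so that $P_t$ is well defined. $P_tf(\eta+\cdot)$ means $P_t$ applied to the function $\xi\mapsto f(\eta+\xi)$, and $P_tf^p(\eta+\cdot)$ means $P_t$ applied to $\xi\mapsto f(\eta+\xi)^p$. *)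

(* Defs.v *)
From HB Require Import structures.
From mathcomp Require Import all_boot all_order all_algebra.
From mathcomp Require Import all_classical all_reals all_analysis.

Set Implicit Arguments.
Unset Strict Implicit.
Unset Printing Implicit Defensive.

Import Order.TTheory GRing.Theory Num.Theory.
Import numFieldNormedType.Exports.

Local Open Scope classical_set_scope.
Local Open Scope ring_scope.

(* [`|x|] on ['cV_d] is the sup norm, hence a separate Euclidean norm. *)
Definition enorm (R : realType) (d : nat) (x : 'cV[R]_d) : R :=
  Num.sqrt (\sum_i x i 0 ^+ 2).

Definition opnorm (R : realType) (d : nat) (A : 'M[R]_d) : R :=
  sup [set enorm (A *m x) | x in [set x | enorm x <= 1]].

Definition borelV (R : realType) (d : nat) :=
  g_sigma_algebraType (@open 'cV[R]_d).

Section Segments.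
Context (R : realType) (r : R) (d : nat).

Definition segment_pred : {pred R -> 'cV[R]_d} :=
  mem [set f : R -> 'cV[R]_d | {within `[- r, 0], continuous f} /\
                               forall s, ~ `[- r, 0]%classic s -> f s = 0].

(* [segment r d] is C([-r, 0]; R^d).  An element is stored as a function on the
   whole line that vanishes off [-r, 0], so that Leibniz equality of elements is
   pointwise equality on [-r, 0]. *)
Record segment := Segment {
  segment_fun :> R -> 'cV[R]_d ;
  _ : segment_fun \in segment_pred }.

HB.instance Definition _ := [isSub for segment_fun].
HB.instance Definition _ := [Choice of segment by <:].

Lemma segment_pred_zmod : zmod_closed segment_pred.
Proof.
split.
  rewrite inE; split => //; first by move=> x; exact: cvg_cst.
move=> f g; rewrite !inE => -[cf f0] [cg g0]; split.
  exact: within_continuousB.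
by move=> s hs; rewrite !fctE f0 // g0 // subr0.
Qed.

HB.instance Definition _ :=
  GRing.isZmodClosed.Build _ segment_pred segment_pred_zmod.
HB.instance Definition _ := [SubChoice_isSubZmodule of segment by <:].
HB.instance Definition _ := isPointed.Build segment 0.

Definition snorm (xi : segment) : R :=
  sup [set enorm (xi s) | s in `[- r, 0]].

Definition segment_open (U : set segment) : Prop :=
  forall xi, U xi -> exists2 e : R, 0 < e &
    forall eta, snorm (eta - xi) < e -> U eta.

HB.instance Definition _ :=
  @isMeasurable.Build (sigma_display segment_open) segment
    <<s segment_open>> (@sigma_algebra0 _ setT segment_open)
    (@sigma_algebraC _ segment_open)
    (@sigma_algebra_bigcup _ setT segment_open).

End Segments.

Definition seg (R : realType) (r : R) (d : nat) (f : R -> 'cV[R]_d) (t : R) :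
    segment r d :=
  insubd 0 (fun s => if s \in `[- r, 0] then f (t + s) else 0).

(* The default value in [seg] is never used when the path is continuous. *)
Lemma segE (R : realType) (r : R) (d : nat) (f : R -> 'cV[R]_d) (t s : R) :
  {within `[t - r, t], continuous f} ->
  seg r f t s = if s \in `[- r, 0] then f (t + s) else 0.
Proof.
move=> cf; set g := fun s : R => if s \in `[- r, 0] then f (t + s) else 0.
have gE v : `[- r, 0]%classic v -> g v = f (t + v) by rewrite /= /g => ->.
suff gP : g \in @segment_pred R r d.
  by rewrite /seg -/g -[segment_fun _]/(val _) insubdK.
rewrite inE; split; last by move=> u /= /negP/negbTE ur; rewrite /g ur.
apply/subspace_continuousP => u ur.
have shift v : `[- r, 0]%classic v -> `[t - r, t]%classic (t + v).
  by rewrite /= !in_itv /= => /andP[v1 v2]; rewrite lerD2l v1 gerDl v2.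
have /subspace_continuousP/(_ _ (shift _ ur)) cfu := cf.
have gu : g u = f (t + u) by exact: gE.
rewrite [X in _ --> X]gu.
apply: (@cvg_trans _ ((fun v => f (t + v)) @ within `[- r, 0] (nbhs u))).
  by apply: near_eq_cvg; rewrite near_withinE; near=> v => vr; exact/esym/gE.
move=> A /cfu hA; rewrite /within /=.
have ct : (fun v => t + v) @ u --> t + u.
  by apply: cvgD; [exact: cvg_cst|exact: cvg_id].
have := ct _ hA; rewrite nbhs_simpl /= => hU.
rewrite nbhs_simpl /=; near=> v => /shift.
by near: v.
Unshelve. all: by end_near.
Qed.

(* [deta] is the derivative of [eta] on the closed interval, one-sided at the
   endpoints. *)
Definition is_C1 (R : realType) (r : R) (d : nat) (eta : segment r d)
    (deta : R -> 'cV[R]_d) : Prop :=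
  {within `[- r, 0], continuous deta} /\
  forall s, `[- r, 0]%classic s ->
    (fun h => h^-1 *: (eta (s + h) - eta s)) @
      within [set h | `[- r, 0]%classic (s + h)] (0 : R)^' --> deta s.

Definition dini_class (R : realType) (phi : R -> R) : Prop :=
  [/\ forall x, 0 <= x -> 0 <= phi x,
      forall x y, 0 <= x -> x <= y -> phi x <= phi y,
      forall x y l, 0 <= x -> 0 <= y -> 0 <= l <= 1 ->
        l * phi x ^+ 2 + (1 - l) * phi y ^+ 2 <=
        phi (l * x + (1 - l) * y) ^+ 2 &
      (\int[lebesgue_measure]_(s in `]0%R, 1%R]) (phi s / s)%:E < +oo)%E].

Section Wasserstein.
Context (R : realType) (r : R) (d : nat).
Notation Cr := (segment r d).

Definition P2 : set (pprobability Cr R) :=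
  [set mu : probability Cr R |
    (\int[mu]_xi (snorm xi ^+ 2)%:E < +oo)%E].

Definition couplings (mu nu : probability Cr R) :
    set (probability (Cr * Cr)%type R) :=
  [set pi | (forall A, measurable A -> pi (A `*` setT) = mu A) /\
            (forall A, measurable A -> pi (setT `*` A) = nu A)].

Definition W2 (mu nu : probability Cr R) : \bar R :=
  ereal_inf [set (poweR (\int[pi]_z (snorm (z.1 - z.2) ^+ 2)%:E) 2^-1)%E
            | pi in couplings mu nu].

Definition Bb_plus (f : Cr -> R) : Prop :=
  [/\ measurable_fun setT f, exists M, forall xi, f xi <= M &
      forall xi, 0 <= f xi].

End Wasserstein.

Definition unorm (R : realType) (U : Type) (D : set U) (g : U -> R) : \bar R :=
  ereal_sup [set (g u)%:E | u in D].
Arguments unorm {R U} D%_classical_set_scope g%_ring_scope.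

Section Stochastic.
Context (R : realType) (dO : measure_display) (Omega : measurableType dO).
Context (P : probability Omega R) (F : R -> set (set Omega)).

Definition complete_filtration : Prop :=
  [/\ forall t, 0 <= t -> sigma_algebra setT (F t),
      forall t, 0 <= t -> F t `<=` dO.-measurable,
      forall s t, 0 <= s -> s <= t -> F s `<=` F t &
      forall N, P.-negligible N -> F 0 N].

Definition measurable_wrt (G : set (set Omega)) (dE : measure_display)
    (E : measurableType dE) (f : Omega -> E) : Prop :=
  forall A, measurable A -> G (f @^-1` A).

(* The increment over [s, t] is independent of F_s with independent
   N(0, t - s) coordinates; [normal_prob] takes the standard deviation. *)
Definition brownian_motion (d : nat) (W : R -> Omega -> 'cV[R]_d) : Prop :=
  [/\ {ae P, forall w, W 0 w = 0},
      forall w, {within `[0, +oo[, continuous (W ^~ w)},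
      forall t i, 0 <= t -> measurable_wrt (F t) (fun w => W t w i 0) &
      forall s t (A : set Omega) (D : 'I_d -> set R), 0 <= s -> s < t ->
        F s A -> (forall i, measurable (D i)) ->
        P (A `&` [set w | forall i, D i ((W t w - W s w) i 0)]) =
        (P A *
         (\prod_(i < d) fine (normal_prob 0 (Num.sqrt (t - s)) (D i)))%:E)%E].

(* The simple process sum_(k < n) xi_k 1_(tau_k, tau_(k+1)]. *)
Record simple_process := SimpleProcess {
  sp_size : nat ;
  sp_time : nat -> R ;
  sp_val : nat -> Omega -> R ;
  sp_time0 : 0 <= sp_time 0 ;
  sp_time_le : forall k, sp_time k <= sp_time k.+1 ;
  sp_adapted : forall k, measurable_wrt (F (sp_time k)) (sp_val k) ;
  sp_bounded : forall k, exists M, forall w, `|sp_val k w| <= M }.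

Definition simple_eval (H : simple_process) (s : R) (w : Omega) : R :=
  \sum_(k < sp_size H)
    sp_val H k w * \1_(`]sp_time H k, sp_time H k.+1]) s.

Definition simple_integral (H : simple_process) (W : R -> Omega -> R)
    (t : R) (w : Omega) : R :=
  \sum_(k < sp_size H) sp_val H k w *
    (W (Num.min t (sp_time H k.+1)) w - W (Num.min t (sp_time H k)) w).

(* [M] is a continuous version on [0, T] of the Ito integral of the
   square-integrable integrand [h] against the scalar Brownian motion [W]. *)
Definition is_ito_integral (T : R) (h : R -> Omega -> R) (W : R -> Omega -> R)
    (M : R -> Omega -> R) : Prop :=
  [/\ forall t, 0 <= t <= T -> measurable_wrt (F t) (M t),
      forall w, {within `[0, T], continuous (M ^~ w)} &
      exists H : nat -> simple_process,
        (\int[lebesgue_measure]_(s in `[0%R, T])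
            \int[P]_w ((simple_eval (H n) s w - h s w) ^+ 2)%:E)%E
          @[n --> \oo] --> 0%E /\
        forall t, 0 <= t <= T ->
          (\int[P]_w ((simple_integral (H n) W t w - M t w) ^+ 2)%:E)%E
            @[n --> \oo] --> 0%E].

Definition has_law (dE : measure_display) (E : measurableType dE)
    (xi : Omega -> E) (mu : probability E R) : Prop :=
  measurable_fun setT xi /\ forall A, measurable A -> mu A = P (xi @^-1` A).

Context (r T : R) (d : nat) (W : R -> Omega -> 'cV[R]_d).
Context (B : R -> segment r d -> pprobability (segment r d) R -> 'cV[R]_d).
Context (b : R -> 'cV[R]_d -> pprobability (segment r d) R -> 'cV[R]_d).
Context (sigma : R -> pprobability (segment r d) R -> 'M[R]_d).

(* [mu t] is the law of the segment X_t.  Measures in the library are functions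
   on all sets, so the law is pinned down on measurable sets only; coefficients
   that are measurable in the measure argument do not see the difference. *)
Definition is_solution (X : R -> Omega -> 'cV[R]_d) : Prop :=
  exists (mu : R -> pprobability (segment r d) R)
         (M : 'I_d -> 'I_d -> R -> Omega -> R),
  [/\ forall w, {within `[- r, T], continuous (X ^~ w)},
      forall t, 0 <= t <= T ->
        measurable_wrt (F t) (fun w => seg r (X ^~ w) t),
      forall t, 0 <= t <= T ->
        has_law (fun w => seg r (X ^~ w) t) (mu t) /\ P2 (mu t),
      forall i j, is_ito_integral T (fun s _ => sigma s (mu s) i j)
                    (fun t w => W t w j 0) (M i j) &
      {ae P, forall w, forall t i, 0 <= t <= T ->
        X t w i 0 = X 0 w i 0
          + \int[lebesgue_measure]_(s in `[0, t])
              B s (seg r (X ^~ w) s) (mu s) i 0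
          + \int[lebesgue_measure]_(s in `[0, t]) b s (X s w) (mu s) i 0
          + \sum_(j < d) M i j t w}].

Definition solution_from (mu0 : pprobability (segment r d) R)
    (X : R -> Omega -> 'cV[R]_d) : Prop :=
  is_solution X /\ has_law (fun w => seg r (X ^~ w) 0) mu0.

(* Existence and uniqueness in law from every initial law in P_2. *)
Definition well_posed : Prop :=
  forall mu0, P2 mu0 ->
    (exists X, solution_from mu0 X) /\
    (forall X Y, solution_from mu0 X -> solution_from mu0 Y ->
       forall t, 0 <= t <= T -> forall A : set (segment r d), measurable A ->
         P [set w | A (seg r (X ^~ w) t)] = P [set w | A (seg r (Y ^~ w) t)]).

Definition sde_solution (mu0 : pprobability (segment r d) R) :
    R -> Omega -> 'cV[R]_d :=
  xget (fun _ _ => 0) (solution_from mu0).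

Definition semigroup (t : R) (f : segment r d -> R)
    (mu0 : pprobability (segment r d) R) : R :=
  \int[P]_w f (seg r (sde_solution mu0 ^~ w) t).

End Stochastic.

(* [sinv] stands for the uniform norm of the inverse of sigma. *)
Definition harnack_beta (R : realType) (r : R) (d : nat) (sinv : R)
    (phi : R -> R) (C : R) (t : R) (eta : segment r d) (deta : R -> 'cV[R]_d) :
    R :=
  sinv ^+ 2 *
    (C * (enorm (eta (- r)) ^+ 2 / (t - r))
     + C * \int[lebesgue_measure]_(s in `[- r, 0]) (enorm (deta s) ^+ 2)
     + C * t * phi (C * snorm eta) ^+ 2
     + C * t * snorm eta ^+ 2).

(* Main.v *)
Require Import Defs.
From HB Require Import structures.
From mathcomp Require Import all_boot all_order all_algebra.
From mathcomp Require Import all_classical all_reals all_analysis.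
From mathcomp Require Import measurable_realfun ring lra.

Set Implicit Arguments.
Unset Strict Implicit.
Unset Printing Implicit Defensive.

Import Order.TTheory GRing.Theory Num.Theory.
Import numFieldNormedType.Exports.

Local Open Scope classical_set_scope.
Local Open Scope ring_scope.

(* The laws [mu s] of the segments of the solution are frozen, so that the drift depends
   on the path and on time only and the noise coefficient on time only.  An increment of
   the noise over [s, u] is then a limit of Gaussian functionals of the Brownian motion:
   it is independent of the past, and translating it by [h] costs
   [sinv^2 |h|^2 / (u - s)] in a power Harnack inequality.

   The whole path over [- r, t] is a single segment, and the solution is compared with
   an Euler chain on a mesh.  A deterministic path [shift_path], which vanishes before
   time 0 and equals [eta] on the last stretch of length [r], is added to the chain by
   translating every noise increment; the translation compensates both the increment of
   [shift_path] and the change it causes in the drift.  The costs add up along the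
   backward recursion of the transition kernels.  As the mesh tends to 0, the chains
   converge pathwise to the solution and to the solution plus [shift_path], without any
   Lipschitz property of the drift: only the consistency error is summed, since the chain
   uses the drift evaluated along the solution.  This also needs a lower bound for the
   limit of the unshifted chain, which is the same comparison applied to [1 - f] with
   exponents decreasing to 1.

   The log-Harnack inequality is the power inequality with exponent 2 for [sqrt f],
   combined with Jensen's inequality for [ln]. *)

(** * Euclidean and segment norms *)

(** The quantity in the middle of the comparison is the value of the genuine Euler scheme, whose
    drift is read at the chain itself. With modulus [phi] for the drift there is no Gronwall
    estimate that would keep this scheme near the solution path by path. A comparison of laws is
    enough. A chain that follows the solution, or the solution plus [shift_path], differs from the
    scheme by one drift discrepancy per step, paid for by translating a Gaussian increment at the
    price of its square over the step length. These prices add up to [beta] for the shifted chain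
    and to a vanishing quantity for the unshifted one, so the scheme value is controlled from both
    sides.

    Storing the whole path turns an equation with memory into a Markov chain on one state space. The
    costs add without loss because the exponent [p] is the same at every step.

    The constant [12 * K ^+ 2] is [3 * (2 * K) ^+ 2]: 3 for the square of a sum of three terms
    (increment of the shift, [phi] part, Lipschitz part), and 2 to leave room between the distance
    of the paths at finite mesh and its limit. *)

Section Enorm.
Context (R : realType) (d : nat).
Implicit Types x y : 'cV[R]_d.

Lemma enorm_sqr x : enorm x ^+ 2 = \sum_i x i 0 ^+ 2.
Proof. by rewrite sqr_sqrtr// sumr_ge0// => i _; exact: sqr_ge0. Qed.

Lemma enorm_ge0 x : 0 <= enorm x. Proof. exact: sqrtr_ge0. Qed.

Lemma enorm0 : enorm (0 : 'cV[R]_d) = 0.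
Proof. by rewrite /enorm big1 ?sqrtr0// => i _; rewrite mxE expr0n. Qed.

Lemma enormZ a x : enorm (a *: x) = `|a| * enorm x.
Proof.
rewrite /enorm -sqrtr_sqr -sqrtrM ?sqr_ge0//; congr Num.sqrt.
by rewrite mulr_sumr; apply: eq_bigr => i _; rewrite mxE exprMn.
Qed.

Lemma enormN x : enorm (- x) = enorm x.
Proof. by rewrite -scaleN1r enormZ normrN1 mul1r. Qed.

Lemma enormB x y : enorm (x - y) = enorm (y - x).
Proof. by rewrite -enormN opprB. Qed.

Lemma enorm_coord x i : `|x i 0| <= enorm x.
Proof.
rewrite -ler_sqr ?nnegrE ?enorm_ge0// enorm_sqr real_normK ?num_real//.
by rewrite (bigD1 i)//= lerDl sumr_ge0// => j _; exact: sqr_ge0.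
Qed.

(** Summing the squares of [Y * a i - A * c i] gives [Y * (X * Y - A ^+ 2)], and [Y] can be divided
    out; when [Y = 0] all [c i] vanish. *)
Lemma sum_cauchy_schwarz (I : finType) (a c : I -> R) :
  (\sum_i a i * c i) ^+ 2 <= (\sum_i a i ^+ 2) * (\sum_i c i ^+ 2).
Proof.
set A := \sum_i a i * c i; set X := \sum_i a i ^+ 2; set Y := \sum_i c i ^+ 2.
have Y0 : 0 <= Y by apply: sumr_ge0 => i _; exact: sqr_ge0.
have [Y00|Yn0] := eqVneq Y 0.
  have c0 i : c i = 0.
    have /eqP := Y00; rewrite psumr_eq0; last by move=> ? _; exact: sqr_ge0.
    by move=> /allP/(_ i); rewrite mem_index_enum => /(_ isT)/=; rewrite sqrf_eq0 => /eqP.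
  by rewrite Y00 mulr0 /A big1 ?expr0n// => i _; rewrite c0 mulr0.
have Yp : 0 < Y by rewrite lt0r Yn0.
have : 0 <= \sum_i (Y * a i - A * c i) ^+ 2 by apply: sumr_ge0 => i _; exact: sqr_ge0.
have -> : \sum_i (Y * a i - A * c i) ^+ 2 =
    Y ^+ 2 * X + (- (2 * Y * A)) * A + A ^+ 2 * Y.
  transitivity (\sum_i (Y ^+ 2 * a i ^+ 2 + (- (2 * Y * A)) * (a i * c i)
                         + A ^+ 2 * c i ^+ 2)).
    by apply: eq_bigr => i _; ring.
  by rewrite !big_split/= -!mulr_sumr.
rewrite (_ : _ + _ = Y * (X * Y - A ^+ 2)); last by ring.
by rewrite pmulr_rge0// subr_ge0.
Qed.

Lemma enormD x y : enorm (x + y) <= enorm x + enorm y.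
Proof.
rewrite -ler_sqr ?nnegrE ?addr_ge0 ?enorm_ge0//.
rewrite sqrrD !enorm_sqr.
have -> : \sum_i (x + y) i 0 ^+ 2 =
    \sum_i x i 0 ^+ 2 + (\sum_i x i 0 * y i 0) *+ 2 + \sum_i y i 0 ^+ 2.
  rewrite -mulr_natr mulr_suml -!big_split/=; apply: eq_bigr => i _.
  by rewrite mxE; ring.
rewrite lerD2r lerD2l lerMn2r/= (le_trans (ler_norm _))//.
rewrite -ler_sqr ?nnegrE ?mulr_ge0 ?enorm_ge0//.
by rewrite real_normK ?num_real// exprMn !enorm_sqr sum_cauchy_schwarz.
Qed.

Lemma enorm_sum (I : Type) (s : seq I) (P : pred I) (v : I -> 'cV[R]_d) :
  enorm (\sum_(i <- s | P i) v i) <= \sum_(i <- s | P i) enorm (v i).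
Proof.
elim/big_ind2 : _ => [|x a y c xa yc|i _]; rewrite ?enorm0//.
by rewrite (le_trans (enormD _ _))// lerD.
Qed.

Lemma enorm_le_sum x : enorm x <= \sum_i `|x i 0|.
Proof.
have xE : x = \sum_i x i 0 *: delta_mx i 0.
  by rewrite {1}[x]matrix_sum_delta; apply: eq_bigr => i _; rewrite big_ord1.
rewrite {1}xE (le_trans (enorm_sum _ _ _))//; apply: ler_sum => i _.
rewrite enormZ [X in _ * X](_ : _ = 1) ?mulr1//.
rewrite /enorm (bigD1 i)//= big1; last first.
  by move=> j /negbTE ji; rewrite !mxE ji/= expr0n.
by rewrite !mxE !eqxx/= expr1n addr0 sqrtr1.
Qed.

Lemma norm_le_enorm x : `|x| <= enorm x.
Proof.
rewrite /Num.norm/= mx_normrE; apply: bigmax_le; first exact: enorm_ge0.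
by move=> [i j] _ /=; rewrite (ord1 j) enorm_coord.
Qed.

Lemma enorm_le_norm x : enorm x <= d%:R * `|x|.
Proof.
rewrite (le_trans (enorm_le_sum x))//.
apply: (@le_trans _ _ (\sum_(i < d) `|x|)); last first.
  by rewrite sumr_const card_ord -[leLHS]mulr_natl.
apply: ler_sum => i _; rewrite [leRHS]/Num.norm/= mx_normrE.
exact: (le_bigmax _ _ (i, 0)).
Qed.

(** The topology on vectors is that of the sup norm. The two norms differ by a factor at most [d],
    so continuity can be tested with [enorm]. *)
Lemma within_enormP (a c : R) (f : R -> 'cV[R]_d) :
  {within `[a, c], continuous f} <->
  (forall s, a <= s <= c -> forall e : R, 0 < e -> exists2 de : R, 0 < de &
     forall s', a <= s' <= c -> `|s' - s| < de -> enorm (f s' - f s) < e).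
Proof.
split => [/subspace_continuousP cf s sac e e0|H].
  (* [d + 1] keeps the divisor positive when [d = 0]. *)
  have e1 : 0 < e / (d%:R + 1) by rewrite divr_gt0// ltr_wpDl.
  have := cf s; rewrite /= in_itv/= => /(_ sac) /cvgrPdist_lt /(_ _ e1).
  rewrite near_withinE => /nbhs_ballP[de/= de0 Hde]; exists de => // s' s'ac ss'.
  have := Hde s'; rewrite /ball/= distrC => /(_ ss'); rewrite in_itv/= => /(_ s'ac) h.
  rewrite enormB (le_lt_trans (enorm_le_norm _))//.
  rewrite (@le_lt_trans _ _ ((d%:R + 1) * `|f s - f s'|))//.
    by rewrite ler_wpM2r// lerDl.
  by rewrite -ltr_pdivlMl ?ltr_wpDl// mulrC.
apply/subspace_continuousP => s; rewrite /= in_itv/= => sac.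
apply/cvgrPdist_lt => e e0; have [de de0 Hde] := H s sac e e0.
rewrite near_withinE; apply/nbhs_ballP; exists de => // s' /=.
rewrite /ball/= distrC => ss'; rewrite in_itv/= => s'ac.
by rewrite (le_lt_trans (norm_le_enorm _))// enormB Hde.
Qed.

End Enorm.

Section Segment_norm.
Context (R : realType) (r : R) (d : nat).
Hypothesis r0 : 0 <= r.
Notation S := (segment r d).
Implicit Types x y : S.

Lemma segment_enormP x s : - r <= s <= 0 -> forall e : R, 0 < e ->
  exists2 de : R, 0 < de & forall s', - r <= s' <= 0 -> `|s' - s| < de ->
    enorm (x s' - x s) < e.
Proof.
by apply: (@within_enormP _ _ (- r) 0 x).1; case: x => f/=; rewrite inE => -[].
Qed.

Lemma segment_out x s : ~~ (- r <= s <= 0) -> x s = 0.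
Proof.
case: x => f /= /[!inE] -[_ f0] /negP sr; apply: f0.
by rewrite /= in_itv.
Qed.

Lemma segment_eq x y : (forall s, - r <= s <= 0 -> x s = y s) -> x = y.
Proof.
move=> xy; apply: val_inj; apply/funext => s /=.
have [/xy//|sr] := boolP (- r <= s <= 0).
by rewrite [LHS]segment_out// [RHS]segment_out.
Qed.

(** Heine's theorem. Compactness is used as a near covering, with the modulus [de] running along the
    right neighbourhoods of 0. *)
Lemma segment_unif x (e : R) : 0 < e ->
  exists2 de : R, 0 < de & forall s s', - r <= s <= 0 -> - r <= s' <= 0 ->
    `|s' - s| < de -> enorm (x s' - x s) < e.
Proof.
move=> e0; have e2 : 0 < e / 2 by rewrite divr_gt0.
have cK := @segment_compact R (- r) 0.
have /compact_near_coveringP/near_covering_withinP := cK.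
move=> /(_ R (0 : R)^'+ (fun de s => forall s', - r <= s' <= 0 ->
   `|s' - s| < de -> enorm (x s' - x s) < e)).
case.
  move=> s; rewrite /= in_itv/= => sr.
  have [de de0 Hde] := segment_enormP x sr e2.
  exists (ball s (de / 2), [set t | 0 < t < de / 2]) => /=.
    split; first by apply: nbhsx_ballx; rewrite divr_gt0.
    rewrite /nbhs/=; exists (de / 2) => /=; first by rewrite divr_gt0.
    move=> t/=; rewrite sub0r normrN => tde t0; rewrite t0/=.
    by rewrite (le_lt_trans (ler_norm _)).
  move=> [u t]/= [+ /andP[t0 tde]]; rewrite /ball/= in_itv/= => su ur s' s'r s'u.
  rewrite (_ : x s' - x u = (x s' - x s) - (x u - x s)); last by rewrite opprB addrA subrK.
  rewrite (le_lt_trans (enormD _ _))// enormN [ltRHS](splitr e) ltrD//.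
    apply: Hde => //; rewrite (_ : s' - s = (s' - u) + (u - s)); last by rewrite addrA subrK.
    rewrite (le_lt_trans (ler_normD _ _))// [ltRHS](splitr de) ltrD ?(lt_trans s'u)//.
    by rewrite distrC.
  by apply: Hde => //; rewrite distrC (lt_trans su)// ltr_pdivrMr// ltr_pMr// ltr1n.
move=> t/= t0 Ht; exists (t / 2); first by rewrite divr_gt0.
move=> s s' sr s'r ss'; apply: (Ht (t / 2)) => //=.
- by rewrite sub0r normrN gtr0_norm ?divr_gt0// ltr_pdivrMr// ltr_pMr// ltr1n.
- by rewrite divr_gt0.
Qed.

(** Walking back from 0 in steps of half the modulus for 1, the norm grows by at most 1 per step.
    Boundedness makes the real [sup] in [snorm] a true supremum. *)
Lemma segment_bounded x : exists M : R, forall s, - r <= s <= 0 -> enorm (x s) <= M.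
Proof.
have [de de0 H] := @segment_unif x 1 ltr01.
pose n := (Num.truncn (r / de)).+1.
have rn : r < n%:R * de by rewrite -ltr_pdivrMr// truncnS_gt.
have step k s : - r <= s <= 0 -> - s <= k%:R * (de / 2) -> enorm (x s) <= enorm (x 0) + k%:R.
  elim: k s => [|k IH] s sr.
    rewrite mul0r oppr_le0 => s0; rewrite addr0 (_ : s = 0)//.
    by apply: le_anti; rewrite s0 andbT; case/andP: sr.
  move=> sk; pose s1 := Num.min 0 (s + de / 2).
  have s1r : - r <= s1 <= 0.
    case/andP: sr => sr s0.
    rewrite /s1 le_min oppr_le0 r0/= ge_min lexx/= andbT.
    by rewrite (le_trans sr)// lerDl divr_ge0// ltW.
  rewrite (_ : x s = x s1 + (x s - x s1)); last by rewrite addrCA subrr addr0.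
  rewrite (le_trans (enormD _ _))// -natr1 addrA lerD//.
    apply: IH => //; rewrite /s1; case: (leP 0 (s + de / 2)) => _.
      by rewrite oppr0 mulr_ge0// divr_ge0// ltW.
    by rewrite opprD lerBlDr -[X in _ + X]mul1r -mulrDl natr1.
  rewrite ltW// H//; rewrite /s1; case: (leP 0 (s + de / 2)) => h.
    rewrite subr0; case/andP: sr => sr s0; rewrite ler0_norm//.
    rewrite (@le_lt_trans _ _ (de / 2))//; first by rewrite -subr_ge0 opprK addrC.
    by rewrite ltr_pdivrMr// ltr_pMr// ltr1n.
  rewrite opprD addNKr normrN gtr0_norm ?divr_gt0//.
  by rewrite ltr_pdivrMr// ltr_pMr// ltr1n.
exists (enorm (x 0) + (n * 2)%:R) => s sr; apply: step => //.
have /andP[sr' _] := sr; rewrite (le_trans (_ : - s <= r))//; first by rewrite lerNl.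
by rewrite (le_trans (ltW rn))// natrM mulrACA [2 * _]mulrC -mulrA mulVf// mulr1 mulrC.
Qed.

Lemma snorm_ge x s : - r <= s <= 0 -> enorm (x s) <= snorm x.
Proof.
move=> sr; rewrite /snorm; apply: ub_le_sup; last first.
  by exists s => //=; rewrite in_itv.
have [M HM] := segment_bounded x.
by exists M => _ [u /= + <-]; rewrite in_itv/=; exact: HM.
Qed.

Lemma snorm_le x (M : R) : (forall s, - r <= s <= 0 -> enorm (x s) <= M) -> snorm x <= M.
Proof.
move=> H; apply: ge_sup => [|_ [s /= + <-]].
  by exists (enorm (x 0)); exists 0 => //=; rewrite in_itv/= lexx oppr_le0 r0.
by rewrite in_itv/=; exact: H.
Qed.

Lemma snorm_ge0 x : 0 <= snorm x.
Proof.
by rewrite (le_trans (enorm_ge0 (x 0)))// snorm_ge// lexx oppr_le0 r0.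
Qed.

Lemma segmentD x y s : (x + y) s = x s + y s.
Proof. by []. Qed.

Lemma segmentN x s : (- x) s = - x s.
Proof. by []. Qed.

Lemma segment0 s : (0 : S) s = 0.
Proof. by []. Qed.

Lemma snorm0 : snorm (0 : S) = 0.
Proof.
apply: le_anti; rewrite snorm_ge0 andbT; apply: snorm_le => s _.
by rewrite segment0 enorm0.
Qed.

Lemma snormN x : snorm (- x) = snorm x.
Proof.
have H (z : S) : snorm (- z) <= snorm z.
  by apply: snorm_le => s sr; rewrite segmentN enormN snorm_ge.
by apply: le_anti; rewrite H -{1}[x]opprK H.
Qed.

Lemma snormB x y : snorm (x - y) = snorm (y - x).
Proof. by rewrite -snormN opprB. Qed.

Lemma snormD x y : snorm (x + y) <= snorm x + snorm y.
Proof.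
apply: snorm_le => s sr; rewrite segmentD (le_trans (enormD _ _))//.
by rewrite lerD// snorm_ge.
Qed.

Lemma snorm_dist x y z : snorm (x - z) <= snorm (x - y) + snorm (y - z).
Proof. by rewrite (le_trans _ (snormD _ _))// addrA subrK. Qed.

Lemma snorm_sum (I : Type) (l : seq I) (Q : pred I) (v : I -> S) :
  snorm (\sum_(i <- l | Q i) v i) <= \sum_(i <- l | Q i) snorm (v i).
Proof.
elim/big_ind2 : _ => [|a b c e ab ce|i _]; rewrite ?snorm0//.
by rewrite (le_trans (snormD _ _))// lerD.
Qed.

End Segment_norm.

(** * Ramps and piecewise linear interpolation *)

Section Ramp.
Context (R : realType).
Implicit Types a c u v : R.

Definition ramp a c u : R := Num.min 1 (Num.max 0 ((u - a) / (c - a))).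

Lemma ramp_itv a c u : 0 <= ramp a c u <= 1.
Proof.
by rewrite /ramp le_min ler01 le_max lexx/= ge_min lexx.
Qed.

Lemma ramp_le a c u : a < c -> u <= a -> ramp a c u = 0.
Proof.
move=> ac ua; rewrite /ramp max_l ?min_r ?ler01//.
by rewrite pmulr_lle0 ?invr_gt0 ?subr_gt0// subr_le0.
Qed.

Lemma ramp_ge a c u : a < c -> c <= u -> ramp a c u = 1.
Proof.
move=> ac cu; rewrite /ramp min_l// le_max; apply/orP; right.
by rewrite ler_pdivlMr ?subr_gt0// mul1r lerD2r.
Qed.

Lemma ramp_lip a c u v : a < c -> `|ramp a c u - ramp a c v| <= `|u - v| / (c - a).
Proof.
move=> ac; rewrite /ramp.
rewrite (_ : `|u - v| / (c - a) = `|(u - a) / (c - a) - (v - a) / (c - a)|); last first.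
  rewrite -mulrBl (_ : u - a - (v - a) = u - v); last by ring.
  by rewrite normrM (@gtr0_norm _ (c - a)^-1)// invr_gt0 subr_gt0.
set x := (u - a) / _; set y := (v - a) / _.
case: (leP 0 x) => x0; case: (leP 0 y) => y0;
  rewrite ?(min_r (@ler01 R)); case: (leP 1 x) => x1; case: (leP 1 y) => y1;
  rewrite ler_norml; case: (ler0P (x - y)) => h; apply/andP; split; lra.
Qed.

End Ramp.

Section Segment_paths.
Context (R : realType) (r : R) (d : nat).
Hypothesis r0 : 0 <= r.
Notation S := (segment r d).
Implicit Types (x y : S) (a c : R).

Lemma segE0 (f : R -> 'cV[R]_d) s : {within `[- r, 0], continuous f} ->
  - r <= s <= 0 -> seg r f 0 s = f s.
Proof. by move=> cf sr; rewrite segE ?sub0r// in_itv/= sr add0r. Qed.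

(** The increment [v] received linearly over [a, c] and kept afterwards, as an element of the path
    space. It is linear in [v], so drift steps, noise steps and their translations are all added as
    segments. *)
Definition vramp (v : 'cV[R]_d) a c : S := seg r (fun u => ramp a c u *: v) 0.

Lemma vrampE v a c s : a < c -> - r <= s <= 0 -> vramp v a c s = ramp a c s *: v.
Proof.
move=> ac; apply: segE0; apply/within_enormP => u _ e e0.
have v1 : 0 < enorm v + 1 by rewrite ltr_wpDl ?enorm_ge0.
exists (e * (c - a) / (enorm v + 1)).
  by rewrite divr_gt0// mulr_gt0// subr_gt0.
move=> u' _; rewrite ltr_pdivlMr// => uu'; rewrite -scalerBl enormZ.
apply: (@le_lt_trans _ _ (`|u' - u| / (c - a) * enorm v)).
  by rewrite ler_wpM2r ?enorm_ge0// ramp_lip.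
rewrite mulrAC ltr_pdivrMr ?subr_gt0//; apply: le_lt_trans uu'.
by rewrite ler_wpM2l// lerDl.
Qed.

Lemma vramp_snorm v a c : a < c -> snorm (vramp v a c) <= enorm v.
Proof.
move=> ac; apply: snorm_le => // s sr; rewrite vrampE// enormZ.
have /andP[h0 h1] := ramp_itv a c s.
by rewrite ger0_norm// ler_piMl ?enorm_ge0.
Qed.

Lemma vrampD v w a c : a < c -> vramp (v + w) a c = vramp v a c + vramp w a c.
Proof.
move=> ac; apply: segment_eq => s sr.
by rewrite segmentD !vrampE// scalerDr.
Qed.

Lemma vrampN v a c : a < c -> vramp (- v) a c = - vramp v a c.
Proof.
by move=> ac; apply: segment_eq => s sr; rewrite segmentN !vrampE// scalerN.
Qed.

Lemma vrampB v w a c : a < c -> vramp (v - w) a c = vramp v a c - vramp w a c.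
Proof. by move=> ac; rewrite vrampD// vrampN. Qed.

Lemma vramp0 a c : a < c -> vramp 0 a c = 0.
Proof.
by move=> ac; apply: segment_eq => s sr; rewrite segment0 vrampE// scaler0.
Qed.

Lemma vramp_sum (I : Type) (l : seq I) (Q : pred I) (v : I -> 'cV[R]_d) a c :
  a < c -> vramp (\sum_(i <- l | Q i) v i) a c = \sum_(i <- l | Q i) vramp (v i) a c.
Proof.
by move=> ac; elim/big_rec2 : _ => [|i y z Qi <-]; rewrite ?vramp0 ?vrampD.
Qed.

Definition sstop a x : S := seg r (fun u => x (Num.min u a)) 0.

Lemma sstopE a x s : - r <= a <= 0 -> - r <= s <= 0 -> sstop a x s = x (Num.min s a).
Proof.
move=> ar; move=> sr; rewrite segE0//; apply/within_enormP => u ur e e0.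
have min_r w : - r <= w <= 0 -> - r <= Num.min w a <= 0.
  by case: (leP w a).
have [de de0 H] := segment_enormP x (min_r _ ur) e0.
exists de => // u' u'r uu'; apply: H; first exact: min_r.
apply: le_lt_trans uu'.
by case: (leP u a) => h1; case: (leP u' a) => h2; rewrite ?subrr ?normr0//;
  rewrite ler_norml; case: (ler0P (u' - u)) => h; apply/andP; split; lra.
Qed.

Section Interp.
Variables (a : R) (N : nat).
Hypothesis ar : - r <= a <= 0.

Definition mesh : R := - a / N%:R.
Definition gpt (k : nat) : R := a + k%:R * mesh.

(** The part of [x] known at [gpt k]: exact up to [a], polygonal up to [gpt k], constant afterwards.
    As a sum of ramps it grows by one ramp per step, like the Euler chain. *)
Definition interp x (k : nat) : S :=
  sstop a x + \sum_(j < k) vramp (x (gpt j.+1) - x (gpt j)) (gpt j) (gpt j.+1).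

Lemma interpS x k : interp x k.+1 =
  interp x k + vramp (x (gpt k.+1) - x (gpt k)) (gpt k) (gpt k.+1).
Proof. by rewrite /interp big_ord_recr/= addrA. Qed.

Lemma gpt0 : gpt 0 = a. Proof. by rewrite /gpt mul0r addr0. Qed.

Lemma gptS k : gpt k.+1 = gpt k + mesh.
Proof. by rewrite /gpt -natr1 mulrDl mul1r addrA. Qed.

Hypothesis a0 : a < 0.
Hypothesis N0 : (0 < N)%N.

Lemma mesh_gt0 : 0 < mesh.
Proof. by rewrite divr_gt0 ?oppr_gt0// ltr0n. Qed.

Lemma gpt_lt k : gpt k < gpt k.+1.
Proof. by rewrite gptS ltrDl mesh_gt0. Qed.

Lemma gptN : gpt N = 0.
Proof. by rewrite /gpt /mesh mulrC divfK ?subrr// pnatr_eq0 -lt0n. Qed.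

Lemma gpt_itv k : (k <= N)%N -> a <= gpt k <= 0.
Proof.
move=> kN; apply/andP; split.
  by rewrite /gpt lerDl mulr_ge0 ?ler0n ?(ltW mesh_gt0).
by rewrite -gptN /gpt lerD2l ler_wpM2r ?(ltW mesh_gt0)// ler_nat.
Qed.

Lemma gpt_itvr k : (k <= N)%N -> - r <= gpt k <= 0.
Proof.
move=> /gpt_itv/andP[h ->]; rewrite andbT.
by case/andP: ar => h1 _; exact: le_trans h.
Qed.

Lemma interp_ge x k s : (k <= N)%N -> gpt k <= s <= 0 -> interp x k s = x (gpt k).
Proof.
elim: k s => [|k IH] s kN /andP[ks s0].
  rewrite gpt0 in ks *; rewrite /interp big_ord0 addr0 sstopE ?min_r//.
  by rewrite s0 andbT (le_trans _ ks)//; case/andP: ar.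
have /andP[h _] := gpt_itvr kN.
rewrite interpS segmentD vrampE ?gpt_lt//; last by rewrite s0 (le_trans h).
rewrite ramp_ge ?gpt_lt// scale1r IH ?(ltnW kN) ?s0 ?(le_trans (ltW (gpt_lt k)))//.
by rewrite addrC subrK.
Qed.

(** Each value of the interpolation is a value of [x] before [a], or a convex combination of two
    neighbouring grid values at a time between them. The last hypothesis lets [s] exceed [gpt k]
    only when interval [k] belongs to the grid. *)
Lemma interp_ind x k (Q : R -> 'cV[R]_d -> Prop) : (k <= N)%N ->
  (forall s, - r <= s <= a -> Q s (x s)) ->
  (forall j s (l : R), (j < N)%N -> gpt j <= s <= gpt j.+1 -> s <= 0 -> 0 <= l <= 1 ->
     Q s ((1 - l) *: x (gpt j) + l *: x (gpt j.+1))) ->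
  forall s, - r <= s <= 0 -> s <= gpt k.+1 -> (k < N)%N || (s <= gpt k) ->
    Q s (interp x k s).
Proof.
move=> kN Qa Ql; have main j s : (j <= N)%N -> - r <= s <= 0 -> s <= gpt j ->
    Q s (interp x j s).
  elim: j => [|j IH] jN sr sj.
    have as' : a <= 0 by case/andP: ar.
    rewrite gpt0 in sj; rewrite /interp big_ord0 addr0 sstopE// min_l//.
    by apply: Qa; rewrite sj andbT; case/andP: sr.
  rewrite interpS segmentD vrampE ?gpt_lt//.
  have [sj'|sj'] := leP s (gpt j).
    by rewrite ramp_le ?gpt_lt// scale0r addr0; apply: IH => //; exact: ltnW.
  rewrite interp_ge ?(ltnW jN) ?(ltW sj')//; last by case/andP: sr.
  rewrite (_ : _ + _ = (1 - ramp (gpt j) (gpt j.+1) s) *: x (gpt j) +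
    ramp (gpt j) (gpt j.+1) s *: x (gpt j.+1)).
    by apply: Ql; rewrite ?ramp_itv ?(ltW sj')//; case/andP: sr.
  by rewrite scalerBr scalerBl scale1r addrA addrAC.
move=> s sr sk; have [sk' _|sk' /orP[kN'|//]] := leP s (gpt k); first exact: main.
rewrite interp_ge ?(ltW sk')//; last by case/andP: sr.
(* Past [gpt k] the path is frozen, which is the combination with weight 0 on the next grid
   value. *)
have := Ql k s 0 kN'; rewrite subr0 scale1r scale0r addr0; apply => //.
- by rewrite (ltW sk').
- by case/andP: sr.
- by rewrite lexx ler01.
Qed.

Lemma enorm_convex (p q z : 'cV[R]_d) (l e : R) : 0 <= l <= 1 ->
  enorm (p - z) <= e -> enorm (q - z) <= e ->
  enorm ((1 - l) *: p + l *: q - z) <= e.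
Proof.
move=> /andP[l0 l1] pe qe.
rewrite (_ : _ - z = (1 - l) *: (p - z) + l *: (q - z)); last first.
  by apply/matrixP => i j; rewrite !mxE; ring.
rewrite (le_trans (enormD _ _))// !enormZ ger0_norm ?subr_ge0// ger0_norm//.
rewrite (_ : e = (1 - l) * e + l * e); last by ring.
rewrite lerD//.
  by rewrite ler_wpM2l ?subr_ge0.
by rewrite ler_wpM2l.
Qed.

Lemma interp_snorm x k : (k <= N)%N -> snorm (interp x k) <= snorm x.
Proof.
move=> kN; apply: snorm_le => // s sr.
have [sk|sk] := leP s (gpt k); last first.
  rewrite interp_ge ?(ltW sk)//; last by case/andP: sr.
  by rewrite snorm_ge// gpt_itvr.
apply: (@interp_ind x k (fun _ v => enorm v <= snorm x)) => //.
- move=> u /andP[ru ua]; rewrite snorm_ge// ru (le_trans ua)//.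
  by case/andP: ar.
- move=> j u l jN uj u0 l01; rewrite -[_ + _]subr0.
  by apply: enorm_convex => //; rewrite subr0 snorm_ge// gpt_itvr// ltnW.
- by rewrite (le_trans sk)// ltW// gpt_lt.
- by rewrite sk orbT.
Qed.

(** [s] may lie one mesh beyond [gpt k], where the interpolation is already frozen: this is the
    stretch read by the drift of the next Euler step. *)
Lemma interp_osc x (e : R) : 0 <= e ->
  (forall s s', - r <= s <= 0 -> - r <= s' <= 0 -> `|s' - s| <= mesh ->
     enorm (x s' - x s) <= e) ->
  forall k s, (k <= N)%N -> - r <= s <= 0 -> s <= gpt k.+1 ->
    (k < N)%N || (s <= gpt k) -> enorm (interp x k s - x s) <= e.
Proof.
move=> e0 xe k s kN sr sk h.
apply: (@interp_ind x k (fun u v => - r <= u <= 0 -> enorm (v - x u) <= e)) => //.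
  by move=> u _ _; rewrite subrr enorm0.
move=> j u l jN /andP[ju uj] u0 l01 ur; rewrite gptS in uj.
apply: enorm_convex => //; apply: xe; rewrite ?gpt_itvr// ?(ltnW jN)//.
  by rewrite distrC ger0_norm ?subr_ge0//; lra.
by rewrite gptS ger0_norm ?subr_ge0//; lra.
Qed.

End Interp.
End Segment_paths.

(** * Measurability of segment-valued maps *)

Section Segment_measurable.
Context (R : realType) (r : R) (d : nat).
Hypothesis r0 : 0 <= r.
Notation S := (segment r d).
Implicit Types (x y z : S).

Lemma scontinuous_measurable (u : S -> R) :
  (forall x (e : R), 0 < e -> exists2 de : R, 0 < de &
     forall y, snorm (y - x) < de -> `|u y - u x| < e) ->
  measurable_fun setT u.
Proof.
move=> cu; apply: (measurability _ (RGenOInfty.measurableE R)) => //.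
move=> _ [_ [c ->] <-]; rewrite setTI; apply: sub_sigma_algebra => x /=.
rewrite in_itv/= andbT => cx.
have [de de0 H] := cu x (u x - c) (eq_ind _ is_true cx _ (esym (subr_gt0 _ _))).
exists de => // y /H; rewrite in_itv/= andbT ltr_norml => /andP[+ _].
by rewrite opprB ltrBrDr subrK.
Qed.

Lemma slipschitz_measurable (u : S -> R) (L : R) :
  (forall x y, `|u x - u y| <= L * snorm (x - y)) -> measurable_fun setT u.
Proof.
move=> uL; apply: scontinuous_measurable => x e e0.
have L0 : 0 < `|L| + 1 by rewrite ltr_wpDl.
exists (e / (`|L| + 1)); first by rewrite divr_gt0.
move=> y; rewrite ltr_pdivlMr// => xy; rewrite (le_lt_trans (uL _ _))//.
apply: le_lt_trans xy; rewrite mulrC ler_wpM2l ?snorm_ge0//.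
by rewrite (le_trans (ler_norm _))// lerDl.
Qed.

Lemma eval_measurable s i : measurable_fun setT (fun x : S => x s i 0).
Proof.
have [sr|sr] := boolP (- r <= s <= 0); last first.
  rewrite (_ : (fun _ => _) = cst 0); first exact: measurable_cst.
  by apply/funext => x; rewrite segment_out// mxE.
apply: (@slipschitz_measurable _ 1) => x y; rewrite mul1r.
rewrite (le_trans _ (snorm_ge _ _ sr))//.
by have := enorm_coord ((x - y) s) i; rewrite segmentD segmentN !mxE.
Qed.

Lemma snorm_lip x y : `|snorm x - snorm y| <= snorm (x - y).
Proof.
have H (u v : S) : snorm u - snorm v <= snorm (u - v).
  by rewrite lerBlDr (le_trans _ (snormD _ _ _))// subrK.
by rewrite ler_norml H andbT lerNl opprB snormB.
Qed.

Lemma snorm_measurable : measurable_fun setT (@snorm R r d).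
Proof.
by apply: (@slipschitz_measurable _ 1) => x y; rewrite mul1r snorm_lip.
Qed.

End Segment_measurable.

Section Evaluations.
Context (R : realType) (r : R) (d : nat).
Hypothesis r0 : 0 < r.
Notation S := (segment r d).
Let r0' : 0 <= r := ltW r0.

Lemma measurable_enorm dE (E : measurableType dE) (v : E -> 'cV[R]_d) :
  (forall i, measurable_fun setT (fun w => v w i 0)) ->
  measurable_fun setT (fun w => enorm (v w)).
Proof.
move=> mv; apply: (@measurableT_comp _ _ _ _ _ _ (@Num.sqrt R)).
  by apply: continuous_measurable_fun; exact: sqrt_continuous.
by apply: measurable_sum => i; apply: measurable_funX.
Qed.

(** By continuity rational times suffice; clipping them keeps the evaluation points inside
    [- r, 0]. *)
Lemma snorm_le_rat (x : S) (e : R) :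
  (forall q : rat, enorm (x (Num.max (- r) (Num.min 0 (ratr q)))) <= e) -> snorm x <= e.
Proof.
move=> H; apply: snorm_le => // s sr; apply/ler_addgt0Pr => c c0.
have [de de0 xde] := segment_enormP x sr c0.
have [q] := @rat_in_itvoo _ (s - de) (s + de) ltac:(by rewrite ltrBlDr -addrA ltrDl addr_gt0).
rewrite in_itv/= => /andP[q1 q2].
set u := Num.max (- r) (Num.min 0 (ratr q)).
have ur : - r <= u <= 0.
  rewrite /u le_max lexx/= ge_max ge_min lexx/= andbT.
  by rewrite oppr_le0.
have su : `|u - s| < de.
  rewrite /u; case/andP: sr => sr s0'.
  case: (leP 0 (ratr q)) => h1; [case: (leP (- r) 0) => h2|case: (leP (- r) (ratr q)) => h2];
    rewrite ltr_norml; apply/andP; split; lra.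
rewrite (_ : x s = x u - (x u - x s)); last by rewrite opprB addrC subrK.
rewrite (le_trans (enormD _ _))// enormN lerD ?H//.
exact/ltW/xde.
Qed.

(** A countable dense family: polygonal paths with rational increments on the mesh [r / n]. For
    [n > 0] the ramp of index 0 ends at [- r], hence contributes the initial value as a constant. *)
Definition rat_path (n : nat) (l : seq 'cV[rat]_d) : S :=
  \sum_(j < n.+1) vramp r (map_mx ratr (nth 0 l j))
     (- r + (j%:R - 1) * (r / n%:R)) (- r + j%:R * (r / n%:R)).

Lemma rat_approx (v : 'cV[R]_d) (e : R) : 0 < e ->
  exists q : 'cV[rat]_d, enorm (v - map_mx ratr q) <= e.
Proof.
move=> e0; have e1 : 0 < e / (d%:R + 1) by rewrite divr_gt0// ltr_wpDl.
have /choice[q Hq] : forall i, exists q : rat, `|v i 0 - ratr q| <= e / (d%:R + 1).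
  move=> i; have [q] := @rat_in_itvoo _ (v i 0 - e / (d%:R + 1)) (v i 0)
    ltac:(by rewrite ltrBlDr ltrDl).
  rewrite in_itv/= => /andP[q1 q2]; exists q.
  by rewrite ger0_norm ?subr_ge0 ?ltW// ltrBlDl -ltrBlDr.
exists (\col_i q i); rewrite (le_trans (enorm_le_sum _))//.
apply: (@le_trans _ _ (\sum_(i < d) (e / (d%:R + 1)))).
  by apply: ler_sum => i _; rewrite !mxE.
rewrite sumr_const card_ord -[leLHS]mulr_natl mulrA ler_pdivrMr ?ltr_wpDl//.
by rewrite mulrC ler_wpM2l ?(ltW e0)// lerDl.
Qed.

Lemma rat_path_dense (x : S) (e : R) : 0 < e ->
  exists n l, snorm (x - rat_path n l) <= e.
Proof.
move=> e0; have e2 : 0 < e / 2 by rewrite divr_gt0.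
have [de de0 xde] := segment_unif x e2.
have [n n0 rn] : exists2 n, (0 < n)%N & r / n%:R < de.
  exists (Num.truncn (r / de)).+1 => //.
  by rewrite ltr_pdivrMr ?ltr0n// mulrC -ltr_pdivrMr// truncnS_gt.
have ar : - r <= - r <= 0 by rewrite lexx oppr_le0.
have a0 : - r < 0 by rewrite oppr_lt0.
have meshE : mesh (- r) n = r / n%:R by rewrite /mesh opprK.
have osc : snorm (x - interp (- r) n x n) <= e / 2.
  apply: snorm_le => // s sr; rewrite segmentD segmentN enormB.
  apply: (@interp_osc R r d (- r) n ar a0 n0 x (e / 2) (ltW e2)) => //.
  - move=> u u' ur u'r; rewrite meshE => uu'; apply/ltW/xde => //.
    exact: le_lt_trans uu' rn.
  - rewrite gptS gptN// (le_trans (_ : s <= 0))//; first by case/andP: sr.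
    by rewrite add0r ltW// mesh_gt0.
  - by rewrite gptN//; case/andP: sr => _ ->; rewrite orbT.
pose w j : 'cV[R]_d := if j is k.+1 then x (gpt (- r) n k.+1) - x (gpt (- r) n k) else x (- r).
(* The half of [e] left over by the interpolation is shared among the [n + 1] increments. *)
have en : 0 < e / 2 / n.+1%:R by rewrite divr_gt0.
have /choice[q Hq] : forall j, exists q : 'cV[rat]_d,
    enorm (w j - map_mx ratr q) <= e / 2 / n.+1%:R.
  by move=> j; exact: rat_approx.
exists n, (mkseq q n.+1).
have lt1 j : - r + (j%:R - 1) * (r / n%:R) < - r + j%:R * (r / n%:R).
  by rewrite ltrD2l ltr_pM2r ?divr_gt0 ?ltr0n// ltrBlDr ltrDl.
have interpE : interp (- r) n x n = \sum_(j < n.+1) vramp r (w j)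
     (- r + (j%:R - 1) * (r / n%:R)) (- r + j%:R * (r / n%:R)).
  rewrite big_ord_recl /interp; congr (_ + _).
    apply: segment_eq => s sr; rewrite sstopE// vrampE// ramp_ge ?scale1r ?min_r//.
    - by case/andP: sr.
    - by rewrite mul0r addr0; case/andP: sr.
  apply: eq_bigr => j _.
  rewrite (_ : ((lift ord0 j : 'I_n.+1)%:R - 1) = j%:R :> R); last first.
    by rewrite lift0 -natr1 addrK.
  by rewrite lift0 -meshE.
rewrite (le_trans (snorm_dist r0' _ (interp (- r) n x n) _))// [leRHS]splitr lerD//.
rewrite interpE /rat_path -sumrB (le_trans (snorm_sum r0' _ _ _))//.
apply: (@le_trans _ _ (\sum_(j < n.+1) (e / 2 / n.+1%:R))).
  apply: ler_sum => j _; rewrite -vrampB// (le_trans (vramp_snorm r0' _ (lt1 j)))//.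
  by rewrite nth_mkseq.
by rewrite sumr_const card_ord -[leLHS]mulr_natl mulrC divfK.
Qed.

(* The Borel sets of [C([-r, 0]; R^d)] are generated by the evaluations, because
   the space is separable and the norm is a supremum over rational times. *)
Lemma segment_measurableP dE (E : measurableType dE) (Phi : E -> S) :
  (forall s i, - r <= s <= 0 -> measurable_fun setT (fun w => Phi w s i 0)) ->
  measurable_fun setT Phi.
Proof.
move=> mPhi; apply: (measurability (@segment_open R r d)) => // _ [U oU <-].
have mball z e : measurable [set w | snorm (Phi w - z) <= e].
  rewrite (_ : [set _ | _] = \bigcap_(q : rat)
     [set w | enorm ((Phi w - z) (Num.max (- r) (Num.min 0 (ratr q)))) <= e]); last first.
    apply/seteqP; split => [w h q _|w h].
      apply: le_trans _ h; apply: snorm_ge => //.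
      by rewrite le_max lexx/= ge_max ge_min lexx/= andbT oppr_le0.
    by apply: snorm_le_rat => q; exact: h.
  rewrite -[X in measurable X]setCK setC_bigcap; apply: measurableC.
  apply: bigcupT_measurable_rat => q; apply: measurableC.
  rewrite -[X in measurable X]setTI.
  pose g w := enorm ((Phi w - z) (Num.max (- r) (Num.min 0 (ratr q)))).
  rewrite (_ : [set _ | _] = g @^-1` `]-oo, e]%classic); last first.
    by apply/seteqP; split => w /=; rewrite in_itv.
  suff : measurable_fun setT g by apply => //; exact: measurable_itv.
  apply: measurable_enorm => i.
  rewrite (_ : (fun _ => _) = (fun w => Phi w (Num.max (- r) (Num.min 0 (ratr q))) i 0
     - z (Num.max (- r) (Num.min 0 (ratr q))) i 0)); last first.
    by apply/funext => w; rewrite segmentD segmentN !mxE.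
  apply: measurable_funB => //; apply: mPhi.
  rewrite le_max lexx/= ge_max ge_min lexx/= andbT.
  by rewrite oppr_le0.
(* [U] is the union of the countably many closed balls, with a [rat_path] as centre and an inverse
   integer as radius, that it contains. *)
pose good (p : nat * seq 'cV[rat]_d * nat) :=
  [set y | snorm (y - rat_path p.1.1 p.1.2) <= p.2.+1%:R^-1] `<=` U.
pose G p := if `[< good p >] then
  [set w | snorm (Phi w - rat_path p.1.1 p.1.2) <= p.2.+1%:R^-1] else set0.
rewrite setTI (_ : Phi @^-1` U = \bigcup_p G p).
  apply: countable_bigcupT_measurable => // p.
  by rewrite /G; case: asboolP => _; [exact: mball|exact: measurable0].
apply/seteqP; split => [w /= Uw|w [p _]]; last first.
  by rewrite /G; case: asboolP => // gp /gp.
have [e e0 He] := oU _ Uw.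
pose k := Num.truncn (2 / e).
have ke : k.+1%:R^-1 < e / 2.
  rewrite -[e / 2]invrK ltf_pV2 ?posrE ?invr_gt0 ?divr_gt0//.
  by rewrite invf_div truncnS_gt.
have [n [l nl]] := @rat_path_dense (Phi w) k.+1%:R^-1 ltac:(by rewrite invr_gt0).
exists (n, l, k) => //; rewrite /G; case: asboolP => //= -[] y /= yl; apply: He.
rewrite (le_lt_trans (snorm_dist r0' _ (rat_path n l) _))// [ltRHS]splitr.
by rewrite ltrD// ?(le_lt_trans yl)// snormB// (le_lt_trans nl).
Qed.

End Evaluations.

(** * Expectations of bounded functions and freezing *)

Section Bounded_measurable.
Context (R : realType) (dO : measure_display) (Omega : measurableType dO).
Context (P : probability Omega R).
Implicit Types f g : Omega -> R.

(** A class closed under the operations used below, on which expectations are finite, so that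
    linearity and monotonicity need no separate integrability argument. *)
Definition bdm f := measurable_fun setT f /\ exists M, forall w, `|f w| <= M.

Lemma bdm_cst c : bdm (fun=> c).
Proof. by split; [exact: measurable_cst|exists `|c|]. Qed.

Lemma bdmD f g : bdm f -> bdm g -> bdm (fun w => f w + g w).
Proof.
move=> [mf [M fM]] [mg [N gN]]; split; first exact: measurable_funD.
by exists (M + N) => w; rewrite (le_trans (ler_normD _ _))// lerD.
Qed.

Lemma bdmM f g : bdm f -> bdm g -> bdm (fun w => f w * g w).
Proof.
move=> [mf [M fM]] [mg [N gN]]; split; first exact: measurable_funM.
by exists (M * N) => w; rewrite normrM ler_pM.
Qed.

Lemma bdmN f : bdm f -> bdm (fun w => - f w).
Proof.
move=> [mf [M fM]]; split; first exact: measurableT_comp.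
by exists M => w; rewrite normrN.
Qed.

Lemma bdmB f g : bdm f -> bdm g -> bdm (fun w => f w - g w).
Proof. by move=> hf hg; apply: bdmD => //; exact: bdmN. Qed.

Lemma bdm_int f : bdm f -> P.-integrable setT (EFin \o f).
Proof.
move=> [mf [M fM]].
have iM : P.-integrable setT (EFin \o cst M) by exact: finite_measure_integrable_cst.
apply: le_integrable iM => //; first exact/measurable_EFinP.
by move=> w _ /=; rewrite lee_fin (le_trans (fM w))// ler_norm.
Qed.

Lemma bdm_powR f (p : R) : 0 <= p -> (forall w, 0 <= f w) -> bdm f -> bdm (fun w => f w `^ p).
Proof.
move=> p0 f0 [mf [M fM]]; split.
  exact: (measurableT_comp (measurable_powR p)).
exists (`|M| `^ p) => w; rewrite ger0_norm ?powR_ge0//.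
rewrite ge0_ler_powR ?nnegrE//.
by rewrite (le_trans (ler_norm _))// (le_trans (fM w))// ler_norm.
Qed.

Lemma bdm_ge0 f (M : R) : measurable_fun setT f -> (forall w, 0 <= f w) ->
  (forall w, f w <= M) -> bdm f.
Proof. by move=> mf f0 fM; split => //; exists M => w; rewrite ger0_norm. Qed.

Lemma EfinE f : bdm f -> (\int[P]_w (f w)%:E)%E = (\int[P]_w f w)%:E.
Proof.
by move=> bf; rewrite fineK//; apply: integrable_fin_num => //; exact: bdm_int.
Qed.

Lemma Ele f g : bdm f -> bdm g -> (forall w, f w <= g w) ->
  \int[P]_w f w <= \int[P]_w g w.
Proof. by move=> hf hg fg; apply: le_Rintegral => //; exact: bdm_int. Qed.

Lemma Ecst (c : R) : \int[P]_w c = c.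
Proof. have PT : P setT = 1%E := probability_setT P.
by rewrite /Rintegral integral_cst// [X in (_ * X)%E]PT mule1. Qed.

Lemma EZ c f : bdm f -> \int[P]_w (c * f w) = c * \int[P]_w f w.
Proof. by move=> hf; rewrite RintegralZl//; exact: bdm_int. Qed.

Lemma EZr c f : bdm f -> \int[P]_w (f w * c) = (\int[P]_w f w) * c.
Proof. by move=> hf; rewrite RintegralZr//; exact: bdm_int. Qed.

Lemma ED f g : bdm f -> bdm g ->
  \int[P]_w (f w + g w) = \int[P]_w f w + \int[P]_w g w.
Proof. by move=> hf hg; rewrite RintegralD//; exact: bdm_int. Qed.

Lemma EB f g : bdm f -> bdm g ->
  \int[P]_w (f w - g w) = \int[P]_w f w - \int[P]_w g w.
Proof. by move=> hf hg; rewrite RintegralB//; exact: bdm_int. Qed.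

Lemma Ege0 f : (forall w, 0 <= f w) -> 0 <= \int[P]_w f w.
Proof. by move=> f0; apply: Rintegral_ge0 => w _. Qed.

Lemma Ele1 f : bdm f -> (forall w, f w <= 1) -> \int[P]_w f w <= 1.
Proof.
move=> hf f1; rewrite -[leRHS](Ecst 1); apply: Ele => //; exact: bdm_cst.
Qed.

Lemma Enorm f : bdm f -> `|\int[P]_w f w| <= \int[P]_w `|f w|.
Proof. by move=> hf; apply: le_normr_Rintegral => //; exact: bdm_int. Qed.

Lemma bdm_norm f : bdm f -> bdm (fun w => `|f w|).
Proof.
move=> [mf [M fM]]; split; first exact: measurableT_comp.
by exists M => w; rewrite normr_id.
Qed.

Lemma bdm_indic (A : set Omega) : measurable A -> bdm (\1_A : Omega -> R).
Proof.
move=> mA; apply: (@bdm_ge0 _ 1) => [|w|w]; first exact: measurable_indic.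
- by rewrite indicE; case: (w \in A).
- by rewrite indicE; case: (w \in A); rewrite ?lexx ?ler01.
Qed.

Lemma E_indic (A : set Omega) : measurable A -> \int[P]_w (\1_A w : R) = fine (P A).
Proof. by move=> mA; rewrite /Rintegral integral_indic// setIT. Qed.

(* Tangent line of [x |-> x^p] at the mean. *)
Lemma jensen_powR f (p : R) : 1 <= p -> (forall w, 0 <= f w) -> bdm f ->
  (\int[P]_w f w) `^ p <= \int[P]_w (f w `^ p).
Proof.
move=> p1 f0 bf; set m := \int[P]_w f w.
have p0 : 0 < p by exact: lt_le_trans p1.
have m0 : 0 <= m by exact: Ege0.
have bp : bdm (fun w => f w `^ p) by apply: bdm_powR => //; exact: ltW.
have [m00|mn0] := eqVneq m 0.
  by rewrite m00 powR0 ?gt_eqF// Ege0// => w; exact: powR_ge0.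
have mp : 0 < m by rewrite lt0r mn0.
have [p_1|pn1] := eqVneq p 1.
  rewrite p_1 powRr1//; rewrite /m; apply: Ele => //; first by rewrite -p_1.
  by move=> w; rewrite powRr1.
have p1' : 1 < p by rewrite lt_neqAle eq_sym pn1.
have q0 : 0 < p / (p - 1) by rewrite divr_gt0// subr_gt0.
have tang w : p * m `^ (p - 1) * f w - (p - 1) * m `^ p <= f w `^ p.
  have := @conjugate_powR _ (f w) (m `^ (p - 1)) p (p / (p - 1)) (f0 w)
     (powR_ge0 _ _) p0 q0.
  rewrite -powRrM mulrCA divff ?subr_eq0// mulr1 invf_div.
  rewrite (_ : p^-1 + (p - 1) / p = 1); last first.
    by field; rewrite gt_eqF.
  move=> /(_ erefl) h.
  have {}h := ler_wpM2l (ltW p0) h.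
  have e : p * (f w `^ p / p + m `^ p * ((p - 1) / p)) = f w `^ p + (p - 1) * m `^ p.
    by field; rewrite gt_eqF.
  by move: h; rewrite e -lerBlDr mulrA mulrAC.
apply: le_trans (Ele _ bp tang); last first.
  by apply: bdmB; [apply: bdmM => //; exact: bdm_cst|exact: bdm_cst].
rewrite EB//; [|by apply: bdmM => //; exact: bdm_cst|exact: bdm_cst].
rewrite EZ// Ecst -/m -mulrA [m `^ _ * m]mulrC mulr_powRB1//.
by rewrite mulrBl opprB addrCA subrr addr0 mul1r.
Qed.

End Bounded_measurable.

Section Measurable_wrt.
Context (R : realType) (dO : measure_display) (Omega : measurableType dO).
Context (G : set (set Omega)) (sG : sigma_algebra setT G).

Lemma sigma_algebra_g : <<s G >> = G.
Proof. exact: (sigma_algebra_id sG). Qed.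

(** Measurability with respect to a sub-sigma-algebra becomes ordinary measurability for another
    measurable structure on the same set, so the usual closure properties carry over. *)
Lemma measurable_wrtP dE (E : measurableType dE) (f : Omega -> E) :
  measurable_wrt G f <->
  @measurable_fun _ _ (g_sigma_algebraType G) E setT f.
Proof.
split=> [mf _ A mA|mf A mA].
  by rewrite setTI; apply: sub_sigma_algebra; exact: mf.
have := mf measurableT A mA; rewrite setTI.
by rewrite -[X in X _ -> _]/(<<s G >>) sigma_algebra_g.
Qed.

Lemma measurable_wrt_fun dE (E : measurableType dE) (f : Omega -> E) :
  G `<=` measurable -> measurable_wrt G f -> measurable_fun setT f.
Proof. by move=> Gm mf _ A mA; rewrite setTI; apply: Gm; exact: mf. Qed.

Lemma measurable_wrt_comp dE (E : measurableType dE) dE' (E' : measurableType dE')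
    (f : Omega -> E) (g : E -> E') :
  measurable_fun setT g -> measurable_wrt G f -> measurable_wrt G (fun w => g (f w)).
Proof.
move=> mg mf A mA; have := mf (g @^-1` A); apply.
by rewrite -[X in measurable X]setTI; exact: mg.
Qed.

Lemma measurable_wrt_pair dE (E : measurableType dE) dE' (E' : measurableType dE')
    (f : Omega -> E) (g : Omega -> E') :
  measurable_wrt G f -> measurable_wrt G g -> measurable_wrt G (fun w => (f w, g w)).
Proof.
move=> /measurable_wrtP mf /measurable_wrtP mg; apply/measurable_wrtP.
exact: measurable_fun_pair.
Qed.

Lemma measurable_wrt_cst dE (E : measurableType dE) (c : E) :
  measurable_wrt G (fun=> c).
Proof. by apply/measurable_wrtP; exact: measurable_cst. Qed.

Lemma measurable_wrt_segment (r : R) d (Phi : Omega -> segment r d) : 0 < r ->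
  (forall s i, - r <= s <= 0 -> measurable_wrt G (fun w => Phi w s i 0)) ->
  measurable_wrt G Phi.
Proof.
move=> r0 h; apply/measurable_wrtP.
have := @segment_measurableP R r d r0 _ (g_sigma_algebraType G) Phi; apply.
by move=> s i sr; apply/measurable_wrtP; exact: h.
Qed.

End Measurable_wrt.

Section Freezing.
Context (R : realType) (dO : measure_display) (Omega : measurableType dO).
Context (P : probability Omega R).

Definition indep_of (G : set (set Omega)) dE (E : measurableType dE) (N : Omega -> E) :=
  forall A U, G A -> measurable U -> P (A `&` N @^-1` U) = (P A * P (N @^-1` U))%E.

Context (G : set (set Omega)) (sG : sigma_algebra setT G) (Gm : G `<=` measurable).
Context dE1 (E1 : measurableType dE1) dE2 (E2 : measurableType dE2).
Context (X : Omega -> E1) (N : Omega -> E2).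
Hypotheses (mX : measurable_wrt G X) (mN : measurable_fun setT N).

Let mX' : measurable_fun setT X := measurable_wrt_fun Gm mX.
Let Xf : {mfun Omega >-> E1} := HB.pack X (isMeasurableFun.Build _ _ _ _ _ mX').
Let Nf : {mfun Omega >-> E2} := HB.pack N (isMeasurableFun.Build _ _ _ _ _ mN).
Let mXN : measurable_fun setT (fun w => (X w, N w)) := measurable_fun_pair mX' mN.
Let XNf : {mfun Omega >-> (E1 * E2)%type} :=
  HB.pack (fun w => (X w, N w)) (isMeasurableFun.Build _ _ _ _ _ mXN).

Section Measurable_inner.
Variable g : E1 * E2 -> \bar R.
Hypotheses (mg : measurable_fun setT g) (g0 : forall z, (0 <= g z)%E).

Lemma inner_law x : (\int[P]_w g (x, N w))%E = (\int[distribution P Nf]_y g (x, y))%E.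
Proof.
rewrite ge0_integral_distribution//.
exact: (measurableT_comp mg (pair1_measurable x)).
Qed.

Lemma emeasurable_inner : measurable_fun setT (fun x => \int[P]_w g (x, N w))%E.
Proof.
rewrite (_ : (fun _ => _) = fubini_F (distribution P Nf) g).
  exact: measurable_fun_fubini_tonelli_F.
by apply/funext => x; rewrite inner_law.
Qed.

(** The joint law of [X] and [N] agrees with the product of their laws on rectangles, hence
    everywhere; Tonelli's theorem then integrates over [N] with [X] frozen. This takes the place of
    conditional expectation given [G]. *)
Lemma freeze : indep_of G N ->
  (\int[P]_w g (X w, N w) = \int[P]_w \int[P]_w' g (X w, N w'))%E.
Proof.
move=> iN.
rewrite -[LHS](@ge0_integral_distribution _ _ _ _ _ P XNf g)//.
transitivity (\int[distribution P Xf \x distribution P Nf]_z g z)%E.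
  apply: eq_measure_integral => A mA _; apply/esym.
  have key := @product_measure_unique _ _ E1 E2 R (distribution P Xf)
    (distribution P Nf) (distribution P XNf).
  have {}key := key _ A mA; apply: key => B C mB mC.
  exact: (iN (X @^-1` B) C (mX mB) mC).
rewrite fubini_tonelli1// (@ge0_integral_distribution _ _ _ _ _ P Xf).
- by apply: eq_integral => w _ /=; rewrite /fubini_F inner_law.
- exact: measurable_fun_fubini_tonelli_F.
- by move=> x; apply: integral_ge0.
Qed.

End Measurable_inner.

Section Real_valued.
Variables (g : E1 * E2 -> R) (M : R).
Hypotheses (mg : measurable_fun setT g) (g0 : forall z, 0 <= g z) (gM : forall z, g z <= M).

Lemma inner_bdm x : bdm (fun w => g (x, N w)).
Proof.
apply: (@bdm_ge0 _ _ _ _ M) => //.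
exact: (measurableT_comp (measurableT_comp mg (pair1_measurable x)) mN).
Qed.

Lemma measurable_inner : measurable_fun setT (fun x => \int[P]_w g (x, N w)).
Proof.
apply: (@measurableT_comp _ _ _ _ _ _ (@fine R)); first exact: fine_measurable.
apply: (@emeasurable_inner (EFin \o g)); first exact/measurable_EFinP.
by move=> z; rewrite lee_fin.
Qed.

Lemma inner_le x : \int[P]_w g (x, N w) <= M.
Proof.
rewrite -[leRHS](Ecst P M); apply: Ele => //; first exact: inner_bdm.
exact: bdm_cst.
Qed.

Lemma freezeR : indep_of G N ->
  \int[P]_w g (X w, N w) = \int[P]_w \int[P]_w' g (X w, N w').
Proof.
move=> iN; rewrite /Rintegral; congr fine.
have mg' : measurable_fun setT (EFin \o g) by exact/measurable_EFinP.
have g0' z : (0 <= (EFin \o g) z)%E by rewrite lee_fin.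
rewrite [LHS](freeze mg' g0' iN).
by apply: eq_integral => w _; rewrite /= EfinE//; exact: inner_bdm.
Qed.

End Real_valued.

End Freezing.

(** * Gaussian shifts *)

Section Nonneg_real.
Context (R : realType) (dT : measure_display) (T : measurableType dT).
Context (mu : {measure set T -> \bar R}).
Implicit Types f g : T -> R.

Lemma integralZ_EFin k f : 0 <= k -> measurable_fun setT f -> (forall x, 0 <= f x) ->
  (\int[mu]_x (k * f x)%:E = k%:E * \int[mu]_x (f x)%:E)%E.
Proof.
move=> k0 mf f0; under eq_integral do rewrite EFinM.
by apply: ge0_integralZl => // [|x _]; [exact/measurable_EFinP|rewrite lee_fin].
Qed.

Lemma integralD_EFin_ge0 f g : measurable_fun setT f -> (forall x, 0 <= f x) ->
  measurable_fun setT g -> (forall x, 0 <= g x) ->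
  (\int[mu]_x (f x + g x)%:E = \int[mu]_x (f x)%:E + \int[mu]_x (g x)%:E)%E.
Proof.
move=> mf f0 mg g0; under eq_integral do rewrite EFinD.
by apply: ge0_integralD => // [x _||x _|]; rewrite ?lee_fin//; exact/measurable_EFinP.
Qed.

Lemma le_integral_EFin f g : measurable_fun setT f -> (forall x, 0 <= f x) ->
  measurable_fun setT g -> (forall x, f x <= g x) ->
  (\int[mu]_x (f x)%:E <= \int[mu]_x (g x)%:E)%E.
Proof.
by move=> mf f0 mg fg; apply: ge0_le_integral => // [x _|||x _];
  rewrite ?lee_fin//; exact/measurable_EFinP.
Qed.

End Nonneg_real.

Section Density.
Local Open Scope ereal_scope.
Context (R : realType) (dT : measure_display) (T : measurableType dT).
Context (mu nu : {measure set T -> \bar R}) (g : T -> R).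
Hypotheses (mg : measurable_fun setT g) (g0 : forall x, (0 <= g x)%R).
Hypothesis nuE : forall A, measurable A -> nu A = \int[mu]_(x in A) (g x)%:E.

Import HBNNSimple.

Lemma integral_density_nnsfun (h : {nnsfun T >-> R}) :
  \int[nu]_x (h x)%:E = \int[mu]_x ((h x)%:E * (g x)%:E).
Proof.
under eq_integral do rewrite fimfunE -fsumEFin//.
rewrite [LHS]ge0_integral_fsum//; last 2 first.
  - by move=> r; exact/measurable_EFinP/measurableT_comp.
  - by move=> n x _; rewrite EFinM nnfun_muleindic_ge0.
rewrite [RHS](_ : _ = \int[mu]_x (\sum_(r \in range h)
    ((r * \1_(h @^-1` [set r]) x)%:E * (g x)%:E))); last first.
  apply: eq_integral => x _; rewrite [in LHS]fimfunE -fsumEFin//.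
  by rewrite ge0_mule_fsuml// => r; rewrite EFinM nnfun_muleindic_ge0.
rewrite [RHS]ge0_integral_fsum//; last 2 first.
  - move=> r; apply: emeasurable_funM; last exact/measurable_EFinP.
    exact/measurable_EFinP/measurableT_comp.
  - move=> n x _; apply: mule_ge0; last by rewrite lee_fin.
    by rewrite EFinM nnfun_muleindic_ge0.
apply: eq_fsbigr => r _.
under [RHS]eq_integral do rewrite EFinM -muleA.
rewrite integralZl_indic_nnsfun// integral_indic// setIT.
have [r0|r0] := leP 0%R r.
  rewrite ge0_integralZl//; last 2 first.
  - apply: emeasurable_funM; last exact/measurable_EFinP.
    by apply/measurable_EFinP; exact: measurable_indic.
  - by move=> x _; rewrite mule_ge0 ?lee_fin.
  congr (_ * _); rewrite nuE// [LHS]integral_mkcond; apply: eq_integral => x _.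
  rewrite patchE indicE; case: ifPn => _; rewrite ?mul1e ?mul0e//.
rewrite preimage_nnfun0// measure0 mule0 integral0_eq// => x _.
by rewrite indicE in_set0 mul0e mule0.
Qed.

Lemma integral_density (f : T -> \bar R) : measurable_fun setT f ->
  (forall x, 0 <= f x) -> \int[nu]_x f x = \int[mu]_x (f x * (g x)%:E).
Proof.
move=> mf f0; pose f_ := nnsfun_approx measurableT mf.
transitivity (limn (fun n => \int[nu]_x (f_ n x)%:E)).
  rewrite -monotone_convergence//.
  - apply: eq_integral => x _; apply/esym/cvg_lim => //.
    exact: cvg_nnsfun_approx.
  - by move=> n; exact/measurable_EFinP.
  - by move=> *; rewrite lee_fin.
  - by move=> x _ m n mn; rewrite lee_fin; exact/lefP/nd_nnsfun_approx.
under eq_fun do rewrite integral_density_nnsfun.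
rewrite -monotone_convergence//; last 3 first.
  - by move=> n; apply: emeasurable_funM; exact/measurable_EFinP.
  - by move=> n x _; rewrite mule_ge0 ?lee_fin.
  - move=> x _ m n mn; rewrite lee_wpmul2r ?lee_fin//.
    exact/lefP/nd_nnsfun_approx.
apply: eq_integral => x _; apply/cvg_lim => //; apply: cvgeZr => //.
exact: cvg_nnsfun_approx.
Qed.

End Density.

Section Gaussian.
Context (R : realType).
Local Notation leb := (@lebesgue_measure R).

Lemma lebesgue_shift (h : R) (A : set R) : measurable A ->
  pushforward leb (fun y : measurableTypeR R => (y + h : measurableTypeR R)) A = leb A.
Proof.
have mh : measurable_fun setT (fun y : measurableTypeR R => (y + h : measurableTypeR R)).
  exact: measurable_funD.
move=> mA; apply/esym/lebesgue_measure_unique => //= _ [[a c]] _ <-.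
rewrite /pushforward (_ : _ @^-1` _ = `]a - h, c - h]%classic); last first.
  by apply/seteqP; split => y /=; rewrite !in_itv/= ltrBlDr lerBrDr.
rewrite !lebesgue_measure_itv/= !lte_fin ltrD2r -!EFinD.
by rewrite (_ : c - h - (a - h) = c - a)//; ring.
Qed.

Lemma integral_shift (h : R) (f : R -> \bar R) : measurable_fun setT f ->
  (forall y, (0 <= f y)%E) ->
  (\int[leb]_y f y = \int[leb]_y f (y + h)%R)%E.
Proof.
move=> mf f0.
have mh : measurable_fun setT (fun y : measurableTypeR R => (y + h : measurableTypeR R)).
  exact: measurable_funD.
rewrite -[RHS](@ge0_integral_pushforward _ _ _ _ R _ mh leb setT f)//.
by apply: eq_measure_integral => //= A mA _; exact/esym/lebesgue_shift.
Qed.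

Lemma integral_opp (f : R -> \bar R) : measurable_fun setT f ->
  (forall y, (0 <= f y)%E) ->
  (\int[leb]_y f y = \int[leb]_y f (- y)%R)%E.
Proof.
move=> mf f0.
have mh : measurable_fun setT (-%R : measurableTypeR R -> measurableTypeR R) by [].
rewrite -[RHS](@ge0_integral_pushforward _ _ _ _ R _ mh leb setT f)//.
by apply: eq_measure_integral => //= A mA _; exact/esym/lebesgue_measureN.
Qed.

Variable s : R.
Hypothesis s0 : 0 < s.
Let sn0 : s != 0. Proof. by rewrite gt_eqF. Qed.

Lemma integral_normal (f : R -> \bar R) : measurable_fun setT f ->
  (forall y, (0 <= f y)%E) ->
  (\int[normal_prob 0 s]_y f y = \int[leb]_y (f y * (normal_pdf 0 s y)%:E))%E.
Proof.
move=> mf f0; apply: integral_density => //; first exact: measurable_normal_pdf.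
by move=> y; exact: normal_pdf_ge0.
Qed.

(** The Cameron-Martin formula in dimension one: the exponential weight moves the mean from 0 to
    [a]. *)
Lemma normal_pdf_tilt (a y : R) :
  expR (a * y / s ^+ 2 - a ^+ 2 / (2 * s ^+ 2)) * normal_pdf 0 s y = normal_pdf a s y.
Proof.
rewrite !normal_pdfE// mulrCA; congr (_ * _); rewrite /normal_fun -expRD; congr expR.
by rewrite subr0 -(mulr_natr (s ^+ 2)); field; rewrite ?sn0 ?pnatr_eq0.
Qed.

Lemma normal_pdf_center (h y : R) : normal_pdf 0 s (y + h) = normal_pdf (- h) s y.
Proof. by rewrite !normal_pdfE// /normal_fun subr0 opprK. Qed.

Lemma integral_normal_opp (f : R -> \bar R) : measurable_fun setT f ->
  (forall y, (0 <= f y)%E) ->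
  (\int[normal_prob 0 s]_y f y = \int[normal_prob 0 s]_y f (- y)%R)%E.
Proof.
move=> mf f0; have mN : measurable_fun setT (fun y : R => f (- y)).
  exact: (measurableT_comp mf).
rewrite (integral_normal mf f0) (integral_normal mN (fun y => f0 (- y))).
rewrite (@integral_opp (fun y => (f y * (normal_pdf 0 s y)%:E)%E)); last 2 first.
- apply: emeasurable_funM => //; apply/measurable_EFinP; exact: measurable_normal_pdf.
- by move=> y; rewrite mule_ge0// lee_fin normal_pdf_ge0.
apply: eq_integral => y _; rewrite !normal_pdfE// /normal_fun !subr0.
by rewrite sqrrN.
Qed.

Lemma normal_exp_moment (c : R) :
  (\int[normal_prob 0 s]_y (expR (c * y))%:E = (expR (c ^+ 2 * s ^+ 2 / 2))%:E)%E.
Proof.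
have mE : measurable_fun setT (fun y : R => (expR (c * y))%:E).
  apply/measurable_EFinP; apply: (measurableT_comp (@measurable_expR R)).
  exact: mulrl_measurable.
have pE (y : R) : (0 <= (expR (c * y))%:E)%E by rewrite lee_fin expR_ge0.
rewrite (integral_normal mE pE).
rewrite (_ : (fun y => _) = fun y => (expR (c ^+ 2 * s ^+ 2 / 2) *
    normal_pdf (c * s ^+ 2) s y)%:E); last first.
  apply/funext => y; rewrite -!EFinM -(normal_pdf_tilt (c * s ^+ 2)) mulrA -expRD.
  by congr (expR _ * _)%:E; field; rewrite sn0.
rewrite integralZ_EFin ?expR_ge0//; first by rewrite integral_normal_pdf mule1.
- exact: measurable_normal_pdf.
- by move=> y; exact: normal_pdf_ge0.
Qed.

(** For [z >= 0], [z / 2 <= expR (z / 2)], and squaring gives [z ^+ 2 <= 4 * expR z]. *)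
Lemma sqr_le_cosh (x : R) : x ^+ 2 <= 4 * (expR x + expR (- x)).
Proof.
have H (z : R) : 0 <= z -> z ^+ 2 <= 4 * expR z.
  move=> z0; have e : expR z = expR (z / 2) ^+ 2 by rewrite -expRM_natl -mulr_natl; congr expR; field.
  have := expR_ge1Dx (z / 2) => h.
  have h0 : 0 <= z / 2 by rewrite divr_ge0.
  rewrite e; have : (z / 2) ^+ 2 <= expR (z / 2) ^+ 2.
    by rewrite ler_sqr ?nnegrE ?expR_ge0// (le_trans _ h)// lerDr.
  by rewrite exprMn exprVn ler_pdivrMr ?exprn_gt0// mulrC -natrX.
rewrite mulrDr; have [x0|x0] := leP 0 x.
  by rewrite (le_trans (H _ x0))// lerDl mulr_ge0// expR_ge0.
rewrite -sqrrN (le_trans (H _ _)) ?oppr_ge0 ?(ltW x0)//.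
by rewrite lerDr mulr_ge0// expR_ge0.
Qed.

(** A bound for the second moment of a standard Gaussian, obtained from [sqr_le_cosh] and the
    exponential moments at [s^-1] and [- s^-1]. It only multiplies approximation errors that tend to
    0, so its size is immaterial. *)
Definition kappa2 : R := 8 * expR (2^-1).

Lemma normal_second_moment :
  (\int[normal_prob 0 s]_y (y ^+ 2)%:E <= (kappa2 * s ^+ 2)%:E)%E.
Proof.
have mE (c : R) : measurable_fun setT (fun y : R => expR (c * y)).
  by apply: (measurableT_comp (@measurable_expR R)); exact: mulrl_measurable.
apply: (@le_trans _ _ (\int[normal_prob 0 s]_y
  ((4 * s ^+ 2) * (expR (s^-1 * y) + expR (- s^-1 * y)))%:E)%E).
  apply: le_integral_EFin => [|y||y].
  - exact: measurable_funX.
  - exact: sqr_ge0.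
  - apply: measurable_funM; first exact: measurable_cst.
    by apply: measurable_funD; exact: mE.
  - have := sqr_le_cosh (s^-1 * y); rewrite exprMn mulNr.
    rewrite -(ler_pM2l (exprn_gt0 2 s0)) mulrA -exprMn divff// expr1n mul1r.
    by move=> /le_trans; apply; rewrite le_eqVlt; apply/orP; left; apply/eqP; ring.
rewrite integralZ_EFin; first last.
- by move=> y; rewrite addr_ge0 ?expR_ge0.
- by apply: measurable_funD; exact: mE.
- by rewrite mulr_ge0// sqr_ge0.
rewrite integralD_EFin_ge0; first last.
- by move=> y; exact: expR_ge0.
- exact: mE.
- by move=> y; exact: expR_ge0.
- exact: mE.
rewrite !normal_exp_moment -EFinD -EFinM lee_fin /kappa2.
rewrite sqrrN -exprMn mulVf// expr1n mul1r.
by rewrite le_eqVlt; apply/orP; left; apply/eqP; ring.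
Qed.

(* [int (S + z y)^2 N(dy)] for a centred Gaussian: the cross term cancels by symmetry. *)
Lemma normal_affine_square (S z : R) :
  (\int[normal_prob 0 s]_y ((S + z * y) ^+ 2)%:E <=
   (S ^+ 2 + kappa2 * s ^+ 2 * z ^+ 2)%:E)%E.
Proof.
have mp (c : R) : measurable_fun setT (fun y : R => (S + c * y) ^+ 2).
  by apply: measurable_funX; apply: measurable_funD.
have pp (c y : R) : 0 <= (S + c * y) ^+ 2 by exact: sqr_ge0.
have my2 : measurable_fun setT (fun y : R => y ^+ 2) by exact: measurable_funX.
have z2 : 0 <= z ^+ 2 by exact: sqr_ge0.
set I := (\int[normal_prob 0 s]_y _)%E.
have Iopp : (\int[normal_prob 0 s]_y ((S + (- z) * y) ^+ 2)%:E = I)%E.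
  rewrite /I [RHS]integral_normal_opp.
  - by apply: eq_integral => y _; rewrite mulNr mulrN.
  - by apply/measurable_EFinP; exact: mp.
  - by move=> y; rewrite lee_fin pp.
have I2 : (I = \int[normal_prob 0 s]_y (S ^+ 2 + z ^+ 2 * y ^+ 2)%:E)%E.
  transitivity (2^-1%:E * (I + I))%E.
    rewrite -[in RHS](mul1e I) -ge0_muleDl ?lee_fin// muleA -EFinD -EFinM.
    by rewrite (_ : 2^-1 * (1 + 1) = 1 :> R) ?mul1e//; field.
  rewrite -[X in (_ * (_ + X))%E]Iopp -integralD_EFin_ge0; [|exact: mp|exact: pp|exact: mp|exact: pp].
  rewrite -integralZ_EFin.
  - by apply: eq_integral => y _; congr (_%:E); field.
  - by rewrite invr_ge0.
  - by apply: measurable_funD; exact: mp.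
  - by move=> y; apply: addr_ge0; exact: pp.
rewrite I2 integralD_EFin_ge0; first last.
- by move=> y; rewrite mulr_ge0 ?sqr_ge0.
- by apply: measurable_funM => //; exact: my2.
- by move=> y; exact: sqr_ge0.
- exact: measurable_cst.
rewrite integral_cst//.
have PT : normal_prob 0 s setT = 1%E := probability_setT _.
rewrite [X in (_ * X)%E]PT mule1 integralZ_EFin; [|exact: z2|exact: my2|by move=> y; exact: sqr_ge0].
rewrite EFinD leeD2l// (mulrC (kappa2 * s ^+ 2)) [X in (_ <= X)%E]EFinM lee_wpmul2l ?lee_fin//.
exact: normal_second_moment.
Qed.

(* Young's inequality with the optimal weight replaces Hoelder's. *)
Lemma normal_shift_powR (u : R -> R) (p h : R) : 1 < p -> measurable_fun setT u ->
  (forall y, 0 <= u y <= 1) ->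
  (\int[normal_prob 0 s]_y u y) `^ p <=
  expR (p / (2 * (p - 1)) * (h ^+ 2 / s ^+ 2)) * \int[normal_prob 0 s]_y (u (y + h) `^ p).
Proof.
move=> p1 mu u01; have p0 : 0 < p by rewrite (lt_trans _ p1).
have pn1 : p - 1 != 0 by rewrite subr_eq0 gt_eqF.
have pn0 : p != 0 by rewrite gt_eqF.
have u0 y : 0 <= u y by case/andP: (u01 y).
have u1 y : u y <= 1 by case/andP: (u01 y).
pose N := normal_prob (0:R) s.
have bu : bdm (u : measurableTypeR R -> R) by exact: (@bdm_ge0 _ _ _ _ 1).
have mh : measurable_fun setT (fun y : R => u (y + h)).
  by apply: (measurableT_comp mu); apply: measurable_funD.
have buh : bdm ((fun y => u (y + h) `^ p) : measurableTypeR R -> R).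
  apply: bdm_powR => //; first exact: ltW.
  exact: (@bdm_ge0 _ _ _ _ 1).
set m := \int[N]_y u y; set A := \int[N]_y _.
have A0 : 0 <= A by apply: Ege0 => y; exact: powR_ge0.
have m0 : 0 <= m by exact: Ege0.
have [m00|mn0] := eqVneq m 0.
  by rewrite m00 powR0// mulr_ge0// expR_ge0.
have mp : 0 < m by rewrite lt0r mn0.
pose q := p / (p - 1).
have q0 : 0 < q by rewrite divr_gt0// subr_gt0.
have qn0 : q != 0 by rewrite gt_eqF.
have pq : p^-1 + q^-1 = 1 by rewrite /q invf_div; field.
(* The weight [l] makes the second Young term integrate to exactly [m / q]. That term is then
   absorbed in the left-hand side, and [q - 1 = 1 / (p - 1)] produces the factor
   [p / (2 * (p - 1))]. *)
pose l := h ^+ 2 * (q - 1) / (2 * s ^+ 2) - ln m / q.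
pose B := expR (q * (q - 1) * h ^+ 2 / (2 * s ^+ 2)).
(* The likelihood ratio of the translated Gaussian is the second factor in Young's inequality; its
   [q]-th power times the density is, up to a constant, the Gaussian density centred at
   [- (q * h)]. *)
have pt y : u (y + h) * normal_pdf 0 s (y + h) <=
    (expR (l * p) / p) * (u (y + h) `^ p * normal_pdf 0 s y) +
    (m / q) * normal_pdf (- (q * h)) s y.
  have := conjugate_powR (mulr_ge0 (expR_ge0 l) (u0 (y + h)))
    (expR_ge0 (- (2 * y * h + h ^+ 2) / (2 * s ^+ 2) - l)) p0 q0 pq.
  move=> /(ler_wpM2r (normal_pdf_ge0 0 s y)).
  rewrite powRM ?expR_ge0// -!expRM.
  rewrite (_ : expR l * u (y + h) * expR (- (2 * y * h + h ^+ 2) / (2 * s ^+ 2) - l) *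
     normal_pdf 0 s y = u (y + h) * normal_pdf 0 s (y + h)); last first.
    rewrite normal_pdf_center -(normal_pdf_tilt (- h)).
    rewrite [expR l * _]mulrC -(mulrA (u (y + h))) -expRD -mulrA.
    by congr (_ * (expR _ * _)); field; rewrite ?sn0.
  rewrite mulrDl => /le_trans; apply.
  rewrite lerD//.
    by rewrite le_eqVlt; apply/orP; left; apply/eqP; ring.
  rewrite -(normal_pdf_tilt (- (q * h))) -[X in _ <= X / q * _]lnK ?posrE//.
  rewrite (_ : (- (2 * y * h + h ^+ 2) / (2 * s ^+ 2) - l) * q = ln m +
    (- (q * h) * y / s ^+ 2 - (- (q * h)) ^+ 2 / (2 * s ^+ 2))); last first.
    by rewrite /l; field; rewrite ?sn0 ?qn0.
  by rewrite expRD le_eqVlt; apply/orP; left; apply/eqP; ring.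
have mE : (m%:E = \int[leb]_y (u (y + h) * normal_pdf 0 s (y + h))%:E)%E.
  have mu' : measurable_fun setT (fun y : R => (u y)%:E) by exact/measurable_EFinP.
  have u0' y : (0 <= (u y)%:E)%E by rewrite lee_fin.
  rewrite -(EfinE _ bu) (integral_normal mu' u0').
  rewrite (@integral_shift h (fun y => ((u y)%:E * (normal_pdf 0 s y)%:E)%E)) //.
  - apply: emeasurable_funM => //; apply/measurable_EFinP.
    exact: measurable_normal_pdf.
  - by move=> y; rewrite mule_ge0// lee_fin normal_pdf_ge0.
have AE : (A%:E = \int[leb]_y (u (y + h) `^ p * normal_pdf 0 s y)%:E)%E.
  have mu' : measurable_fun setT (fun y : R => (u (y + h) `^ p)%:E).
    by apply/measurable_EFinP; case: buh.
  have u0' y : (0 <= (u (y + h) `^ p)%:E)%E by rewrite lee_fin powR_ge0.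
  by rewrite -(EfinE _ buh) (integral_normal mu' u0').
have le1 : m <= expR (l * p) / p * A + m / q.
  rewrite -lee_fin [leLHS]mE EFinD EFinM AE -[(m / q)%:E]mule1.
  rewrite -(integral_normal_pdf (- (q * h)) s).
  have mpdf a : measurable_fun setT (fun y : R => normal_pdf a s y).
    exact: measurable_normal_pdf.
  have mup : measurable_fun setT (fun y : R => u (y + h) `^ p) by case: buh.
  have pos1 y : 0 <= u (y + h) `^ p * normal_pdf 0 s y.
    by rewrite mulr_ge0 ?powR_ge0 ?normal_pdf_ge0.
  have pos2 y : 0 <= normal_pdf (- (q * h)) s y by exact: normal_pdf_ge0.
  have c1 : 0 <= expR (l * p) / p by rewrite divr_ge0 ?expR_ge0 ?(ltW p0).
  have c2 : 0 <= m / q by rewrite divr_ge0 ?(ltW q0).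
  have m1 : measurable_fun setT (fun y : R => u (y + h) `^ p * normal_pdf 0 s y).
    by apply: measurable_funM; [exact: mup|exact: mpdf].
  rewrite -integralZ_EFin; [|exact: c1|exact: m1|exact: pos1].
  rewrite -[X in (_ + X)%E]integralZ_EFin; [|exact: c2|exact: mpdf|exact: pos2].
  rewrite -integralD_EFin_ge0; first last.
  - by move=> y; apply: mulr_ge0.
  - by apply: measurable_funM; [exact: measurable_cst|exact: mpdf].
  - by move=> y; apply: mulr_ge0.
  - by apply: measurable_funM; [exact: measurable_cst|exact: m1].
  apply: le_integral_EFin; last exact: pt.
  - apply: measurable_funM; first exact: mh.
    by apply: (measurableT_comp (mpdf 0)); apply: measurable_funD.
  - by move=> y; rewrite mulr_ge0 ?normal_pdf_ge0.
  - apply: measurable_funD; apply: measurable_funM; try exact: measurable_cst.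
      exact: m1.
    exact: mpdf.
have le2 : m <= expR (l * p) * A.
  have : m - m / q <= expR (l * p) / p * A by rewrite lerBlDr.
  rewrite (_ : m - m / q = m / p); last by rewrite /q; field; rewrite pn0.
  by rewrite mulrAC ler_pM2r// invr_gt0.
rewrite (_ : expR (p / (2 * (p - 1)) * (h ^+ 2 / s ^+ 2)) =
  expR (l * p) * m `^ (p - 1)); last first.
  rewrite -[in m `^ _](lnK (mp : m \in Num.pos)) -expRM -expRD; congr expR.
  by rewrite /l /q invf_div; field; rewrite ?sn0 ?pn0 ?pn1.
by rewrite -mulr_powRB1// mulrAC ler_wpM2r ?powR_ge0.
Qed.

End Gaussian.

(** * Lipschitz approximation *)

Section Bounded_limits.
Context (R : realType) (dO : measure_display) (Omega : measurableType dO).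
Context (P : probability Omega R).

Lemma bounded_cvg (f_ : nat -> Omega -> R) (f : Omega -> R) (M : R) :
  (forall n, measurable_fun setT (f_ n)) -> measurable_fun setT f ->
  (forall n w, `|f_ n w| <= M) ->
  {ae P, forall w, f_ ^~ w @ \oo --> f w} ->
  \int[P]_w f_ n w @[n --> \oo] --> \int[P]_w f w.
Proof.
move=> mf_ mf fM cf.
have iM : P.-integrable setT (EFin \o cst M) by exact: finite_measure_integrable_cst.
have [If _ H] := @dominated_convergence _ _ _ P setT measurableT
  (fun n => EFin \o f_ n) (EFin \o f) (EFin \o cst M)
  (fun n => (measurable_EFinP _ _).2 (mf_ n)) ((measurable_EFinP _ _).2 mf)
  ltac:(by apply: filterS cf => w cw _; apply/cvg_EFin; [exact: nearW|exact: cw]) iM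
  ltac:(by apply: aeW => w n _; rewrite /= lee_fin).
have H' : (\int[P]_w (f_ n w)%:E)%E @[n --> \oo] --> (\int[P]_w f w)%:E.
  by rewrite fineK; [exact: H|exact: integrable_fin_num].
exact: fine_cvg H'.
Qed.

Lemma powR_lip (p x y : R) : 1 <= p -> 0 <= x <= 1 -> 0 <= y <= 1 ->
  `|x `^ p - y `^ p| <= p * `|x - y|.
Proof.
move=> p1; wlog xy : x y / y <= x.
  move=> H hx hy; have [xy|xy] := leP y x; first exact: H.
  by rewrite distrC [X in _ <= _ * X]distrC H// ltW.
move=> /andP[x0 x1] /andP[y0 y1].
have p0 : 0 < p by exact: lt_le_trans p1.
rewrite ger0_norm ?subr_ge0 ?ge0_ler_powR ?nnegrE ?(ltW p0)//.
rewrite ger0_norm ?subr_ge0//.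
have [x00|xn0] := eqVneq x 0.
  have y00 : y = 0 by apply: le_anti; rewrite y0 andbT -x00.
  by rewrite x00 y00 !subrr mulr0.
have xp : 0 < x by rewrite lt0r xn0.
have pow1 c : (1 : R) `^ c = 1 by rewrite powR1.
have xp1 : x `^ p <= 1 by rewrite -[leRHS](pow1 p) ge0_ler_powR ?nnegrE ?(ltW p0) ?ler01.
have [p_1|pn1] := eqVneq p 1; first by rewrite p_1 !powRr1// mul1r.
have p1' : 1 < p by rewrite lt_neqAle eq_sym pn1.
have q0 : 0 < p / (p - 1) by rewrite divr_gt0// subr_gt0.
have pn0 : p != 0 by rewrite gt_eqF.
(* Young's inequality for [y * x^(p-1)] gives [x^p - y^p <= p x^(p-1) (x - y)]. *)
have := @conjugate_powR _ y (x `^ (p - 1)) p (p / (p - 1)) y0 (powR_ge0 _ _) p0 q0.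
rewrite -powRrM mulrCA divff ?subr_eq0// mulr1 invf_div.
rewrite (_ : p^-1 + (p - 1) / p = 1); last by field.
move=> /(_ erefl) /(ler_wpM2l (ltW p0)).
rewrite (_ : p * (y `^ p / p + x `^ p * ((p - 1) / p)) = y `^ p + (p - 1) * x `^ p); last by field.
have : x `^ (p - 1) * x = x `^ p by rewrite mulrC mulr_powRB1.
have xpp : x `^ (p - 1) <= 1.
  by rewrite -[leRHS](pow1 (p - 1)) ge0_ler_powR ?nnegrE ?subr_ge0 ?ler01.
have xpp0 := powR_ge0 x (p - 1).
move: (x `^ (p - 1)) (x `^ p) (y `^ p) xpp xpp0 => a c e a1 a0 ac h.
have : p * (a * (x - y)) <= p * (x - y).
  by rewrite ler_wpM2l ?(ltW p0)// ler_piMl// subr_ge0.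
rewrite mulrBr ac; nra.
Qed.

End Bounded_limits.

Section Lipschitz_density.
Context (R : realType) (r : R) (d : nat) (r0 : 0 < r).
Context (dO : measure_display) (Omega : measurableType dO) (P : probability Omega R).
Notation S := (segment r d).
Let r0' : 0 <= r := ltW r0.

(** Test functions whose expectations pass to limits in probability. Measurable functions are
    reached afterwards through [lip_approx]. *)
Definition lip01 (u : S -> R) := (forall x, 0 <= u x <= 1) /\
  exists2 L : R, 0 <= L & forall x y, `|u x - u y| <= L * snorm (x - y).

Lemma lip01_measurable u : lip01 u -> measurable_fun setT u.
Proof. by move=> [_ [L _ uL]]; exact: (slipschitz_measurable r0' uL). Qed.

Definition unit_fun (u : S -> R) := measurable_fun setT u /\ forall x, 0 <= u x <= 1.

Lemma lip01_unit u : lip01 u -> unit_fun u.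
Proof. by move=> hu; split; [exact: lip01_measurable|case: hu]. Qed.

Lemma unit_bdm u (X : Omega -> S) : unit_fun u -> measurable_fun setT X ->
  bdm (fun w => u (X w)).
Proof.
move=> [mu u01] mX; apply: (@bdm_ge0 _ _ _ _ 1) => [|w|w].
- exact: measurableT_comp.
- by case/andP: (u01 (X w)).
- by case/andP: (u01 (X w)).
Qed.

Lemma lip01_compl u : lip01 u -> lip01 (fun x => 1 - u x).
Proof.
move=> [u01 [L L0 uL]]; split=> [x|]; first by have /andP[? ?] := u01 x; lra.
exists L => // x y; rewrite (_ : 1 - u x - (1 - u y) = u y - u x); last by ring.
by rewrite distrC uL.
Qed.

Lemma lip01_max u v : lip01 u -> lip01 v -> lip01 (fun x => Num.max (u x) (v x)).
Proof.
move=> [u01 [L L0 uL]] [v01 [L' L0' vL]]; split=> [x|].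
  have /andP[? ?] := u01 x; have /andP[? ?] := v01 x.
  by case: (leP (u x) (v x)) => _; apply/andP; split.
exists (L + L') => [|x y]; first exact: addr_ge0.
rewrite mulrDl (le_trans _ (lerD (uL x y) (vL x y)))//.
have H (a c e f : R) : Num.max a c - Num.max e f <= `|a - e| + `|c - f|.
  have e1 : e <= Num.max e f by rewrite le_max lexx.
  have f1 : f <= Num.max e f by rewrite le_max lexx orbT.
  have a1 := ler_norm (a - e); have c1 := ler_norm (c - f).
  have a0 := normr_ge0 (a - e); have c0 := normr_ge0 (c - f).
  by rewrite lerBlDr ge_max; apply/andP; split; lra.
rewrite ler_norml H andbT lerNl opprB.
by rewrite (distrC (u x)) (distrC (v x)) H.
Qed.

Lemma lip01_avg m (u : 'I_m.+1 -> S -> R) : (forall i, lip01 (u i)) ->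
  lip01 (fun x => m.+1%:R^-1 * \sum_i u i x).
Proof.
move=> hu; have /choice[L HL] : forall i, exists L : R, 0 <= L /\
    forall x y, `|u i x - u i y| <= L * snorm (x - y).
  by move=> i; have [_ [L L0 HL]] := hu i; exists L.
have m0 : 0 <= m.+1%:R^-1 :> R by rewrite invr_ge0.
split=> [x|].
  rewrite mulr_ge0/= ?sumr_ge0// => [|i _]; last by have [/(_ x)/andP[]] := hu i.
  rewrite ler_pdivrMl// mulr1 (le_trans (ler_sum _ (_ : forall i, true -> u i x <= 1)))//.
    by move=> i _; have [/(_ x)/andP[]] := hu i.
  by rewrite sumr_const card_ord.
exists (m.+1%:R^-1 * \sum_i L i) => [|x y].
  by rewrite mulr_ge0 ?sumr_ge0// => i _; case: (HL i).
rewrite -mulrBr normrM ger0_norm// -mulrA ler_wpM2l// -sumrB mulr_suml.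
by rewrite (le_trans (ler_norm_sum _ _ _))// ler_sum// => i _; case: (HL i).
Qed.

(* Distance to the complement of [U], truncated at 1 so that [U = setT] is allowed. *)
Definition cdist (U : set S) (x : S) : R :=
  inf ([set snorm (x - y) | y in ~` U] `|` [set 1]).

Let cdist_lb (U : set S) x : has_lbound ([set snorm (x - y) | y in ~` U] `|` [set 1]).
Proof. by exists 0 => z [[y _ <-]|->]//; exact: snorm_ge0. Qed.

Lemma cdist_ge0 U x : 0 <= cdist U x.
Proof.
apply: lb_le_inf; first by exists 1; right.
by move=> z [[y _ <-]|->]//; exact: snorm_ge0.
Qed.

Lemma cdist_out U x : ~ U x -> cdist U x = 0.
Proof.
move=> Ux; apply: le_anti; rewrite cdist_ge0 andbT.
by apply: ge_inf; [exact: cdist_lb|left; exists x => //; rewrite subrr snorm0].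
Qed.

Lemma cdist_in U x : segment_open U -> U x -> 0 < cdist U x.
Proof.
move=> oU /oU[e e0 He]; have : 0 < Num.min e 1 by rewrite lt_min e0 ltr01.
move=> h; apply: (lt_le_trans h); apply: lb_le_inf; first by exists 1; right.
move=> z [[y Uy <-]|->]; last by rewrite ge_min lexx orbT.
rewrite ge_min; apply/orP; left; rewrite leNgt; apply/negP => ye.
by apply: Uy; apply: He; rewrite snormB.
Qed.

Lemma cdist_lip U x y : `|cdist U x - cdist U y| <= snorm (x - y).
Proof.
have H (a c : S) : cdist U a - cdist U c <= snorm (a - c).
  rewrite lerBlDl -lerBlDr; apply: lb_le_inf; first by exists 1; right.
  move=> z [[v Uv <-]|->].
    rewrite lerBlDr (@le_trans _ _ (snorm (a - v)))//.
      by apply: ge_inf; [exact: cdist_lb|left; exists v].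
    by rewrite [leRHS]addrC; exact: snorm_dist.
  rewrite lerBlDr (@le_trans _ _ 1)//; last by rewrite lerDl snorm_ge0.
  by apply: ge_inf; [exact: cdist_lb|right].
rewrite ler_norml H andbT lerNl opprB.
by rewrite (le_trans (H y x))// snormB.
Qed.

Definition bump (U : set S) (j : nat) (x : S) : R := Num.min 1 (j%:R * cdist U x).

Lemma bump_lip U j : lip01 (bump U j).
Proof.
split=> [x|].
  by rewrite /bump le_min ler01 mulr_ge0 ?cdist_ge0//= ge_min lexx.
exists j%:R => // x y.
have H (a c : R) : Num.min 1 a - Num.min 1 c <= `|a - c|.
  have a1 : Num.min 1 a <= 1 by rewrite ge_min lexx.
  have a2 : Num.min 1 a <= a by rewrite ge_min lexx orbT.
  have := ler_norm (a - c); have := normr_ge0 (a - c).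
  by case: (leP 1 c) => c1 h1 h2; lra.
have {}H (a c : R) : `|Num.min 1 a - Num.min 1 c| <= `|a - c|.
  by rewrite ler_norml H andbT lerNl opprB distrC H.
rewrite (le_trans (H _ _))// -mulrBr normrM ger0_norm// ler_wpM2l//.
exact: cdist_lip.
Qed.

Lemma bump_cvg U x : segment_open U -> bump U ^~ x @ \oo --> (\1_U x : R).
Proof.
move=> oU; rewrite indicE; have [xU|xU] := boolP (x \in U).
  have U0 := cdist_in oU (set_mem xU).
  apply: cvg_near_cst; exists (Num.truncn (cdist U x)^-1).+1 => // n /= nU.
  rewrite /bump min_l// -ler_pdivrMr// mul1r.
  by rewrite (le_trans (ltW (truncnS_gt _)))// ler_nat.
rewrite (_ : bump U ^~ x = cst 0); first exact: cvg_cst.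
apply/funext => n; rewrite /bump cdist_out ?mulr0 ?min_r//.
by move=> /mem_set; exact/negP.
Qed.

Section Approx.
Context (X Y : Omega -> S).
Hypotheses (mX : measurable_fun setT X) (mY : measurable_fun setT Y).

(** A Harnack inequality involves two laws, so a single [v] has to approximate [u] under both. *)
Let approx (u : S -> R) := forall e : R, 0 < e -> exists2 v, lip01 v &
  \int[P]_w `|u (X w) - v (X w)| + \int[P]_w `|u (Y w) - v (Y w)| <= e.

Let bdm_diff u v (Z : Omega -> S) : unit_fun u -> unit_fun v -> measurable_fun setT Z ->
  bdm (fun w => `|u (Z w) - v (Z w)|).
Proof. by move=> hu hv mZ; apply/bdm_norm/bdmB; exact: unit_bdm. Qed.

Let unit_indic (A : set S) : measurable A -> unit_fun (\1_A).
Proof.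
move=> mA; split; first exact: measurable_indic.
by move=> x; rewrite indicE; case: (x \in A); rewrite ?lexx ?ler01.
Qed.

Let approx_limit (u_ : nat -> S -> R) u : (forall n, unit_fun (u_ n)) -> unit_fun u ->
  (forall x, u_ ^~ x @ \oo --> u x) -> (forall n, approx (u_ n)) -> approx u.
Proof.
move=> hu_ hu cu au e e0; have e2 : 0 < e / 2 by rewrite divr_gt0.
have cv (Z : Omega -> S) : measurable_fun setT Z ->
    \int[P]_w `|u (Z w) - u_ n (Z w)| @[n --> \oo] --> (0 : R).
  move=> mZ; rewrite -[X in _ --> X](Ecst P 0).
  apply: (@bounded_cvg _ _ _ _ _ _ 2).
  - by move=> n; have [] := bdm_diff hu (hu_ n) mZ.
  - exact: measurable_cst.
  - move=> n w; rewrite normr_id; have /andP[? ?] := hu.2 (Z w).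
    have /andP[? ?] := (hu_ n).2 (Z w); rewrite ler_norml; apply/andP; split; lra.
  - apply: aeW => w; rewrite -[X in _ --> X](normr0 R) -(subrr (u (Z w))).
    by apply: cvg_norm; apply: cvgB; [exact: cvg_cst|exact: cu].
have cvn : \int[P]_w `|u (X w) - u_ n (X w)| + \int[P]_w `|u (Y w) - u_ n (Y w)|
    @[n --> \oo] --> (0 : R).
  by rewrite -[X in _ --> X](addr0 0); apply: cvgD; exact: cv.
have /cvgrPdist_lt/(_ _ e2)[n _ Hn] := cvn.
have {Hn}Hn := Hn n (leqnn n).
have [v lv vn] := au n _ e2; exists v => //.
have tri (Z : Omega -> S) : measurable_fun setT Z -> \int[P]_w `|u (Z w) - v (Z w)| <=
    \int[P]_w `|u (Z w) - u_ n (Z w)| + \int[P]_w `|u_ n (Z w) - v (Z w)|.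
  move=> mZ; have b1 := bdm_diff hu (hu_ n) mZ.
  have b2 := bdm_diff (hu_ n) (lip01_unit lv) mZ.
  have b3 := bdm_diff hu (lip01_unit lv) mZ.
  rewrite -(ED P b1 b2); apply: Ele => //; first exact: bdmD.
  by move=> w; exact: ler_distD.
rewrite (le_trans (lerD (tri _ mX) (tri _ mY)))// addrACA [leRHS]splitr lerD//.
by rewrite (le_trans (ler_norm _))// -normrN -[X in `|X|]add0r ltW.
Qed.

(** The sets with this property form a sigma-algebra containing the open sets: bumps handle open
    sets, [1 - v] complements, maxima finite unions, and dominated convergence countable unions. *)
Let approx_set : forall A : set S, measurable A -> approx (\1_A : S -> R).
Proof.
pose F := [set A : set S | measurable A /\ approx (\1_A : S -> R)].
suff : (<<s @segment_open R r d >>) `<=` F by move=> H A /H[].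
have unionF (A B : set S) : F A -> F B -> F (A `|` B).
  move=> [mA aA] [mB aB]; split; first exact: measurableU.
  move=> e e0; have e2 : 0 < e / 2 by rewrite divr_gt0.
  have [v lv Hv] := aA _ e2; have [v' lv' Hv'] := aB _ e2.
  exists (fun x => Num.max (v x) (v' x)); first exact: lip01_max.
  have H (Z : Omega -> S) : measurable_fun setT Z ->
    \int[P]_w `|\1_(A `|` B) (Z w) - Num.max (v (Z w)) (v' (Z w))| <=
    \int[P]_w `|\1_A (Z w) - v (Z w)| + \int[P]_w `|\1_B (Z w) - v' (Z w)|.
    move=> mZ; have b1 := bdm_diff (unit_indic mA) (lip01_unit lv) mZ.
    have b2 := bdm_diff (unit_indic mB) (lip01_unit lv') mZ.
    have b3 := bdm_diff (unit_indic (measurableU _ _ mA mB))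
      (lip01_unit (lip01_max lv lv')) mZ.
    rewrite -(ED P b1 b2); apply: Ele => //; first exact: bdmD.
    move=> w; rewrite !indicE in_setU.
      have /andP[? ?] := lv.1 (Z w); have /andP[? ?] := lv'.1 (Z w).
      case: (Z w \in A); case: (Z w \in B) => /=;
      case: (leP (v (Z w)) (v' (Z w))) => h;
      rewrite ?subr0 ?sub0r ?normrN; 
      rewrite ?(@ger0_norm _ (1 - _)) ?subr_ge0// ?ger0_norm//; lra.
  rewrite (le_trans (lerD (H _ mX) (H _ mY)))// addrACA [leRHS]splitr.
  by rewrite lerD.
apply: smallest_sub; last first.
  move=> U oU; split; first exact: sub_sigma_algebra.
  apply: (@approx_limit (bump U)).
  - by move=> n; apply: lip01_unit; exact: bump_lip.
  - by apply: unit_indic; exact: sub_sigma_algebra.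
  - by move=> x; exact: bump_cvg.
  - move=> n e e0; exists (bump U n); first exact: bump_lip.
    have z (Z : Omega -> S) : \int[P]_w `|bump U n (Z w) - bump U n (Z w)| = 0.
      rewrite -[RHS](Ecst P 0); apply: eq_Rintegral => w _.
      by rewrite subrr normr0.
    have le0 (a : R) : a = 0 -> a <= 0 by move=> ->.
    apply: le_trans (lerD (le0 _ (z X)) (le0 _ (z Y))) _.
    by rewrite addr0 ltW.
split.
- split; first exact: measurable0.
  move=> e e0; exists (fun=> 0).
    split=> [x|]; first by rewrite lexx ler01.
    by exists 0 => // x y; rewrite subrr normr0 mul0r.
  have z (Z : Omega -> S) : \int[P]_w `|\1_set0 (Z w) - (0 : R)| = 0.
    rewrite -[RHS](Ecst P 0); apply: eq_Rintegral => w _.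
    by rewrite indicE in_set0 subrr normr0.
  have le0 (a : R) : a = 0 -> a <= 0 by move=> ->.
  apply: le_trans (lerD (le0 _ (z X)) (le0 _ (z Y))) _.
  by rewrite addr0 ltW.
- move=> A [mA aA]; rewrite setTD; split; first exact: measurableC.
  move=> e e0; have [v lv Hv] := aA _ e0.
  exists (fun x => 1 - v x); first exact: lip01_compl.
  have E (x : S) : `|\1_(~` A) x - (1 - v x)| = `|\1_A x - v x|.
    rewrite -normrN !indicE in_setC; congr `|_|; case: (x \in A) => /=; lra.
  have EE (Z : Omega -> S) : \int[P]_w `|\1_(~` A) (Z w) - (1 - v (Z w))| =
      \int[P]_w `|\1_A (Z w) - v (Z w)|.
    by apply: eq_Rintegral => w _; exact: E.
  by rewrite (EE X) (EE Y).
- move=> A_ FA_; split; first by apply: bigcupT_measurable => n; case: (FA_ n).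
  pose B_ n := \big[setU/set0]_(k < n.+1) A_ k.
  have FB_ n : F (B_ n).
    rewrite /B_; elim: n => [|n IH]; first by rewrite big_ord1.
    by rewrite big_ord_recr/=; exact: unionF.
  apply: (@approx_limit (fun n => \1_(B_ n))).
  - by move=> n; apply: unit_indic; case: (FB_ n).
  - by apply: unit_indic; apply: bigcupT_measurable => n; case: (FA_ n).
  - move=> x; have [[n _ Anx]|nA] := pselect ((\bigcup_k A_ k) x).
      apply: cvg_near_cst; exists n => // m /= nm; rewrite !indicE.
      rewrite !mem_set//; first by exists n.
      rewrite /B_ -bigcup_mkord; exists n => //=.
    rewrite (_ : (fun n => _) = cst (\1_(\bigcup_k A_ k) x)); first exact: cvg_cst.
    apply/funext => n /=; rewrite !indicE !memNset//.
    by rewrite /B_ -bigcup_mkord => -[k _ Akx]; apply: nA; exists k.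
  - by move=> n; case: (FB_ n).
Qed.

Lemma lip_approx u (e : R) : unit_fun u -> 0 < e -> exists2 v, lip01 v &
  \int[P]_w `|u (X w) - v (X w)| + \int[P]_w `|u (Y w) - v (Y w)| <= e.
Proof.
move=> hu; have [mu u01] := hu.
(* Layer cake: [u] is within [1 / (n + 1)] of the average of the indicators of its level sets, to
   which [approx_set] applies. *)
pose u_ (n : nat) x := n.+1%:R^-1 * \sum_(i < n.+1) \1_[set y | i.+1%:R / n.+1%:R <= u y] x : R.
have mset (c : R) : measurable [set y | c <= u y].
  rewrite -[X in measurable X]setTI (_ : [set _ | _] = u @^-1` `[c, +oo[%classic); last first.
    by apply/seteqP; split => y /=; rewrite in_itv/= andbT.
  by apply: mu => //; exact: measurable_itv.
have u_E n x : `|u x - u_ n x| <= n.+1%:R^-1.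
  have n0 : (0 : R) < n.+1%:R by [].
  (* [k] is the number of levels that [u x] reaches. *)
  pose k := Num.truncn (n.+1%:R * u x).
  have /andP[ux0 ux1] := u01 x.
  have /andP[k1 k2] : k%:R <= n.+1%:R * u x < k.+1%:R by rewrite truncn_itv// mulr_ge0.
  have kn : (k <= n.+1)%N.
    by rewrite -(ler_nat R) (le_trans k1)// ler_piMr.
  have -> : u_ n x = n.+1%:R^-1 * k%:R.
    rewrite /u_; congr (_ * _).
    transitivity (\sum_(i < n.+1) (if (i < k)%N then 1 else 0) : R).
      apply: eq_bigr => i _; rewrite indicE; case: ifPn => ik.
        rewrite mem_set//= ler_pdivrMr// mulrC (le_trans _ k1)// ler_nat//.
      rewrite memNset//=; apply/negP; rewrite -ltNge ltr_pdivlMr// mulrC.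
      by rewrite (lt_le_trans k2)// ler_nat ltnS leqNgt.
    rewrite -big_mkcond/= -(big_ord_widen _ (fun=> 1)) //.
    by rewrite sumr_const card_ord.
  rewrite -(ler_pM2l n0) divff ?gt_eqF// -[X in X * `|_|]ger0_norm// -normrM mulrBr.
  rewrite mulrA divff ?gt_eqF// mul1r ger0_norm ?subr_ge0//.
  by move: k2; rewrite -natr1 => k2; lra.
move=> e0; apply: (@approx_limit u_) => //.
- move=> n; split.
    apply: measurable_funM => //; apply: measurable_sum => i.
    by apply: measurable_indic; exact: mset.
  move=> x; rewrite mulr_ge0 ?sumr_ge0//=.
  rewrite ler_pdivrMl// mulr1 (@le_trans _ _ (\sum_(i < n.+1) 1))//; last first.
    by rewrite sumr_const card_ord.
  by apply: ler_sum => i _; rewrite indicE; case: (_ \in _); rewrite ?lexx ?ler01.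
- move=> x; apply/cvgrPdist_le => c c0.
  exists (Num.truncn c^-1) => // n /= nc; rewrite (le_trans (u_E n x))//.
  rewrite -[leRHS]invrK lef_pV2 ?posrE ?invr_gt0//.
  by rewrite (le_trans (ltW (truncnS_gt _)))// ler_nat.
- move=> n c c0.
  have cn : 0 < c / n.+1%:R by rewrite divr_gt0.
  have /choice[v Hv] : forall i : 'I_n.+1, exists v, lip01 v /\
    \int[P]_w `|\1_[set y | i.+1%:R / n.+1%:R <= u y] (X w) - v (X w)| +
    \int[P]_w `|\1_[set y | i.+1%:R / n.+1%:R <= u y] (Y w) - v (Y w)| <= c.
    by move=> i; have [v lv Hv] := approx_set (mset (i.+1%:R / n.+1%:R)) c0; exists v.
  exists (fun x => n.+1%:R^-1 * \sum_i v i x).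
    by apply: lip01_avg => i; case: (Hv i).
  pose D (i : 'I_n.+1) (Z : Omega -> S) w := `|\1_[set y | i.+1%:R / n.+1%:R <= u y] (Z w) - v i (Z w)|.
  have bD (i : 'I_n.+1) Z : measurable_fun setT Z -> bdm (D i Z).
    move=> mZ; apply: bdm_diff => //; first by apply: unit_indic; exact: mset.
    by apply: lip01_unit; case: (Hv i).
  have bDs (s : seq 'I_n.+1) Z : measurable_fun setT Z -> bdm (fun w => \sum_(i <- s) D i Z w) /\
      \int[P]_w (\sum_(i <- s) D i Z w) = \sum_(i <- s) \int[P]_w D i Z w.
    move=> mZ; elim: s => [|i s [IH1 IH2]].
      rewrite (_ : (fun w => _) = fun=> 0); last by apply/funext => w; rewrite big_nil.
      by split; [exact: bdm_cst|rewrite Ecst big_nil].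
    rewrite (_ : (fun w => _) = fun w => D i Z w + \sum_(j <- s) D j Z w); last first.
      by apply/funext => w; rewrite big_cons.
    split; first by apply: bdmD => //; exact: bD.
    by rewrite big_cons -IH2 (ED P (bD i Z mZ) IH1).
  have key (Z : Omega -> S) : measurable_fun setT Z ->
    \int[P]_w `|u_ n (Z w) - n.+1%:R^-1 * \sum_i v i (Z w)| <=
    n.+1%:R^-1 * \sum_i \int[P]_w D i Z w.
    move=> mZ; rewrite -(bDs _ _ mZ).2 -EZ; last exact: (bDs _ _ mZ).1.
    apply: Ele.
    - apply: (@bdm_ge0 _ _ _ _ 2) => //.
        apply: measurableT_comp => //; apply: measurable_funB.
          apply: measurable_funM => //; apply: measurable_sum => i.
          by have [] := unit_bdm (unit_indic (mset (i.+1%:R / n.+1%:R))) mZ.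
        apply: measurable_funM => //; apply: measurable_sum => i.
        by have [] := unit_bdm (lip01_unit (Hv i).1) mZ.
      move=> w.
      have [/(_ (Z w))/andP[h1 h2] _] := lip01_avg (fun i => (Hv i).1).
      have := u_E n (Z w); have /andP[? ?] := u01 (Z w).
      have : n.+1%:R^-1 <= 1 :> R by rewrite invf_le1// ler1n.
      rewrite !ler_norml => h3 /andP[h4 h5].
      move: (u_ n (Z w)) (n.+1%:R^-1 * \sum_i v i (Z w)) n.+1%:R^-1 h1 h2 h3 h4 h5.
      by move=> a b k *; apply/andP; split; lra.
    - by apply: bdmM; [exact: bdm_cst|exact: (bDs _ _ mZ).1].
    - move=> w; rewrite /u_ -mulrBr normrM ger0_norm ?invr_ge0// ler_wpM2l ?invr_ge0//.
      by rewrite -sumrB ler_norm_sum.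
  rewrite (le_trans (lerD (key _ mX) (key _ mY)))// -mulrDr -big_split/=.
  rewrite ler_pdivrMl// (le_trans (ler_sum _ (fun i _ => (Hv i).2)))//.
  by rewrite sumr_const card_ord mulr_natl.
Qed.

End Approx.
End Lipschitz_density.

(** * Independence and shift bounds *)

Section Shift.
Context (R : realType) (r : R) (d : nat) (r0 : 0 < r).
Context (dO : measure_display) (Omega : measurableType dO) (P : probability Omega R).
Notation S := (segment r d).
Implicit Types (G : set (set Omega)).
Let r0' : 0 <= r := ltW r0.

Lemma segmentD_measurable dE (E : measurableType dE) (f g : E -> S) :
  measurable_fun setT f -> measurable_fun setT g -> measurable_fun setT (fun x => f x + g x).
Proof.
move=> mf mg; apply: segment_measurableP => // s i _.
rewrite (_ : (fun _ => _) = (fun x => f x s i 0 + g x s i 0)); last first.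
  by apply/funext => x; rewrite segmentD mxE.
apply: measurable_funD.
  exact: (measurableT_comp (eval_measurable r0' s i) mf).
exact: (measurableT_comp (eval_measurable r0' s i) mg).
Qed.

Lemma freezeG G dE2 (E2 : measurableType dE2) (N : Omega -> E2)
    (g : Omega -> E2 -> R) (M : R) : sigma_algebra setT G -> G `<=` measurable ->
  measurable_fun setT N -> indep_of P G N ->
  measurable_fun setT (fun z : g_sigma_algebraType G * E2 => g z.1 z.2) ->
  (forall w y, 0 <= g w y <= M) ->
  \int[P]_w g w (N w) = \int[P]_w \int[P]_w' g w (N w').
Proof.
move=> sG Gm mN iN mg g0.
have mid : measurable_wrt G (fun w : Omega => w : g_sigma_algebraType G).
  by move=> A mA; rewrite preimage_id; rewrite -(sigma_algebra_g sG).
apply: (@freezeR R dO Omega P G Gm _ (g_sigma_algebraType G) _ E2 _ N mid mN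
  (fun z => g z.1 z.2) M) => //.
- by move=> z; case/andP: (g0 z.1 z.2).
- by move=> z; case/andP: (g0 z.1 z.2).
Qed.

Lemma indep_int G dE2 (E2 : measurableType dE2) (N : Omega -> E2) (A : set Omega)
    (g : E2 -> R) (M : R) : sigma_algebra setT G -> G `<=` measurable ->
  measurable_fun setT N -> indep_of P G N -> G A ->
  measurable_fun setT g -> (forall y, 0 <= g y <= M) ->
  \int[P]_w (\1_A w * g (N w)) = fine (P A) * \int[P]_w g (N w).
Proof.
move=> sG Gm mN iN GA mg g0.
have bg : bdm (fun w => g (N w)).
  apply: (@bdm_ge0 _ _ _ _ M) => [|w|w]; first exact: measurableT_comp.
  - by case/andP: (g0 (N w)).
  - by case/andP: (g0 (N w)).
rewrite (@freezeG G _ E2 N (fun w y => \1_A w * g y) M)//.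
- rewrite -(E_indic P (Gm _ GA)) -EZr; last exact/bdm_indic/Gm.
  by apply: eq_Rintegral => w _; rewrite EZ.
- apply: measurable_funM.
    have mA : @measurable _ (g_sigma_algebraType G) A by exact: sub_sigma_algebra.
    have := @measurable_indic _ (g_sigma_algebraType G) R setT A mA.
    by move=> h; exact: (measurableT_comp h).
  exact: (measurableT_comp mg).
- move=> w y; have /andP[h1 h2] := g0 y.
  by rewrite indicE; case: (w \in A); rewrite ?mul1r ?h1// mul0r lexx (le_trans h1).
Qed.

(** A power Harnack inequality for the law of [N], required for all [p > 1] with one cost [ka]: the
    lower bound on the scheme value needs exponents close to 1. *)
Definition shift_bound (N : Omega -> S) (th : S) (ka : R) :=
  forall p u, 1 < p -> unit_fun u ->
  (\int[P]_w u (N w)) `^ p <=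
  expR (p / (2 * (p - 1)) * ka) * \int[P]_w (u (N w + th) `^ p).

Lemma unit_powR_bdm (u : S -> R) p (N : Omega -> S) : 0 <= p -> unit_fun u ->
  measurable_fun setT N -> bdm (fun w => u (N w) `^ p).
Proof.
move=> p0 hu mN; apply: bdm_powR => //; first by move=> w; case/andP: (hu.2 (N w)).
exact: unit_bdm.
Qed.

Lemma unit_shift (u : S -> R) th : unit_fun u -> unit_fun (fun x => u (x + th)).
Proof.
move=> [mu u01]; split => //; apply: (measurableT_comp mu).
by apply: segmentD_measurable; [exact: measurable_id|exact: measurable_cst].
Qed.

Lemma unit_powR (u : S -> R) p : 0 <= p -> unit_fun u -> unit_fun (fun x => u x `^ p).
Proof.
move=> p0 [mu u01]; split; first exact: (measurableT_comp (measurable_powR p)).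
move=> x; rewrite powR_ge0/=; have /andP[h0 h1] := u01 x.
have -> : (1 : R) = 1 `^ p by rewrite powR1.
by rewrite ge0_ler_powR ?nnegrE.
Qed.

Section Perturb.
Variables (f g : Omega -> R) (p : R).
Hypotheses (bf : bdm f) (bg : bdm g) (p1 : 1 <= p).
Hypotheses (f01 : forall w, 0 <= f w <= 1) (g01 : forall w, 0 <= g w <= 1).

Let E01 (h : Omega -> R) : bdm h -> (forall w, 0 <= h w <= 1) -> 0 <= \int[P]_w h w <= 1.
Proof.
move=> bh h01; rewrite Ege0/= => [|w]; last by case/andP: (h01 w).
by apply: Ele1 => // w; case/andP: (h01 w).
Qed.

Lemma powR_int_perturb : (\int[P]_w f w) `^ p <=
  (\int[P]_w g w) `^ p + p * \int[P]_w `|f w - g w|.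
Proof.
rewrite -lerBlDl (le_trans (ler_norm _))//.
rewrite (le_trans (powR_lip p1 (E01 bf f01) (E01 bg g01)))//.
rewrite ler_wpM2l ?(le_trans _ p1)// -EB//.
by apply: Enorm; exact: bdmB.
Qed.

Lemma int_powR_perturb : \int[P]_w (g w `^ p) <=
  \int[P]_w (f w `^ p) + p * \int[P]_w `|f w - g w|.
Proof.
have p0 : 0 <= p by exact: le_trans p1.
have f0 w : 0 <= f w by case/andP: (f01 w).
have g0 w : 0 <= g w by case/andP: (g01 w).
have b1 := bdm_norm (bdmB bf bg).
have b2 : bdm (fun w => p * `|f w - g w|) by apply: bdmM => //; exact: bdm_cst.
have b3 := bdm_powR p0 f0 bf; have b4 := bdm_powR p0 g0 bg.
rewrite -EZ// -ED//; apply: Ele => //; first exact: bdmD.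
move=> w; rewrite -lerBlDl (le_trans (ler_norm _))// distrC.
exact: powR_lip.
Qed.

End Perturb.

Section Add.
Variables (G G' : set (set Omega)).
Hypotheses (sG : sigma_algebra setT G) (sG' : sigma_algebra setT G').
Hypotheses (GG' : G `<=` G') (Gm' : G' `<=` measurable).
Variables (n1 n2 : Omega -> S).
Hypotheses (m1 : measurable_wrt G' n1) (m2 : measurable_fun setT n2).
Hypotheses (i1 : indep_of P G n1) (i2 : indep_of P G' n2).

Let m1' : measurable_fun setT n1 := measurable_wrt_fun Gm' m1.

Let inner u := fun x => \int[P]_w u (x + n2 w).

Let inner_unit u : unit_fun u -> unit_fun (inner u).
Proof.
move=> [mu u01].
have mg : measurable_fun setT (fun z : S * S => u (z.1 + z.2)).
  by apply: (measurableT_comp mu); exact: segmentD_measurable.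
have g0 (z : S * S) : 0 <= u (z.1 + z.2) by case/andP: (u01 (z.1 + z.2)).
have g1 (z : S * S) : u (z.1 + z.2) <= 1 by case/andP: (u01 (z.1 + z.2)).
split.
  exact: (measurable_inner P m2 mg g0).
move=> x; rewrite /inner (Ege0 P (fun w => g0 (x, n2 w)))/=.
exact: (inner_le P m2 mg g0 g1 x).
Qed.

Let innerE u : unit_fun u -> \int[P]_w u (n1 w + n2 w) = \int[P]_w inner u (n1 w).
Proof.
move=> [mu u01].
apply: (@freezeR R dO Omega P G' Gm' _ S _ S n1 n2 m1 m2 (fun z => u (z.1 + z.2)) 1) => //.
- by apply: (measurableT_comp mu); exact: segmentD_measurable.
- by move=> z; case/andP: (u01 (z.1 + z.2)).
- by move=> z; case/andP: (u01 (z.1 + z.2)).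
Qed.

(** Freezing the past in [G'] to integrate over [n2], and then using that [n1] is independent of
    [G], factors the expectation of the product of the two indicators. *)
Lemma indep_add : indep_of P G (fun w => n1 w + n2 w).
Proof.
move=> A U GA mU.
have mU' : unit_fun (\1_U : S -> R).
  split; first exact: measurable_indic.
  by move=> x; rewrite indicE; case: (x \in U); rewrite ?lexx ?ler01.
have m12 : measurable_fun setT (fun w => n1 w + n2 w) by exact: segmentD_measurable.
have mA : measurable A by exact/Gm'/GG'.
have mB : measurable ((fun w => n1 w + n2 w) @^-1` U).
  by rewrite -[X in measurable X]setTI; exact: m12.
have Gm : G `<=` measurable by exact: subset_trans Gm'.
have P1 : fine (P (A `&` (fun w => n1 w + n2 w) @^-1` U)) =
    \int[P]_w (\1_A w * \1_U (n1 w + n2 w)).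
  rewrite -(E_indic P); last exact: measurableI.
  by apply: eq_Rintegral => w _; rewrite indicI !indicE.
have P2 : fine (P ((fun w => n1 w + n2 w) @^-1` U)) = \int[P]_w (\1_U (n1 w + n2 w)).
  rewrite -(E_indic P)//.
have key : \int[P]_w (\1_A w * \1_U (n1 w + n2 w)) =
    fine (P A) * \int[P]_w (\1_U (n1 w + n2 w)).
  rewrite innerE// -(@indep_int G _ S n1 A (inner \1_U) 1) //; last 2 first.
  - by have [] := inner_unit mU'.
  - by have [] := inner_unit mU'.
  rewrite (@freezeG G' _ S n2 (fun w y => \1_A w * \1_U (n1 w + y)) 1) //.
  - apply: eq_Rintegral => w _; rewrite EZ//.
    by apply: (unit_bdm mU'); apply: segmentD_measurable => //; exact: measurable_cst.
  - apply: measurable_funM.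
      have mA' : @measurable _ (g_sigma_algebraType G') A.
        by apply: sub_sigma_algebra; exact: GG'.
      have := @measurable_indic _ (g_sigma_algebraType G') R setT A mA'.
      by move=> h; exact: (measurableT_comp h).
    apply: (measurableT_comp mU'.1); apply: segmentD_measurable => //.
    have /(measurable_wrtP sG') h := m1.
    exact: (measurableT_comp h).
  - move=> w y; rewrite !indicE.
    by case: (_ \in _); case: (_ \in _); rewrite ?mulr1 ?mulr0 ?lexx ?ler01.
have fin B : measurable B -> (fine (P B))%:E = P B.
  by move=> mB'; rewrite fineK// fin_num_measure.
rewrite -(fin _ mA) -(fin _ mB) -EFinM P2 -key -P1 fin//.
exact: measurableI.
Qed.

(** The bound for [n1] is applied to [u] averaged over [n2], then the bound for [n2] with [n1 + th1]
    frozen. Both use the same [p], so the costs add. *)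
Lemma shift_bound_add th1 th2 ka1 ka2 : shift_bound n1 th1 ka1 -> shift_bound n2 th2 ka2 ->
  shift_bound (fun w => n1 w + n2 w) (th1 + th2) (ka1 + ka2).
Proof.
move=> s1 s2 p u p1 hu; have p0 : 0 <= p by rewrite ltW// (lt_trans _ p1).
rewrite innerE//; apply: le_trans (s1 _ _ p1 (inner_unit hu)) _.
rewrite (mulrDr _ ka1 ka2) expRD -[leRHS]mulrA ler_wpM2l ?expR_ge0//.
have hv : unit_fun (fun x => u (x + (th1 + th2)) `^ p).
  by apply: unit_powR => //; exact: unit_shift.
rewrite (innerE hv) -EZ; last exact: (unit_bdm (inner_unit hv)).
apply: Ele.
- apply: unit_powR_bdm => //; first exact: inner_unit.
  by apply: segmentD_measurable => //; exact: measurable_cst.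
- by apply: bdmM; [exact: bdm_cst|exact: (unit_bdm (inner_unit hv))].
move=> w; have hx : unit_fun (fun y => u (n1 w + th1 + y)).
  have := unit_shift (n1 w + th1) hu; congr (unit_fun _); apply/funext => y.
  by rewrite addrC.
have := s2 _ _ p1 hx; have := expR_ge0 (p / (2 * (p - 1)) * ka2).
set k := expR _ => k0 h; apply: (le_trans h).
suff -> : \int[P]_w' (u (n1 w + th1 + (n2 w' + th2)) `^ p) =
  inner (fun x => u (x + (th1 + th2)) `^ p) (n1 w) by exact: lexx.
apply: eq_Rintegral => w' _.
by congr (u _ `^ p); rewrite addrACA.
Qed.

End Add.

Lemma indep_zero G : G `<=` measurable -> indep_of P G (fun=> 0 : S).
Proof.
move=> Gm A U GA mU; have [U0|U0] := pselect (U 0).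
  rewrite (_ : _ @^-1` U = setT); last by apply/seteqP; split.
  have PT : P setT = 1%E := probability_setT P.
  by rewrite setIT [X in (_ * X)%E]PT mule1.
rewrite (_ : _ @^-1` U = set0); last by apply/seteqP; split.
by rewrite setI0 measure0 mule0.
Qed.

Lemma shift_bound_zero : shift_bound (fun=> 0) 0 0.
Proof.
move=> p u p1 hu; rewrite mulr0 expR0 mul1r !Ecst.
by rewrite addr0.
Qed.

Section Scalar.
Variables (G : set (set Omega)) (D : Omega -> R) (s : R) (v : 'cV[R]_d) (a c : R).
Hypotheses (s0 : 0 < s) (ac : a < c) (mD : measurable_fun setT D).
Hypothesis lawD : forall U, measurable U -> P (D @^-1` U) = normal_prob 0 s U.

Let N w : S := vramp r (D w *: v) a c.

Lemma vramp_measurable dE (E : measurableType dE) (f : E -> 'cV[R]_d) :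
  (forall i, measurable_fun setT (fun x => f x i 0)) ->
  measurable_fun setT (fun x => vramp r (f x) a c).
Proof.
move=> mf; apply: segment_measurableP => // u i ur.
rewrite (_ : (fun _ => _) = (fun x => ramp a c u * f x i 0)); last first.
  by apply/funext => x; rewrite vrampE// mxE.
by apply: measurable_funM.
Qed.

Let mvec : measurable_fun setT (fun y : R => vramp r (y *: v) a c).
Proof.
apply: vramp_measurable => i; rewrite (_ : (fun _ => _) = (fun y => y * v i 0)).
  exact: measurable_funM.
by apply/funext => y; rewrite mxE.
Qed.

Lemma indep_scalar : indep_of P G D -> indep_of P G N.
Proof.
move=> iD A U GA mU; have := iD A ((fun y : R => vramp r (y *: v) a c) @^-1` U) GA.
apply; rewrite -[X in measurable X]setTI; exact: mvec.
Qed.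

Lemma integral_normal_law (f : R -> R) : measurable_fun setT f -> (forall y, 0 <= f y) ->
  (\int[P]_w (f (D w))%:E = \int[normal_prob 0 s]_y (f y)%:E)%E.
Proof.
move=> mf f0.
have mD' : measurable_fun setT (D : Omega -> measurableTypeR R) by exact: mD.
pose Df : {mfun Omega >-> measurableTypeR R} :=
  HB.pack (D : Omega -> measurableTypeR R) (isMeasurableFun.Build _ _ _ _ _ mD').
have mf' : measurable_fun setT (EFin \o f : measurableTypeR R -> \bar R).
  exact/measurable_EFinP.
have f0' y : (0 <= (EFin \o f : measurableTypeR R -> \bar R) y)%E by rewrite lee_fin.
rewrite -[LHS](@ge0_integral_distribution _ _ _ _ _ P Df (EFin \o f) mf' f0').
by apply: eq_measure_integral => A mA _; exact: lawD.
Qed.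

(** Composing [u] with [y |-> vramp r (y *: v) a c] reduces the claim to the real Gaussian. *)
Lemma shift_bound_scalar h : shift_bound N (vramp r (h *: v) a c) (h ^+ 2 / s ^+ 2).
Proof.
move=> p u p1 hu; have p0 : 0 <= p by rewrite ltW// (lt_trans _ p1).
pose u' y := u (vramp r (y *: v) a c).
have mu' : measurable_fun setT u' by exact: (measurableT_comp hu.1 mvec).
have u01 y : 0 <= u' y <= 1 by exact: hu.2.
have lawE (f : R -> R) : measurable_fun setT f -> (forall y, 0 <= f y) ->
    \int[P]_w f (D w) = \int[normal_prob 0 s]_y f y.
  by move=> mf f0; rewrite /Rintegral integral_normal_law.
have := normal_shift_powR s0 h p1 mu' u01.
rewrite -(lawE u')//; last by move=> y; case/andP: (u01 y).
rewrite -(lawE (fun y => u' (y + h) `^ p)); last 2 first.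
- apply: (measurableT_comp (measurable_powR p)); apply: (measurableT_comp mu').
  exact: measurable_funD.
- by move=> y; exact: powR_ge0.
move=> /le_trans; apply; rewrite ler_wpM2l ?expR_ge0//.
rewrite le_eqVlt; apply/orP; left; apply/eqP; apply: eq_Rintegral => w _.
by rewrite /u' scalerDl vrampD.
Qed.

End Scalar.

(** Truncated at 1 so that the mean is finite without moments; convergence of this mean to 0 is
    convergence in probability. *)
Definition sdist1 (x y : S) : R := Num.min 1 (snorm (x - y)).

Lemma sdist1_bdm (X Y : Omega -> S) : measurable_fun setT X -> measurable_fun setT Y ->
  bdm (fun w => sdist1 (X w) (Y w)).
Proof.
move=> mX mY; apply: (@bdm_ge0 _ _ _ _ 1).
- apply: measurable_minr => //; apply: (measurableT_comp (snorm_measurable r0')).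
  apply: segmentD_measurable => //.
  apply: segment_measurableP => // s i _.
  rewrite (_ : (fun _ => _) = (fun x => - (Y x s i 0))); last first.
    by apply/funext => w; rewrite segmentN mxE.
  apply: measurableT_comp => //.
  exact: (measurableT_comp (eval_measurable r0' s i) mY).
- by move=> w; rewrite le_min ler01 snorm_ge0.
- by move=> w; rewrite ge_min lexx.
Qed.

Lemma lip01_sdist1 u : lip01 u -> exists2 L, 0 <= L &
  forall x y, `|u x - u y| <= L * sdist1 x y.
Proof.
move=> [u01 [L L0 uL]]; exists (L + 1) => [|x y]; first by rewrite addr_ge0.
rewrite /sdist1; case: (leP 1 (snorm (x - y))) => h.
  have /andP[? ?] := u01 x; have /andP[? ?] := u01 y.
  by rewrite mulr1 ler_norml; apply/andP; split; lra.
by rewrite (le_trans (uL x y))// ler_wpM2r ?snorm_ge0// lerDl.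
Qed.

Lemma lip01_cvg u (X_ : nat -> Omega -> S) (X : Omega -> S) : lip01 u ->
  (forall n, measurable_fun setT (X_ n)) -> measurable_fun setT X ->
  \int[P]_w sdist1 (X_ n w) (X w) @[n --> \oo] --> (0 : R) ->
  \int[P]_w `|u (X_ n w) - u (X w)| @[n --> \oo] --> (0 : R).
Proof.
move=> lu mX_ mX cX; have [L L0 uL] := lip01_sdist1 lu.
have hu := lip01_unit r0 lu.
apply: (@squeeze_cvgr _ _ _ _ (fun=> 0) (fun n => L * \int[P]_w sdist1 (X_ n w) (X w))).
- apply: nearW => n; rewrite Ege0//= -EZ; last exact: sdist1_bdm.
  apply: Ele => //; first by apply/bdm_norm/bdmB; exact: unit_bdm.
  by apply: bdmM; [exact: bdm_cst|exact: sdist1_bdm].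
- exact: cvg_cst.
- by rewrite -(mulr0 L); apply: cvgMr; exact: cX.
Qed.

Section Limit.
Variables (N_ : nat -> Omega -> S) (N : Omega -> S).
Hypotheses (mN_ : forall n, measurable_fun setT (N_ n)) (mN : measurable_fun setT N).
Hypothesis cN : \int[P]_w sdist1 (N_ n w) (N w) @[n --> \oo] --> (0 : R).

Lemma indep_limit G : sigma_algebra setT G -> G `<=` measurable ->
  (forall n, indep_of P G (N_ n)) -> indep_of P G N.
Proof.
move=> sG Gm iN A U GA mU; have mA := Gm _ GA.
have mB : measurable (N @^-1` U) by rewrite -[X in measurable X]setTI; exact: mN.
have hU : unit_fun (\1_U : S -> R).
  split; first exact: measurable_indic.
  by move=> x; rewrite indicE; case: (x \in U); rewrite ?lexx ?ler01.
have bA : bdm (\1_A : Omega -> R) := bdm_indic R mA.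
have A01 w : 0 <= (\1_A w : R) <= 1.
  by rewrite indicE; case: (w \in A); rewrite ?lexx ?ler01.
have PA01 : 0 <= fine (P A) <= 1.
  rewrite -(E_indic P mA) Ege0/= => [|w]; last by case/andP: (A01 w).
  by apply: Ele1 => // w; case/andP: (A01 w).
suff key : \int[P]_w (\1_A w * \1_U (N w)) = fine (P A) * \int[P]_w (\1_U (N w)).
  have fin B : measurable B -> (fine (P B))%:E = P B.
    by move=> mB'; rewrite fineK// fin_num_measure.
  rewrite -(fin _ mA) -(fin _ mB) -EFinM -fin; last exact: measurableI.
  congr _%:E; rewrite -(E_indic P); last exact: measurableI.
  rewrite -(E_indic P mB) -key.
  by apply: eq_Rintegral => w _; rewrite indicI !indicE.
apply/eqP; rewrite -subr_eq0 -normr_le0; apply/ler_addgt0Pr => e e0; rewrite add0r.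
(* Four errors: [\1_U] replaced by [v], and [N] by [N_ n], in each of the two expressions. *)
have e4 : 0 < e / 4 by rewrite divr_gt0.
have [v lv Hv] := lip_approx r0 P mN mN hU e4.
have hv := lip01_unit r0 lv.
have /cvgrPdist_lt/(_ _ e4)[n _ Hn] := lip01_cvg lv mN_ mN cN.
have {Hn} := Hn n (leqnn n); rewrite sub0r normrN => Hn.
have vn : \int[P]_w (\1_A w * v (N_ n w)) = fine (P A) * \int[P]_w v (N_ n w).
  by apply: (@indep_int G _ S (N_ n) A v 1) => //; [exact: hv.1|exact: hv.2].
have diff (f g : Omega -> R) : bdm f -> bdm g ->
    `|\int[P]_w (\1_A w * f w) - \int[P]_w (\1_A w * g w)| <= \int[P]_w `|f w - g w| /\
    `|fine (P A) * \int[P]_w f w - fine (P A) * \int[P]_w g w| <= \int[P]_w `|f w - g w|.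
  move=> bf bg; have bfg := bdmB bf bg.
  split.
    rewrite -EB; try exact: bdmM.
    apply: le_trans (Enorm P _) _; first by apply: bdmB; exact: bdmM.
    apply: Ele; [by apply/bdm_norm/bdmB; exact: bdmM|exact: bdm_norm|].
    move=> w; have /andP[h0 h1] := A01 w.
    by rewrite -mulrBr normrM ger0_norm// ler_piMl.
  rewrite -mulrBr -EB// normrM; have /andP[h0 h1] := PA01.
  by rewrite ger0_norm// (le_trans _ (Enorm P bfg))// ler_piMl.
have bU := unit_bdm hU mN; have bv := unit_bdm hv mN; have bvn := unit_bdm hv (mN_ n).
have [d1 d1'] := diff _ _ bU bv.
have [d2 d2'] := diff _ _ bvn bv.
have /ltr_normlW Hn' := Hn.
have a0 : 0 <= \int[P]_w `|\1_U (N w) - v (N w)| by exact: Ege0.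
move: d1 d1' d2 d2' Hv Hn' a0; rewrite vn !ler_norml.
by move=> /andP[? ?] /andP[? ?] /andP[? ?] /andP[? ?] ? ? ?; apply/andP; split; lra.
Qed.

Lemma lip_to_unit_powR (X Y : Omega -> S) (p k : R) : 1 < p -> 0 <= k ->
  measurable_fun setT X -> measurable_fun setT Y ->
  (forall v, lip01 v -> (\int[P]_w v (X w)) `^ p <= k * \int[P]_w (v (Y w) `^ p)) ->
  forall u, unit_fun u -> (\int[P]_w u (X w)) `^ p <= k * \int[P]_w (u (Y w) `^ p).
Proof.
move=> p1 k0 mX mY H u hu; have p0 : 0 <= p by rewrite ltW// (lt_trans _ p1).
apply/ler_addgt0Pr => e e0.
(* The approximation costs [p * A] on the left and [k * (p * B)] on the right, together at most
   [p * (1 + k) * (A + B)]. *)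
have den : 0 < p * (1 + k) by rewrite mulr_gt0 ?ltr_wpDr// (lt_trans _ p1).
have e1 : 0 < e / (p * (1 + k)) by rewrite divr_gt0.
have [v lv Hv] := lip_approx r0 P mX mY hu e1.
have hv := lip01_unit r0 lv.
set A := \int[P]_w `|u (X w) - v (X w)| in Hv.
set B := \int[P]_w `|u (Y w) - v (Y w)| in Hv.
have A0 : 0 <= A by exact: Ege0.
have B0 : 0 <= B by exact: Ege0.
have h1 : (\int[P]_w u (X w)) `^ p <= (\int[P]_w v (X w)) `^ p + p * A.
  apply: powR_int_perturb; [exact: unit_bdm|exact: unit_bdm|exact: ltW| |] => w.
    exact: hu.2.
  exact: hv.2.
have h2 : \int[P]_w (v (Y w) `^ p) <= \int[P]_w (u (Y w) `^ p) + p * B.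
  apply: int_powR_perturb; [exact: unit_bdm|exact: unit_bdm|exact: ltW| |] => w.
    exact: hu.2.
  exact: hv.2.
rewrite (le_trans h1)// (le_trans (lerD (H v lv) (lexx _)))//.
rewrite (le_trans (lerD (ler_wpM2l k0 h2) (lexx _)))// mulrDr -addrA lerD2l.
move: Hv; rewrite ler_pdivlMr// => Hv; apply: le_trans Hv.
have : 0 <= p * A by rewrite mulr_ge0.
have : 0 <= p * B by rewrite mulr_ge0.
move=> pB pA; have : 0 <= k * (p * A) by rewrite mulr_ge0.
by lra.
Qed.

(** Both sides converge for Lipschitz test functions, and [lip_to_unit_powR] extends the result. The
    cost is the same for every [n], so it survives the limit. *)
Lemma shift_bound_limit (th_ : nat -> S) th ka : (forall n, shift_bound (N_ n) (th_ n) ka) ->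
  snorm (th_ n - th) @[n --> \oo] --> (0 : R) -> shift_bound N th ka.
Proof.
move=> sN cth p u p1 hu; have p0 : 0 <= p by rewrite ltW// (lt_trans _ p1).
have mNt t : measurable_fun setT (fun w => N w + t).
  by apply: segmentD_measurable => //; exact: measurable_cst.
have mNt_ n t : measurable_fun setT (fun w => N_ n w + t).
  by apply: segmentD_measurable => //; exact: measurable_cst.
apply: (lip_to_unit_powR p1 (expR_ge0 (p / (2 * (p - 1)) * ka)) mN (mNt th)) => //.
move=> v lv; have hv := lip01_unit r0 lv.
set k := expR _; have k0 : 0 <= k by exact: expR_ge0.
have cD : \int[P]_w sdist1 (N_ n w + th_ n) (N w + th) @[n --> \oo] --> (0 : R).
  apply: (@squeeze_cvgr _ _ _ _ (fun=> 0)
    (fun n => \int[P]_w sdist1 (N_ n w) (N w) + snorm (th_ n - th))).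
  - apply: nearW => n; rewrite Ege0 => [|w]; last by rewrite le_min ler01 snorm_ge0.
    rewrite -[X in _ + X](Ecst P) -ED; last 2 first.
    + exact: sdist1_bdm.
    + exact: bdm_cst.
    apply: Ele; first exact: sdist1_bdm.
      by apply: bdmD; [exact: sdist1_bdm|exact: bdm_cst].
    move=> w; rewrite /sdist1 opprD addrACA.
    have cab := snormD r0' (N_ n w - N w) (th_ n - th).
    have c0 := snorm_ge0 r0' (th_ n - th); have b0 := snorm_ge0 r0' (N_ n w - N w).
    rewrite ge_min; case: (leP 1 (snorm (N_ n w - N w))) => b1; apply/orP.
      by left; rewrite lerDl.
    by right.
  - exact: cvg_cst.
  - by rewrite -(addr0 0); apply: cvgD.
have c1 := lip01_cvg lv mN_ mN cN.
have c2 := lip01_cvg lv (fun n => mNt_ n (th_ n)) (mNt th) cD.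
apply/ler_addgt0Pr => e e0.
have den : 0 < p * (1 + k) by rewrite mulr_gt0 ?ltr_wpDr// (lt_trans _ p1).
have e1 : 0 < e / (p * (1 + k)) by rewrite divr_gt0.
have c12 : \int[P]_w `|v (N_ n w) - v (N w)| +
    \int[P]_w `|v (N_ n w + th_ n) - v (N w + th)| @[n --> \oo] --> (0 : R).
  by rewrite -(addr0 0); apply: cvgD.
have /cvgrPdist_lt/(_ _ e1)[n _ Hn] := c12.
have {Hn} := Hn n (leqnn n); rewrite sub0r normrN => /ltr_normlW.
set A := \int[P]_w _; set B := \int[P]_w _ => Hv.
have A0 : 0 <= A by exact: Ege0.
have B0 : 0 <= B by exact: Ege0.
have h1 : (\int[P]_w v (N w)) `^ p <= (\int[P]_w v (N_ n w)) `^ p + p * A.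
  have -> : A = \int[P]_w `|v (N w) - v (N_ n w)|.
    by apply: eq_Rintegral => w _; rewrite distrC.
  by apply: powR_int_perturb; [exact: unit_bdm|exact: unit_bdm|exact: ltW| |] => w;
    exact: hv.2.
have h2 : \int[P]_w (v (N_ n w + th_ n) `^ p) <=
    \int[P]_w (v (N w + th) `^ p) + p * B.
  have -> : B = \int[P]_w `|v (N w + th) - v (N_ n w + th_ n)|.
    by apply: eq_Rintegral => w _; rewrite distrC.
  by apply: int_powR_perturb; [exact: (unit_bdm hv)|exact: (unit_bdm hv)|exact: ltW| |] => w;
    exact: hv.2.
rewrite (le_trans h1)// (le_trans (lerD (sN n p v p1 hv) (lexx _)))// -/k.
rewrite (le_trans (lerD (ler_wpM2l k0 h2) (lexx _)))// mulrDr -addrA lerD2l.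
move: Hv; rewrite ltr_pdivlMr// => Hv; apply: le_trans (ltW Hv).
have : 0 <= p * A by rewrite mulr_ge0.
have : 0 <= p * B by rewrite mulr_ge0.
move=> pB pA; have : 0 <= k * (p * A) by rewrite mulr_ge0.
by lra.
Qed.

End Limit.
End Shift.

(** * The Euler chain *)

Section Euler_chain.
Context (R : realType) (r : R) (d : nat) (r0 : 0 < r).
Context (dO : measure_display) (Omega : measurableType dO) (P : probability Omega R).
Notation S := (segment r d).
Let r0' : 0 <= r := ltW r0.

Variables (G : nat -> set (set Omega)) (n : nat -> Omega -> S).
Variables (T : nat -> 'cV[R]_d -> S) (ka : nat -> 'cV[R]_d -> R) (c : nat -> S -> 'cV[R]_d).

(* Backward iteration of the transition kernels
   [z |-> z + T k (c k z) + n k] of the Euler chain. *)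
Fixpoint euler_value (f : S -> R) (m k : nat) (z : S) : R :=
  if m is m'.+1 then \int[P]_w euler_value f m' k.+1 (z + T k (c k z) + n k w) else f z.

Hypothesis sG : forall k, sigma_algebra setT (G k).
Hypothesis Gm : forall k, G k `<=` measurable.
Hypothesis GS : forall k, G k `<=` G k.+1.
Variable N : nat.
Hypothesis mn : forall k, (k < N)%N -> measurable_wrt (G k.+1) (n k).
Hypothesis inn : forall k, (k < N)%N -> indep_of P (G k) (n k).
Hypothesis TB : forall k v w, T k (v - w) = T k v - T k w.
Hypothesis shn : forall k v, (k < N)%N -> shift_bound P (n k) (T k v) (ka k v).
Hypothesis mc : forall k, (k < N)%N -> measurable_fun setT (fun z => T k (c k z)).

Let mn' k : (k < N)%N -> measurable_fun setT (n k).
Proof. by move=> kN; exact: (measurable_wrt_fun (@Gm k.+1) (mn kN)). Qed.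

Lemma euler_value_unit f m k : (k + m <= N)%N -> unit_fun f -> unit_fun (euler_value f m k).
Proof.
move=> + hf; elim: m k => [//|m IH] k kN.
have kN' : (k < N)%N by apply: leq_trans kN; rewrite addnS ltnS leq_addr.
have [mV V01] := IH k.+1 ltac:(by rewrite addSnnS).
have mg : measurable_fun setT (fun z : S * S =>
    euler_value f m k.+1 (z.1 + T k (c k z.1) + z.2)).
  apply: (measurableT_comp mV); apply: segmentD_measurable => //.
  apply: segmentD_measurable => //.
  exact: (measurableT_comp (mc kN')).
have g0 (z : S * S) : 0 <= euler_value f m k.+1 (z.1 + T k (c k z.1) + z.2).
  by case/andP: (V01 (z.1 + T k (c k z.1) + z.2)).
have g1 (z : S * S) : euler_value f m k.+1 (z.1 + T k (c k z.1) + z.2) <= 1.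
  by case/andP: (V01 (z.1 + T k (c k z.1) + z.2)).
split; first exact: (measurable_inner P (mn' kN') mg g0).
move=> z /=; rewrite (Ege0 P (fun w => g0 (z, n k w)))/=.
exact: (inner_le P (mn' kN') mg g0 g1 z).
Qed.

Lemma euler_value_compl f m k z : (k + m <= N)%N -> unit_fun f ->
  euler_value (fun x => 1 - f x) m k z = 1 - euler_value f m k z.
Proof.
move=> + hf; elim: m k z => [//|m IH] k z kN.
have kN' : (k < N)%N by apply: leq_trans kN; rewrite addnS ltnS leq_addr.
have kN'' : (k.+1 + m <= N)%N by rewrite addSnnS.
have hV := euler_value_unit kN'' hf.
have bV : bdm (fun w => euler_value f m k.+1 (z + T k (c k z) + n k w)).
  by apply: (unit_bdm hV); apply: segmentD_measurable => //; exact: mn'.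
rewrite /= -[X in X - _](Ecst P) -EB//; last exact: bdm_cst.
by apply: eq_Rintegral => w _; exact: IH.
Qed.

Variables (Y : nat -> Omega -> S) (e : nat -> Omega -> 'cV[R]_d).
Hypothesis Y0 : measurable_wrt (G 0) (Y 0).
Hypothesis YS : forall k w, (k < N)%N -> Y k.+1 w = Y k w + T k (e k w) + n k w.
Hypothesis me : forall k, (k < N)%N -> measurable_wrt (G k) (fun w => T k (e k w)).
(** The price of moving the kernel step, with drift [c k (Y k w)], to the step that [Y] makes, with
    drift [e k w]: the noise is translated by the difference. *)
Let cost k w := ka k (e k w - c k (Y k w)).
Hypothesis mcost : forall k, (k < N)%N -> measurable_wrt (G k) (cost k).
Variable M : R.
Hypothesis cost0 : forall k w, (k < N)%N -> 0 <= cost k w <= M.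

Lemma wrtD k (f g : Omega -> S) : measurable_wrt (G k) f -> measurable_wrt (G k) g ->
  measurable_wrt (G k) (fun w => f w + g w).
Proof.
move=> /(measurable_wrtP (sG k)) mf /(measurable_wrtP (sG k)) mg.
apply/(measurable_wrtP (sG k)).
exact: (@segmentD_measurable R r d r0 _ (g_sigma_algebraType (G k))).
Qed.

Lemma chain_measurable k : (k <= N)%N -> measurable_wrt (G k) (Y k).
Proof.
elim: k => [//|k IH] kN; have kN' := ltnW kN.
rewrite (_ : Y k.+1 = fun w => Y k w + T k (e k w) + n k w); last first.
  by apply/funext => w; rewrite YS.
apply: wrtD; last exact: mn.
by apply: wrtD => A mA; apply: GS; [exact: IH|exact: me].
Qed.

(** The weight [q] carries the exponential of the costs already paid. The cost of step [k] is
    [G k]-measurable, so it moves into the weight before the next kernel is treated. Keeping it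
    inside the expectation retains the random costs, whose limit is better than their uniform
    bound. *)
Lemma euler_compare_step f p m k (q : Omega -> R) (B : R) : 1 < p -> unit_fun f ->
  (k + m <= N)%N -> measurable_wrt (G k) q -> (forall w, 0 <= q w <= B) ->
  \int[P]_w (q w * euler_value f m k (Y k w) `^ p) <=
  \int[P]_w (q w * expR (p / (2 * (p - 1)) * \sum_(k <= j < k + m) cost j w)
             * f (Y (k + m)%N w) `^ p).
Proof.
move=> p1 hf; have p0 : 0 <= p by rewrite ltW// (lt_trans _ p1).
have a0 : 0 <= p / (2 * (p - 1)).
  by rewrite divr_ge0// mulr_ge0// subr_ge0 ltW.
elim: m k q B => [|m IH] k q B kN mq q0.
  rewrite addn0 /= le_eqVlt; apply/orP; left; apply/eqP; apply: eq_Rintegral => w _.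
  by rewrite big_geq// mulr0 expR0 mulr1.
have kN' : (k < N)%N by apply: leq_trans kN; rewrite addnS ltnS leq_addr.
have kN'' : (k.+1 + m <= N)%N by rewrite addSnnS.
have hV := euler_value_unit kN'' hf.
have hVk := euler_value_unit kN hf.
have mY := chain_measurable (ltnW kN').
have mY' := measurable_wrt_fun (@Gm k) mY.
set a := p / _ in a0 *.
pose q' w := q w * expR (a * cost k w).
have q'0 w : 0 <= q' w <= B * expR (a * M).
  have /andP[h0 h1] := q0 w; have /andP[c0 c1] := cost0 w kN'.
  rewrite /q' mulr_ge0 ?expR_ge0//= ler_pM ?expR_ge0// ler_expR.
  by rewrite ler_wpM2l.
have mq' : measurable_wrt (G k) q'.
  apply/(measurable_wrtP (sG k)); apply: measurable_funM.
    exact/(measurable_wrtP (sG k)).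
  apply: (measurableT_comp (@measurable_expR R)); apply: measurable_funM => //.
  exact/(measurable_wrtP (sG k))/mcost.
have mYe := wrtD mY (me kN').
have bq w : bdm (fun w' => euler_value f m k.+1 (Y k w + T k (e k w) + n k w') `^ p).
  apply: (unit_powR_bdm p0 hV); apply: segmentD_measurable => //.
  exact: mn'.
have mg : measurable_fun setT (fun z : g_sigma_algebraType (G k) * S =>
    q' z.1 * euler_value f m k.+1 (Y k z.1 + T k (e k z.1) + z.2) `^ p).
  apply: measurable_funM.
    have /(measurable_wrtP (sG k)) h := mq'.
    exact: (measurableT_comp h).
  apply: (measurableT_comp (measurable_powR p)); apply: (measurableT_comp hV.1).
  apply: segmentD_measurable => //.
  have /(measurable_wrtP (sG k)) h := mYe.
  exact: (measurableT_comp h).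
have g01 w y : 0 <= q' w * euler_value f m k.+1 (Y k w + T k (e k w) + y) `^ p
    <= B * expR (a * M).
  have /andP[h0 h1] := q'0 w.
  rewrite mulr_ge0 ?powR_ge0//= (le_trans _ h1)// ler_piMr//.
  by have /andP[] := (unit_powR p0 hV).2 (Y k w + T k (e k w) + y).
have bg w : bdm (fun w' => q' w * euler_value f m k.+1 (Y k w + T k (e k w) + n k w') `^ p).
  by apply: bdmM; [exact: bdm_cst|exact: bq].
have frz := freezeG (sG k) (@Gm k) (mn' kN') (inn kN') mg g01.
have step : \int[P]_w (q w * euler_value f m.+1 k (Y k w) `^ p) <=
    \int[P]_w (q' w * euler_value f m k.+1 (Y k.+1 w) `^ p).
  rewrite [leRHS](_ : _ = \int[P]_w \int[P]_w' (q' w *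
      euler_value f m k.+1 (Y k w + T k (e k w) + n k w') `^ p)); last first.
    by rewrite -frz; apply: eq_Rintegral => w _; rewrite YS.
  apply: Ele.
  - apply: bdmM; last exact: unit_powR_bdm.
    apply: (@bdm_ge0 _ _ _ _ B) => [|w|w]; first exact: (measurable_wrt_fun (@Gm k)).
    + by case/andP: (q0 w).
    + by case/andP: (q0 w).
  - have g0' z : 0 <= q' z.1 * euler_value f m k.+1 (Y k z.1 + T k (e k z.1) + z.2) `^ p.
      by case/andP: (g01 z.1 z.2).
    have mI := measurable_inner P (mn' kN') mg g0'.
    apply: (@bdm_ge0 _ _ _ _ (B * expR (a * M))) => [|w|w].
    + apply: (measurable_wrt_fun (@Gm k)); apply/(measurable_wrtP (sG k)); exact: mI.
    + by apply: Ege0 => w'; exact: (g0' (w, n k w')).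
    + rewrite -[leRHS](Ecst P); apply: Ele => //; first exact: bdm_cst.
      by move=> w'; case/andP: (g01 w (n k w')).
  move=> w; rewrite EZ//; have /andP[h0 h1] := q0 w.
  rewrite /q' -mulrA ler_wpM2l//=.
  have hu := unit_shift r0 (Y k w + T k (c k (Y k w))) hV.
  have := @shn k (e k w - c k (Y k w)) kN' p _ p1 hu.
  rewrite -/a -/(cost k w) => h; apply: le_trans (le_trans _ h) _.
    rewrite le_eqVlt; apply/orP; left; apply/eqP; congr (_ `^ p).
    by apply: eq_Rintegral => w' _; rewrite addrC.
  rewrite le_eqVlt; apply/orP; left; apply/eqP; congr (_ * _).
  apply: eq_Rintegral => w' _; congr (euler_value f m k.+1 _ `^ p).
  by rewrite TB addrACA subrK [n k w' + _]addrC addrAC.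
apply: le_trans step _.
have mq1 : measurable_wrt (G k.+1) q' by move=> A mA; apply: GS; exact: mq'.
apply: le_trans (IH k.+1 q' _ kN'' mq1 q'0) _.
rewrite le_eqVlt; apply/orP; left; apply/eqP; apply: eq_Rintegral => w _.
rewrite addSnnS /q' -[X in X * _ = _]mulrA -expRD -mulrDr.
by rewrite [in RHS]big_ltn ?addnS ?ltnS ?leq_addr.
Qed.

Lemma euler_compare f p : 1 < p -> unit_fun f ->
  (\int[P]_w euler_value f N 0 (Y 0 w)) `^ p <=
  \int[P]_w (expR (p / (2 * (p - 1)) * \sum_(0 <= j < N) cost j w) * f (Y N w) `^ p).
Proof.
move=> p1 hf; have hV := @euler_value_unit f N 0 (leqnn _) hf.
have mY := measurable_wrt_fun (@Gm 0) Y0.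
apply: (@le_trans _ _ (\int[P]_w (euler_value f N 0 (Y 0 w) `^ p))).
  apply: jensen_powR; first exact: ltW.
    by move=> w; case/andP: (hV.2 (Y 0 w)).
  exact: unit_bdm.
have m1 : measurable_wrt (G 0) ((fun=> 1) : Omega -> R) by exact: measurable_wrt_cst.
have le11 (w : Omega) : 0 <= ((fun=> 1) : Omega -> R) w <= 1 by rewrite ler01 lexx.
have h := @euler_compare_step f p N 0 _ 1 p1 hf (leqnn _) m1 le11.
move: h; rewrite add0n => h.
apply: le_trans (le_trans _ h) _; rewrite le_eqVlt; apply/orP; left; apply/eqP;
  apply: eq_Rintegral => w _; rewrite mul1r//.
Qed.

End Euler_chain.

(** * Functionals of Brownian increments *)

Section Brownian_increment.
Context (R : realType) (r : R) (d : nat) (r0 : 0 < r).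
Context (dO : measure_display) (Omega : measurableType dO) (P : probability Omega R).
Context (F : R -> set (set Omega)) (W : R -> Omega -> 'cV[R]_d).
Hypotheses (hF : complete_filtration P F) (hW : brownian_motion P F W).
Notation S := (segment r d).

Lemma filtration_sigma t : 0 <= t -> sigma_algebra setT (F t).
Proof. by case: hF => h _ _ _; exact: h. Qed.

Lemma filtration_measurable t : 0 <= t -> F t `<=` measurable.
Proof. by case: hF => _ h _ _; exact: h. Qed.

Lemma filtration_le s t : 0 <= s -> s <= t -> F s `<=` F t.
Proof. by case: hF => _ _ h _; exact: h. Qed.

Lemma brownian_wrt s t i : 0 <= s -> s <= t -> measurable_wrt (F t) (fun w => W s w i 0).
Proof.
move=> s0 st A mA; apply: (filtration_le s0 st).
by case: hW => _ _ h _; exact: h.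
Qed.

Section One_step.
Variables (s t : R) (s0 : 0 <= s) (st : s < t).
Let t0 : 0 <= t := le_trans s0 (ltW st).

Let D (i : 'I_d) w := (W t w - W s w) i 0.
Let sd := Num.sqrt (t - s).
Let NN (U : set R) : R := fine (normal_prob 0 sd U).

Let sd0 : 0 < sd. Proof. by rewrite sqrtr_gt0 subr_gt0. Qed.

Lemma increment_wrt i : measurable_wrt (F t) (D i).
Proof.
apply/(measurable_wrtP (filtration_sigma t0)).
rewrite (_ : D i = fun w => W t w i 0 - W s w i 0); last first.
  by apply/funext => w; rewrite /D !mxE.
by apply: measurable_funB; apply/(measurable_wrtP (filtration_sigma t0));
  apply: brownian_wrt => //; exact: ltW.
Qed.

Let mD i : measurable_fun setT (D i).
Proof. exact: (measurable_wrt_fun (filtration_measurable t0) (increment_wrt i)). Qed.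

Let NNT : NN setT = 1.
Proof.
have PT : normal_prob 0 sd setT = 1%E := probability_setT _.
by rewrite /NN PT.
Qed.

Let joint A (E : 'I_d -> set R) : F s A -> (forall i, measurable (E i)) ->
  P (A `&` [set w | forall i, E i (D i w)]) = (P A * (\prod_i NN (E i))%:E)%E.
Proof. by move=> FA mE; case: hW => _ _ _ h; exact: h. Qed.

Let FT : F s setT.
Proof. by have [h0 hC _] := filtration_sigma s0; have := hC _ h0; rewrite setD0. Qed.

Lemma increment_law i U : measurable U -> P (D i @^-1` U) = normal_prob 0 sd U.
Proof.
move=> mU.
have := @joint setT (fun k : 'I_d => if k == i then U else setT) FT.
rewrite (bigD1 i)//= eqxx big1 => [|k /negbTE ->]; last exact: NNT.
rewrite mulr1 setTI => H.
have PT : P setT = 1%E := probability_setT P.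
rewrite (_ : D i @^-1` U = [set w | forall k, (if k == i then U else setT) (D k w)]).
  rewrite H; last by move=> k; case: ifP.
  by rewrite [X in (X * _)%E]PT mul1e /NN fineK// fin_num_measure.
apply/seteqP; split => w /=; last by move=> /(_ i); rewrite eqxx.
by move=> Uw k; have [->|] := eqVneq k i.
Qed.

Lemma increment_indep i : indep_of P (F s) (D i).
Proof.
move=> A U FA mU.
have mE (k : 'I_d) : measurable (if k == i then U else setT) by case: ifP.
have := joint FA mE.
rewrite (bigD1 i)//= eqxx big1 => [|k /negbTE ->]; last exact: NNT.
rewrite mulr1 increment_law// /NN fineK ?fin_num_measure// => <-; congr (P (_ `&` _)).
apply/seteqP; split => w /=; last by move=> /(_ i); rewrite eqxx.
by move=> Uw k; have [->|] := eqVneq k i.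
Qed.

Let gens j := [set B | exists A (E : 'I_d -> set R), [/\ F s A, forall i, measurable (E i) &
  B = A `&` [set w | forall i : 'I_d, (i < j)%N -> E i (D i w)]]].

(* The coordinates enter the sigma-algebra one at a time: each is independent of the
   previous ones and of [F s], so that scalar shifts can be composed. *)
Let Gf j := <<s gens j >>.

Let sGf j : sigma_algebra setT (Gf j). Proof. exact: smallest_sigma_algebra. Qed.

Let gens_meas j : gens j `<=` measurable.
Proof.
move=> _ [A [E [FA mE ->]]]; apply: measurableI; first exact: (filtration_measurable s0).
rewrite (_ : [set w | _] = \bigcap_(i in [set i : 'I_d | (i < j)%N]) D i @^-1` (E i)).
  apply: fin_bigcap_measurable => // i _.
  by rewrite -[X in measurable X]setTI; exact: mD.
by apply/seteqP; split => w /= H i; exact: H.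
Qed.

Let Gf_meas j : Gf j `<=` measurable.
Proof. by apply: smallest_sub; [exact: sigma_algebra_measurable|exact: gens_meas]. Qed.

Let Gf_F0 : F s `<=` Gf 0.
Proof.
move=> A FA; apply: sub_sigma_algebra; exists A, (fun=> setT); split => //.
by apply/seteqP; split => [w Aw|w []//].
Qed.

Let GfS j : Gf j `<=` Gf j.+1.
Proof.
apply: smallest_sub; first exact: smallest_sigma_algebra.
move=> _ [A [E [FA mE ->]]].
apply: sub_sigma_algebra.
exists A, (fun i : 'I_d => if (i < j)%N then E i else setT); split => //.
  by move=> i; case: ifP.
congr (_ `&` _); apply/seteqP; split => w /= H i.
  by move=> _; case: ifPn => // ij; exact: H.
by move=> ij; have := H i (ltnW ij); rewrite ij.
Qed.

Let Gf_t j : Gf j `<=` F t.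
Proof.
apply: smallest_sub; first exact: filtration_sigma.
move=> _ [A [E [FA mE ->]]].
have sgt := filtration_sigma t0.
pose Ot := g_sigma_algebraType (F t).
suff : @measurable _ Ot (A `&` [set w | forall i : 'I_d, (i < j)%N -> E i (D i w)]).
  by move=> h; rewrite -(sigma_algebra_g sgt).
apply: (@measurableI _ Ot).
  by apply: sub_sigma_algebra; exact: (filtration_le s0 (ltW st)).
rewrite (_ : [set w | _] = \bigcap_(i in [set i : 'I_d | (i < j)%N]) D i @^-1` (E i)).
  apply: (@fin_bigcap_measurable _ Ot) => // i _.
  by apply: sub_sigma_algebra; apply: increment_wrt.
by apply/seteqP; split => w /= H i; exact: H.
Qed.

Let D_wrt (i : 'I_d) : measurable_wrt (Gf i.+1) (D i).
Proof.
move=> U mU; apply: sub_sigma_algebra.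
exists setT, (fun k : 'I_d => if k == i then U else setT); split => //.
  by move=> k; case: ifP.
rewrite setTI; apply/seteqP; split => w /=; last by move=> /(_ i (ltnSn i)); rewrite eqxx.
by move=> Uw k; have [->|] := eqVneq k i.
Qed.

(** Uniqueness of measures: [m1] and [m2], which express the two sides of the product formula as
    functions of the event [B], agree on the pi-system [gens j] because the coordinates of a
    Brownian increment are jointly independent of [F s]. *)
Let D_indep (j : 'I_d) : indep_of P (Gf j) (D j).
Proof.
move=> B U GB mU.
have mDU : measurable (D j @^-1` U) by rewrite -[X in measurable X]setTI; exact: mD.
have k0 : 0 <= fine (P (D j @^-1` U)) by rewrite fine_ge0.
have fE : (fine (P (D j @^-1` U)))%:E = P (D j @^-1` U) by rewrite fineK// fin_num_measure.
pose m1 := mrestr P mDU.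
pose m2 := mscale (NngNum k0) P.
have E1 C : m1 C = P (C `&` D j @^-1` U) by [].
have E2 C : m2 C = (P (D j @^-1` U) * P C)%E.
  by rewrite -[LHS]/((fine (P (D j @^-1` U)))%:E * P C)%E fE.
suff H : m1 B = m2 B by rewrite -E1 H E2 muleC.
apply: (@g_sigma_algebra_measure_unique _ R Omega (gens j) (@gens_meas j) (fun=> setT)) GB => //.
- move=> _; exists setT, (fun=> setT); split => //.
  by apply/seteqP; split.
- by apply/seteqP; split => // w _; exists 0%N.
- move=> _ _ [A [E [FA mE ->]]] [A' [E' [FA' mE' ->]]].
  exists (A `&` A'), (fun i => E i `&` E' i); split.
  + have sgs := filtration_sigma s0; rewrite -(sigma_algebra_g sgs).
    by apply: (@measurableI _ (g_sigma_algebraType (F s))); exact: sub_sigma_algebra.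
  + by move=> i; exact: measurableI.
  + apply/seteqP; split => w /=.
      by move=> [[Aw H1] [A'w H2]]; split => // i ij; split; [exact: H1|exact: H2].
    by move=> [[Aw A'w] H1]; split; split => // i ij; case: (H1 i ij).
- move=> _ [A [E [FA mE ->]]]; rewrite -[LHS]/(m1 _) -[RHS]/(m2 _) E1 E2 increment_law//.
  (* Unconstrained coordinates get [setT], so that the product formula applies to both events; they
     then differ by the factor of index [j]. *)
  have e1 : A `&` [set w | forall i : 'I_d, (i < j)%N -> E i (D i w)] `&` D j @^-1` U =
      A `&` [set w | forall i : 'I_d, (if (i < j)%N then E i else if i == j then U else setT) (D i w)].
    rewrite -setIA; congr (_ `&` _); apply/seteqP; split => w /=.
      move=> [H1 Uw] i; case: ifPn => [ij|ij]; first exact: H1.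
      by have [->|] := eqVneq i j.
    move=> H1; split=> [i ij|]; first by have := H1 i; rewrite ij.
    by have := H1 j; rewrite ltnn eqxx.
  have e2 : A `&` [set w | forall i : 'I_d, (i < j)%N -> E i (D i w)] =
      A `&` [set w | forall i : 'I_d, (if (i < j)%N then E i else setT) (D i w)].
    congr (_ `&` _); apply/seteqP; split => w /= H1 i.
      by case: ifPn => // ij; exact: H1.
    by move=> ij; have := H1 i; rewrite ij.
  rewrite e1 e2 (@joint A (fun i : 'I_d => if (i < j)%N then E i else if i == j then U else setT))//; last first.
    by move=> i; case: ifP => //; case: ifP.
  rewrite (@joint A (fun i : 'I_d => if (i < j)%N then E i else setT))//; last first.
    by move=> i; case: ifP.
  rewrite (bigD1 j)//= [in RHS](bigD1 j)//= ltnn eqxx NNT mul1r.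
  rewrite (eq_bigr (fun i : 'I_d => NN (if (i < j)%N then E i else setT))); last first.
    by move=> i /negbTE ->.
  rewrite EFinM muleCA; congr (_ * _)%E.
  by rewrite /NN fineK// fin_num_measure.
- move=> _; rewrite -[ltLHS]/(m1 _) E1 setTI.
  by apply: le_lt_trans (probability_le1 _ mDU) _; exact: ltry.
Qed.

Variables (a c : R) (ac : a < c) (psi : 'I_d -> 'cV[R]_d) (h : 'I_d -> R).

Let Nj j w : S := \sum_(i < d | (j <= i)%N) vramp r (D i w *: psi i) a c.
Let thj j : S := \sum_(i < d | (j <= i)%N) vramp r (h i *: psi i) a c.

Let mterm i : measurable_fun setT (fun y : R => vramp r (y *: psi i) a c).
Proof.
apply: (vramp_measurable r0 ac) => k.
rewrite (_ : (fun _ => _) = (fun y => y * psi i k 0)).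
  exact: measurable_funM.
by apply/funext => y; rewrite mxE.
Qed.

Let kap j : R := \sum_(i < d | (j <= i)%N) h i ^+ 2 / (t - s).

Let mNj (i : 'I_d) : measurable_wrt (Gf i.+1) (fun w => vramp r (D i w *: psi i) a c).
Proof. exact: (measurable_wrt_comp (mterm i) (@D_wrt i)). Qed.

Let split_sum (V : zmodType) (f : 'I_d -> V) (j : 'I_d) :
  \sum_(i < d | (j <= i)%N) f i = f j + \sum_(i < d | (j.+1 <= i)%N) f i.
Proof.
rewrite (bigD1 j)//=; congr (_ + _); apply: eq_bigl => i.
by rewrite [RHS]ltn_neqAle andbC eq_sym.
Qed.

(** Coordinates are added from the last to the first: the tail starting at [j + 1] is independent of
    [Gf j.+1], for which coordinate [j] is measurable, as [indep_add] and [shift_bound_add]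
    require. *)
Let steps m : (m <= d)%N -> [/\ measurable_wrt (F t) (Nj (d - m)),
  indep_of P (Gf (d - m)) (Nj (d - m)) &
  shift_bound P (Nj (d - m)) (thj (d - m)) (kap (d - m))].
Proof.
elim: m => [_|m IH md].
  rewrite subn0.
  have e0 (V : zmodType) (f : 'I_d -> V) : \sum_(i < d | (d <= i)%N) f i = 0.
    by rewrite big_pred0// => i; rewrite leqNgt ltn_ord.
  rewrite (_ : Nj d = fun=> 0); last by apply/funext => w; rewrite /Nj e0.
  rewrite /thj /kap !e0; split; last exact: shift_bound_zero.
  - by apply: measurable_wrt_cst; exact: filtration_sigma.
  - exact: indep_zero (@Gf_meas _).
have [m1 i1 s1] := IH (ltnW md).
have jd : (d - m.+1 < d)%N by rewrite ltn_subrL /=; exact: leq_ltn_trans md.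
pose j := Ordinal jd.
have jS : (d - m)%N = j.+1 by rewrite /= subnSK.
rewrite (_ : Nj (d - m.+1) = fun w => vramp r (D j w *: psi j) a c + Nj (d - m) w); last first.
  by apply/funext => w; rewrite /Nj jS -(split_sum _ j).
rewrite (_ : thj (d - m.+1) = vramp r (h j *: psi j) a c + thj (d - m)); last first.
  by rewrite /thj jS -(split_sum _ j).
rewrite (_ : kap (d - m.+1) = h j ^+ 2 / sd ^+ 2 + kap (d - m)); last first.
  by rewrite /kap jS sqr_sqrtr ?subr_ge0 ?(ltW st)// -(split_sum _ j).
rewrite jS in m1 i1 s1 *.
have m1' := measurable_wrt_fun (filtration_measurable t0) m1.
have iD := indep_scalar r0 (psi j) ac (@D_indep j).
have sD := shift_bound_scalar r0 (psi j) sd0 ac (mD j) (@increment_law j) (h j).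
split.
- apply/(measurable_wrtP (filtration_sigma t0)); apply: segmentD_measurable => //.
    apply/(measurable_wrtP (filtration_sigma t0)).
    by move=> A mA; apply: (@Gf_t j.+1); exact: mNj.
  exact/(measurable_wrtP (filtration_sigma t0)).
- exact: (indep_add r0 (sGf _) (sGf _) (@GfS j) (@Gf_meas j.+1) (@mNj j) m1' iD i1).
- exact: (shift_bound_add r0 (@Gf_meas j.+1) (@mNj j) m1' i1 sD s1).
Qed.

(** [h] is the translation of the Brownian increment itself, which fixes the cost; [psi i] is the
    direction into which coordinate [i] is sent. *)
Lemma increment_shift :
  [/\ measurable_wrt (F t) (fun w => \sum_i vramp r ((W t w - W s w) i 0 *: psi i) a c),
   indep_of P (F s) (fun w => \sum_i vramp r ((W t w - W s w) i 0 *: psi i) a c) &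
   shift_bound P (fun w => \sum_i vramp r ((W t w - W s w) i 0 *: psi i) a c)
     (\sum_i vramp r (h i *: psi i) a c) (\sum_i h i ^+ 2 / (t - s))].
Proof.
have [m1 i1 s1] := steps (leqnn d); rewrite subnn in m1 i1 s1.
split; [exact: m1| |exact: s1].
by move=> A U FA mU; apply: i1 => //; exact: Gf_F0.
Qed.

End One_step.
End Brownian_increment.

Section Brownian_functional.
Context (R : realType) (r : R) (d : nat) (r0 : 0 < r).
Context (dO : measure_display) (Omega : measurableType dO) (P : probability Omega R).
Context (F : R -> set (set Omega)) (W : R -> Omega -> 'cV[R]_d).
Hypotheses (hF : complete_filtration P F) (hW : brownian_motion P F W).
Notation S := (segment r d).

Lemma shift_bound_le (N : Omega -> S) th ka ka' : ka <= ka' ->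
  shift_bound P N th ka -> shift_bound P N th ka'.
Proof.
move=> kk h p u p1 uu; apply: (le_trans (h p u p1 uu)).
apply: ler_wpM2r; first by apply: Rintegral_ge0 => w _; exact: powR_ge0.
rewrite ler_expR ler_wpM2l//; apply: divr_ge0; first exact: (ltW (lt_trans ltr01 p1)).
by rewrite mulr_ge0// subr_ge0 ltW.
Qed.

Section Partition.
Variables (a c : R) (ac : a < c) (tau : nat -> R) (v : nat -> 'I_d -> 'cV[R]_d).
Variable (h : nat -> 'I_d -> R).
Hypothesis tau0 : 0 <= tau 0%N.

Let step l w := \sum_j vramp r ((W (tau l.+1) w - W (tau l) w) j 0 *: v l j) a c.

(** Successive cells are composed by [indep_add] and [shift_bound_add], with [F (tau L)] as the
    intermediate sigma-algebra. *)
Lemma partition_shift L : (forall l, (l < L)%N -> tau l < tau l.+1) ->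
  [/\ tau 0%N <= tau L,
   measurable_wrt (F (tau L)) (fun w => \sum_(l < L) step l w),
   indep_of P (F (tau 0%N)) (fun w => \sum_(l < L) step l w) &
   shift_bound P (fun w => \sum_(l < L) step l w)
     (\sum_(l < L) \sum_j vramp r (h l j *: v l j) a c)
     (\sum_(l < L) \sum_j h l j ^+ 2 / (tau l.+1 - tau l))].
Proof.
have F0 := filtration_sigma hF tau0.
elim: L => [_|L IH tL].
  rewrite (_ : (fun w => _) = fun=> 0); last by apply/funext => w; rewrite big_ord0.
  rewrite !big_ord0; split => //; last exact: shift_bound_zero.
  - exact: measurable_wrt_cst.
  - exact: (indep_zero P (filtration_measurable hF tau0)).
have [t0L mL iL sL] := IH (fun l lL => tL l (ltnW lL)).
have tLS := tL L (ltnSn L).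
have tL0 : 0 <= tau L := le_trans tau0 t0L.
have tS0 : 0 <= tau L.+1 := le_trans tL0 (ltW tLS).
have [mS iS sS] := increment_shift r0 hF hW tL0 tLS ac (v L) (h L).
have mS' := measurable_wrt_fun (filtration_measurable hF tS0) mS.
have e w : \sum_(l < L.+1) step l w = \sum_(l < L) step l w + step L w.
  by rewrite big_ord_recr.
rewrite (_ : (fun w => _) = fun w => \sum_(l < L) step l w + step L w); last exact/funext.
rewrite !big_ord_recr/=; split.
- exact: le_trans t0L (ltW tLS).
- apply/(measurable_wrtP (filtration_sigma hF tS0)); apply: segmentD_measurable => //.
    apply/(measurable_wrtP (filtration_sigma hF tS0)) => A mA.
    by apply: (filtration_le hF tL0 (ltW tLS)); exact: mL.
  exact/(measurable_wrtP (filtration_sigma hF tS0)).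
- exact: (indep_add r0 F0 (filtration_sigma hF tL0) (filtration_le hF tau0 t0L)
    (filtration_measurable hF tL0) mL mS' iL iS).
- exact: (shift_bound_add r0 (filtration_measurable hF tL0) mL mS' iS sL sS).
Qed.

End Partition.

(** The endpoints appear as conditions inside one sum over the common partition, so that increments
    with different endpoints can be added and the sums exchanged. *)
Lemma telescope_partition (V : zmodType) (f : R -> V) (tau : nat -> R) L (p q : nat) :
  {in [pred l | (l <= L)%N] &, {mono tau : l m / (l <= m)%N >-> l <= m}} ->
  (p <= q)%N -> (q <= L)%N ->
  f (tau q) - f (tau p) =
  \sum_(l < L | (tau p <= tau l) && (tau l < tau q)) (f (tau l.+1) - f (tau l)).
Proof.
move=> mt pq qL.
rewrite -(telescope_sumr (fun l => f (tau l)) pq) big_nat_cond.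
rewrite (eq_bigl (fun l : 'I_L => (p <= l < q)%N)); last first.
  move=> l; have lL : (l <= L)%N by exact: ltnW.
  rewrite ltNge !mt ?inE//; first by rewrite -ltnNge.
  exact: leq_trans qL.
rewrite -(big_mkord (fun l => (p <= l < q)%N) (fun l => f (tau l.+1) - f (tau l))).
rewrite [RHS]big_nat_cond (big_nat_widen p q L)//.
rewrite [RHS](@big_cat_nat _ _ _ p)//=; last exact: leq_trans qL.
rewrite [X in _ = X + _]big1_seq ?add0r.
  rewrite [LHS]big_nat_cond [RHS]big_nat_cond; apply: eq_bigl => l.
  by case: (p <= l)%N; case: (l < L)%N; case: (l < q)%N.
move=> l; rewrite mem_index_iota => /andP[/and3P[_ pl _] /andP[_ lp]].
by rewrite ltnNge pl in lp.
Qed.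

(* The points [x e], [y e] of the finitely many increments need not be ordered:
   sorting them turns the functional into one of a partition. *)
Lemma functional_shift (I : finType) (j : I -> 'I_d) (v : I -> 'cV[R]_d) (x y : I -> R)
    (a c s u k : R) (path : R -> 'cV[R]_d) :
  a < c -> 0 <= s -> s <= u -> 0 <= k ->
  (forall e, [/\ s <= x e, x e <= y e & y e <= u]) ->
  (forall t t', s <= t -> t < t' -> t' <= u -> enorm (path t' - path t) <= k * (t' - t)) ->
  let Lam (om : R -> 'cV[R]_d) := \sum_e (om (y e) - om (x e)) (j e) 0 *: v e in
  [/\ measurable_wrt (F u) (fun w => vramp r (Lam (W ^~ w)) a c),
   indep_of P (F s) (fun w => vramp r (Lam (W ^~ w)) a c) &
   shift_bound P (fun w => vramp r (Lam (W ^~ w)) a c) (vramp r (Lam path) a c)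
     (k ^+ 2 * (u - s))].
Proof.
move=> ac s0 su k0 xy hp Lam.
pose ts := sort <=%R (undup (s :: [seq x e | e : I] ++ [seq y e | e : I])).
have tsP t : t \in ts -> s <= t <= u.
  rewrite mem_sort mem_undup inE mem_cat => /or3P[/eqP->|/mapP[e _ ->]|/mapP[e _ ->]].
  - by rewrite lexx.
  - by have [h1 h2 h3] := xy e; rewrite h1 (le_trans h2).
  - by have [h1 h2 h3] := xy e; rewrite h3 (le_trans h1).
have sts : sorted <%R ts by rewrite sort_lt_sorted undup_uniq.
have xts e : x e \in ts.
  by rewrite mem_sort mem_undup inE mem_cat map_f ?orbT// mem_enum.
have yts e : y e \in ts.
  by rewrite mem_sort mem_undup inE mem_cat (map_f y) ?orbT// mem_enum.
have nts : (0 < size ts)%N.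
  by rewrite -has_predT; apply/hasP; exists s => //; rewrite mem_sort mem_undup inE eqxx.
pose L := (size ts).-1.
have LE : size ts = L.+1 by rewrite /L prednK.
pose tau l := nth 0 ts l.
have tmem l : (l <= L)%N -> tau l \in ts by move=> lL; apply: mem_nth; rewrite LE.
have mt : {in [pred l | (l <= L)%N] &, {mono tau : l m / (l <= m)%N >-> l <= m}}.
  apply: le_mono_in => l m; rewrite !inE => lL mL lm.
  by apply: (sorted_ltn_nth lt_trans) => //; rewrite inE LE.
have tlt l : (l < L)%N -> tau l < tau l.+1.
  by move=> lL; rewrite ltNge mt ?inE// -?ltnNge// ltnW.
have /andP[st0 _] := tsP _ (tmem 0%N (leq0n _)).
have /andP[_ tLu] := tsP _ (tmem L (leqnn _)).
have t00 : 0 <= tau 0%N := le_trans s0 st0.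
(* The vector multiplying coordinate [i] of the increment over cell [l]: the sum of the [v e] whose
   interval covers that cell. *)
pose V l i : 'cV[R]_d := \sum_(e | (j e == i) && ((x e <= tau l) && (tau l < y e))) v e.
have LamE om : Lam om = \sum_(l < L) \sum_i (om (tau l.+1) - om (tau l)) i 0 *: V l i.
  rewrite /Lam.
  have e1 e : (om (y e) - om (x e)) (j e) 0 *: v e =
     \sum_(l < L) \sum_i (if (j e == i) && ((x e <= tau l) && (tau l < y e)) then
       (om (tau l.+1) - om (tau l)) i 0 *: v e else 0).
    have [p pL xE] : exists2 p, (p <= L)%N & x e = tau p.
      by exists (index (x e) ts); rewrite ?/tau ?nth_index// -ltnS -LE index_mem.
    have [q qL yE] : exists2 q, (q <= L)%N & y e = tau q.
      by exists (index (y e) ts); rewrite ?/tau ?nth_index// -ltnS -LE index_mem.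
    have pq : (p <= q)%N by rewrite -mt ?inE// -xE -yE; case: (xy e).
    rewrite xE yE (telescope_partition om mt pq qL) summxE scaler_suml big_mkcond/=.
    apply: eq_bigr => l _.
    rewrite (bigD1 (j e))//= eqxx/= big1 ?addr0// => i /negbTE ie.
    by rewrite eq_sym ie.
  rewrite (eq_bigr _ (fun e _ => e1 e)) exchange_big; apply: eq_bigr => l _.
  rewrite exchange_big; apply: eq_bigr => i _.
  by rewrite /V scaler_sumr [RHS]big_mkcond.
(* The translation given to a cell is the increment of [path] over it, so the total shift is that of
   [Lam path]. *)
have [_ m1 i1 s1] := partition_shift ac V (fun l i => (path (tau l.+1) - path (tau l)) i 0) t00 tlt.
have E1 om : vramp r (Lam om) a c =
    \sum_(l < L) \sum_i vramp r ((om (tau l.+1) - om (tau l)) i 0 *: V l i) a c.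
  by rewrite LamE vramp_sum//; apply: eq_bigr => l _; rewrite vramp_sum.
rewrite (_ : (fun w => _) = fun w => \sum_(l < L) \sum_i
    vramp r ((W (tau l.+1) w - W (tau l) w) i 0 *: V l i) a c); last first.
  by apply/funext => w; rewrite E1.
rewrite E1; split.
- move=> A mA; apply: (filtration_le hF _ tLu); last exact: m1.
  by apply: le_trans t00 _; rewrite mt ?inE.
- by move=> A U FA mU; apply: i1 => //; exact: (filtration_le hF s0 st0).
(* Since [path] is [k]-Lipschitz, each cell costs at most [k ^+ 2] times its length. *)
- apply: shift_bound_le s1.
  apply: (@le_trans _ _ (\sum_(l < L) k ^+ 2 * (tau l.+1 - tau l))).
    apply: ler_sum => l _.
    have dl : 0 < tau l.+1 - tau l by rewrite subr_gt0 tlt.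
    rewrite -mulr_suml -enorm_sqr ler_pdivrMr// -mulrA -expr2 -exprMn.
    rewrite ler_sqr ?nnegrE ?enorm_ge0 ?mulr_ge0 ?(ltW dl)//.
    have /andP[h1 _] := tsP _ (tmem l (ltnW (ltn_ord l))).
    have /andP[_ h2] := tsP _ (tmem l.+1 (ltn_ord l)).
    by apply: hp => //; exact: tlt.
  rewrite -mulr_sumr ler_wpM2l ?sqr_ge0//.
  rewrite -(big_mkord xpredT (fun l => tau l.+1 - tau l)) telescope_sumr//.
  exact: lerB.
Qed.

End Brownian_functional.

(** * Ito integrals of deterministic integrands *)

Section Simple_process.
Context (R : realType) (d : nat).
Context (dO : measure_display) (Omega : measurableType dO) (P : probability Omega R).
Context (F : R -> set (set Omega)) (W : R -> Omega -> 'cV[R]_d).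
Hypotheses (hF : complete_filtration P F) (hW : brownian_motion P F W).

Lemma bdm_sum (I : Type) (l : seq I) (Q : pred I) (f : I -> Omega -> R) :
  (forall i, bdm (f i)) -> bdm (fun w => \sum_(i <- l | Q i) f i w).
Proof.
move=> bf; elim: l => [|i l IH].
  by rewrite (_ : (fun _ => _) = fun=> 0); [exact: bdm_cst|apply/funext => w; rewrite big_nil].
rewrite (_ : (fun _ => _) = fun w => (if Q i then f i w else 0) + \sum_(i <- l | Q i) f i w).
  by apply: bdmD => //; case: (Q i) => //; exact: bdm_cst.
by apply/funext => w; rewrite big_cons; case: (Q i); rewrite ?add0r.
Qed.

Lemma E_sum (I : Type) (l : seq I) (Q : pred I) (f : I -> Omega -> R) : (forall i, bdm (f i)) ->
  \int[P]_w (\sum_(i <- l | Q i) f i w) = \sum_(i <- l | Q i) \int[P]_w f i w.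
Proof.
move=> bf; elim: l => [|i l IH].
  rewrite big_nil (_ : (fun _ => _) = fun=> 0); first exact: Ecst.
  by apply/funext => w; rewrite big_nil.
rewrite big_cons -IH; case: ifPn => Qi.
  rewrite -ED//; last exact: bdm_sum.
  by apply: eq_Rintegral => w _; rewrite big_cons Qi.
by apply: eq_Rintegral => w _; rewrite big_cons (negbTE Qi).
Qed.

Lemma variance_split (Y : Omega -> R) (c : R) : bdm Y ->
  \int[P]_w ((Y w - c) ^+ 2) =
  \int[P]_w ((Y w - \int[P]_w Y w) ^+ 2) + (\int[P]_w Y w - c) ^+ 2.
Proof.
move=> bY; set m := \int[P]_w Y w.
have bq e : bdm (fun w => (Y w - e) ^+ 2).
  by rewrite (_ : (fun _ => _) = fun w => (Y w - e) * (Y w - e)); [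
    apply: bdmM; apply: bdmB => //; exact: bdm_cst|apply/funext => w; rewrite expr2].
have bl : bdm (fun w => 2 * (m - c) * (Y w - m)).
  by apply: bdmM; [exact: bdm_cst|apply: bdmB => //; exact: bdm_cst].
transitivity (\int[P]_w ((Y w - m) ^+ 2 + (2 * (m - c) * (Y w - m) + (m - c) ^+ 2))).
  by apply: eq_Rintegral => w _; ring.
rewrite ED//; last by apply: bdmD => //; exact: bdm_cst.
congr (_ + _); rewrite ED//; last exact: bdm_cst.
rewrite Ecst EZ; last by apply: bdmB => //; exact: bdm_cst.
by rewrite EB//; [rewrite Ecst subrr mulr0 add0r|exact: bdm_cst].
Qed.

Section One_process.
Variable H : simple_process F.
Notation tau := (sp_time H).
Notation xi := (sp_val H).
Notation n := (sp_size H).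

Let tau_mono k l : (k <= l)%N -> tau k <= tau l.
Proof. by move=> kl; apply: (homo_leq lexx le_trans) kl => m; exact: sp_time_le. Qed.

Let tau_ge0 k : 0 <= tau k.
Proof. exact: le_trans (sp_time0 H) (tau_mono (leq0n k)). Qed.

Lemma simple_val_bdm k : bdm (xi k).
Proof.
split; last exact: sp_bounded.
exact: (measurable_wrt_fun (filtration_measurable hF (tau_ge0 k)) (@sp_adapted _ _ _ _ H k)).
Qed.

Definition simple_mean k : R := \int[P]_w xi k w.
Notation m := simple_mean.

Let G k w := xi k w - m k.
Let v k : R := \int[P]_w (G k w ^+ 2).
Let J k (x : R) : R := \1_(`]tau k, tau k.+1]) x.

Let bG k : bdm (G k).
Proof. by apply: bdmB; [exact: simple_val_bdm|exact: bdm_cst]. Qed.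

Let J_disj (k l : nat) x : k != l -> J k x * J l x = 0.
Proof.
wlog kl : k l / (k < l)%N.
  by move=> h kl; case: (ltngtP k l) (kl) => // ? _; [exact: h|rewrite mulrC h// eq_sym].
move=> _; rewrite /J !indicE; case: (boolP (x \in _)) => xk; last by rewrite mul0r.
case: (boolP (x \in _)) => xl; last by rewrite mulr0.
move: xk xl; rewrite !inE/= !in_itv/= => /andP[_ h1] /andP[h2 _].
by have := lt_le_trans h2 h1; rewrite ltNge tau_mono.
Qed.

Let J_sqr k x : J k x * J k x = J k x.
Proof. by rewrite /J indicE; case: (_ \in _); rewrite ?mulr1 ?mulr0. Qed.

Let sum_sqr (a : nat -> R) x :
  (\sum_(k < n) a k * J k x) ^+ 2 = \sum_(k < n) a k ^+ 2 * J k x.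
Proof.
rewrite expr2 mulr_suml; apply: eq_bigr => k _.
rewrite mulr_sumr (bigD1 k)//= big1 ?addr0 => [|l lk].
  by rewrite mulrACA J_sqr expr2.
by rewrite mulrACA J_disj ?mulr0// eq_sym.
Qed.

Definition simple_amean (x : R) : R := \sum_(k < n) m k * J k x.

Let bE x : bdm (simple_eval H x).
Proof.
by apply: bdm_sum => k; apply: bdmM; [exact: simple_val_bdm|exact: bdm_cst].
Qed.

Let E_eval x : \int[P]_w simple_eval H x w = simple_amean x.
Proof.
rewrite E_sum; last by move=> k; apply: bdmM; [exact: simple_val_bdm|exact: bdm_cst].
by apply: eq_bigr => k _; rewrite EZr//; exact: simple_val_bdm.
Qed.

(** Bias and variance at a fixed time. Each is at most the approximation error: the variance
    controls the passage from the random values to their means, and the bias shows that the means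
    approximate the integrand as well. *)
Lemma simple_second_moment (g x : R) :
  (\int[P]_w ((simple_eval H x w - g) ^+ 2)%:E =
   (\sum_(k < n) v k * J k x + (simple_amean x - g) ^+ 2)%:E)%E.
Proof.
have bq : bdm (fun w => (simple_eval H x w - g) ^+ 2).
  rewrite (_ : (fun _ => _) = fun w => (simple_eval H x w - g) * (simple_eval H x w - g)).
    by apply: bdmM; apply: bdmB => //; exact: bdm_cst.
  by apply/funext => w; rewrite expr2.
rewrite EfinE// variance_split// E_eval; congr (_ + _)%:E.
transitivity (\int[P]_w (\sum_(k < n) G k w ^+ 2 * J k x)).
  apply: eq_Rintegral => w _; rewrite -(sum_sqr (G ^~ w)); congr (_ ^+ 2).
  rewrite /simple_eval /simple_amean -sumrB; apply: eq_bigr => k _.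
  by rewrite -mulrBl.
have b2 k : bdm (fun w => G k w ^+ 2).
  by rewrite (_ : (fun _ => _) = fun w => G k w * G k w); [exact: bdmM|].
rewrite E_sum => [|k]; last by apply: bdmM => //; exact: bdm_cst.
by apply: eq_bigr => k _; rewrite EZr.
Qed.

Variables (s u T : R) (s0 : 0 <= s) (su : s <= u) (uT : u <= T).

(** At clamped times the sum that defines the simple integral represents its increment over
    [s, u]. *)
Definition clamp (t : R) := Num.max s (Num.min u t).

Lemma clamp_itv t : s <= clamp t <= u.
Proof. by rewrite /clamp le_max lexx/= ge_max su ge_min lexx. Qed.

Lemma clamp_mono : {homo clamp : x y / x <= y}.
Proof.
move=> x y xy; rewrite /clamp ge_max !le_max lexx/=; apply/orP; right.
by rewrite le_min !ge_min lexx/= xy orbT.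
Qed.

Lemma clamp_ge t : t <= u -> t <= clamp t.
Proof. by move=> tu; rewrite /clamp (min_idPr tu) le_max lexx orbT. Qed.

Lemma clamp_out t : u <= t -> clamp t = u.
Proof. by move=> tu; rewrite /clamp (min_idPl tu); exact/max_idPr. Qed.

Let D (j : 'I_d) k w := (W (clamp (tau k.+1)) w - W (clamp (tau k)) w) j 0.

Let tauS k : clamp (tau k) <= clamp (tau k.+1).
Proof. by apply: clamp_mono; exact: sp_time_le. Qed.

Let cl0 t : 0 <= clamp t.
Proof. by have /andP[h _] := clamp_itv t; exact: le_trans h. Qed.

Let Wt (s' t : R) i : 0 <= s' -> s' <= t -> measurable_wrt (F t) (fun w => W s' w i 0).
Proof. by move=> h1 h2; exact: (brownian_wrt hF hW). Qed.

Let S j K w := \sum_(k < K) G k w * D j k w.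

Let G_wrt k : tau k <= u -> measurable_wrt (F (clamp (tau k))) (G k).
Proof.
move=> tu; have sg := filtration_sigma hF (cl0 (tau k)).
apply/(measurable_wrtP sg); apply: measurable_funB; last exact: measurable_cst.
apply/(measurable_wrtP sg) => A mA; apply: (filtration_le hF (tau_ge0 k) (clamp_ge tu)).
exact: sp_adapted.
Qed.

Let D0 j k w : u <= tau k -> D j k w = 0.
Proof.
by move=> ut; rewrite /D !clamp_out ?subrr ?mxE// (le_trans ut)//; exact: sp_time_le.
Qed.

Let S_wrt j K : measurable_wrt (F (clamp (tau K))) (S j K).
Proof.
elim: K => [|K IH].
  rewrite (_ : S j 0 = fun=> 0); last by apply/funext => w; rewrite /S big_ord0.
  exact: (measurable_wrt_cst (filtration_sigma hF (cl0 _)) (0 : R)).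
have sg := filtration_sigma hF (cl0 (tau K.+1)).
apply/(measurable_wrtP sg).
rewrite (_ : S j K.+1 = fun w => S j K w + G K w * D j K w); last first.
  by apply/funext => w; rewrite /S big_ord_recr.
apply: measurable_funD.
  by apply/(measurable_wrtP sg) => A mA; apply: (filtration_le hF (cl0 (tau K)) (tauS K)); exact: IH.
have [tu|/ltW ut] := leP (tau K) u; last first.
  rewrite (_ : (fun w => _) = fun=> 0); first exact: measurable_cst.
  by apply/funext => w; rewrite D0// mulr0.
apply: measurable_funM.
  apply/(measurable_wrtP sg) => A mA; apply: (filtration_le hF (cl0 (tau K)) (tauS K)).
  exact: G_wrt.
rewrite (_ : D j K = fun w => W (clamp (tau K.+1)) w j 0 - W (clamp (tau K)) w j 0); last first.
  by apply/funext => w; rewrite /D !mxE.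
by apply: measurable_funB; apply/(measurable_wrtP sg); exact: Wt.
Qed.

Let v0 k : 0 <= v k.
Proof. by apply: Ege0 => w; exact: sqr_ge0. Qed.

(** Ito's isometry for the centred values, as an inequality with constant [kappa2]. Each step
    freezes the partial sum together with the next coefficient and integrates the Gaussian increment
    by [normal_affine_square]. *)
Lemma isometry_clamp j K :
  (\int[P]_w (S j K w ^+ 2)%:E <=
   (kappa2 R * \sum_(k < K) v k * (clamp (tau k.+1) - clamp (tau k)))%:E)%E.
Proof.
elim: K => [|K IH].
  rewrite big_ord0 mulr0 (_ : (fun w => _) = cst 0%E) ?integral0//.
  by apply/funext => w; rewrite /S big_ord0 expr0n.
rewrite big_ord_recr/= mulrDr.
have SE w : S j K.+1 w = S j K w + G K w * D j K w by rewrite /S big_ord_recr.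
have k0 : 0 <= kappa2 R by rewrite /kappa2 mulr_ge0// expR_ge0.
(* A clamped interval may reduce to a point; its increment is then 0. *)
have := tauS K; rewrite le_eqVlt => /orP[/eqP cE|cl].
  rewrite -cE subrr !mulr0 addr0; apply: le_trans IH.
  rewrite le_eqVlt; apply/orP; left; apply/eqP; apply: eq_integral => w _.
  by rewrite SE /D cE subrr mxE mulr0 addr0.
have tu : tau K <= u by rewrite leNgt; apply/negP => /ltW ut;
  move: cl; rewrite !clamp_out ?ltxx// (le_trans ut)//; exact: sp_time_le.
set a := clamp (tau K) in cl *; set e := clamp (tau K.+1) in cl *.
have a0 : 0 <= a := cl0 _.
have e0 : 0 <= e := cl0 _.
have sg := filtration_sigma hF a0.
have mS := @S_wrt j K; have mG := G_wrt tu; rewrite -/a in mS mG.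
have mD := measurable_wrt_fun (filtration_measurable hF e0) (increment_wrt hF hW a0 cl j).
have iD := increment_indep hF hW a0 cl j.
have lD := fun U => @increment_law _ _ _ _ _ _ _ hF hW a e a0 cl j U.
have sd : 0 < Num.sqrt (e - a) by rewrite sqrtr_gt0 subr_gt0.
pose g (z : (R * R) * R) := ((z.1.1 + z.1.2 * z.2) ^+ 2)%:E.
have mg : measurable_fun setT g.
  apply/measurable_EFinP; apply: measurable_funX; apply: measurable_funD.
    by apply: measurableT_comp => //; exact: measurableT_comp.
  by apply: measurable_funM => //; apply: measurableT_comp => //; exact: measurableT_comp.
have g0 z : (0 <= g z)%E by rewrite lee_fin sqr_ge0.
have mX : measurable_wrt (F a) (fun w => (S j K w, G K w)) by exact: measurable_wrt_pair.
have fr := freeze (filtration_measurable hF a0) mX (N := D j K) mD mg g0 iD.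
rewrite /g/= in fr.
have -> : (\int[P]_w (S j K.+1 w ^+ 2)%:E =
    \int[P]_w ((S j K w + G K w * D j K w) ^+ 2)%:E)%E.
  by apply: eq_integral => w _; rewrite SE.
rewrite fr.
have mS' := measurable_wrt_fun (filtration_measurable hF a0) mS.
have mG' := measurable_wrt_fun (filtration_measurable hF a0) mG.
apply: (@le_trans _ _ (\int[P]_w (S j K w ^+ 2 + kappa2 R * (e - a) * G K w ^+ 2)%:E)%E).
  apply: ge0_le_integral => //.
  - by move=> w _; apply: integral_ge0 => w' _; rewrite lee_fin sqr_ge0.
  - have h := emeasurable_inner P (N := D j K) mD mg g0.
    exact: (measurableT_comp h (measurable_fun_pair mS' mG')).
  - apply/measurable_EFinP; apply: measurable_funD; first exact: measurable_funX.
    by apply: measurable_funM => //; exact: measurable_funX.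
  - move=> w _.
    have mf : measurable_fun setT (fun y : R => (S j K w + G K w * y) ^+ 2).
      by apply: measurable_funX; apply: measurable_funD.
    rewrite (integral_normal_law mD lD mf (fun y => sqr_ge0 _)).
    apply: le_trans (normal_affine_square sd _ _) _.
    by rewrite sqr_sqrtr ?subr_ge0 ?(ltW cl).
have mS2 : measurable_fun setT (fun w => S j K w ^+ 2) by exact: measurable_funX.
have mG2 : measurable_fun setT (fun w => G K w ^+ 2) by exact: measurable_funX.
have c0 : 0 <= kappa2 R * (e - a) by rewrite mulr_ge0 ?subr_ge0 ?(ltW cl).
rewrite (integralD_EFin_ge0 P mS2 (fun w => sqr_ge0 _) (measurable_funM (measurable_cst _) mG2)
  (fun w => mulr_ge0 c0 (sqr_ge0 _))) EFinD leeD//.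
rewrite (integralZ_EFin P c0 mG2 (fun w => sqr_ge0 _)).
rewrite EfinE; last by rewrite (_ : (fun _ => _) = fun w => G K w * G K w); [exact: bdmM|].
by rewrite -EFinM lee_fin -/(v K) le_eqVlt; apply/orP; left; apply/eqP; ring.
Qed.

Let J' k (x : R) : R := \1_(`]clamp (tau k), clamp (tau k.+1)]) x.

Let J'E k x : s < x -> x <= u -> J' k x = J k x.
Proof.
move=> sx xu; rewrite /J' /J !indicE; congr (nat_of_bool _)%:R.
apply/idP/idP; rewrite !inE/= !in_itv/= /clamp gt_max le_max gt_min le_min sx leNgt sx xu/=.
  by rewrite ltNge xu.
by move=> /andP[-> ->]; rewrite orbT.
Qed.

Let J'le k x : J' k x <= J k x.
Proof.
have [sxu|] := boolP (x \in `]s, u]).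
  by move: sxu; rewrite in_itv/= => /andP[sx xu]; rewrite J'E.
move=> nx; rewrite /J' indicE; case: (boolP (x \in _)) => [|_]; last by rewrite /J indicE ler0n.
rewrite inE/= in_itv/= => /andP[h1 h2]; move: nx; rewrite in_itv/=.
have /andP[h3 _] := clamp_itv (tau k); have /andP[_ h4] := clamp_itv (tau k.+1).
by rewrite (le_lt_trans h3 h1) (le_trans h2 h4).
Qed.

Let mJ k (A : set R) : measurable_fun A (J k).
Proof. exact: measurable_indic. Qed.

Let mJ' k (A : set R) : measurable_fun A (J' k).
Proof. exact: measurable_indic. Qed.

Let int_J' : (\int[lebesgue_measure]_(x in `[0%R, T]) (\sum_(k < n) v k * J' k x)%:E =
  (\sum_(k < n) v k * (clamp (tau k.+1) - clamp (tau k)))%:E)%E.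
Proof.
under eq_integral do rewrite -sumEFin.
rewrite ge0_integral_sum//; last 2 first.
- by move=> k; apply/measurable_EFinP; apply: measurable_funM => //; exact: mJ'.
- by move=> k x _; rewrite lee_fin mulr_ge0.
rewrite -sumEFin; apply: eq_bigr => k _.
under eq_integral do rewrite EFinM.
rewrite ge0_integralZl//; last 3 first.
- by apply/measurable_EFinP; exact: mJ'.
- by move=> x _; rewrite lee_fin.
- by rewrite lee_fin.
rewrite EFinM; congr (_ * _)%E; rewrite integral_indic// setIidl; last first.
  move=> x; rewrite /= !in_itv/= => /andP[h1 h2]; apply/andP; split.
    exact: le_trans (cl0 _) (ltW h1).
  by have /andP[_ h4] := clamp_itv (tau k.+1); rewrite (le_trans h2)// (le_trans h4).
transitivity (lebesgue_measure `]clamp (tau k), clamp (tau k.+1)]%classic) => //.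
rewrite lebesgue_measure_itv/= lte_fin; have := tauS k; rewrite le_eqVlt => /orP[/eqP ->|->].
  by rewrite ltxx subrr.
by rewrite EFinB.
Qed.

Variables (g : R -> R) (mg : measurable_fun `[0, T] g).

Let mamean : measurable_fun `[0, T] simple_amean.
Proof. by apply: measurable_sum => k; apply: measurable_funM => //; exact: mJ. Qed.

Let mmoment : measurable_fun `[0, T]
  (fun x => \int[P]_w ((simple_eval H x w - g x) ^+ 2)%:E)%E.
Proof.
rewrite (_ : (fun x => _) = fun x =>
    (\sum_(k < n) v k * J k x + (simple_amean x - g x) ^+ 2)%:E); last first.
  by apply/funext => x; exact: simple_second_moment.
apply/measurable_EFinP; apply: measurable_funD.
  by apply: measurable_sum => k; apply: measurable_funM => //; exact: mJ.
by apply: measurable_funX; exact: measurable_funB.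
Qed.

Lemma simple_ito_error j :
  (\int[P]_w ((\sum_(k < n) (xi k w - m k) *
     (W (clamp (tau k.+1)) w - W (clamp (tau k)) w) j 0) ^+ 2)%:E <=
   (kappa2 R)%:E * \int[lebesgue_measure]_(x in `[0%R, T])
     \int[P]_w ((simple_eval H x w - g x) ^+ 2)%:E)%E.
Proof.
apply: le_trans (isometry_clamp j n) _; rewrite EFinM lee_wpmul2l ?lee_fin//.
  by rewrite /kappa2 mulr_ge0// expR_ge0.
rewrite -int_J'; apply: ge0_le_integral => //.
- by move=> x _; rewrite lee_fin sumr_ge0// => k _; rewrite mulr_ge0.
- by apply/measurable_EFinP; apply: measurable_sum => k; apply: measurable_funM => //; exact: mJ'.
- move=> x _; rewrite simple_second_moment lee_fin -[leLHS]addr0 lerD ?sqr_ge0//.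
  by apply: ler_sum => k _; rewrite ler_wpM2l.
Qed.

Lemma simple_mean_error :
  (\int[lebesgue_measure]_(x in `]s, u]) ((\sum_(k < n)
     m k * \1_(`]clamp (tau k), clamp (tau k.+1)]) x - g x) ^+ 2)%:E <=
   \int[lebesgue_measure]_(x in `[0%R, T])
     \int[P]_w ((simple_eval H x w - g x) ^+ 2)%:E)%E.
Proof.
have sub : `]s, u] `<=` `[0, T].
  move=> x; rewrite /= !in_itv/= => /andP[h1 h2]; apply/andP; split.
    exact: le_trans s0 (ltW h1).
  exact: le_trans uT.
apply: (@le_trans _ _ (\int[lebesgue_measure]_(x in `]s, u])
     \int[P]_w ((simple_eval H x w - g x) ^+ 2)%:E)%E).
  apply: ge0_le_integral => //.
  - by move=> x _; rewrite lee_fin sqr_ge0.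
  - apply/measurable_EFinP; apply: measurable_funX; apply: measurable_funB.
      by apply: measurable_sum => k; apply: measurable_funM => //; exact: mJ'.
    exact: measurable_funS mg.
  - exact: measurable_funS mmoment.
  - move=> x; rewrite /= in_itv/= => /andP[sx xu].
    rewrite simple_second_moment lee_fin.
    rewrite (_ : \sum_(k < n) _ = simple_amean x); last first.
      by apply: eq_bigr => k _; congr (_ * _); exact: J'E.
    by rewrite lerDr sumr_ge0// => k _; rewrite mulr_ge0.
by apply: ge0_subset_integral => // x _; apply: integral_ge0 => w _; rewrite lee_fin sqr_ge0.
Qed.

End One_process.
End Simple_process.

(** * Integrals of bounded functions over bounded intervals *)

Section Interval_integrals.
Context (R : realType).
Implicit Types (f g : R -> R) (i : interval R) (a b : R).
Notation leb := (@lebesgue_measure R).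

(** The counterpart of [bdm] for Lebesgue integrals over an interval. *)
Definition bint i f := measurable_fun [set` i] f /\ exists M, forall x, x \in i -> `|f x| <= M.

Lemma bint_cst i c : bint i (fun=> c).
Proof. by split; [exact: measurable_cst|exists `|c|]. Qed.

Lemma bintD i f g : bint i f -> bint i g -> bint i (fun x => f x + g x).
Proof.
move=> [mf [M fM]] [mg [N gN]]; split; first exact: measurable_funD.
by exists (M + N) => x xi; rewrite (le_trans (ler_normD _ _))// lerD ?fM ?gN.
Qed.

Lemma bintM i f g : bint i f -> bint i g -> bint i (fun x => f x * g x).
Proof.
move=> [mf [M fM]] [mg [N gN]]; split; first exact: measurable_funM.
by exists (M * N) => x xi; rewrite normrM ler_pM ?fM ?gN.
Qed.

Lemma bintB i f g : bint i f -> bint i g -> bint i (fun x => f x - g x).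
Proof.
move=> bf bg; rewrite (_ : (fun _ => _) = fun x => f x + (-1) * g x).
  by apply: bintD => //; apply: bintM => //; exact: bint_cst.
by apply/funext => x; rewrite mulN1r.
Qed.

Lemma bint_norm i f : bint i f -> bint i (fun x => `|f x|).
Proof.
move=> [mf [M fM]]; split; first exact: measurableT_comp.
by exists M => x xi; rewrite normr_id fM.
Qed.

Lemma bint_indic i (j : interval R) : bint i (\1_[set` j] : R -> R).
Proof.
split; first exact: measurable_indic.
by exists 1 => x _; rewrite indicE; case: (_ \in _); rewrite ?normr1 ?normr0.
Qed.

Lemma bint_sum i (I : Type) (l : seq I) (f : I -> R -> R) :
  (forall k, bint i (f k)) -> bint i (fun x => \sum_(k <- l) f k x).
Proof.
move=> bf; elim: l => [|k l IH].
  by rewrite (_ : (fun _ => _) = fun=> 0); [exact: bint_cst|apply/funext => x; rewrite big_nil].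
rewrite (_ : (fun _ => _) = fun x => f k x + \sum_(k <- l) f k x); first exact: bintD.
by apply/funext => x; rewrite big_cons.
Qed.

Lemma bintS i j f : [set` i] `<=` [set` j] -> bint j f -> bint i f.
Proof.
move=> ij [mf [M fM]]; split; first exact: measurable_funS mf.
by exists M => x xi; apply: fM; exact: ij.
Qed.

Lemma itv_finite i a b : [set` i] `<=` `[a, b] -> (leb [set` i] < +oo)%E.
Proof.
move=> sub; apply: (@le_lt_trans _ _ (leb `[a, b]%classic)).
  by apply: le_measure => //; rewrite inE.
by rewrite lebesgue_measure_itv/=; case: ifP => // _; rewrite -EFinB ltry.
Qed.

Variables (i : interval R) (a b : R).
Hypothesis (sub : [set` i] `<=` `[a, b]).

Lemma bint_int f : bint i f -> leb.-integrable [set` i] (EFin \o f).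
Proof.
move=> [mf [M fM]]; apply: measurable_bounded_integrable => //.
  exact: itv_finite sub.
exists M; split; first exact: num_real.
by move=> N MN x /= xi; rewrite (le_trans (fM _ xi))// ltW.
Qed.

Lemma ID f g : bint i f -> bint i g ->
  \int[leb]_(x in [set` i]) (f x + g x) = \int[leb]_(x in [set` i]) f x + \int[leb]_(x in [set` i]) g x.
Proof. by move=> bf bg; apply: RintegralD => //; exact: bint_int. Qed.

Lemma IZ c f : bint i f ->
  \int[leb]_(x in [set` i]) (c * f x) = c * \int[leb]_(x in [set` i]) f x.
Proof. by move=> bf; apply: RintegralZl => //; exact: bint_int. Qed.

Lemma IB f g : bint i f -> bint i g ->
  \int[leb]_(x in [set` i]) (f x - g x) = \int[leb]_(x in [set` i]) f x - \int[leb]_(x in [set` i]) g x.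
Proof. by move=> bf bg; apply: RintegralB => //; exact: bint_int. Qed.

Lemma Ile f g : bint i f -> bint i g -> (forall x, x \in i -> f x <= g x) ->
  \int[leb]_(x in [set` i]) f x <= \int[leb]_(x in [set` i]) g x.
Proof. by move=> bf bg fg; apply: le_Rintegral => //; exact: bint_int. Qed.

Lemma Inorm f : bint i f ->
  `|\int[leb]_(x in [set` i]) f x| <= \int[leb]_(x in [set` i]) `|f x|.
Proof. by move=> bf; apply: le_normr_Rintegral => //; exact: bint_int. Qed.

Lemma I_sum (I : Type) (l : seq I) (f : I -> R -> R) : (forall k, bint i (f k)) ->
  \int[leb]_(x in [set` i]) (\sum_(k <- l) f k x) = \sum_(k <- l) \int[leb]_(x in [set` i]) f k x.
Proof.
move=> bf; elim: l => [|k l IH].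
  rewrite big_nil; transitivity (\int[leb]_(x in [set` i]) (0 : R)).
    by apply: eq_Rintegral => x _; rewrite big_nil.
  by rewrite Rintegral_cst// mul0r.
rewrite big_cons -IH -ID//; last exact: bint_sum.
by apply: eq_Rintegral => x _; rewrite big_cons.
Qed.

Lemma IfinE f : bint i f ->
  (\int[leb]_(x in [set` i]) (f x)%:E)%E = (\int[leb]_(x in [set` i]) f x)%:E.
Proof. by move=> bf; rewrite fineK//; apply: integrable_fin_num => //; exact: bint_int. Qed.

Lemma Icst c : \int[leb]_(x in [set` i]) c = c * fine (leb [set` i]).
Proof. by rewrite Rintegral_cst. Qed.

Lemma Ileb_le : a <= b -> fine (leb [set` i]) <= b - a.
Proof.
move=> ab; rewrite -lee_fin fineK; last by rewrite ge0_fin_numE// (itv_finite sub).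
apply: (@le_trans _ _ (leb `[a, b]%classic)); first by apply: le_measure => //; rewrite inE.
by rewrite lebesgue_measure_itv/= lte_fin; case: ifP => _; rewrite ?lee_fin ?subr_ge0// -EFinB.
Qed.

Lemma Ige0 f : (forall x, x \in i -> 0 <= f x) -> 0 <= \int[leb]_(x in [set` i]) f x.
Proof. by move=> f0; apply: Rintegral_ge0 => x; exact: f0. Qed.

Lemma Ile_cst f c : a <= b -> 0 <= c -> bint i f -> (forall x, x \in i -> f x <= c) ->
  \int[leb]_(x in [set` i]) f x <= c * (b - a).
Proof.
move=> ab c0 bf fc; apply: (@le_trans _ _ (\int[leb]_(x in [set` i]) c)).
  by apply: Ile => //; exact: bint_cst.
by rewrite Icst ler_wpM2l// Ileb_le.
Qed.

Variable d : nat.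

(* Pair with the constant vector [\int f] and use the Cauchy-Schwarz inequality. *)
Lemma enorm_integral_le (f : R -> 'cV[R]_d) (g : R -> R) :
  (forall k, bint i (fun x => f x k 0)) -> bint i g ->
  (forall x, x \in i -> enorm (f x) <= g x) ->
  enorm (\col_k \int[leb]_(x in [set` i]) f x k 0) <= \int[leb]_(x in [set` i]) g x.
Proof.
move=> bf bg fg; set v := \col_k _.
have [->|v0] := eqVneq (enorm v) 0.
  by apply: Ige0 => x xi; exact: le_trans (enorm_ge0 _) (fg x xi).
have v1 : 0 < enorm v by rewrite lt_neqAle eq_sym v0 enorm_ge0.
rewrite -(ler_pM2l v1) -expr2 enorm_sqr -IZ//.
rewrite (_ : \sum_k v k 0 ^+ 2 = \int[leb]_(x in [set` i]) (\sum_k v k 0 * f x k 0)); last first.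
  rewrite I_sum; last by move=> k; apply: bintM => //; exact: bint_cst.
  by apply: eq_bigr => k _; rewrite IZ// expr2 {2}/v mxE.
apply: Ile => [||x xi].
- by apply: bint_sum => k; apply: bintM => //; exact: bint_cst.
- by apply: bintM => //; exact: bint_cst.
- apply: le_trans (ler_wpM2l (enorm_ge0 v) (fg x xi)).
  apply: le_trans (ler_norm _) _.
  rewrite -ler_sqr ?nnegrE ?mulr_ge0 ?enorm_ge0//.
  by rewrite real_normK ?num_real// exprMn !enorm_sqr sum_cauchy_schwarz.
Qed.

End Interval_integrals.

Lemma cvge0_near (R : realType) (f : nat -> \bar R) : f @ \oo --> 0%E ->
  forall e : R, 0 < e -> \forall n \near \oo, (f n <= e%:E)%E.
Proof.
move=> /fine_cvgP[ff f0] e e0.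
have /cvgr0Pnorm_le/(_ _ e0) h := f0.
near=> n; have fn : f n \is a fin_num by near: n.
rewrite -(fineK fn) lee_fin; apply: le_trans (ler_norm _) _.
by near: n.
Unshelve. all: by end_near. Qed.

Lemma measurable_invr (R : realType) dE (E : measurableType dE) (D : set E) (f : E -> R) :
  measurable_fun D f -> measurable_fun D (fun x => (f x)^-1).
Proof.
(* The square makes the base nonnegative, so the inverse becomes a real power times [f]; both sides
   are 0 where [f] vanishes. *)
move=> mf; rewrite (_ : (fun _ => _) = fun x => f x * (f x ^+ 2) `^ (-1)); last first.
  apply/funext => x; rewrite powR_inv1 ?sqr_ge0//; have [->|f0] := eqVneq (f x) 0.
    by rewrite invr0 mul0r.
  by rewrite expr2 invfM mulrA divff// mul1r.
apply: measurable_funM => //.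
apply: (measurableT_comp (measurable_powR (-1))); exact: measurable_funX.
Qed.

Lemma measurable_det (R : realType) dE (E : measurableType dE) (D : set E) m
    (A : E -> 'M[R]_m) : (forall i j, measurable_fun D (fun x => A x i j)) ->
  measurable_fun D (fun x => \det (A x)).
Proof.
move=> mA; apply: measurable_sum => s; apply: measurable_funM => //.
by apply: measurable_prod => i _; exact: mA.
Qed.

(** Cramer's formula expresses the entries of the inverse through determinants, which are
    polynomials in the entries of [A]. *)
Lemma measurable_invmx (R : realType) dE (E : measurableType dE) (D : set E) m
    (A : E -> 'M[R]_m) i j : (forall x, D x -> A x \in unitmx) ->
  (forall i j, measurable_fun D (fun x => A x i j)) ->
  measurable_fun D (fun x => invmx (A x) i j).
Proof.
move=> uA mA.
apply: (eq_measurable_fun (fun x => (\det (A x))^-1 * cofactor (A x) j i)).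
  by move=> x; rewrite inE => Dx; rewrite /invmx uA// !mxE.
apply: measurable_funM; first by apply: measurable_invr; exact: measurable_det.
apply: measurable_funM => //; apply: measurable_det => k l.
by rewrite (_ : (fun _ => _) = fun x => A x (lift j k) (lift i l))//; apply/funext => x; rewrite !mxE.
Qed.

Section Ito_deterministic.
Context (R : realType) (d : nat).
Context (dO : measure_display) (Omega : measurableType dO) (P : probability Omega R).
Context (F : R -> set (set Omega)) (W : R -> Omega -> 'cV[R]_d).
Hypotheses (hF : complete_filtration P F) (hW : brownian_motion P F W).
Variables (T s u : R) (s0 : 0 <= s) (su : s <= u) (uT : u <= T).

(* The integrand is deterministic, so replacing the values of the approximating simple
   processes by their means still approximates the integral, and makes it a functional
   of finitely many increments of [W]. *)
Lemma ito_approx (g : R -> R) (j : 'I_d) (M : R -> Omega -> R) :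
  measurable_fun `[0, T] g ->
  is_ito_integral P F T (fun x _ => g x) (fun t w => W t w j 0) M ->
  exists (sz : nat -> nat) (m : nat -> nat -> R) (x : nat -> nat -> R),
  [/\ forall n k, [/\ s <= x n k, x n k <= x n k.+1 & x n k.+1 <= u],
   forall e : R, 0 < e -> \forall n \near \oo,
     (\int[P]_w ((\sum_(k < sz n) m n k * (W (x n k.+1) w - W (x n k) w) j 0
        - (M u w - M s w)) ^+ 2)%:E <= e%:E)%E &
   forall e : R, 0 < e -> \forall n \near \oo,
     (\int[lebesgue_measure]_(y in `]s, u])
        ((\sum_(k < sz n) m n k * \1_(`]x n k, x n k.+1]) y - g y) ^+ 2)%:E <= e%:E)%E].
Proof.
move=> mg [MF _ [H [cH cI]]].
have uu : 0 <= u <= T by rewrite (le_trans s0).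
have ss : 0 <= s <= T by rewrite s0 (le_trans su).
exists (fun n => sp_size (H n)), (fun n k => simple_mean P (H n) k).
exists (fun n k => clamp s u (sp_time (H n) k)); split.
- move=> n k; have /andP[h1 h2] := clamp_itv su (sp_time (H n) k).
  have /andP[h3 h4] := clamp_itv su (sp_time (H n) k.+1); split => //.
  by apply: clamp_mono; exact: sp_time_le.
- move=> e e0.
  have k0 : 0 < kappa2 R by rewrite /kappa2 mulr_gt0// expR_gt0.
  (* Three errors, each multiplied by 3 when the square of their sum is expanded. *)
  have e9 : 0 < e / 9 by rewrite divr_gt0.
  have ek : 0 < e / 9 / kappa2 R by rewrite divr_gt0.
  have h1 := cvge0_near cH ek.
  have h2 := cvge0_near (cI _ uu) e9; have h3 := cvge0_near (cI _ ss) e9.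
  near=> n.
  have H1 := near h1 n _; have H2 := near h2 n _; have H3 := near h3 n _.
  pose I t w := simple_integral (H n) (fun t w => W t w j 0) t w.
  pose E w := \sum_(k < sp_size (H n)) (sp_val (H n) k w - simple_mean P (H n) k) *
     (W (clamp s u (sp_time (H n) k.+1)) w - W (clamp s u (sp_time (H n) k)) w) j 0.
  have tau0 k : 0 <= sp_time (H n) k.
    elim: k => [|k IH]; first exact: sp_time0.
    exact: le_trans IH (sp_time_le (H n) k).
  have mW t : 0 <= t -> measurable_fun setT (fun w => W t w j 0).
    move=> t0; apply: (measurable_wrt_fun (filtration_measurable hF t0)).
    exact: (brownian_wrt hF hW).
  have mxi k : measurable_fun setT (sp_val (H n) k).
    by have [] := simple_val_bdm hF (H n) k.
  have cl0 t : 0 <= clamp s u t by have /andP[h _] := clamp_itv su t; exact: le_trans h.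
  have mE : measurable_fun setT E.
    apply: measurable_sum => k; apply: measurable_funM; first exact: measurable_funB.
    rewrite (_ : (fun _ => _) = fun w => W (clamp s u (sp_time (H n) k.+1)) w j 0 -
      W (clamp s u (sp_time (H n) k)) w j 0); last by apply/funext => w; rewrite !mxE.
    by apply: measurable_funB; exact: mW.
  have mM t : 0 <= t <= T -> measurable_fun setT (M t).
    move=> tt; have /andP[t0 _] := tt.
    exact: (measurable_wrt_fun (filtration_measurable hF t0) (MF t tt)).
  have mI t : 0 <= t <= T -> measurable_fun setT (fun w => I t w - M t w).
    move=> /[dup] /mM mMt /andP[t0 _]; apply: measurable_funB => //.
    apply: measurable_sum => k; apply: measurable_funM => //.
    by apply: measurable_funB; apply: mW; rewrite le_min t0 tau0.
  have IE w : \sum_(k < sp_size (H n)) sp_val (H n) k w *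
     (W (clamp s u (sp_time (H n) k.+1)) w - W (clamp s u (sp_time (H n) k)) w) j 0 = I u w - I s w.
    rewrite /I /simple_integral -sumrB; apply: eq_bigr => k _.
    (* The term [W s] does not depend on [t] and cancels in increments. *)
    have cE t : W (clamp s u t) w j 0 = W (Num.min u t) w j 0 - W (Num.min s t) w j 0 + W s w j 0.
      rewrite /clamp; have [ts|st] := orP (le_total t s).
        by rewrite (min_idPr (le_trans ts su)) (min_idPr ts) (max_idPl ts) subrr add0r.
      rewrite (min_idPl st) subrK; congr (W _ w j 0).
      by apply/max_idPr; rewrite le_min su.
    by rewrite mxE [X in _ + X]mxE !cE; ring.
  pose q f w := 3 * ((f : Omega -> R) w ^+ 2).
  have mq f : measurable_fun setT f -> measurable_fun setT (q f).
    by move=> mf; apply: measurable_funM => //; exact: measurable_funX.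
  have q0 f w : 0 <= q f w by rewrite mulr_ge0// sqr_ge0.
  have Iq (f : Omega -> R) (c : R) : measurable_fun setT f -> (\int[P]_w (f w ^+ 2)%:E <= c%:E)%E ->
      (\int[P]_w (q f w)%:E <= (3 * c)%:E)%E.
    move=> mf fc; rewrite integralZ_EFin//; [|exact: measurable_funX|by move=> w; exact: sqr_ge0].
    by rewrite EFinM lee_wpmul2l// lee_fin.
  apply: (@le_trans _ _ (\int[P]_w (q E w + (q (fun w => I u w - M u w)%R w +
      q (fun w => I s w - M s w)%R w))%:E)%E).
    apply: le_integral_EFin => [|w||w].
    + apply: measurable_funX; apply: measurable_funB; last by apply: measurable_funB; exact: mM.
      apply: measurable_sum => k; apply: measurable_funM => //.
      rewrite (_ : (fun _ => _) = fun w => W (clamp s u (sp_time (H n) k.+1)) w j 0 -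
        W (clamp s u (sp_time (H n) k)) w j 0); last by apply/funext => w; rewrite !mxE.
      by apply: measurable_funB; exact: mW.
    + exact: sqr_ge0.
    + by apply: measurable_funD; [exact: mq|apply: measurable_funD; apply: mq; exact: mI].
    + have EE : E w = (I u w - I s w) - \sum_(k < sp_size (H n)) simple_mean P (H n) k *
         (W (clamp s u (sp_time (H n) k.+1)) w - W (clamp s u (sp_time (H n) k)) w) j 0.
        by rewrite -IE -sumrB; apply: eq_bigr => k _; rewrite mulrBl.
      rewrite (_ : \sum_(k < _) _ = I u w - I s w - E w); last by rewrite EE; ring.
      rewrite /q; set a := E w; set b := I u w - M u w; set c := I s w - M s w.
      rewrite (_ : _ - _ - _ - _ = b - c - a); last by rewrite /a /b /c; ring.
      have := sqr_ge0 (a + b); have := sqr_ge0 (a - c); have := sqr_ge0 (b + c); rewrite -subr_ge0 => ? ? ?.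
      nra.
  have mqu := mq _ (mI u uu); have mqs := mq _ (mI s ss).
  rewrite (integralD_EFin_ge0 P (mq E mE) (q0 E) (measurable_funD mqu mqs)
    (fun w => addr_ge0 (q0 _ w) (q0 _ w))).
  rewrite (integralD_EFin_ge0 P mqu (q0 _) mqs (q0 _)).
  rewrite (_ : e = 3 * (e / 9) + (3 * (e / 9) + 3 * (e / 9))); last by field.
  rewrite !EFinD; apply: leeD; last first.
    by apply: leeD; apply: Iq; [exact: (mI u uu)|exact: H2|exact: (mI s ss)|exact: H3].
  apply: Iq => //.
  apply: le_trans (simple_ito_error hF hW (H n) s0 su uT mg j) _.
  rewrite (_ : e / 9 = kappa2 R * (e / 9 / kappa2 R)); last by rewrite mulrCA divff ?mulr1 ?gt_eqF.
  by rewrite [X in (_ <= X)%E]EFinM; apply: lee_wpmul2l; [rewrite lee_fin ltW|exact: H1].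
- move=> e e0; have h := cvge0_near cH e0; near=> n.
  apply: le_trans (simple_mean_error hF (H n) s0 uT mg) _.
  by near: n.
Unshelve. all: by end_near. Qed.

End Ito_deterministic.

Lemma cvg0_scale (R : realType) (f : nat -> R) (C : R) : 0 <= C ->
  (forall e, 0 < e -> \forall n \near \oo, `|f n| <= C * e) -> f @ \oo --> (0 : R).
Proof.
move=> C0 h; apply/cvgr0Pnorm_le => e e0.
have e1 : 0 < e / (C + 1) by rewrite divr_gt0// ltr_wpDl.
apply: filterS (h _ e1) => n /le_trans; apply.
by rewrite mulrCA ler_piMr ?(ltW e0)// ler_pdivrMr ?ltr_wpDl// mul1r lerDl.
Qed.

(** Turns a bound [e ^+ 2] on a second moment into the bound [2 * e] on the mean of the absolute
    value. *)
Lemma le_add_sqr (R : realType) (e z : R) : 0 < e -> `|z| <= e + e^-1 * z ^+ 2.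
Proof.
move=> e0; have [ze|ez] := leP `|z| e.
  by rewrite (le_trans ze)// lerDl mulr_ge0 ?sqr_ge0// invr_ge0 ltW.
rewrite (_ : z ^+ 2 = `|z| * `|z|); last by rewrite -expr2 real_normK ?num_real.
apply: (@le_trans _ _ (e^-1 * (e * `|z|))).
  by rewrite mulKf ?gt_eqF.
rewrite -[leLHS]add0r lerD ?(ltW e0)//.
by rewrite ler_wpM2l ?invr_ge0 ?(ltW e0)// ler_wpM2r// ltW.
Qed.

(** * The noise increment of the solution over one interval *)

Section Noise.
Context (R : realType) (r : R) (d : nat) (r0 : 0 < r).
Context (dO : measure_display) (Omega : measurableType dO) (P : probability Omega R).
Context (F : R -> set (set Omega)) (W : R -> Omega -> 'cV[R]_d).
Hypotheses (hF : complete_filtration P F) (hW : brownian_motion P F W).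
Variables (T s u : R) (s0 : 0 <= s) (su : s < u) (uT : u <= T).
Variables (sg : R -> 'M[R]_d) (M : 'I_d -> 'I_d -> R -> Omega -> R) (N sinv : R).
Hypothesis msg : forall i j, measurable_fun `[0, T] (fun x => sg x i j).
Hypothesis usg : forall x, 0 <= x <= T -> sg x \in unitmx.
Hypothesis bsg : forall x i j, 0 <= x <= T -> `|sg x i j| <= N.
Hypothesis sinv0 : 0 <= sinv.
Hypothesis isg : forall x h, 0 <= x <= T -> enorm (invmx (sg x) *m h) <= sinv * enorm h.
Hypothesis hM : forall i j,
  is_ito_integral P F T (fun x _ => sg x i j) (fun t w => W t w j 0) (M i j).

Definition noise w : 'cV[R]_d := \col_i \sum_j (M i j u w - M i j s w).

Let uu : 0 <= u <= T. Proof. by rewrite (le_trans s0 (ltW su)). Qed.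
Let ss : 0 <= s <= T. Proof. by rewrite s0 (le_trans (ltW su)). Qed.

Lemma noise_wrt (a c : R) : a < c -> measurable_wrt (F u) (fun w => vramp r (noise w) a c).
Proof.
move=> ac; have /andP[u0 _] := uu; have sgu := filtration_sigma hF u0.
apply/(measurable_wrtP sgu); apply: (vramp_measurable r0 ac) => i.
rewrite (_ : (fun _ => _) = fun w => \sum_j (M i j u w - M i j s w)); last first.
  by apply/funext => w; rewrite mxE.
apply: measurable_sum => j; have [Mw _ _] := hM i j.
apply: measurable_funB; apply/(measurable_wrtP sgu); first exact: Mw.
by move=> A mA; apply: (filtration_le hF s0 (ltW su)); exact: Mw.
Qed.

Variables (a c : R) (ac : a < c) (h : 'cV[R]_d).

(** The direction in which [W] is translated: [sg y *m v y] is the constant [h / (u - s)], so moving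
    [W] by the primitive [path] of [v] moves the noise by [h]. *)
Let v y : 'cV[R]_d := (u - s)^-1 *: (invmx (sg y) *m h).
Let kv := (u - s)^-1 * (sinv * enorm h).
Let us0 : 0 < u - s. Proof. by rewrite subr_gt0. Qed.
Let kv0 : 0 <= kv.
Proof. by rewrite /kv mulr_ge0 ?invr_ge0 ?(ltW us0)// mulr_ge0// enorm_ge0. Qed.

Let su_T x : x \in `]s, u] -> 0 <= x <= T.
Proof.
by rewrite in_itv/= => /andP[sx xu]; rewrite (le_trans s0 (ltW sx)) (le_trans xu).
Qed.

Let subT : `]s, u] `<=` (`[0, T] : set R).
Proof. by move=> x /= /su_T; rewrite in_itv. Qed.

Let v_le x : x \in `]s, u] -> enorm (v x) <= kv.
Proof.
move=> /su_T xT; rewrite /v enormZ ger0_norm ?invr_ge0 ?(ltW us0)//.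
by rewrite ler_wpM2l ?invr_ge0 ?(ltW us0)// isg.
Qed.

Let bv j : bint `]s, u] (fun y => v y j 0).
Proof.
split; last by exists kv => x xi; exact: le_trans (enorm_coord _ _) (v_le xi).
rewrite (_ : (fun _ => _) = fun y => (u - s)^-1 * \sum_k invmx (sg y) j k * h k 0); last first.
  by apply/funext => y; rewrite !mxE.
apply: measurable_funM => //; apply: measurable_sum => k; apply: measurable_funM => //.
apply: measurable_invmx => [y /su_T|i' j']; first exact: usg.
exact: measurable_funS (msg i' j').
Qed.

Let bs i j : bint `]s, u] (fun y => sg y i j).
Proof.
split; first exact: measurable_funS (msg i j).
by exists N => x /su_T; exact: bsg.
Qed.

Let sub_su : `]s, u] `<=` (`[s, u] : set R).
Proof. by move=> x; rewrite /= !in_itv/= => /andP[/ltW -> ->]. Qed.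

Let path x : 'cV[R]_d := \col_j \int[lebesgue_measure]_(y in `]s, x]) v y j 0.

Let sub_itv t t' : s <= t -> t' <= u -> `]t, t'] `<=` (`]s, u] : set R).
Proof.
move=> st tu x; rewrite /= !in_itv/= => /andP[tx xt].
by rewrite (le_lt_trans st tx) (le_trans xt tu).
Qed.

Let pathB t t' : s <= t -> t <= t' -> t' <= u ->
  path t' - path t = \col_j \int[lebesgue_measure]_(y in `]t, t']) v y j 0.
Proof.
move=> st tt tu; apply/matrixP => j k; rewrite !mxE.
apply: Rintegral_itvB; rewrite ?bnd_simp//.
have st' := sub_itv (lexx s) tu.
by apply: (@bint_int _ _ s u); [move=> x hx; apply: sub_su; exact: st'|exact: (bintS st' (bv j))].
Qed.

Let path_lip t t' : s <= t -> t < t' -> t' <= u -> enorm (path t' - path t) <= kv * (t' - t).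
Proof.
move=> st tt tu; rewrite pathB ?(ltW tt)//.
have st' := sub_itv st tu.
have sub' : `]t, t'] `<=` (`[t, t'] : set R).
  by move=> x; rewrite /= !in_itv/= => /andP[/ltW -> ->].
apply: (@le_trans _ _ (\int[lebesgue_measure]_(y in `]t, t']) kv)).
  apply: (enorm_integral_le sub') => [k||x xi]; [exact: (bintS st' (bv k))|exact: bint_cst|].
  by apply: v_le; exact: st'.
by apply: Ile_cst => //; [exact: ltW|exact: bint_cst].
Qed.

(** The noise is the limit of functionals [Lam n] of finitely many Brownian increments, to which
    [functional_shift] applies along [path]. The Lipschitz constant [kv] of [path] gives every [n]
    the same cost [kv ^+ 2 * (u - s)], and [Lam n path] converges to [h]. *)
Lemma noise_shift : indep_of P (F s) (fun w => vramp r (noise w) a c) /\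
  shift_bound P (fun w => vramp r (noise w) a c) (vramp r h a c)
    (sinv ^+ 2 * enorm h ^+ 2 / (u - s)).
Proof.
have /choice[sz] : forall p : 'I_d * 'I_d, exists (sz : nat -> nat), exists m x : nat -> nat -> R,
    [/\ forall n k, [/\ s <= x n k, x n k <= x n k.+1 & x n k.+1 <= u],
     forall e : R, 0 < e -> \forall n \near \oo,
       (\int[P]_w ((\sum_(k < sz n) m n k * (W (x n k.+1) w - W (x n k) w) p.2 0
          - (M p.1 p.2 u w - M p.1 p.2 s w)) ^+ 2)%:E <= e%:E)%E &
     forall e : R, 0 < e -> \forall n \near \oo,
       (\int[lebesgue_measure]_(y in `]s, u])
          ((\sum_(k < sz n) m n k * \1_(`]x n k, x n k.+1]) y - sg y p.1 p.2) ^+ 2)%:E <= e%:E)%E].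
  move=> [i j] /=; have [sz [m [x [h1 h2 h3]]]] := ito_approx hF hW s0 (ltW su) uT (msg i j) (hM i j).
  by exists sz, m, x; split.
move=> H1; have [m H2] := choice H1; have [x app] := choice H2.
have pairE (f : 'I_d * 'I_d -> R) : \sum_p f p = \sum_i \sum_j f (i, j).
  by rewrite pair_bigA; apply: eq_bigr => -[].
(* One index per matrix entry and per interval of its approximating process; the number of intervals
   depends on the entry, hence a dependent pair. *)
pose I n := {p : 'I_d * 'I_d & 'I_(sz p n)}.
pose je n (e : I n) := (tag e).2.
pose ve n (e : I n) : 'cV[R]_d := m (tag e) n (tagged e) *: delta_mx (tag e).1 0.
pose xe n (e : I n) := x (tag e) n (tagged e).
pose ye n (e : I n) := x (tag e) n (tagged e).+1.
pose Lam n (om : R -> 'cV[R]_d) := \sum_(e : I n) (om (ye n e) - om (xe n e)) (je n e) 0 *: ve n e.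
have LamE n om i : Lam n om i 0 =
    \sum_j \sum_(k < sz (i, j) n) m (i, j) n k * (om (x (i, j) n k.+1) - om (x (i, j) n k)) j 0.
  rewrite /Lam summxE.
  pose G p k := (om (x p n k.+1) - om (x p n k)) p.2 0 * (m p n k * (i == p.1)%:R).
  transitivity (\sum_(e : I n) G (tag e) (tagged e)).
    by apply: eq_bigr => e _; rewrite /G !mxE eqxx andbT.
  rewrite -(sig_big_dep xpredT (fun p => xpredT) (fun p (k : 'I_(sz p n)) => G p k))/=.
  rewrite pairE.
  rewrite (bigD1 i)//= [X in _ + X]big1 ?addr0 => [|i' ii].
    by apply: eq_bigr => j _; apply: eq_bigr => k _; rewrite /G/= eqxx mulr1 mulrC.
  rewrite big1// => j _; rewrite big1// => k _.
  by rewrite /G/= eq_sym (negbTE ii) !mulr0.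
have fs n : [/\ measurable_wrt (F u) (fun w => vramp r (Lam n (W ^~ w)) a c),
    indep_of P (F s) (fun w => vramp r (Lam n (W ^~ w)) a c) &
    shift_bound P (fun w => vramp r (Lam n (W ^~ w)) a c) (vramp r (Lam n path) a c)
      (kv ^+ 2 * (u - s))].
  apply: (functional_shift r0 hF hW _ _ ac s0 (ltW su) kv0 _ path_lip) => e.
  by have [A _ _] := app (tag e); exact: A.
have kvE : kv ^+ 2 * (u - s) = sinv ^+ 2 * enorm h ^+ 2 / (u - s).
  by rewrite /kv; field; rewrite gt_eqF.
have /andP[u0 _] := uu.
pose Nn n w := vramp r (Lam n (W ^~ w)) a c.
have mNn n : measurable_fun setT (Nn n).
  by have [mw _ _] := fs n; exact: (measurable_wrt_fun (filtration_measurable hF u0) mw).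
have mN : measurable_fun setT (fun w => vramp r (noise w) a c).
  exact: (measurable_wrt_fun (filtration_measurable hF u0) (noise_wrt ac)).
pose D2 : R := d%:R * d%:R.
have D20 : 0 <= D2 by rewrite mulr_ge0.
have sumD2 (z : R) : \sum_(i < d) \sum_(j < d) z = D2 * z.
  by rewrite /D2 !sumr_const card_ord -mulrA !mulr_natl.
pose z n p w := \sum_(k < sz p n) m p n k * (W (x p n k.+1) w - W (x p n k) w) p.2 0
   - (M p.1 p.2 u w - M p.1 p.2 s w).
have mW t j : 0 <= t -> measurable_fun setT (fun w => W t w j 0).
  move=> t0; apply: (measurable_wrt_fun (filtration_measurable hF t0)).
  exact: (brownian_wrt hF hW).
have mz n p : measurable_fun setT (z n p).
  apply: measurable_funB.
    apply: measurable_sum => k; apply: measurable_funM => //.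
    have [A _ _] := app p; have [A1 A2 A3] := A n k.
    rewrite (_ : (fun _ => _) = fun w => W (x p n k.+1) w p.2 0 - W (x p n k) w p.2 0); last first.
      by apply/funext => w; rewrite !mxE.
    have x0 : 0 <= x p n k by exact: le_trans A1.
    by apply: measurable_funB; apply: mW => //; exact: le_trans A2.
  have [Mw _ _] := hM p.1 p.2.
  apply: measurable_funB.
    exact: (measurable_wrt_fun (filtration_measurable hF u0) (Mw u uu)).
  exact: (measurable_wrt_fun (filtration_measurable hF s0) (Mw s ss)).
have cN : \int[P]_w sdist1 (Nn n w) (vramp r (noise w) a c) @[n --> \oo] --> (0 : R).
  apply: (cvg0_scale (C := 2 * D2)) => [|e e0]; first by rewrite mulr_ge0.
  have e2 : 0 < e ^+ 2 by rewrite exprn_gt0.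
  have : \forall n \near \oo, forall p, (\int[P]_w (z n p w ^+ 2)%:E <= (e ^+ 2)%:E)%E.
    by apply: filter_forall => p; have [_ A _] := app p; exact: (A _ e2).
  apply: filterS => n zn.
  have bS := sdist1_bdm r0 (mNn n) mN.
  rewrite ger0_norm; last by apply: Ege0 => w; rewrite /sdist1 le_min ler01 snorm_ge0// ltW.
  rewrite -lee_fin -EfinE//.
  have sdle w : sdist1 (Nn n w) (vramp r (noise w) a c) <= \sum_p (e + e^-1 * z n p w ^+ 2).
    rewrite /sdist1 ge_min; apply/orP; right.
    rewrite /Nn -vrampB//; apply: le_trans (vramp_snorm _ _ _) _; rewrite ?(ltW r0)//.
    apply: le_trans (enorm_le_sum _) _.
    rewrite pairE.
    apply: ler_sum => i _.
    rewrite mxE [X in _ + X]mxE LamE mxE -sumrB; apply: le_trans (ler_norm_sum _ _ _) _.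
    by apply: ler_sum => j _; exact: le_add_sqr.
  apply: (@le_trans _ _ (\int[P]_w (\sum_p (e + e^-1 * z n p w ^+ 2))%:E)%E).
    apply: le_integral_EFin => //; first by case: bS.
      by move=> w; rewrite /sdist1 le_min ler01 snorm_ge0// ltW.
    apply: measurable_sum => p; apply: measurable_funD => //.
    by apply: measurable_funM => //; exact: measurable_funX.
  under eq_integral do rewrite -sumEFin.
  rewrite ge0_integral_sum//; last 2 first.
  - move=> p; apply/measurable_EFinP; apply: measurable_funD => //.
    by apply: measurable_funM => //; exact: measurable_funX.
  - by move=> p w _; rewrite lee_fin addr_ge0 ?(ltW e0)// mulr_ge0 ?sqr_ge0// invr_ge0 ltW.
  rewrite (_ : 2 * D2 * e = \sum_(p : 'I_d * 'I_d) (e + e^-1 * e ^+ 2)); last first.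
    rewrite pairE sumD2.
    by rewrite expr2 mulKf ?gt_eqF//; ring.
  rewrite -sumEFin; apply: lee_sum => p _.
  rewrite (integralD_EFin_ge0 P (measurable_cst _) (fun w => ltW e0)
    (measurable_funM (measurable_cst _) (measurable_funX 2 (mz n p))) _); last first.
    by move=> w; rewrite mulr_ge0 ?sqr_ge0// invr_ge0 ltW.
  rewrite integralZ_EFin ?invr_ge0 ?(ltW e0)//; [|exact: measurable_funX|by move=> w; exact: sqr_ge0].
  have PT : P setT = 1%E := probability_setT P.
  have ec : (\int[P]_w e%:E <= e%:E)%E by rewrite integral_cst// [X in (_ * X)%E]PT mule1.
  rewrite EFinD; apply: leeD; first exact: ec.
  by rewrite EFinM; apply: lee_wpmul2l; [rewrite lee_fin invr_ge0 ltW|exact: zn].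
have cth : snorm (vramp r (Lam n path) a c - vramp r h a c) @[n --> \oo] --> (0 : R).
  apply: (cvg0_scale (C := D2 * (kv * (u - s + 1)))) => [|e e0].
    by rewrite mulr_ge0// mulr_ge0// addr_ge0// ltW.
  have e2 : 0 < e ^+ 2 by rewrite exprn_gt0.
  pose al n p y := \sum_(k < sz p n) m p n k * \1_(`]x p n k, x p n k.+1]) y : R.
  have : \forall n \near \oo, forall p, (\int[lebesgue_measure]_(y in `]s, u])
      ((al n p y - sg y p.1 p.2) ^+ 2)%:E <= (e ^+ 2)%:E)%E.
    by apply: filter_forall => p; have [_ _ A] := app p; exact: (A _ e2).
  apply: filterS => n zn.
  have bal p : bint `]s, u] (al n p).
    by apply: bint_sum => k; apply: bintM; [exact: bint_cst|exact: bint_indic].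
  have bd p : bint `]s, u] (fun y => al n p y - sg y p.1 p.2) by exact: bintB.
  have bd2 p : bint `]s, u] (fun y => (al n p y - sg y p.1 p.2) ^+ 2).
    by rewrite (_ : (fun _ => _) = fun y => (al n p y - sg y p.1 p.2) * (al n p y - sg y p.1 p.2)); [exact: bintM|].
  have leb_su : fine (lebesgue_measure (`]s, u] : set R)) = u - s.
    by rewrite lebesgue_measure_itv/= lte_fin su.
  (* [h] is the integral of [sg *m v]; compared with [LE], the error involves [al n - sg] only,
     which is small in mean square. *)
  have hE i : h i 0 = \sum_j \int[lebesgue_measure]_(y in `]s, u]) (sg y i j * v y j 0).
    rewrite -(I_sum sub_su); last by move=> j; exact: bintM.
    transitivity (\int[lebesgue_measure]_(y in `]s, u]) ((u - s)^-1 * h i 0)).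
      by rewrite Icst leb_su mulrAC mulVf ?mul1r// gt_eqF.
    apply: eq_Rintegral => y; rewrite inE/= => /su_T yT.
    rewrite (_ : \sum_j _ = (sg y *m v y) i 0); last by rewrite mxE.
    by rewrite /v -scalemxAr mulmxA mulmxV ?mul1mx ?usg// mxE.
  have LE i : Lam n path i 0 = \sum_j \int[lebesgue_measure]_(y in `]s, u]) (al n (i, j) y * v y j 0).
    rewrite LamE; apply: eq_bigr => j _.
    transitivity (\int[lebesgue_measure]_(y in `]s, u])
        (\sum_(k < sz (i, j) n) m (i, j) n k * (\1_(`]x (i, j) n k, x (i, j) n k.+1]) y * v y j 0))); last first.
      apply: eq_Rintegral => y _; rewrite /al mulr_suml; apply: eq_bigr => k _.
      by rewrite mulrA.
    have bk (k : nat) : bint `]s, u] (fun y => \1_(`]x (i, j) n k, x (i, j) n k.+1]) y * v y j 0).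
      by apply: bintM => //; exact: bint_indic.
    rewrite (I_sum sub_su); last by move=> k; apply: bintM => //; exact: bint_cst.
    apply: eq_bigr => k _; rewrite (IZ sub_su)//; congr (_ * _).
    have [A _ _] := app (i, j); have [A1 A2 A3] := A n k.
    rewrite pathB// mxE; rewrite Rintegral_mkcond [RHS]Rintegral_mkcond.
    apply: eq_Rintegral => y _; rewrite !patchE.
    case: ifPn => [yi|yi].
      rewrite ifT; last by move: yi; rewrite !inE/=; exact: sub_itv.
      by rewrite indicE yi mul1r.
    by case: ifP => // _; rewrite indicE (negbTE yi) mul0r.
  rewrite ger0_norm ?snorm_ge0 ?(ltW r0)// -vrampB//.
  apply: le_trans (vramp_snorm _ _ _) _; rewrite ?(ltW r0)//.
  apply: le_trans (enorm_le_sum _) _; rewrite -mulrA -sumD2; apply: ler_sum => i _.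
  rewrite mxE [X in _ + X]mxE LE hE -sumrB; apply: le_trans (ler_norm_sum _ _ _) _.
  apply: ler_sum => j _.
  have bp : bint `]s, u] (fun y => (al n (i, j) y - sg y i j) * v y j 0).
    by apply: bintM => //; exact: (bd (i, j)).
  rewrite -(IB sub_su); [|exact: bintM|exact: bintM].
  rewrite (_ : \int[lebesgue_measure]_(y in _) _ =
    \int[lebesgue_measure]_(y in `]s, u]) ((al n (i, j) y - sg y i j) * v y j 0)); last first.
    by apply: eq_Rintegral => y _; rewrite mulrBl.
  apply: le_trans (Inorm sub_su bp) _.
  have bq : bint `]s, u] (fun y => e + e^-1 * (al n (i, j) y - sg y i j) ^+ 2).
    by apply: bintD; [exact: bint_cst|apply: bintM; [exact: bint_cst|exact: (bd2 (i, j))]].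
  apply: (@le_trans _ _ (\int[lebesgue_measure]_(y in `]s, u])
      (kv * (e + e^-1 * (al n (i, j) y - sg y i j) ^+ 2)))).
    apply: (Ile sub_su) => [||y yi]; first exact: bint_norm.
      by apply: bintM => //; exact: bint_cst.
    rewrite normrM mulrC; apply: ler_pM => //; last exact: le_add_sqr.
    exact: le_trans (enorm_coord _ _) (v_le yi).
  rewrite (IZ sub_su)// -(mulrA kv); apply: ler_wpM2l => //.
  rewrite (ID sub_su); [|exact: bint_cst|by apply: bintM; [exact: bint_cst|exact: (bd2 (i, j))]].
  rewrite Icst leb_su (IZ sub_su); last exact: (bd2 (i, j)).
  rewrite mulrDl mul1r mulrC lerD2l ler_pdivrMl// -expr2.
  by have := zn (i, j); rewrite (IfinE sub_su) ?lee_fin//; exact: (bd2 (i, j)).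
split.
- apply: (indep_limit r0 mNn mN cN (filtration_sigma hF s0) (filtration_measurable hF s0)) => n.
  by have [] := fs n.
- rewrite -kvE; apply: (shift_bound_limit r0 mNn mN cN _ cth) => n.
  by have [] := fs n.
Qed.

End Noise.

(** * Convergence of the Euler scheme *)

Section Paths.
Context (R : realType) (d : nat).
Implicit Types (x : R -> 'cV[R]_d) (s u t e : R).

(** Continuity on the whole line. Paths given on an interval are extended by [clip], so that
    evaluation and measurability carry no condition on the time. *)
Definition pcont x := forall s e, 0 < e ->
  exists2 de : R, 0 < de & forall s', `|s' - s| < de -> enorm (x s' - x s) < e.

Lemma pcont_cst (v : 'cV[R]_d) : pcont (fun=> v).
Proof. by move=> s e e0; exists 1 => // s' _; rewrite subrr enorm0. Qed.

Lemma pcont_within x a c : pcont x -> {within `[a, c], continuous x}.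
Proof.
move=> px; apply/within_enormP => s _ e e0; have [de de0 h] := px s e e0.
by exists de => // s' _; exact: h.
Qed.

Lemma segP (r : R) x s v : pcont x -> - r <= v <= 0 -> seg r x s v = x (s + v).
Proof. by move=> px vr; rewrite segE ?in_itv/= ?vr//; exact: pcont_within. Qed.

Definition clip (a c s : R) : R := Num.max a (Num.min s c).

Lemma clip_itv a c s : a <= c -> a <= clip a c s <= c.
Proof. by move=> ac; rewrite /clip le_max lexx/= ge_max ac ge_min lexx orbT. Qed.

Lemma clip_id a c s : a <= s <= c -> clip a c s = s.
Proof. by move=> /andP[h1 h2]; rewrite /clip (min_idPl h2); exact/max_idPr. Qed.

Lemma clip_lip a c s s' : a <= c -> `|clip a c s' - clip a c s| <= `|s' - s|.
Proof.
move=> ac; rewrite /clip; case: (leP s' c) => h1; case: (leP s c) => h2;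
  case: (leP a s') => h3; case: (leP a s) => h4; rewrite ?(max_idPr ac) ?subrr ?normr0//;
  rewrite ler_norml; case: (ler0P (s' - s)) => h; apply/andP; split; lra.
Qed.

Lemma pcont_clip a c x : a <= c -> {within `[a, c], continuous x} ->
  pcont (fun s => x (clip a c s)).
Proof.
move=> ac /within_enormP cx s e e0.
have [de de0 h] := cx _ (clip_itv s ac) e e0.
exists de => // s' ss; apply: h; first exact: clip_itv.
exact: le_lt_trans (clip_lip _ _ ac) ss.
Qed.

End Paths.

Section Drift.
Context (R : realType) (r t : R) (d : nat) (r0 : 0 < r) (t0 : 0 < t).
Notation S := (segment (r + t) d).
Let rt0 : 0 < r + t. Proof. by rewrite addr_gt0. Qed.
Let rt : 0 <= r + t := ltW rt0.

Variables (bb : R -> 'cV[R]_d -> 'cV[R]_d) (BB : R -> segment r d -> 'cV[R]_d).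
Variables (phi : R -> R) (K Nd : R).
Hypothesis mb : forall x i, pcont x -> measurable_fun `[0, t] (fun s => bb s (x s) i 0).
Hypothesis mB : forall x i, pcont x -> measurable_fun `[0, t] (fun s => BB s (seg r x s) i 0).
Hypothesis bN : forall s x, 0 <= s <= t -> enorm (bb s x) <= Nd.
Hypothesis BN : forall s x, 0 <= s <= t -> enorm (BB s x) <= Nd.
Hypothesis bphi : forall s x y, 0 <= s <= t ->
  enorm (bb s x - bb s y) <= phi (enorm (x - y)).
Hypothesis BK : forall s x y, 0 <= s <= t ->
  enorm (BB s x - BB s y) <= K * snorm (x - y).
Hypothesis phi_ge0 : forall x, 0 <= x -> 0 <= phi x.
Hypothesis phi_le : forall x y, 0 <= x -> x <= y -> phi x <= phi y.
Hypothesis phi_cvg : forall e : R, 0 < e -> exists2 de : R, 0 < de & phi de <= e.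
Hypothesis K0 : 0 <= K.

Lemma Nd_ge0 : 0 <= Nd.
Proof. by apply: le_trans (enorm_ge0 _) (@bN 0 0 _); rewrite lexx ltW. Qed.

(** The pointwise drift and the memory drift get separate paths, because the Euler scheme replaces
    the argument of the first one by a constant on each interval. *)
Definition drift_integrand (x xi : R -> 'cV[R]_d) (s : R) : 'cV[R]_d :=
  bb s (x s) + BB s (seg r xi s).

Definition drift (x xi : R -> 'cV[R]_d) (lo hi : R) : 'cV[R]_d :=
  \col_i \int[lebesgue_measure]_(s in `]lo, hi]) drift_integrand x xi s i 0.

Section One_interval.
Variables (lo hi : R) (lo0 : 0 <= lo) (lohi : lo <= hi) (hit : hi <= t).

Let sub_t : `]lo, hi] `<=` (`[0, t] : set R).
Proof.
move=> s; rewrite /= !in_itv/= => /andP[h1 h2].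
by rewrite (le_trans lo0 (ltW h1)) (le_trans h2).
Qed.

Let in_t s : s \in `]lo, hi] -> 0 <= s <= t.
Proof. by move=> /sub_t; rewrite /= in_itv. Qed.

Let sub_lh : `]lo, hi] `<=` (`[lo, hi] : set R).
Proof. by move=> s; rewrite /= !in_itv/= => /andP[/ltW -> ->]. Qed.

Lemma drift_bint x xi i : pcont x -> pcont xi ->
  bint `]lo, hi] (fun s => drift_integrand x xi s i 0).
Proof.
move=> px pxi; rewrite (_ : (fun _ => _) = fun s => bb s (x s) i 0 + BB s (seg r xi s) i 0); last first.
  by apply/funext => s; rewrite mxE.
apply: bintD.
  split; first exact: measurable_funS (mb i px).
  by exists Nd => s /in_t st; exact: le_trans (enorm_coord _ _) (bN _ st).
split; first exact: measurable_funS (mB i pxi).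
by exists Nd => s /in_t st; exact: le_trans (enorm_coord _ _) (BN _ st).
Qed.

Lemma drift_bound x xi : pcont x -> pcont xi -> enorm (drift x xi lo hi) <= 2 * Nd * (hi - lo).
Proof.
move=> px pxi; apply: (@le_trans _ _ (\int[lebesgue_measure]_(s in `]lo, hi]) (2 * Nd))).
  apply: (enorm_integral_le sub_lh) => [i||s /in_t st]; first exact: drift_bint.
    exact: bint_cst.
  by rewrite (le_trans (enormD _ _))// mulr2n mulrDl mul1r lerD ?bN ?BN.
apply: (Ile_cst sub_lh) => //; last exact: bint_cst.
by rewrite mulr_ge0// Nd_ge0.
Qed.

Lemma drift_diff x xi x' xi' h1 h2 : pcont x -> pcont xi -> pcont x' -> pcont xi' ->
  0 <= h1 -> 0 <= h2 ->
  (forall s, lo < s <= hi -> enorm (x s - x' s) <= h1) ->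
  (forall s, lo < s <= hi -> snorm (seg r xi s - seg r xi' s) <= h2) ->
  enorm (drift x xi lo hi - drift x' xi' lo hi) <= (phi h1 + K * h2) * (hi - lo).
Proof.
move=> px pxi px' pxi' h10 h20 H1 H2.
have bd i : bint `]lo, hi] (fun s => drift_integrand x xi s i 0) by exact: drift_bint.
have bd' i : bint `]lo, hi] (fun s => drift_integrand x' xi' s i 0) by exact: drift_bint.
have bc : bint `]lo, hi] (fun=> phi h1 + K * h2) by exact: bint_cst.
have c0 : 0 <= phi h1 + K * h2 by rewrite addr_ge0 ?phi_ge0// mulr_ge0.
apply: (@le_trans _ _ (\int[lebesgue_measure]_(s in `]lo, hi]) (phi h1 + K * h2))); last first.
  exact: (Ile_cst sub_lh).
rewrite (_ : _ - _ = \col_i \int[lebesgue_measure]_(s in `]lo, hi])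
    (drift_integrand x xi s - drift_integrand x' xi' s) i 0); last first.
  apply/matrixP => i j; rewrite !mxE -(IB sub_lh)//.
  by apply: eq_Rintegral => s _; rewrite !mxE.
apply: (enorm_integral_le sub_lh) => // [i|s sl].
  rewrite (_ : (fun _ => _) = fun s => drift_integrand x xi s i 0 - drift_integrand x' xi' s i 0).
    exact: bintB.
  by apply/funext => s; rewrite !mxE.
have st := in_t sl.
have sl' : lo < s <= hi by move: sl; rewrite in_itv.
rewrite /drift_integrand opprD addrACA (le_trans (enormD _ _))// lerD//.
  by apply: le_trans (bphi _ _ st) _; apply: phi_le; [exact: enorm_ge0|exact: H1].
by apply: le_trans (BK _ _ st) _; apply: ler_wpM2l => //; exact: H2.
Qed.

End One_interval.

(* The path over [[- r, t]] stored in [z], whose time origin is [t]. *)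
Definition unshift (z : S) (s : R) : 'cV[R]_d := z (clip (- (r + t)) 0 (s - t)).

Let rt_le : - (r + t) <= 0. Proof. by rewrite oppr_le0. Qed.

Lemma unshift_pcont z : pcont (unshift z).
Proof.
move=> s e e0; have [de de0 h] := segment_enormP z (clip_itv (s - t) rt_le) e0.
exists de => // s' ss; apply: h; first exact: clip_itv.
apply: le_lt_trans ss; apply: le_trans (clip_lip _ _ rt_le) _.
by rewrite opprB addrA subrK.
Qed.

Lemma unshiftE z s : - r <= s <= t -> unshift z s = z (s - t).
Proof. by move=> st; rewrite /unshift clip_id//; lra. Qed.

Lemma seg_unshift z s v : 0 <= s <= t -> - r <= v <= 0 ->
  seg r (unshift z) s v = z (s + v - t).
Proof.
move=> st vr; rewrite segP//; last exact: unshift_pcont.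
by rewrite unshiftE//; lra.
Qed.

Lemma seg_unshift_le z z' s : 0 <= s <= t ->
  snorm (seg r (unshift z) s - seg r (unshift z') s) <= snorm (z - z').
Proof.
move=> st; apply: (snorm_le (ltW r0)) => v vr.
rewrite segmentD segmentN !seg_unshift//.
by apply: le_trans (snorm_ge rt (z - z') _); rewrite ?segmentD//; lra.
Qed.

Section Grid.
Variables (N : nat) (N0 : (0 < N)%N).
Notation a := (- t).
Let ar : - (r + t) <= a <= 0.
Proof. by rewrite lerN2 oppr_le0 lerDr (ltW r0) (ltW t0). Qed.
Let a0 : a < 0. Proof. by rewrite oppr_lt0. Qed.
Notation gp := (gpt a N).
Notation dt := (mesh a N).
Let dt0 : 0 < dt := mesh_gt0 a0 N0.

(** Grid points are stored with origin [t]; this converts them to the time of the equation. *)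
Definition tk (k : nat) : R := gp k + t.

Lemma tk_ge0 k : 0 <= tk k.
Proof.
by rewrite /tk /gpt addrAC addNr add0r mulr_ge0// ltW.
Qed.

Lemma tkB k : tk k.+1 - tk k = dt.
Proof. by rewrite /tk gptS; ring. Qed.

Lemma tk_le k : tk k <= tk k.+1.
Proof. by rewrite -subr_ge0 tkB ltW. Qed.

Lemma tk_t k : (k <= N)%N -> tk k <= t.
Proof. by move=> /(gpt_itv a0 N0)/andP[_ h]; rewrite /tk gerDr. Qed.

(* The drift of the Euler scheme: the pointwise argument is frozen on each interval. *)
Definition edrift (k : nat) (z : S) : 'cV[R]_d :=
  drift (fun=> z (gp k)) (unshift z) (tk k) (tk k.+1).

Let gp_r k : (k <= N)%N -> - (r + t) <= gp k <= 0.
Proof. by move=> kN; exact: gpt_itvr. Qed.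

Lemma edrift_bound k z : (k < N)%N -> enorm (edrift k z) <= 2 * Nd * dt.
Proof.
move=> kN; rewrite -(tkB k); apply: drift_bound; rewrite ?tk_ge0 ?tk_le ?tk_t//.
  exact: pcont_cst.
exact: unshift_pcont.
Qed.

Lemma edrift_diff k z z' : (k < N)%N ->
  enorm (edrift k z - edrift k z') <= (phi (snorm (z - z')) + K * snorm (z - z')) * dt.
Proof.
move=> kN; rewrite -(tkB k); apply: drift_diff; rewrite ?tk_ge0 ?tk_le ?tk_t ?snorm_ge0//.
- exact: pcont_cst.
- exact: unshift_pcont.
- exact: pcont_cst.
- exact: unshift_pcont.
- move=> s _; have := snorm_ge rt (z - z') (gp_r (ltnW kN)).
  by rewrite segmentD segmentN.
- move=> s /andP[h1 h2]; apply: seg_unshift_le.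
  by rewrite (le_trans (tk_ge0 k) (ltW h1)) (le_trans h2)// tk_t.
Qed.

Lemma phi_small (e : R) : 0 < e ->
  exists2 de : R, 0 < de & forall h, 0 <= h <= de -> phi h + K * h <= e.
Proof.
move=> e0; have [de de0 h] := phi_cvg (divr_gt0 e0 (ltr0n _ 2)).
have K1 : 0 < K + 1 by rewrite ltr_wpDl.
exists (Num.min de (e / 2 / (K + 1))); first by rewrite lt_min de0 !divr_gt0.
move=> u /andP[u0]; rewrite le_min => /andP[h1 h2].
rewrite (_ : e = e / 2 + e / 2); last by field.
rewrite lerD ?(le_trans (phi_le u0 h1))//.
rewrite ler_pdivlMr// in h2; apply: le_trans h2; rewrite mulrDr mulr1 mulrC.
by rewrite lerDl.
Qed.

(** The Euler drift is continuous for [snorm], by [edrift_diff] and the smallness of [phi] near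
    0. *)
Lemma edrift_measurable k i : (k < N)%N -> measurable_fun setT (fun z => edrift k z i 0).
Proof.
move=> kN; apply: scontinuous_measurable => x e e0.
have [de de0 h] := phi_small (divr_gt0 e0 (mulr_gt0 (ltr0n _ 2) dt0)).
exists de => // y yx.
rewrite (_ : _ - _ = (edrift k y - edrift k x) i 0); last by rewrite !mxE.
apply: le_lt_trans (enorm_coord _ _) _; apply: le_lt_trans (edrift_diff _ _ kN) _.
have := h (snorm (y - x)); rewrite snorm_ge0// (ltW yx) => /(_ isT) H.
apply: (@le_lt_trans _ _ (e / (2 * dt) * dt)); first by rewrite ler_wpM2r// ltW.
rewrite (_ : _ / _ * _ = e / 2); last by field; rewrite gt_eqF.
by rewrite ltr_pdivrMr// ltr_pMr// ltr1n.
Qed.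

Fixpoint echain (x : S) (nz : nat -> S) (k : nat) : S :=
  if k is k'.+1 then
    echain x nz k' + vramp (r + t) (edrift k' (interp a N x k')) (gp k') (gp k'.+1) + nz k'
  else sstop a x.

(* On the [k]-th interval both drifts only see times up to [tk k.+1], where [interp k]
   differs from [x] by at most the oscillation of [x] over one mesh. *)
Lemma echain_error (x : S) (nz : nat -> 'cV[R]_d) (e : R) : 0 <= e ->
  (forall k, (k < N)%N -> x (gp k.+1) - x (gp k) =
     drift (unshift x) (unshift x) (tk k) (tk k.+1) + nz k) ->
  (forall s s', - (r + t) <= s <= 0 -> - (r + t) <= s' <= 0 -> `|s' - s| <= dt ->
     enorm (x s' - x s) <= e) ->
  forall k, (k <= N)%N ->
  snorm (interp a N x k - echain x (fun k => vramp (r + t) (nz k) (gp k) (gp k.+1)) k)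
    <= k%:R * (dt * (phi e + K * e)).
Proof.
move=> e0 xE xosc; have glt k := gpt_lt a0 N0 k.
elim=> [_|k IH kN].
  by rewrite /interp big_ord0 addr0 subrr snorm0 ?mul0r.
set Z := echain x _; pose D := drift (unshift x) (unshift x) (tk k) (tk k.+1); set c := edrift k (interp a N x k).
have -> : interp a N x k.+1 - Z k.+1 =
    interp a N x k - Z k + vramp (r + t) (D - c) (gp k) (gp k.+1).
  rewrite interpS xE// vrampD// vrampB// /Z /= -/c -/D.
  move: (interp a N x k) (vramp _ D _ _) (vramp _ (nz k) _ _) (echain _ _ k) (vramp _ c _ _).
  by move=> i D' n z c'; rewrite addrA opprD addrACA subrr addr0 opprD addrACA.
apply: le_trans (snormD rt _ _) _; rewrite -natr1 mulrDl mul1r; apply: lerD.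
  by apply: IH; exact: ltnW.
apply: le_trans (vramp_snorm rt _ (glt k)) _; rewrite /D /c.
rewrite -(tkB k) mulrC; apply: drift_diff; rewrite ?tk_ge0 ?tk_le ?tk_t//.
- exact: unshift_pcont.
- exact: unshift_pcont.
- exact: pcont_cst.
- exact: unshift_pcont.
- move=> s /andP[ks sk].
  have s0 : 0 <= s by exact: le_trans (tk_ge0 k) (ltW ks).
  have st : s <= t by exact: le_trans sk (tk_t kN).
  rewrite unshiftE; last by rewrite st andbT (le_trans _ s0)// oppr_le0 ltW.
  rewrite (interp_ge ar a0 N0) ?(ltnW kN) ?lexx//; last by have /andP[_ ->] := gpt_itv a0 N0 (ltnW kN).
  apply: xosc; rewrite ?gp_r ?(ltnW kN)//; first by have h1 := r0; apply/andP; split; lra.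
  move: ks sk; rewrite /tk => ks sk; have := gptS a N k => gS.
  by rewrite ger0_norm; lra.
- move=> s /andP[ks sk].
  have s0 : 0 <= s by exact: le_trans (tk_ge0 k) (ltW ks).
  have st : s <= t by exact: le_trans sk (tk_t kN).
  have s0t : 0 <= s <= t by rewrite s0.
  apply: (snorm_le (ltW r0)) => v /[dup] vr /andP[v1 v2].
  rewrite segmentD segmentN !seg_unshift// -enormN opprB.
  have sv : - (r + t) <= s + v - t <= 0 by apply/andP; split; lra.
  apply: (@interp_osc R (r + t) d a N ar a0 N0 x e e0 xosc k _ (ltnW kN) sv).
    by move: sk; rewrite /tk; lra.
  by rewrite kN.
Qed.

End Grid.

(** * The comparison between scheme and solution as the mesh vanishes *)

Section Limit.
Context (dO : measure_display) (Omega : measurableType dO) (P : probability Omega R).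
Context (F : R -> set (set Omega)) (hF : complete_filtration P F).
Variables (X : Omega -> S) (nz : R -> R -> Omega -> 'cV[R]_d) (sinv : R).
Hypothesis mX : forall s i, - (r + t) <= s <= 0 ->
  measurable_wrt (F (Num.max 0 (s + t))) (fun w => X w s i 0).
Hypothesis nz_shift : forall lo hi a c h, 0 <= lo -> lo < hi -> hi <= t -> a < c ->
  [/\ measurable_wrt (F hi) (fun w => vramp (r + t) (nz lo hi w) a c),
   indep_of P (F lo) (fun w => vramp (r + t) (nz lo hi w) a c) &
   shift_bound P (fun w => vramp (r + t) (nz lo hi w) a c) (vramp (r + t) h a c)
    (sinv ^+ 2 * enorm h ^+ 2 / (hi - lo))].
Hypothesis XE : {ae P, forall w, forall lo hi, 0 <= lo -> lo <= hi -> hi <= t ->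
  unshift (X w) hi - unshift (X w) lo =
  drift (unshift (X w)) (unshift (X w)) lo hi + nz lo hi w}.

Notation a := (- t).
Let ar : - (r + t) <= a <= 0.
Proof. by rewrite lerN2 oppr_le0 lerDr (ltW r0) (ltW t0). Qed.
Let a0 : a < 0. Proof. by rewrite oppr_lt0. Qed.

Let mX' : measurable_fun setT X.
Proof.
apply: (segment_measurableP rt0) => s i sr.
apply: (measurable_wrt_fun _ (mX i sr)); apply: (filtration_measurable hF).
by rewrite le_max lexx.
Qed.

Definition noise_chain (N k : nat) (w : Omega) : S :=
  vramp (r + t) (nz (tk N k) (tk N k.+1) w) (gpt a N k) (gpt a N k.+1).

Definition grid_ramp (N k : nat) (v : 'cV[R]_d) : S :=
  vramp (r + t) v (gpt a N k) (gpt a N k.+1).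

(** Here the drift is read at the chain itself; only the path up to time 0 comes from [X]. *)
Definition scheme_value (N : nat) (f : S -> R) : R :=
  \int[P]_w euler_value P (noise_chain N) (grid_ramp N) (edrift N) f N 0 (sstop a (X w)).

Section Shifted.
Variable ga : S.
Hypothesis ga0 : forall s, - (r + t) <= s <= a -> ga s = 0.

Definition ga_inc (N k : nat) : 'cV[R]_d := ga (gpt a N k.+1) - ga (gpt a N k).

Variable En : R.
Hypothesis ga_energy : forall N, (0 < N)%N ->
  \sum_(0 <= k < N) enorm (ga_inc N k) ^+ 2 / mesh a N <= En.

(** The factor 3 comes from the square of a sum of three terms. The distance between the two
    arguments of the drift is asymptotically at most [snorm ga]; doubling it leaves room for the
    error at finite mesh. *)
Definition cost_bound : R :=
  sinv ^+ 2 * (3 * (En + t * (phi (2 * snorm ga)) ^+ 2 + t * (K * (2 * snorm ga)) ^+ 2)).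

Section Fixed_mesh.
Variables (N : nat) (N0 : (0 < N)%N).
Notation gp := (gpt a N).
Notation dt := (mesh a N).
Let dt0 : 0 < dt := mesh_gt0 a0 N0.
Let glt k : gp k < gp k.+1 := gpt_lt a0 N0 k.

(** A discretisation of [X] plus [ga]. It follows the recursion of the scheme with the same noise,
    but with [sdrift] in place of the drift read at [schain]; [scost] is the price of that
    replacement. *)
Definition schain k w := echain N (X w) (noise_chain N ^~ w) k + interp a N ga k.
Definition sdrift k w := edrift N k (interp a N (X w) k) + ga_inc N k.
Definition scost k w : R :=
  sinv ^+ 2 * enorm (sdrift k w - edrift N k (schain k w)) ^+ 2 / dt.

Let G k := F (tk N k).
Let sG k : sigma_algebra setT (G k). Proof. by apply: (filtration_sigma hF); exact: tk_ge0. Qed.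
Let Gm k : G k `<=` measurable. Proof. by apply: (filtration_measurable hF); exact: tk_ge0. Qed.
Let GS k : G k `<=` G k.+1.
Proof. by apply: (filtration_le hF); [exact: tk_ge0|exact: tk_le]. Qed.

Let tk_lt k : tk N k < tk N k.+1. Proof. by rewrite -subr_gt0 tkB. Qed.

Let nsh k h (kN : (k < N)%N) :=
  nz_shift h (tk_ge0 N0 k) (tk_lt k) (tk_t N0 kN) (glt k).

Let mn k : (k < N)%N -> measurable_wrt (G k.+1) (noise_chain N k).
Proof. by move=> kN; have [] := nsh 0 kN. Qed.

Let inn k : (k < N)%N -> indep_of P (G k) (noise_chain N k).
Proof. by move=> kN; have [] := nsh 0 kN. Qed.

Let shn k v : (k < N)%N ->
  shift_bound P (noise_chain N k) (grid_ramp N k v) (sinv ^+ 2 * enorm v ^+ 2 / dt).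
Proof. by move=> kN; have [_ _] := nsh v kN; rewrite tkB. Qed.

Let mc k : (k < N)%N -> measurable_fun setT (fun z => grid_ramp N k (edrift N k z)).
Proof. by move=> kN; apply: (vramp_measurable rt0 (glt k)) => i; exact: edrift_measurable. Qed.

Let mXg k i : (k <= N)%N -> measurable_wrt (G k) (fun w => X w (gp k) i 0).
Proof.
move=> kN; have := mX i (gpt_itvr ar a0 N0 kN).
by rewrite (max_idPr _)//; exact: tk_ge0.
Qed.

Let mstop : measurable_wrt (G 0) (fun w => sstop a (X w)).
Proof.
apply: (measurable_wrt_segment (sG 0) rt0) => s i sr.
have ms : - (r + t) <= Num.min s a <= 0.
  move: sr ar => /andP[s1 s2] /andP[a1 a2].
  by rewrite le_min s1 a1/= ge_min s2.
rewrite (_ : (fun _ => _) = fun w => X w (Num.min s a) i 0); last first.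
  by apply/funext => w; rewrite sstopE.
have := mX i ms; rewrite (max_idPl _); last by rewrite -lerBrDr sub0r ge_min lexx orbT.
by rewrite /G /tk gpt0 addNr.
Qed.

Let minterp k : (k <= N)%N -> measurable_wrt (G k) (fun w => interp a N (X w) k).
Proof.
elim: k => [_|k IH kN].
  rewrite (_ : (fun _ => _) = fun w => sstop a (X w)); first exact: mstop.
  by apply/funext => w; rewrite /interp big_ord0 addr0.
rewrite (_ : (fun _ => _) = fun w => interp a N (X w) k +
   vramp (r + t) (X w (gp k.+1) - X w (gp k)) (gp k) (gp k.+1)); last first.
  by apply/funext => w; rewrite interpS.
apply: (wrtD rt0 sG).
  by move=> A mA; apply: GS; apply: IH => //; exact: ltnW.
apply/(measurable_wrtP (sG k.+1)); apply: (vramp_measurable rt0 (glt k)) => i.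
rewrite (_ : (fun _ => _) = fun w => X w (gp k.+1) i 0 - X w (gp k) i 0); last first.
  by apply/funext => w; rewrite !mxE.
apply: measurable_funB; apply/(measurable_wrtP (sG k.+1)); first exact: mXg.
by move=> A mA; apply: GS; apply: mXg => //; exact: ltnW.
Qed.

Let me_coord k i : (k < N)%N -> measurable_wrt (G k) (fun w => sdrift k w i 0).
Proof.
move=> kN; apply/(measurable_wrtP (sG k)).
rewrite (_ : (fun _ => _) = fun w => edrift N k (interp a N (X w) k) i 0 + ga_inc N k i 0); last first.
  by apply/funext => w; rewrite !mxE.
apply: measurable_funD => //.
have mi := (measurable_wrtP (sG k) _).1 (minterp (ltnW kN)).
exact: (measurableT_comp (edrift_measurable N0 i kN) mi).
Qed.

Let me k : (k < N)%N -> measurable_wrt (G k) (fun w => grid_ramp N k (sdrift k w)).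
Proof.
move=> kN; apply/(measurable_wrtP (sG k)); apply: (vramp_measurable rt0 (glt k)) => i.
exact/(measurable_wrtP (sG k))/me_coord.
Qed.

(** Because [ga] vanishes up to time 0, the shifted chain and the scheme start from the same
    segment. *)
Lemma schain0 w : schain 0 w = sstop a (X w).
Proof.
rewrite /schain/= /interp big_ord0 addr0 (_ : sstop a ga = 0) ?addr0//.
apply: segment_eq => s sr; rewrite sstopE// segment0; apply: ga0.
move: sr ar => /andP[s1 s2] /andP[a1 a2].
by rewrite le_min s1 a1/= ge_min lexx orbT.
Qed.

Let Y0 : measurable_wrt (G 0) (schain 0).
Proof.
by rewrite (_ : schain 0 = fun w => sstop a (X w)); [exact: mstop|apply/funext => w; exact: schain0].
Qed.

Let YS k w : (k < N)%N -> schain k.+1 w = schain k w + grid_ramp N k (sdrift k w) + noise_chain N k w.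
Proof.
move=> kN; rewrite /schain /= interpS /grid_ramp /sdrift -/(ga_inc N k) vrampD//.
have key (z c n i g : S) : z + c + n + (i + g) = z + i + (c + g) + n.
  by rewrite addrAC addrACA.
exact: key.
Qed.

Lemma schain_wrt k : (k <= N)%N -> measurable_wrt (G k) (schain k).
Proof. exact: (chain_measurable rt0 sG GS mn Y0 YS me). Qed.

Let mcost k : (k < N)%N -> measurable_wrt (G k) (scost k).
Proof.
move=> kN; apply/(measurable_wrtP (sG k)).
rewrite (_ : scost k = fun w => sinv ^+ 2 * (\sum_i (sdrift k w i 0 - edrift N k (schain k w) i 0) ^+ 2) / dt).
  apply: measurable_funM => //; apply: measurable_funM => //.
  apply: measurable_sum => i; apply: measurable_funX; apply: measurable_funB.
    exact/(measurable_wrtP (sG k))/me_coord.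
  have mi := (measurable_wrtP (sG k) _).1 (schain_wrt (ltnW kN)).
  exact: (measurableT_comp (edrift_measurable N0 i kN) mi).
apply/funext => w; rewrite /scost enorm_sqr; congr (_ * _ / _).
by apply: eq_bigr => i _; rewrite !mxE.
Qed.

Lemma scost_ge0 k w : 0 <= scost k w.
Proof. by rewrite /scost divr_ge0 ?(ltW dt0)// mulr_ge0 ?sqr_ge0. Qed.

(* The drift difference is at most [4 Nd dt]; this crude bound is uniform in [w], which
   dominated convergence needs. *)
Lemma scost_le k w : (k < N)%N ->
  scost k w <= sinv ^+ 2 * (32 * Nd ^+ 2 * dt + 2 * (enorm (ga_inc N k) ^+ 2 / dt)).
Proof.
move=> kN; rewrite /scost -mulrA ler_wpM2l ?sqr_ge0//.
set x := enorm (ga_inc N k); set c := edrift N k _.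
have x0 : 0 <= x := enorm_ge0 _.
have N00 : 0 <= 4 * Nd * dt by rewrite mulr_ge0 ?(ltW dt0)// mulr_ge0// Nd_ge0.
have H : enorm (sdrift k w - c) <= 4 * Nd * dt + x.
  rewrite /sdrift addrAC; apply: le_trans (enormD _ _) _; rewrite lerD//.
  apply: le_trans (enormD _ _) _; rewrite enormN.
  rewrite (_ : 4 * Nd * dt = 2 * Nd * dt + 2 * Nd * dt); last by ring.
  by rewrite lerD// edrift_bound.
have H2 : enorm (sdrift k w - c) ^+ 2 <= 2 * (4 * Nd * dt) ^+ 2 + 2 * x ^+ 2.
  apply: (@le_trans _ _ ((4 * Nd * dt + x) ^+ 2)).
    by rewrite ler_sqr ?nnegrE ?enorm_ge0 ?addr_ge0.
  rewrite -subr_ge0 (_ : _ - _ = (4 * Nd * dt - x) ^+ 2) ?sqr_ge0//; ring.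
rewrite ler_pdivrMr//; apply: le_trans H2 _; rewrite le_eqVlt; apply/orP; left; apply/eqP.
by field; rewrite gt_eqF.
Qed.

Lemma sum_dt : \sum_(0 <= k < N) dt = t.
Proof.
rewrite sumr_const_nat subn0 /mesh opprK -[LHS]mulr_natr divfK//.
by rewrite pnatr_eq0 -lt0n.
Qed.

Lemma sum_scost_le w :
  \sum_(0 <= k < N) scost k w <= sinv ^+ 2 * (32 * Nd ^+ 2 * t + 2 * En).
Proof.
apply: (@le_trans _ _ (\sum_(0 <= k < N) sinv ^+ 2 *
   (32 * Nd ^+ 2 * dt + 2 * (enorm (ga_inc N k) ^+ 2 / dt)))).
  by rewrite !big_nat; apply: ler_sum => k /andP[_ kN]; exact: scost_le.
rewrite -mulr_sumr ler_wpM2l ?sqr_ge0// big_split/=.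
by apply: lerD; rewrite -mulr_sumr ?sum_dt// ler_wpM2l// ga_energy.
Qed.

(** The sharp counterpart of [sum_scost_le], valid where the chain is within [h] of the interpolated
    solution; it has the form of the final cost. *)
Lemma sum_scost_close w (h : R) :
  (forall k, (k <= N)%N -> snorm (interp a N (X w) k - schain k w) <= h) ->
  \sum_(0 <= k < N) scost k w <=
  sinv ^+ 2 * (3 * (En + t * (phi h) ^+ 2 + t * (K * h) ^+ 2)).
Proof.
move=> Hh.
have h0 : 0 <= h by exact: le_trans (snorm_ge0 rt _) (Hh 0%N (leq0n _)).
apply: (@le_trans _ _ (\sum_(0 <= k < N) sinv ^+ 2 *
   (3 * (enorm (ga_inc N k) ^+ 2 / dt + dt * (phi h) ^+ 2 + dt * (K * h) ^+ 2)))); last first.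
  rewrite -mulr_sumr ler_wpM2l ?sqr_ge0// -mulr_sumr ler_wpM2l// !big_split/=.
  apply: lerD; last by rewrite -mulr_suml sum_dt.
  by apply: lerD; [exact: ga_energy|rewrite -mulr_suml sum_dt].
rewrite !big_nat; apply: ler_sum => k /andP[_ kN].
rewrite /scost -[leLHS]mulrA ler_wpM2l ?sqr_ge0//.
set x := enorm (ga_inc N k); have x0 : 0 <= x := enorm_ge0 _.
have p0 : 0 <= phi h by exact: phi_ge0.
have Kh0 : 0 <= K * h by exact: mulr_ge0.
have H : enorm (sdrift k w - edrift N k (schain k w)) <= (phi h + K * h) * dt + x.
  rewrite /sdrift addrAC; apply: le_trans (enormD _ _) _; rewrite lerD//.
  apply: le_trans (edrift_diff N0 _ _ kN) _; rewrite ler_wpM2r ?(ltW dt0)//.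
  have := Hh k (ltnW kN) => H.
  by apply: lerD; [apply: phi_le => //; exact: snorm_ge0|exact: ler_wpM2l].
have H2 : enorm (sdrift k w - edrift N k (schain k w)) ^+ 2 <= ((phi h + K * h) * dt + x) ^+ 2.
  rewrite ler_sqr ?nnegrE ?enorm_ge0// addr_ge0//.
  by rewrite mulr_ge0 ?addr_ge0 ?(ltW dt0).
rewrite ler_pdivrMr//; apply: le_trans H2 _.
set u := phi h in p0 *; set v := K * h in Kh0 *.
rewrite (_ : 3 * _ * dt = 3 * x ^+ 2 + 3 * (u * dt) ^+ 2 + 3 * (v * dt) ^+ 2); last first.
  by field; rewrite gt_eqF.
rewrite -subr_ge0 (_ : _ - _ = (u * dt - v * dt) ^+ 2 + (u * dt - x) ^+ 2 + (v * dt - x) ^+ 2).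
  by rewrite !addr_ge0 ?sqr_ge0.
ring.
Qed.

Lemma scheme_compare f p : 1 < p -> unit_fun f ->
  (scheme_value N f) `^ p <=
  \int[P]_w (expR (p / (2 * (p - 1)) * \sum_(0 <= j < N) scost j w) * f (schain N w) `^ p).
Proof.
move=> p1 hf.
have TB k v w : grid_ramp N k (v - w) = grid_ramp N k v - grid_ramp N k w by exact: vrampB.
have c0 k w : (k < N)%N -> 0 <= scost k w <= sinv ^+ 2 * (32 * Nd ^+ 2 * t + 2 * En).
  move=> kN; rewrite scost_ge0/=; apply: le_trans (sum_scost_le w).
  rewrite (big_mkord xpredT (fun k => scost k w)) (bigD1 (Ordinal kN))//= lerDl.
  by apply: sumr_ge0 => j _; exact: scost_ge0.
have := @euler_compare _ _ _ rt0 _ _ P G (noise_chain N) (grid_ramp N)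
  (fun k v => sinv ^+ 2 * enorm v ^+ 2 / dt) (edrift N) sG Gm GS N mn inn TB shn mc
  schain sdrift Y0 YS me mcost _ c0 f p p1 hf.
apply: le_trans; rewrite le_eqVlt; apply/orP; left; apply/eqP; congr (_ `^ p).
by apply: eq_Rintegral => w _; rewrite schain0.
Qed.

(** The kernels preserve constants. This turns an upper bound for [1 - f] into a lower bound for
    [f]. *)
Lemma scheme_compl f : unit_fun f ->
  scheme_value N (fun x => 1 - f x) = 1 - scheme_value N f /\ 0 <= scheme_value N f <= 1.
Proof.
move=> hf; have hV := euler_value_unit rt0 P Gm mn mc (leqnn (0 + N)) hf.
have bV : bdm (fun w => euler_value P (noise_chain N) (grid_ramp N) (edrift N) f N 0 (sstop a (X w))).
  by apply: (unit_bdm hV); exact: (measurable_wrt_fun (@Gm 0) mstop).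
split; last first.
  rewrite /scheme_value Ege0 => [|w]; last by have /andP[] := hV.2 (sstop a (X w)).
  by apply: Ele1 => // w; have /andP[] := hV.2 (sstop a (X w)).
rewrite /scheme_value -[X in X - _](Ecst P) -EB//; last exact: bdm_cst.
by apply: eq_Rintegral => w _; exact: (euler_value_compl rt0 P Gm mn mc _ (leqnn (0 + N)) hf).
Qed.

Lemma schain_measurable : measurable_fun setT (schain N).
Proof. exact: (measurable_wrt_fun (@Gm N) (schain_wrt (leqnn N))). Qed.

Lemma scost_measurable : measurable_fun setT (fun w => \sum_(0 <= k < N) scost k w).
Proof.
rewrite (_ : (fun _ => _) = fun w => \sum_(k < N) scost k w); last first.
  by apply/funext => w; rewrite big_mkord.
apply: measurable_sum => k; exact: (measurable_wrt_fun (@Gm k) (mcost (ltn_ord k))).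
Qed.

End Fixed_mesh.

Lemma interp_cvg (x : S) (e : R) : 0 < e ->
  \forall N \near \oo, snorm (interp a N.+1 x N.+1 - x) <= e.
Proof.
move=> e0; have [de de0 h] := segment_unif x e0.
near=> N.
have mN : mesh a N.+1 < de.
  rewrite /mesh opprK ltr_pdivrMr ?ltr0n// mulrC -ltr_pdivrMr//.
  have : (Num.truncn (t / de) <= N)%N by near: N; exact: nbhs_infty_ge.
  by move=> hN; apply: lt_le_trans (truncnS_gt _) _; rewrite ler_nat.
apply: (snorm_le rt) => s sr; rewrite segmentD segmentN.
apply: (@interp_osc R (r + t) d a N.+1 ar a0 (ltn0Sn N) x e (ltW e0) _ N.+1 s (leqnn _) sr).
- by move=> s1 s2 h1 h2 h12; apply/ltW/h => //; exact: le_lt_trans mN.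
- have /andP[_ s0] := sr; apply: le_trans s0 _.
  by rewrite gptS gptN// add0r ltW// mesh_gt0.
- by rewrite gptN//; case/andP: sr => _ ->; rewrite orbT.
Unshelve. all: by end_near. Qed.

Lemma echain_cvg : {ae P, forall w, forall e, 0 < e -> \forall N \near \oo,
  forall k, (k <= N.+1)%N ->
    snorm (interp a N.+1 (X w) k - echain N.+1 (X w) (noise_chain N.+1 ^~ w) k) <= e}.
Proof.
apply: filterS XE => w xE e e0.
(* [de1] will bound the oscillation of the path over one mesh; all steps together then contribute at
   most [t * (phi de1 + K * de1) <= e]. *)
have [de1 de10 h1] := phi_small (divr_gt0 e0 t0).
have [de de0 h] := segment_unif (X w) de10.
near=> N => k kN.
have mN : mesh a N.+1 < de.
  rewrite /mesh opprK ltr_pdivrMr ?ltr0n// mulrC -ltr_pdivrMr//.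
  have : (Num.truncn (t / de) <= N)%N by near: N; exact: nbhs_infty_ge.
  by move=> hN; apply: lt_le_trans (truncnS_gt _) _; rewrite ler_nat.
have N0 := ltn0Sn N.
have m0 : 0 < mesh a N.+1 by exact: mesh_gt0.
have := @echain_error N.+1 N0 (X w) (fun k => nz (tk N.+1 k) (tk N.+1 k.+1) w) de1 (ltW de10).
move=> H; apply: le_trans (H _ _ k kN) _.
- move=> j jN.
  rewrite -xE ?tk_ge0 ?tk_le ?tk_t// !unshiftE; first by rewrite /tk !addrK.
    by rewrite tk_t ?(ltnW jN)// andbT (le_trans _ (tk_ge0 N0 _))// oppr_le0 ltW.
  by rewrite tk_t// andbT (le_trans _ (tk_ge0 N0 _))// oppr_le0 ltW.
- by move=> s1 s2 s1r s2r h12; apply/ltW/h => //; exact: le_lt_trans mN.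
have p0 : 0 <= phi de1 + K * de1 by rewrite addr_ge0 ?phi_ge0 ?mulr_ge0 ?(ltW de10).
apply: (@le_trans _ _ (t * (phi de1 + K * de1))).
  rewrite mulrA ler_wpM2r// /mesh opprK mulrCA ler_piMr ?(ltW t0)//.
  by rewrite ler_pdivrMr ?ltr0n// mul1r ler_nat.
by rewrite mulrC -ler_pdivlMr// h1// lexx ltW.
Unshelve. all: by end_near. Qed.

Lemma schain_cvg : {ae P, forall w, forall e, 0 < e -> \forall N \near \oo,
  snorm (schain N.+1 N.+1 w - (X w + ga)) <= e}.
Proof.
apply: filterS echain_cvg => w cw e e0.
have e3 : 0 < e / 3 by rewrite divr_gt0.
apply: filterS3 (cw _ e3) (interp_cvg (X w) e3) (interp_cvg ga e3) => N h1 h2 h3.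
rewrite /schain (_ : _ - _ = - (interp a N.+1 (X w) N.+1 -
  echain N.+1 (X w) (noise_chain N.+1 ^~ w) N.+1) + (interp a N.+1 (X w) N.+1 - X w) +
  (interp a N.+1 ga N.+1 - ga)); last first.
  have key (z g x y i : S) : z + g - (x + y) = - (i - z) + (i - x) + (g - y).
    by rewrite opprD addrACA opprB [z - i + _]addrA subrK.
  exact: key.
rewrite (_ : e = e / 3 + e / 3 + e / 3); last by field.
apply: le_trans (snormD rt _ _) _; apply: lerD; last exact: h3.
apply: le_trans (snormD rt _ _) _; apply: lerD; last exact: h2.
by rewrite snormN//; exact: h1.
Qed.

Lemma scost_cvg : {ae P, forall w, forall e, 0 < e -> \forall N \near \oo,
  \sum_(0 <= k < N.+1) scost N.+1 k w <= cost_bound + e}.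
Proof.
apply: filterS echain_cvg => w cw e e0; set g := snorm ga.
have g0 : 0 <= g by exact: snorm_ge0.
have [ep ep0 Hep] : exists2 ep : R, 0 < ep &
    sinv ^+ 2 * (3 * (En + t * (phi (ep + g)) ^+ 2 + t * (K * (ep + g)) ^+ 2)) <= cost_bound + e.
  (* If [g > 0], [ep = g] works because [cost_bound] contains [2 * g]. If [g = 0] there is no such
     room, and [ep] is taken so small that the two squares are at most [e1], whose total coefficient
     is below [q]. *)
  have [gz|gn] := eqVneq g 0; last first.
    have gp : 0 < g by rewrite lt_neqAle eq_sym gn.
    by exists g => //; rewrite /cost_bound -/g -mulr2n -[g *+ 2]mulr_natl lerDl ltW.
  pose q := sinv ^+ 2 * (6 * t) + 1.
  have q0 : 0 < q by rewrite ltr_wpDl// mulr_ge0 ?sqr_ge0// mulr_ge0// ltW.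
  pose e1 := Num.min 1 (e / q).
  have e10 : 0 < e1 by rewrite lt_min ltr01 divr_gt0.
  have [de de0 h] := phi_small e10; exists de => //.
  rewrite gz addr0; have := h de; rewrite lexx (ltW de0) => /(_ isT) hd.
  have p0 : 0 <= phi de by rewrite phi_ge0// ltW.
  have k0 : 0 <= K * de by rewrite mulr_ge0// ltW.
  have e1q : e1 * q <= e by rewrite -ler_pdivlMr// ge_min lexx orbT.
  have e11 : e1 <= 1 by rewrite ge_min lexx.
  have sq (x : R) : 0 <= x -> x <= e1 -> x ^+ 2 <= e1.
    move=> x0 xe; rewrite expr2; apply: (@le_trans _ _ (e1 * 1)); last by rewrite mulr1.
    by apply: ler_pM => //; exact: le_trans e11.
  apply: (@le_trans _ _ (sinv ^+ 2 * (3 * (En + t * e1 + t * e1)))).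
    rewrite ler_wpM2l ?sqr_ge0// ler_wpM2l//.
    apply: lerD; first (apply: lerD => //); rewrite ler_wpM2l ?(ltW t0)// sq//; lra.
  apply: (@le_trans _ _ (sinv ^+ 2 * (3 * En) + e1 * q)).
    rewrite /q; have := e10; have : 0 <= sinv ^+ 2 by exact: sqr_ge0.
    move: (sinv ^+ 2) => s2 s20 e1p; rewrite -subr_ge0 (_ : _ - _ = e1) ?ltW//; ring.
  apply: lerD => //; rewrite /cost_bound -/g gz ler_wpM2l ?sqr_ge0// ler_wpM2l//.
  by rewrite -addrA lerDl addr_ge0// mulr_ge0 ?sqr_ge0// ltW.
apply: filterS (cw _ ep0) => N H; apply: le_trans Hep.
apply: sum_scost_close => // k kN.
rewrite /schain opprD addrA; apply: le_trans (snormD rt _ _) _; apply: lerD; first exact: H.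
by rewrite snormN//; exact: interp_snorm.
Qed.

Lemma scheme_limit f p e : 1 < p -> lip01 f -> 0 < e ->
  \forall N \near \oo, (scheme_value N.+1 f) `^ p <=
    expR (p / (2 * (p - 1)) * cost_bound) * \int[P]_w (f (X w + ga) `^ p) + e.
Proof.
move=> p1 lf e0; have hf := lip01_unit rt0 lf.
have p0 : 0 <= p by rewrite ltW// (lt_trans _ p1).
set al := p / _; have al0 : 0 <= al by rewrite divr_ge0// mulr_ge0// subr_ge0 ltW.
(* The sums of costs are only bounded above in the limit; their maximum with [cost_bound] converges
   to it, as dominated convergence requires. *)
pose mx N w := Num.max (\sum_(0 <= k < N.+1) scost N.+1 k w) cost_bound.
pose g_ N w := expR (al * mx N w) * f (schain N.+1 N.+1 w) `^ p.
pose gl w := expR (al * cost_bound) * f (X w + ga) `^ p.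
pose Mx := Num.max (sinv ^+ 2 * (32 * Nd ^+ 2 * t + 2 * En)) cost_bound.
have mmx N : measurable_fun setT (mx N).
  by apply: measurable_maxr => //; exact: scost_measurable.
have mg_ N : measurable_fun setT (g_ N).
  apply: measurable_funM.
    by apply: (measurableT_comp (@measurable_expR R)); exact: measurable_funM.
  apply: (measurableT_comp (measurable_powR p)); apply: (measurableT_comp hf.1).
  exact: schain_measurable.
have mXg : measurable_fun setT (fun w => X w + ga) by apply: segmentD_measurable.
have mgl : measurable_fun setT gl.
  apply: measurable_funM => //.
  by apply: (measurableT_comp (measurable_powR p)); exact: (measurableT_comp hf.1).
have f1 x : 0 <= f x `^ p <= 1 := (unit_powR p0 hf).2 x.
have mxle N w : mx N w <= Mx.
  by rewrite /mx /Mx ge_max !le_max sum_scost_le// lexx orbT.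
have gb N w : 0 <= g_ N w <= expR (al * Mx).
  have /andP[h1 h2] := f1 (schain N.+1 N.+1 w).
  rewrite /g_ mulr_ge0 ?expR_ge0//=; apply: (@le_trans _ _ (expR (al * mx N w) * 1)).
    by rewrite ler_wpM2l ?expR_ge0.
  by rewrite mulr1 ler_expR ler_wpM2l.
have cg : \int[P]_w g_ N w @[N --> \oo] --> \int[P]_w gl w.
  apply: (@bounded_cvg _ _ _ P g_ gl (expR (al * Mx))) => //.
    by move=> N w; have /andP[h1 h2] := gb N w; rewrite ger0_norm.
  apply: filterS2 scost_cvg schain_cvg => w cw sw.
  apply: cvgM.
    apply: (@cvg_comp _ _ _ (fun N => al * mx N w) expR _ (nbhs (al * cost_bound))); last first.
      exact: continuous_expR.
    apply: cvgMr; apply/cvgrPdist_le => ep ep0; apply: filterS (cw ep ep0) => N hN.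
    rewrite distrC ger0_norm; last by rewrite subr_ge0 le_max lexx orbT.
    by rewrite lerBlDr addrC ge_max hN lerDl ltW.
  have [_ [L L0 fL]] := lf.
  apply/cvgrPdist_le => ep ep0.
  have L1 : 0 < p * L + 1 by rewrite ltr_wpDl// mulr_ge0.
  apply: filterS (sw (ep / (p * L + 1)) (divr_gt0 ep0 L1)) => N hN.
  rewrite distrC; apply: le_trans (powR_lip (ltW p1) (hf.2 _) (hf.2 _)) _.
  apply: (@le_trans _ _ (p * (L * snorm (schain N.+1 N.+1 w - (X w + ga))))).
    by rewrite ler_wpM2l.
  rewrite mulrA; apply: (@le_trans _ _ (p * L * (ep / (p * L + 1)))).
    by rewrite ler_wpM2l// mulr_ge0.
  by rewrite mulrCA ler_piMr ?(ltW ep0)// ler_pdivrMr// mul1r lerDl.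
have bl : bdm (fun w => f (X w + ga) `^ p) by exact: unit_powR_bdm.
have -> : expR (al * cost_bound) * \int[P]_w (f (X w + ga) `^ p) = \int[P]_w gl w.
  by rewrite /gl EZ.
have /cvgrPdist_le/(_ _ e0) := cg; apply: filterS => N.
have near_le (x y z : R) : `|x - y| <= z -> y <= x + z.
  by move=> h; rewrite -lerBlDl; apply: le_trans (ler_norm _) _; rewrite distrC.
move=> /near_le h.
apply: le_trans (scheme_compare (ltn0Sn N) p1 hf) _; apply: le_trans h.
apply: Ele => [||w].
- apply: bdmM; last by apply: unit_powR_bdm => //; exact: schain_measurable.
  apply: (@bdm_ge0 _ _ _ _ (expR (al * Mx))) => [|w|w]; last 2 first.
  + exact: expR_ge0.
  + by rewrite ler_expR ler_wpM2l// le_max sum_scost_le.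
  + apply: (measurableT_comp (@measurable_expR R)); apply: measurable_funM => //.
    exact: scost_measurable.
- apply: (@bdm_ge0 _ _ _ _ (expR (al * Mx))) => // w; by have /andP[] := gb N w.
- rewrite /g_ ler_wpM2r ?powR_ge0// ler_expR ler_wpM2l// /mx.
  by rewrite le_max lexx.
Qed.

End Shifted.

Let phi0 : phi 0 = 0.
Proof.
apply/eqP; rewrite eq_le phi_ge0// andbT; apply/ler_addgt0Pr => e e0; rewrite add0r.
by have [de de0 h] := phi_cvg e0; apply: le_trans (phi_le (lexx 0) (ltW de0)) h.
Qed.

(* The unshifted comparison for [1 - f] with exponents decreasing to 1. *)
Lemma scheme_lower f de : lip01 f -> 0 < de ->
  \forall N \near \oo, \int[P]_w f (X w) - de <= scheme_value N.+1 f.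
Proof.
move=> lf de0; have hf := lip01_unit rt0 lf; have lf' := lip01_compl lf.
have hf' := lip01_unit rt0 lf'.
have bf : bdm (fun w => f (X w)) by exact: unit_bdm.
have bf' : bdm (fun w => 1 - f (X w)) by exact: (unit_bdm hf').
pose q := \int[P]_w (1 - f (X w)).
have qE : \int[P]_w f (X w) = 1 - q.
  by rewrite /q EB ?Ecst; [ring|exact: bdm_cst|].
have q0 : 0 <= q by apply: Ege0 => w; have /andP[] := hf'.2 (X w).
set x := q + de; have x0 : 0 < x by rewrite ltr_wpDl.
(* If [x >= 1], the lower bound to be proved is at most 0. *)
have [x1|x1] := leP 1 x.
  apply: nearW => N; have [_ /andP[v0 _]] := scheme_compl (ltn0Sn N) hf.
  by apply: le_trans v0; rewrite qE -/x; rewrite /x in x1; lra.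
have lnx : ln x <= 0 by apply: ln_le0; exact: ltW.
have l1 : 0 < 2 * (1 - ln x) by rewrite mulr_gt0// subr_gt0 (le_lt_trans lnx).
have qx : 0 < 1 - q / x by rewrite subr_gt0 ltr_pdivrMr// mul1r ltrDl.
pose h := (1 - q / x) / (2 * (1 - ln x)).
have h0 : 0 < h by rewrite divr_gt0.
have p1 : 1 < 1 + h by rewrite ltrDl.
have xq : q < x `^ (1 + h).
  rewrite powRD; last by rewrite (gt_eqF x0) implybT.
  rewrite powRr1 ?(ltW x0)// mulrC -ltr_pdivrMr//.
  rewrite /powR (gt_eqF x0); apply: lt_le_trans (expR_ge1Dx _).
  have : - (h * ln x) <= (1 - q / x) / 2.
    rewrite /h (_ : - _ = (1 - q / x) / 2 * (- ln x / (1 - ln x))); last first.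
      have l2 : 1 - ln x != 0 by rewrite gt_eqF// subr_gt0 (le_lt_trans lnx).
      by move: (q / x) => y; field.
    rewrite ler_piMr ?divr_ge0 ?(ltW qx)// ler_pdivrMr ?subr_gt0 ?(le_lt_trans lnx)//.
    by rewrite mul1r lerDr.
  by move: qx; set y := q / x; move=> ? ?; lra.
have e0 : 0 < x `^ (1 + h) - q by rewrite subr_gt0.
(* The zero shift has zero energy, and [phi 0 = 0], so the exponential factor in [scheme_limit] is
   1. *)
have z0 s : - (r + t) <= s <= a -> (0 : S) s = 0 by [].
have zE N : (0 < N)%N -> \sum_(0 <= k < N) enorm (ga_inc 0 N k) ^+ 2 / mesh a N <= 0.
  by move=> _; rewrite big1// => k _; rewrite /ga_inc subrr enorm0 expr0n mul0r.
apply: filterS (scheme_limit z0 zE p1 lf' e0) => N.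
have [-> /andP[v0 v1]] := scheme_compl (ltn0Sn N) hf.
rewrite /cost_bound snorm0// mulr0 phi0 mulr0 expr0n/= mulr0 !addr0 !mulr0 expR0 mul1r => H.
(* On [0, 1] the power [1 + h] only decreases values, so the right-hand side is at most [q] plus the
   room left by [xq]. *)
have : (1 - scheme_value N.+1 f) `^ (1 + h) <= x `^ (1 + h).
  apply: le_trans H _; rewrite addrA lerBlDr [leLHS]addrC lerD2l.
  apply: Ele => // [|w].
    have p10 : 0 <= 1 + h by rewrite addr_ge0// ltW.
    have mX0 : measurable_fun setT (fun w => X w + 0) by apply: segmentD_measurable.
    exact: (unit_powR_bdm p10 hf' mX0).
  rewrite addr0; have /andP[f0 f1] := hf'.2 (X w).
  have [->|fn] := eqVneq (1 - f (X w)) 0; first by rewrite powR0// gt_eqF// (lt_trans _ p1).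
  rewrite -[leRHS]powRr1//; apply: ger_powR; last exact: ltW.
  by rewrite lt_neqAle eq_sym fn f0 f1.
rewrite qE; set v := scheme_value _ _ in v0 v1 * => Hv.
rewrite leNgt; apply/negP => vx.
have : x `^ (1 + h) < (1 - v) `^ (1 + h).
  apply: gt0_ltr_powR; rewrite ?nnegrE ?(ltW x0) ?subr_ge0//; first exact: lt_trans p1.
  by rewrite /x; lra.
by rewrite ltNge Hv.
Qed.

(** The two limits meet at the scheme value: it dominates the expectation at [X] by [scheme_lower],
    and its [p]-th power is dominated by the shifted expectation by [scheme_limit]. *)
Lemma path_harnack (ga : S) (En : R) f p :
  (forall s, - (r + t) <= s <= a -> ga s = 0) ->
  (forall N, (0 < N)%N -> \sum_(0 <= k < N) enorm (ga_inc ga N k) ^+ 2 / mesh a N <= En) ->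
  1 < p -> lip01 f ->
  (\int[P]_w f (X w)) `^ p <=
  expR (p / (2 * (p - 1)) * cost_bound ga En) * \int[P]_w (f (X w + ga) `^ p).
Proof.
move=> ga0 gaE p1 lf; have hf := lip01_unit rt0 lf.
have p0 : 0 < p by exact: lt_trans p1.
apply/ler_addgt0Pr => e e0; set Q := expR _ * _.
(* One share of [e] for the upper limit and [p] shares for the power, which is [p]-Lipschitz on
   [0, 1]. *)
have d0 : 0 < e / (1 + p) by rewrite divr_gt0// addr_gt0.
have bf : bdm (fun w => f (X w)) by exact: unit_bdm.
near \oo => N.
have h1 : \int[P]_w f (X w) - e / (1 + p) <= scheme_value N.+1 f.
  by near: N; exact: scheme_lower.
have h2 : (scheme_value N.+1 f) `^ p <= Q + e / (1 + p).
  by near: N; exact: (scheme_limit ga0 gaE p1 lf d0).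
have [_ v01] := scheme_compl (ltn0Sn N) hf.
set v := scheme_value _ _ in h1 h2 v01; set E := \int[P]_w f (X w) in h1 *.
have E01 : 0 <= E <= 1.
  rewrite /E Ege0 => [|w]; last by have /andP[] := hf.2 (X w).
  by apply: Ele1 => // w; have /andP[] := hf.2 (X w).
have H : E `^ p <= v `^ p + p * (e / (1 + p)).
  have [Ev|vE] := leP E v.
    apply: (@le_trans _ _ (v `^ p)); last by rewrite lerDl mulr_ge0 ?(ltW p0) ?(ltW d0).
    have /andP[E0 _] := E01; have /andP[v0 _] := v01.
    by apply: ge0_ler_powR; rewrite ?nnegrE ?(ltW p0).
  rewrite addrC -lerBlDr; apply: le_trans (ler_norm _) _.
  apply: le_trans (powR_lip (ltW p1) E01 v01) _; rewrite ler_wpM2l ?(ltW p0)//.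
  by rewrite ger0_norm ?subr_ge0 ?(ltW vE)// lerBlDr addrC -lerBlDr.
apply: le_trans H _; apply: (@le_trans _ _ (Q + e / (1 + p) + p * (e / (1 + p)))).
  by rewrite lerD2r.
rewrite le_eqVlt; apply/orP; left; apply/eqP; rewrite -addrA; congr (_ + _).
by field; rewrite gt_eqF// addr_gt0.
Unshelve. all: by end_near. Qed.

End Limit.
End Drift.

(** * Laws of segments and the Dini condition *)

(* If [phi] stayed above [e], each dyadic interval would contribute [e / 2] to the
   Dini integral. *)
Lemma dini_small (R : realType) (phi : R -> R) : dini_class phi ->
  forall e, 0 < e -> exists2 de : R, 0 < de & phi de <= e.
Proof.
move=> [p0 pm _ pint] e e0; apply/not_exists2P => H.
have He de : 0 < de -> e < phi de.
  move=> d0; have [//|h] := H de; rewrite ltNge; exact/negP.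
pose leb := @lebesgue_measure R.
pose I n : set R := `]0, 2^-1 ^+ n]%classic.
have h0 n : 0 < (2^-1 : R) ^+ n by rewrite exprn_gt0.
have h1 n : (2^-1 : R) ^+ n.+1 < 2^-1 ^+ n.
  by rewrite exprS gtr_pMl// invf_lt1// ltr1n.
have mphi (A : set R) : measurable A -> (forall x, A x -> 0 < x) ->
    measurable_fun A (fun s => (phi s / s)%:E).
  move=> mA A0; have mp : measurable_fun A phi.
    apply: (@eq_measurable_fun _ _ R R A (fun s : R => phi (Num.max 0 s)) phi).
      by move=> s; rewrite inE => As; rewrite (max_idPr (ltW (A0 s As))).
    apply: nondecreasing_measurable => // x y xy; apply: pm; first by rewrite le_max lexx.
    by rewrite ge_max le_max lexx/= le_max xy orbT.
  have mi : measurable_fun A (fun s : R => s^-1) by apply: measurable_invr.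
  have mq : measurable_fun A (fun s : R => phi s / s) := measurable_funM mp mi.
  by apply/measurable_EFinP; exact: mq.
have f0 (A : set R) : (forall x, A x -> 0 < x) -> forall x, A x -> (0 <= (phi x / x)%:E)%E.
  by move=> A0 x Ax; rewrite lee_fin divr_ge0 ?(ltW (A0 x Ax))// p0// ltW// A0.
have I0 n x : I n x -> 0 < x by rewrite /I/= in_itv/= => /andP[].
have step n : (\int[leb]_(s in I n.+1) (phi s / s)%:E + (e / 2)%:E <=
    \int[leb]_(s in I n) (phi s / s)%:E)%E.
  pose J : set R := `]2^-1 ^+ n.+1, 2^-1 ^+ n]%classic.
  have J0 x : J x -> 0 < x.
    by rewrite /J/= in_itv/= => /andP[+ _]; exact: lt_trans.
  have IJ : I n = I n.+1 `|` J.
    apply/seteqP; split => x; rewrite /I /J/= !in_itv/=.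
      by move=> /andP[x0 xn]; rewrite x0 xn/= andbT; have [h|h] := leP x (2^-1 ^+ n.+1); [left|right].
    move=> [/andP[-> h]|/andP[h ->]]; rewrite ?andbT/=; first exact: le_trans h (ltW (h1 n)).
    exact: lt_trans h.
  have mIJ : measurable_fun (I n.+1 `|` J) (fun s => (phi s / s)%:E).
    by apply: mphi; rewrite -IJ; [exact: measurable_itv|exact: I0].
  have pIJ x : (I n.+1 `|` J) x -> (0 <= (phi x / x)%:E)%E.
    by apply: (f0 (I n.+1 `|` J)) => y; rewrite -IJ; exact: I0.
  have dIJ : [disjoint I n.+1 & J].
    rewrite disj_set2E; apply/eqP/seteqP; split => // x []; rewrite /I /J /=.
    by rewrite !in_itv/= => /andP[_ h] /andP[h' _]; have := lt_le_trans h' h; rewrite ltxx.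
  have mI : measurable (I n.+1) by exact: measurable_itv.
  have mJ : measurable J by exact: measurable_itv.
  rewrite IJ (ge0_integral_setU leb mI mJ mIJ pIJ dIJ); apply: leeD => //.
  apply: (@le_trans _ _ (\int[leb]_(s in J) (e * 2 ^+ n)%:E)%E).
    have mJE : leb J = (2^-1 ^+ n - 2^-1 ^+ n.+1)%:E.
      by rewrite /leb /J lebesgue_measure_itv/= lte_fin h1 -EFinB.
    rewrite integral_cst// [X in (_ * X)%E]mJE -EFinM lee_fin.
    rewrite exprS (_ : _ - _ = 2^-1 * 2^-1 ^+ n); last by field.
    rewrite exprVn (_ : e * _ * _ = e / 2)//.
    by field; rewrite expf_neq0.
  apply: ge0_le_integral => //.
  - by move=> x _; rewrite lee_fin mulr_ge0 ?exprn_ge0// ltW.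
  - exact: mphi.
  - move=> x Jx; have x0 := J0 _ Jx; rewrite lee_fin ler_pdivlMr//.
    apply: (@le_trans _ _ e); last exact: ltW (He x x0).
    rewrite -mulrA ler_piMr ?(ltW e0)//.
    move: Jx; rewrite /J/= in_itv/= => /andP[_]; rewrite exprVn => h.
    by rewrite mulrC -ler_pdivlMr ?exprn_gt0// mul1r.
have big n : ((n%:R * (e / 2))%:E <= \int[leb]_(s in I 0%N) (phi s / s)%:E)%E.
  suff H' : ((n%:R * (e / 2))%:E + \int[leb]_(s in I n) (phi s / s)%:E <=
      \int[leb]_(s in I 0%N) (phi s / s)%:E)%E.
    apply: le_trans H'; rewrite leeDl//; apply: integral_ge0 => x Ix.
    exact: (f0 (I n) (I0 n)).
  elim: n => [|n IH]; first by rewrite mul0r add0e.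
  apply: le_trans IH; rewrite -natr1 mulrDl mul1r EFinD -addeA leeD2l//.
  by rewrite addeC.
have II : I 0%N = `]0, 1]%classic by rewrite /I expr0.
have Ige : (0 <= \int[leb]_(s in I 0%N) (phi s / s)%:E)%E.
  by apply: integral_ge0; exact: (f0 (I 0%N) (I0 0%N)).
rewrite II in big Ige.
have fin : (\int[leb]_(s in `]0%R, 1%R]) (phi s / s)%:E)%E \is a fin_num by rewrite ge0_fin_numE.
set v := (\int[leb]_(s in _) _)%E in big fin.
have := big (Num.truncn (fine v / (e / 2))).+1.
rewrite -(fineK fin) lee_fin leNgt => /negP; apply.
by rewrite -ltr_pdivrMr ?divr_gt0// truncnS_gt.
Qed.

Section Segment_laws.
Context (R : realType) (r : R) (d : nat) (r0 : 0 < r).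
Notation Cr := (segment r d).

(** The diagonal coupling has cost 0. With the laws frozen, both arguments of a coefficient carry
    the same law and the Wasserstein term disappears. *)
Lemma W2_refl (mu : probability Cr R) : (W2 mu mu <= 0)%E.
Proof.
have mdiag : measurable_fun setT (fun x : Cr => (x, x)) by exact: measurable_fun_pair.
pose D : {mfun Cr >-> (Cr * Cr)%type} := HB.pack (fun x : Cr => (x, x)) (isMeasurableFun.Build _ _ _ _ _ mdiag).
pose pi : probability (Cr * Cr)%type R := distribution mu D.
have mf : measurable_fun setT (fun z : Cr * Cr => (snorm (z.1 - z.2) ^+ 2)%:E).
  apply/measurable_EFinP; apply: measurable_funX; apply: (measurableT_comp (snorm_measurable (ltW r0))).
  apply: (segment_measurableP r0) => s i sr.
  rewrite (_ : (fun _ => _) = fun z : Cr * Cr => z.1 s i 0 - z.2 s i 0); last first.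
    by apply/funext => z; rewrite segmentD segmentN !mxE.
  by apply: measurable_funB; apply: (measurableT_comp (eval_measurable (ltW r0) s i)).
apply: (@le_trans _ _ (poweR (\int[pi]_z (snorm (z.1 - z.2) ^+ 2)%:E) 2^-1)%E).
  apply: ereal_inf_lbound; exists pi => //; split => A mA.
    by rewrite /pi /distribution/= /pushforward; congr (mu _); apply/seteqP; split => // x [].
  by rewrite /pi /distribution/= /pushforward; congr (mu _); apply/seteqP; split => // x [].
rewrite /pi (@ge0_integral_distribution _ _ _ _ _ mu D _ mf); last first.
  by move=> z; rewrite lee_fin sqr_ge0.
rewrite (_ : (\int[_]_x _)%E = 0%E) ?poweR0r ?invr_eq0//.
rewrite -[RHS](integral0 mu setT); apply: eq_integral => x _ /=.
by rewrite subrr snorm0 ?expr0n// ltW.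
Qed.

(** [sigma] is measurable on a domain that involves this set, which must itself be measurable for
    the composition with the law of the segment. *)
Lemma measurable_P2 : measurable (@P2 R r d).
Proof.
have mid : measurable_fun setT (@id (pprobability Cr R)) by exact: measurable_id.
have mk : measurable_fun setT (fun xi : Cr => (snorm xi ^+ 2)%:E).
  by apply/measurable_EFinP; apply: measurable_funX; exact: (snorm_measurable (ltW r0)).
have k0 (xi : Cr) : (0 <= (snorm xi ^+ 2)%:E)%E by rewrite lee_fin sqr_ge0.
have H := @measurable_fun_integral_kernel _ _ (pprobability Cr R) Cr R (kprobability mid)
  (fun U mU => measurable_kernel (kprobability mid) U mU) _
  k0 mk.
have := emeasurable_fun_infty_o measurableT H +oo%E; rewrite setTI.
exact.
Qed.

End Segment_laws.

(** * Measurability in time of the law of the segment *)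

Section Law_measurable.
Context (R : realType) (r T : R) (d : nat) (r0 : 0 < r) (T0 : 0 <= T).
Context (dO : measure_display) (Omega : measurableType dO) (P : probability Omega R).
Variable X : R -> Omega -> 'cV[R]_d.
Hypothesis cX : forall w, pcont (X ^~ w).
Hypothesis mX : forall s i, measurable_fun setT (fun w => X s w i 0).

Let fl (m : nat) (s : R) : R := (Num.truncn (m.+1%:R * s))%:R / m.+1%:R.

Let fl_close m s : 0 <= s -> `|fl m s - s| <= m.+1%:R^-1.
Proof.
move=> s0; have m0 : 0 < m.+1%:R :> R by rewrite ltr0n.
have ms0 : 0 <= m.+1%:R * s by rewrite mulr_ge0// ltW.
have /andP[h1 h2] := truncn_itv ms0.
rewrite /fl (_ : _ - s = ((Num.truncn (m.+1%:R * s))%:R - m.+1%:R * s) / m.+1%:R); last first.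
  by field; rewrite gt_eqF.
rewrite normrM [`|_^-1|]gtr0_norm ?invr_gt0// ler_piMl ?invr_ge0 ?(ltW m0)//.
rewrite ler0_norm ?subr_le0// opprB lerBlDr; rewrite addrC natr1; exact: ltW.
Qed.

(** With the time rounded down to a multiple of [1 / (m + 1)], the path is jointly measurable;
    continuity makes these approximations converge. *)
Lemma joint_measurable v i : measurable_fun setT
  (fun z : R * Omega => X (Num.max 0 z.1 + v) z.2 i 0).
Proof.
apply: (@measurable_fun_cvg _ _ _ _ (fun m (z : R * Omega) => X (fl m (Num.max 0 z.1) + v) z.2 i 0)).
  move=> m _ U mU; rewrite setTI.
  pose k (z : R * Omega) := Num.truncn (m.+1%:R * Num.max 0 z.1).
  rewrite (_ : _ @^-1` _ = \bigcup_n (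
      [set s : R | (Num.truncn (m.+1%:R * Num.max 0 s))%:R = n%:R :> R] `*`
      [set w | U (X (n%:R / m.+1%:R + v) w i 0)])); last first.
    apply/seteqP; split => [[s w]/= Us|[s w] [n _] [/= e Un]].
      by exists (k (s, w)).
    by rewrite /fl e.
  apply: bigcup_measurable => n _; apply: measurableX.
    have mh : measurable_fun setT (fun s : R => (Num.truncn (m.+1%:R * Num.max 0 s))%:R : R).
      apply: nondecreasing_measurable => // x y xy; rewrite ler_nat; apply: le_truncn.
      rewrite ler_wpM2l// ge_max le_max lexx/= le_max xy orbT//.
    by have := mh measurableT _ (measurable_set1 n%:R); rewrite setTI.
  by have := mX (n%:R / m.+1%:R + v) i measurableT mU; rewrite setTI.
move=> [s w] _ /=; apply/cvgrPdist_le => e e0.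
have s0 : 0 <= Num.max 0 s by rewrite le_max lexx.
have [de de0 h] := cX w (Num.max 0 s + v) e0.
near=> m.
rewrite -opprB normrN (_ : _ - _ = (X (fl m (Num.max 0 s) + v) w - X (Num.max 0 s + v) w) i 0); last by rewrite !mxE.
apply: le_trans (enorm_coord _ _) _; apply/ltW/h.
rewrite opprD addrACA subrr addr0; apply: le_lt_trans (fl_close _ s0) _.
rewrite invf_plt ?posrE ?ltr0n//.
apply: lt_le_trans (truncnS_gt _) _; rewrite ler_nat.
near: m; exists (Num.truncn de^-1) => // m /= hm; exact: leqW.
Unshelve. all: by end_near. Qed.

Lemma joint_segment_measurable : measurable_fun setT
  (fun z : R * Omega => seg r (X ^~ z.2) (Num.max 0 z.1)).
Proof.
apply: (segment_measurableP r0) => v i vr.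
rewrite (_ : (fun _ => _) = fun z : R * Omega => X (Num.max 0 z.1 + v) z.2 i 0).
  exact: joint_measurable.
by apply/funext => z; rewrite segP.
Qed.

(** The mass of a fixed set is the probability of a section of a jointly measurable set, hence
    measurable in time. [clip] keeps the time in [0, T], where the law is known. *)
Lemma law_measurable (mu : R -> pprobability (segment r d) R) :
  (forall s A, 0 <= s <= T -> measurable A -> mu s A = P [set w | A (seg r (X ^~ w) s)]) ->
  measurable_fun setT (fun s => mu (clip 0 T s)).
Proof.
move=> muE.
apply: (measurability (@pset _ _ _ : set (set (pprobability _ R)))) => // _ [_ [y y01 [U mU <-]] <-].
rewrite setTI /mset/=.
pose A := (fun z : R * Omega => seg r (X ^~ z.2) (Num.max 0 z.1)) @^-1` U.
have mA : measurable A by have := joint_segment_measurable measurableT mU; rewrite setTI.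
have mh := measurable_fun_xsection P mA.
have mc : measurable_fun setT (clip 0 T).
  by apply: nondecreasing_measurable => // x z xz; rewrite /clip ge_max !le_max lexx/= le_min !ge_min lexx xz/= !orbT.
have mcomp := measurableT_comp mh mc.
have := emeasurable_fun_infty_o measurableT mcomp y%:E; rewrite setTI.
rewrite (_ : [set x | _] = [set x | (mu (clip 0 T x) U < y%:E)%E]); first exact.
apply/seteqP; split => x /=; rewrite muE ?clip_itv//.
  by congr (P _ < _)%E; apply/seteqP; split => w; rewrite /xsection/= inE /A/= (max_idPr _)//;
    have /andP[] := clip_itv x T0.
by congr (P _ < _)%E; apply/seteqP; split => w; rewrite /xsection/= inE /A/= (max_idPr _)//;
  have /andP[] := clip_itv x T0.
Qed.

End Law_measurable.

(** * The shift path and its energy *)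

Section Continuous_paths.
Context (R : realType) (d : nat).

Lemma pcont_coord (x : R -> 'cV[R]_d) i : pcont x -> continuous (fun s => x s i 0).
Proof.
move=> px s; apply/cvgrPdist_lt => e e0; have [de de0 h] := px s e e0.
exists de => //= s'; rewrite /ball/= distrC => /h; apply: le_lt_trans.
rewrite -normrN opprB (_ : _ - _ = (x s' - x s) i 0); last by rewrite !mxE.
exact: enorm_coord.
Qed.

Lemma pcont_measurable (x : R -> 'cV[R]_d) i : pcont x -> measurable_fun setT (fun s => x s i 0).
Proof. by move=> px; apply: continuous_measurable_fun; exact: pcont_coord. Qed.

Lemma pcont_borel (x : R -> 'cV[R]_d) : pcont x -> measurable_fun setT (x : R -> borelV R d).
Proof.
move=> px; apply: (@measurability _ _ R (borelV R d) setT x (@open 'cV[R]_d)) => // _ [U oU <-]; rewrite setTI.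
apply: open_measurable; rewrite openE => s Us.
have [e /= e0 he] := (nbhs_ballP _ _).1 (open_nbhs_nbhs (conj oU Us)).
have [de de0 h] := px s e e0.
apply/nbhs_ballP; exists de => //= s'; rewrite /ball/= distrC => /h h'.
apply: he; rewrite -ball_normE /=; apply: le_lt_trans h'.
by rewrite -normrN opprB; exact: norm_le_enorm.
Qed.

Lemma pcont_bint (x : R -> 'cV[R]_d) i a c : pcont x -> bint `[a, c] (fun s => x s i 0).
Proof.
move=> px; split; first exact: measurable_funS (pcont_measurable i px).
have [ac|ca] := leP a c; last by exists 0 => s; rewrite in_itv/= => /andP[h1 h2];
  have := le_lt_trans (le_trans h1 h2) ca; rewrite ltxx.
have cx : {within `[a, c], continuous (fun s => x s i 0)}.
  by apply: continuous_subspaceT; exact: pcont_coord.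
have [M [_ hM]] := compact_bounded (continuous_compact cx (@segment_compact _ a c)).
exists (M + 1) => s si; apply: (hM (M + 1)); first by rewrite ltrDl.
by exists s.
Qed.

End Continuous_paths.

(** [x^2 / a] is convex and homogeneous in the pair [(x, a)], hence subadditive: energy bounds on
    two adjacent intervals give one on their union. *)
Lemma energy_concat (R : realType) (x y a1 a2 e1 e2 : R) : 0 <= a1 -> 0 <= a2 -> 0 <= e1 -> 0 <= e2 ->
  0 <= x -> 0 <= y -> x ^+ 2 <= a1 * e1 -> y ^+ 2 <= a2 * e2 ->
  (x + y) ^+ 2 <= (a1 + a2) * (e1 + e2).
Proof.
move=> a10 a20 e10 e20 x0 y0 hx hy.
have h : 2 * (x * y) <= a1 * e2 + a2 * e1.
  have s0 : 0 <= a1 * e2 + a2 * e1 by rewrite addr_ge0// mulr_ge0.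
  rewrite -ler_sqr ?nnegrE ?mulr_ge0//.
  apply: (@le_trans _ _ (4 * ((a1 * e1) * (a2 * e2)))).
    rewrite (_ : (2 * (x * y)) ^+ 2 = 4 * (x ^+ 2 * y ^+ 2)); last by ring.
    by rewrite ler_wpM2l//; apply: ler_pM; rewrite ?sqr_ge0.
  rewrite -subr_ge0 (_ : _ - _ = (a1 * e2 - a2 * e1) ^+ 2) ?sqr_ge0//; ring.
rewrite (_ : (x + y) ^+ 2 = x ^+ 2 + y ^+ 2 + 2 * (x * y)); last by ring.
rewrite (_ : (a1 + a2) * _ = a1 * e1 + a2 * e2 + (a1 * e2 + a2 * e1)); last by ring.
by rewrite lerD// lerD.
Qed.

Lemma integral_sqr_le (R : realType) (a c : R) (g : R -> R) : a < c -> bint `[a, c] g ->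
  (\int[lebesgue_measure]_(s in `[a, c]) g s) ^+ 2 <=
  (c - a) * \int[lebesgue_measure]_(s in `[a, c]) (g s ^+ 2).
Proof.
move=> ac bg; have sub : `[a, c] `<=` (`[a, c] : set R) by [].
have bgg : bint `[a, c] (fun s => g s ^+ 2).
  by rewrite (_ : (fun _ => _) = fun s => g s * g s); [exact: bintM|].
have ca : 0 < c - a by rewrite subr_gt0.
(* [l] is the mean of [g]; the claim is that the integral of [(g s - l) ^+ 2] is nonnegative. *)
set I := Rintegral lebesgue_measure _ g; pose l := I / (c - a).
have lebE : fine (lebesgue_measure (`[a, c] : set R)) = c - a.
  by rewrite lebesgue_measure_itv/= lte_fin ac.
have : 0 <= \int[lebesgue_measure]_(s in `[a, c]) (g s ^+ 2 + ((- 2 * l) * g s + l ^+ 2)).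
  apply: Ige0 => s _; rewrite (_ : _ + _ = (g s - l) ^+ 2) ?sqr_ge0//; ring.
rewrite (ID sub)//; last first.
  by apply: bintD; [apply: bintM => //; exact: bint_cst|exact: bint_cst].
rewrite (ID sub); [|apply: bintM => //; exact: bint_cst|exact: bint_cst].
rewrite (IZ sub)// Icst lebE -/I => h.
rewrite -subr_ge0; rewrite -(pmulr_rge0 _ ca) in h; apply: le_trans h _.
by rewrite /l le_eqVlt; apply/orP; left; apply/eqP; field; rewrite gt_eqF.
Qed.

Section Interpolating_shift.
Context (R : realType) (r t : R) (d : nat) (r0 : 0 < r) (rt : r < t).
Variables (eta : segment r d) (deta : R -> 'cV[R]_d).
Hypothesis C1 : is_C1 eta deta.
Notation S := (segment (r + t) d).
Let t0 : 0 < t := lt_trans r0 rt.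
Let tr0 : 0 < t - r. Proof. by rewrite subr_gt0. Qed.
Let rt0 : 0 <= r + t. Proof. by rewrite addr_ge0 ?ltW. Qed.
Let rle : - r <= 0. Proof. by rewrite oppr_le0 ltW. Qed.

Let etx s : 'cV[R]_d := eta (clip (- r) 0 s).
Let dtx s : 'cV[R]_d := deta (clip (- r) 0 s).

Let etx_pc : pcont etx.
Proof.
apply: (pcont_clip (x := eta)) => //; apply/within_enormP => s sr e e0.
have [de de0 h] := segment_enormP eta sr e0; by exists de.
Qed.

Let dtx_pc : pcont dtx. Proof. by apply: (pcont_clip (x := deta)) => //; case: C1. Qed.

Let etx_ftc u v i : - r <= u -> u < v -> v <= 0 ->
  \int[lebesgue_measure]_(s in `[u, v]) dtx s i 0 = etx v i 0 - etx u i 0.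
Proof.
move=> ru uv v0.
have H := @continuous_FTC2 R (fun s => dtx s i 0) (fun s => etx s i 0) u v uv.
have cE := @pcont_coord _ _ _ i etx_pc.
(* At interior points the restriction to [- r, 0] in [is_C1] is void for small [h], and the clipped
   path coincides with [eta]. *)
have key s : s \in `]u, v[ -> (fun h => h^-1 *: (etx (h + s) i 0 - etx s i 0)) @ 0^' --> dtx s i 0.
    rewrite in_itv/= => /andP[us sv].
    have s1 : - r < s by exact: le_lt_trans us.
    have s2 : s < 0 by exact: lt_le_trans v0.
    have [_ c1] := C1.
    have sr : `[- r, 0]%classic s by rewrite /= in_itv/= !ltW.
    have nD : \forall h \near 0^', `[- r, 0]%classic (s + h).
      near=> h; rewrite /= in_itv/=.
      have h1 : `|h| < Num.min (s + r) (- s).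
        by near: h; apply: dnbhs0_lt; rewrite lt_min -ltrBlDr sub0r s1 oppr_gt0.
      move: h1; rewrite lt_min !ltr_norml => /andP[/andP[h1 _] /andP[_ h2]].
      by apply/andP; split; lra.
    have H1 : (fun h => (h^-1 *: (eta (s + h) - eta s)) i 0) @
        within [set h | `[- r, 0]%classic (s + h)] (0 : R)^' --> deta s i 0.
      exact: (cvg_comp _ _ (c1 s sr) (@coord_continuous _ _ _ i 0 (deta s))).
    rewrite (_ : dtx s i 0 = deta s i 0); last by rewrite /dtx clip_id ?ltW ?s1.
    move=> A /H1 hA; rewrite nbhs_simpl/=.
    apply: filterS2 nD hA => h sh /(_ sh).
    have cs : clip (- r) 0 s = s by rewrite clip_id// !ltW.
    have csh : clip (- r) 0 (h + s) = h + s.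
      by rewrite clip_id//; move: sh; rewrite /= in_itv/= addrC.
    rewrite /= (_ : h^-1 *: (etx (h + s) i 0 - etx s i 0) = (h^-1 *: (eta (s + h) - eta s)) i 0)//.
    by rewrite /etx cs csh [h + s]addrC !mxE.
rewrite /Rintegral H//.
- by apply: continuous_subspaceT; exact: pcont_coord.
- split.
  + move=> s suv; apply/cvg_ex; exists (dtx s i 0).
    rewrite (_ : (fun h => _) = (fun h => h^-1 *: (etx (h + s) i 0 - etx s i 0))); first exact: key.
    by apply/funext => h /=; rewrite [h *: 1]mulr1.
  + exact: cvg_at_right_filter (cE u).
  + exact: cvg_at_left_filter (cE v).
- by move=> s suv; rewrite /derive1; apply/cvg_lim; [exact: Rhausdorff|exact: key].
Unshelve. all: by end_near. Qed.

Let g2 s := enorm (dtx s) ^+ 2.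

Let bdn a c : bint `[a, c] (fun s => enorm (dtx s)).
Proof.
have bi i : bint `[a, c] (fun s => dtx s i 0) by exact: pcont_bint.
split; last first.
  have [M hM] : exists M, forall s, s \in `[a, c] -> \sum_i `|dtx s i 0| <= M.
    have [_ [M hM]] : bint `[a, c] (fun s => \sum_i `|dtx s i 0|).
      by apply: bint_sum => i; exact: bint_norm.
    by exists M => s /hM; apply: le_trans; exact: ler_norm.
  by exists M => s /hM; apply: le_trans; rewrite ger0_norm ?enorm_ge0 ?enorm_le_sum.
apply: (measurable_funS measurableT) => //.
by apply: measurable_enorm => i; exact: pcont_measurable.
Qed.

Let bg2 a c : bint `[a, c] g2.
Proof.
by rewrite (_ : g2 = fun s => enorm (dtx s) * enorm (dtx s)); [exact: bintM|].
Qed.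

Let etx_incr u v : - r <= u -> u <= v -> v <= 0 ->
  enorm (etx v - etx u) ^+ 2 <= (v - u) * \int[lebesgue_measure]_(s in `[u, v]) g2 s.
Proof.
move=> ru; rewrite le_eqVlt => /orP[/eqP <- _|uv v0].
  by rewrite !subrr enorm0 expr0n mul0r.
have sub : `[u, v] `<=` (`[u, v] : set R) by [].
apply: le_trans (integral_sqr_le uv (bdn u v)).
rewrite ler_sqr ?nnegrE ?enorm_ge0//; last by apply: Ige0 => s _; exact: enorm_ge0.
rewrite (_ : etx v - etx u = \col_k \int[lebesgue_measure]_(s in `[u, v]) dtx s k 0); last first.
  by apply/matrixP => i j; rewrite !mxE (ord1 j) etx_ftc.
by apply: (enorm_integral_le sub) => // k; exact: pcont_bint.
Qed.

Let J u := \int[lebesgue_measure]_(s in `[- r, u]) g2 s.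

Let J_diff u v : - r <= u -> u <= v -> J v - J u = \int[lebesgue_measure]_(s in `[u, v]) g2 s.
Proof.
move=> ru uv; rewrite /J.
have iv : lebesgue_measure.-integrable `[- r, v] (EFin \o g2).
  by apply: (@bint_int _ `[- r, v] (- r) v) => //; exact: bg2.
have iu : lebesgue_measure.-integrable `]u, v] (EFin \o g2).
  apply: (integrableS _ _ _ iv) => // s; rewrite /= !in_itv/= => /andP[h ->].
  by rewrite (le_trans ru (ltW h)).
by rewrite -(Rintegral_itv_obnd_cbnd iu); apply: Rintegral_itvB => //; rewrite bnd_simp.
Qed.

Let gs u : 'cV[R]_d := clip 0 1 ((u + t) / (t - r)) *: etx u.

Let etx_le u : enorm (etx u) <= snorm eta.
Proof. by apply: (snorm_ge (ltW r0)); exact: clip_itv. Qed.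

Let gs_pc : pcont gs.
Proof.
move=> s e e0; have e2 : 0 < e / 2 by rewrite divr_gt0.
have [de de0 h] := etx_pc s e2.
have S1 : 0 < snorm eta + 1 by rewrite ltr_wpDl// snorm_ge0// ltW.
exists (Num.min de (e / 2 * (t - r) / (snorm eta + 1))).
  by rewrite lt_min de0 divr_gt0// mulr_gt0.
move=> s'; rewrite lt_min => /andP[h1 h2]; rewrite /gs.
set c := clip 0 1 _; set c' := clip 0 1 _.
rewrite (_ : _ - _ = (c - c') *: etx s' + c' *: (etx s' - etx s)); last first.
  by apply/matrixP => i j; rewrite !mxE; ring.
apply: le_lt_trans (enormD _ _) _; rewrite !enormZ.
have /andP[c0 c1] : 0 <= c' <= 1 by exact: clip_itv.
rewrite (_ : e = e / 2 + e / 2); last by field.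
apply: ler_ltD; last first.
  by rewrite ger0_norm//; apply: le_lt_trans (h s' h1); rewrite ler_piMl// enorm_ge0.
apply: (@le_trans _ _ (`|s' - s| / (t - r) * (snorm eta + 1))).
  apply: ler_pM => //; first exact: enorm_ge0.
    apply: le_trans (clip_lip _ _ (@ler01 R)) _.
    rewrite -mulrBl normrM [`|(t - r)^-1|]gtr0_norm ?invr_gt0//.
    by rewrite (_ : s' + t - (s + t) = s' - s)//; ring.
  by apply: le_trans (etx_le _) _; rewrite lerDl.
by rewrite mulrAC ler_pdivrMr// -ler_pdivlMr// ltW.
Qed.

(* Zero up to time [0], then linear up to [eta (- r)] at time [t - r], then [eta]. *)
Definition shift_path : S := seg (r + t) gs 0.

Let shift_pathE u : - (r + t) <= u <= 0 -> shift_path u = gs u.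
Proof. by move=> ur; rewrite /shift_path segE0//; exact: pcont_within. Qed.

Lemma shift_path_past u : - (r + t) <= u <= - t -> shift_path u = 0.
Proof.
move=> /andP[h1 h2]; rewrite shift_pathE; last first.
  by rewrite h1 (le_trans h2)// oppr_le0 ltW.
rewrite /gs (_ : clip 0 1 _ = 0) ?scale0r//.
have h : (u + t) / (t - r) <= 0 by rewrite pmulr_lle0 ?invr_gt0//; lra.
by rewrite /clip min_l ?max_l// (le_trans h).
Qed.

Lemma shift_path_end u : - r <= u <= 0 -> shift_path u = eta u.
Proof.
move=> /[dup] ur /andP[h1 h2]; have h3 := t0; rewrite shift_pathE; last by apply/andP; split; lra.
rewrite /gs /etx (clip_id ur) (_ : clip 0 1 _ = 1) ?scale1r//.
have h : 1 <= (u + t) / (t - r) by rewrite ler_pdivlMr// mul1r; lra.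
by rewrite /clip min_r// max_r.
Qed.

Lemma shift_path_snorm : snorm shift_path <= snorm eta.
Proof.
apply: (snorm_le rt0) => s sr; rewrite shift_pathE// /gs enormZ.
have /andP[c0 c1] : 0 <= clip 0 1 ((s + t) / (t - r)) <= 1 by exact: clip_itv.
by rewrite ger0_norm//; apply: le_trans (etx_le s); rewrite ler_piMl// enorm_ge0.
Qed.

Let n2 := enorm (eta (- r)) ^+ 2.

(** The energy accumulated by [shift_path] from [- t] to [u]: a linear stretch with slope
    [eta (- r) / (t - r)], then the integral of the squared derivative of [eta]. Through [Q], which
    bounds a squared increment by length times energy, the discrete energies telescope. *)
Let Ef u : R := if u <= - r then (u + t) / (t - r) ^+ 2 * n2 else n2 / (t - r) + J u.

Let Ef_right u : - r <= u -> Ef u = n2 / (t - r) + J u.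
Proof.
rewrite le_eqVlt => /orP[/eqP <-|ru]; last by rewrite /Ef leNgt ru.
rewrite /Ef lexx /J set_itv1 Rintegral_set1 addr0.
by field; rewrite gt_eqF.
Qed.

Let Q u v := enorm (shift_path v - shift_path u) ^+ 2 <= (v - u) * (Ef v - Ef u) /\ Ef u <= Ef v.

Let Q_left u v : - t <= u -> u <= v -> v <= - r -> Q u v.
Proof.
move=> tu uv vr; have ur : u <= - r by exact: le_trans vr.
have h1 := r0; have h2 := t0; have h3 := tr0.
have gsE x : - t <= x -> x <= - r -> shift_path x = ((x + t) / (t - r)) *: eta (- r).
  move=> x1 x2; rewrite shift_pathE; last by apply/andP; split; lra.
  rewrite /gs /etx clip_id; last first.
    rewrite divr_ge0 ?(ltW tr0)//=; last by lra.
    by rewrite ler_pdivrMr// mul1r; lra.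
  congr (_ *: eta _); rewrite /clip min_l; last by lra.
  by rewrite max_l.
have EE : Ef v - Ef u = (v - u) / (t - r) ^+ 2 * n2 by rewrite /Ef ur vr; ring.
split.
  rewrite EE !gsE ?(le_trans tu uv)// -scalerBl enormZ exprMn real_normK ?num_real//.
  rewrite -/n2 le_eqVlt; apply/orP; left; apply/eqP; field; rewrite gt_eqF//.
by rewrite -subr_ge0 EE mulr_ge0 ?sqr_ge0// divr_ge0 ?sqr_ge0// subr_ge0.
Qed.

Let Q_right u v : - r <= u -> u <= v -> v <= 0 -> Q u v.
Proof.
move=> ru uv v0; have rv : - r <= v by exact: le_trans uv.
have EE : Ef v - Ef u = \int[lebesgue_measure]_(s in `[u, v]) g2 s.
  by rewrite !Ef_right// -J_diff//; ring.
split; last by rewrite -subr_ge0 EE; apply: Ige0 => s _; exact: sqr_ge0.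
rewrite EE !shift_path_end ?ru ?rv ?(le_trans uv)//.
have := etx_incr ru uv v0; rewrite /etx !clip_id//; first by rewrite ru (le_trans uv).
by rewrite rv v0.
Qed.

(** A mesh interval may straddle [- r]; its two parts are joined by [energy_concat]. *)
Let Q_all u v : - t <= u -> u <= v -> v <= 0 -> Q u v.
Proof.
move=> tu uv v0; have [vr|rv] := leP v (- r); first exact: Q_left.
have [ru|ur] := leP (- r) u; first exact: Q_right.
have [q1 e1] := Q_left tu (ltW ur) (lexx _).
have [q2 e2] := Q_right (lexx _) (ltW rv) v0.
split; last exact: le_trans e2.
apply: (@le_trans _ _ ((enorm (shift_path v - shift_path (- r)) +
    enorm (shift_path (- r) - shift_path u)) ^+ 2)).
  rewrite ler_sqr ?nnegrE ?addr_ge0 ?enorm_ge0//; apply: le_trans (enormD _ _).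
  by rewrite addrA subrK.
rewrite (_ : v - u = (v - - r) + (- r - u)); last by ring.
rewrite (_ : Ef v - Ef u = (Ef v - Ef (- r)) + (Ef (- r) - Ef u)); last by ring.
by apply: energy_concat; rewrite ?enorm_ge0 ?subr_ge0 ?(ltW ur) ?(ltW rv).
Qed.

Lemma shift_path_energy N : (0 < N)%N ->
  \sum_(0 <= k < N) enorm (ga_inc shift_path N k) ^+ 2 / mesh (- t) N <=
  enorm (eta (- r)) ^+ 2 / (t - r) +
  \int[lebesgue_measure]_(s in `[- r, 0]) (enorm (deta s) ^+ 2).
Proof.
move=> N0; have a0 : - t < 0 by rewrite oppr_lt0.
have dt0 := mesh_gt0 a0 N0.
apply: (@le_trans _ _ (\sum_(0 <= k < N) (Ef (gpt (- t) N k.+1) - Ef (gpt (- t) N k)))).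
  rewrite !big_nat; apply: ler_sum => k /andP[_ kN].
  have /andP[g1 g2'] := gpt_itv a0 N0 (ltnW kN).
  have /andP[_ g3] := gpt_itv a0 N0 kN.
  have [q _] := Q_all g1 (ltW (gpt_lt a0 N0 k)) g3.
  rewrite ler_pdivrMr// mulrC; apply: le_trans q _.
  by rewrite gptS addrAC subrr add0r.
rewrite telescope_sumr// gptN// gpt0 Ef_right//.
rewrite (_ : Ef (- t) = 0) ?subr0; last first.
  by rewrite /Ef lerN2 (ltW rt) addNr !mul0r.
rewrite lerD2l le_eqVlt; apply/orP; left; apply/eqP; rewrite /J.
by apply: eq_Rintegral => s; rewrite inE/= in_itv/= => sr; rewrite /g2 /dtx clip_id.
Qed.

End Interpolating_shift.

(** * The Harnack inequalities *)

Section Operator_norm.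
Context (R : realType) (d : nat).
Implicit Types (A : 'M[R]_d) (h : 'cV[R]_d).

Let row_bound A h : enorm (A *m h) <= (\sum_i \sum_j `|A i j|) * enorm h.
Proof.
apply: le_trans (enorm_le_sum _) _; rewrite mulr_suml; apply: ler_sum => i _.
rewrite mxE; apply: le_trans (ler_norm_sum _ _ _) _; rewrite mulr_suml.
by apply: ler_sum => j _; rewrite normrM ler_wpM2l// enorm_coord.
Qed.

(** [opnorm] is a supremum in the reals, an upper bound only if its set is bounded; this is the
    purpose of [row_bound]. *)
Lemma enorm_mulmx_le A h : enorm (A *m h) <= opnorm A * enorm h.
Proof.
have sup_ub x : enorm x <= 1 -> enorm (A *m x) <= opnorm A.
  move=> x1; apply: ub_le_sup; last by exists x.
  exists (\sum_i \sum_j `|A i j|) => _ [y /= y1 <-].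
  apply: le_trans (row_bound A y) _; rewrite ler_piMr// sumr_ge0// => i _.
  by apply: sumr_ge0 => j _.
have [h0|h0] := eqVneq (enorm h) 0.
  by apply: le_trans (row_bound A h) _; rewrite h0 !mulr0.
have hp : 0 < enorm h by rewrite lt_neqAle eq_sym h0 enorm_ge0.
have := sup_ub ((enorm h)^-1 *: h).
rewrite enormZ gtr0_norm ?invr_gt0// mulVf// lexx => /(_ isT).
by rewrite -scalemxAr enormZ gtr0_norm ?invr_gt0// mulrC ler_pdivrMr.
Qed.

Lemma entry_le_opnorm A i j : `|A i j| <= opnorm A.
Proof.
have e1 : enorm (delta_mx j 0 : 'cV[R]_d) = 1.
  rewrite /enorm (bigD1 j)//= big1; last by move=> k /negbTE kj; rewrite !mxE kj expr0n.
  by rewrite !mxE !eqxx expr1n addr0 sqrtr1.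
have -> : A i j = (A *m (delta_mx j 0 : 'cV[R]_d)) i 0.
  rewrite mxE (bigD1 j)//= big1 ?addr0; last by move=> k /negbTE kj; rewrite !mxE kj mulr0.
  by rewrite !mxE !eqxx mulr1.
by apply: le_trans (enorm_coord _ _) _; apply: le_trans (enorm_mulmx_le _ _) _; rewrite e1 mulr1.
Qed.

End Operator_norm.

(** [x] is the other summand of a sum of two uniform norms; [-oo < x] excludes [+oo + -oo = -oo],
    where [fine] would return 0. *)
Lemma unorm_le (R : realType) (U : Type) (D : set U) (g : U -> R) (x : \bar R) u :
  (unorm D g + x < +oo)%E -> (-oo < x)%E -> D u -> g u <= fine (unorm D g).
Proof.
move=> h x0 Du; have gu : ((g u)%:E <= unorm D g)%E by apply: ereal_sup_ubound; exists u.
have fin : unorm D g \is a fin_num.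
  rewrite fin_numE gt_eqF ?(lt_le_trans _ gu) ?ltNyr//=.
  by apply/negP => /eqP e; move: h; rewrite e addye ?ltxx// gt_eqF.
by rewrite -lee_fin fineK.
Qed.

Lemma unorm_gtNy (R : realType) (U : Type) (D : set U) (g : U -> R) u :
  D u -> (-oo < unorm D g)%E.
Proof.
move=> Du; apply: (@lt_le_trans _ _ (g u)%:E); first exact: ltNyr.
by apply: ereal_sup_ubound; exists u.
Qed.

(** * The inequality for Lipschitz functions of the solution *)

Section Equation.
Context (R : realType) (d : nat) (r T : R).
Context (dO : measure_display) (Omega : measurableType dO) (P : probability Omega R).
Context (F : R -> set (set Omega)) (W : R -> Omega -> 'cV[R]_d).
Context (sigma : R -> pprobability (segment r d) R -> 'M[R]_d).
Context (b : R -> 'cV[R]_d -> pprobability (segment r d) R -> 'cV[R]_d).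
Context (B : R -> segment r d -> pprobability (segment r d) R -> 'cV[R]_d).
Context (K : R) (phi : R -> R).
Hypotheses (hr : 0 < r) (hT : 0 < T).
Hypotheses (hF : complete_filtration P F) (hW : brownian_motion P F W).
Hypothesis sigma_meas : forall i j,
  measurable_fun (`[0, T]%classic `*` @P2 R r d)
    (fun u : R * pprobability (segment r d) R => sigma u.1 u.2 i j).
Hypothesis sigma_inv : forall (t : R) mu, 0 <= t <= T -> P2 mu -> sigma t mu \in unitmx.
Hypothesis b_meas : forall i,
  measurable_fun (`[0, T]%classic `*` setT `*` setT)
    (fun u : R * borelV R d * pprobability (segment r d) R => b u.1.1 u.1.2 u.2 i 0).
Hypothesis B_meas : forall i,
  measurable_fun (`[0, T]%classic `*` setT `*` setT)
    (fun u : R * segment r d * pprobability (segment r d) R => B u.1.1 u.1.2 u.2 i 0).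
Variables (S0 sinv Nd : R).
Hypothesis sigma_le : forall (t : R) mu, 0 <= t <= T -> P2 mu -> opnorm (sigma t mu) <= S0.
Hypothesis sinv_le : forall (t : R) mu, 0 <= t <= T -> P2 mu ->
  opnorm (invmx (sigma t mu)) <= sinv.
Hypothesis sinv0 : 0 <= sinv.
Hypothesis b_le : forall (t : R) x mu, 0 <= t <= T -> enorm (b t x mu) <= Nd.
Hypothesis B_le : forall (t : R) x mu, 0 <= t <= T -> enorm (B t x mu) <= Nd.
Hypotheses (hK : 1 < K) (hphi : dini_class phi).
Hypothesis b_reg : forall (t : R) x y mu nu, 0 <= t <= T -> P2 mu -> P2 nu ->
  ((enorm (b t x mu - b t y nu))%:E <= (phi (enorm (x - y)))%:E + K%:E * W2 mu nu)%E.
Hypothesis B_reg : forall (t : R) xi xi' mu nu, 0 <= t <= T -> P2 mu -> P2 nu ->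
  ((enorm (B t xi mu - B t xi' nu))%:E <= K%:E * ((snorm (xi - xi'))%:E + W2 mu nu))%E.

Variable X : R -> Omega -> 'cV[R]_d.
Hypothesis hX : is_solution P F T W B b sigma X.

Let K0 : 0 < K. Proof. exact: lt_trans hK. Qed.

Section Coefficients.
Variable mu : R -> pprobability (segment r d) R.
Hypothesis mu_meas : measurable_fun setT (fun s => mu (clip 0 T s)).
Hypothesis mu_P2 : forall s, 0 <= s <= T -> P2 (mu s).
Variables (t : R) (tT : t <= T).

Let in_T s : 0 <= s <= t -> 0 <= s <= T.
Proof. by move=> /andP[-> h]; exact: le_trans tT. Qed.

Let mclip : measurable_fun setT (clip 0 T : R -> R).
Proof.
apply: nondecreasing_measurable => // x z xz.
by rewrite /clip ge_max !le_max lexx/= le_min !ge_min lexx xz/= !orbT.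
Qed.

Let clT s : `[0, T]%classic (clip 0 T s). Proof. by rewrite /= in_itv/= clip_itv// ltW. Qed.

(** Clipping the time makes the composed map total with values in the domain of [b_meas]; on [0, t]
    it changes nothing. *)
Lemma drift_b_measurable x i : pcont x ->
  measurable_fun `[0, t] (fun s => b s (x s) (mu s) i 0).
Proof.
move=> px.
have mD : measurable (`[0, T]%classic `*` setT `*` setT : set (R * borelV R d * pprobability (segment r d) R)).
  by apply: measurableX => //; apply: measurableX.
have mg : measurable_fun setT (fun s : R => ((clip 0 T s, x s : borelV R d), mu (clip 0 T s))).
  by apply: measurable_fun_pair => //; apply: measurable_fun_pair => //; exact: pcont_borel.
have sub : (fun s : R => ((clip 0 T s, x s : borelV R d), mu (clip 0 T s))) @` setT `<=`
    (`[0, T]%classic `*` setT `*` setT).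
  by move=> _ [s _ <-] /=; split => //; split => //; exact: clT.
have H := measurable_comp mD sub (b_meas i) mg.
apply: (@eq_measurable_fun _ _ R R `[0, t]%classic
  (fun s : R => b (clip 0 T s) (x s) (mu (clip 0 T s)) i 0)).
  by move=> s; rewrite inE/= in_itv/= => /in_T st; rewrite clip_id.
exact: measurable_funS H.
Qed.

Lemma drift_B_measurable x i : pcont x ->
  measurable_fun `[0, t] (fun s => B s (seg r x s) (mu s) i 0).
Proof.
move=> px.
have mD : measurable (`[0, T]%classic `*` setT `*` setT : set (R * segment r d * pprobability (segment r d) R)).
  by apply: measurableX => //; apply: measurableX.
have ms : measurable_fun setT (fun s : R => seg r x s).
  apply: (segment_measurableP hr) => v j vr.
  rewrite (_ : (fun _ => _) = fun s => x (s + v) j 0); last by apply/funext => s; rewrite segP.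
  apply: (measurableT_comp (pcont_measurable j px)); exact: measurable_funD.
have mg : measurable_fun setT (fun s : R => ((clip 0 T s, seg r x s), mu (clip 0 T s))).
  by apply: measurable_fun_pair => //; exact: measurable_fun_pair.
have sub : (fun s : R => ((clip 0 T s, seg r x s), mu (clip 0 T s))) @` setT `<=`
    (`[0, T]%classic `*` setT `*` setT).
  by move=> _ [s _ <-] /=; split => //; split => //; exact: clT.
have H := measurable_comp mD sub (B_meas i) mg.
apply: (@eq_measurable_fun _ _ R R `[0, t]%classic
  (fun s : R => B (clip 0 T s) (seg r x s) (mu (clip 0 T s)) i 0)).
  by move=> s; rewrite inE/= in_itv/= => /in_T st; rewrite clip_id.
exact: measurable_funS H.
Qed.

Lemma sigma_law_measurable i j : measurable_fun `[0, T] (fun s => sigma s (mu s) i j).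
Proof.
have mD : measurable (`[0, T]%classic `*` @P2 R r d).
  by apply: measurableX => //; exact: measurable_P2.
have mg : measurable_fun setT (fun s : R => (clip 0 T s, mu (clip 0 T s))).
  exact: measurable_fun_pair.
have sub : (fun s : R => (clip 0 T s, mu (clip 0 T s))) @` setT `<=` (`[0, T]%classic `*` @P2 R r d).
  by move=> _ [s _ <-] /=; split => /=; [exact: clT|apply: mu_P2; apply: clip_itv; exact: ltW].
have H := measurable_comp mD sub (sigma_meas i j) mg.
apply: (@eq_measurable_fun _ _ R R `[0, T]%classic
  (fun s : R => sigma (clip 0 T s) (mu (clip 0 T s)) i j)).
  by move=> s; rewrite inE/= in_itv/= => st; rewrite clip_id.
exact: measurable_funS H.
Qed.

Lemma b_modulus s x y : 0 <= s <= T ->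
  enorm (b s x (mu s) - b s y (mu s)) <= phi (enorm (x - y)).
Proof.
move=> sT; rewrite -lee_fin; apply: le_trans (b_reg x y sT (mu_P2 sT) (mu_P2 sT)) _.
rewrite -[leRHS]adde0 leeD2l//; apply: mule_ge0_le0; first by rewrite lee_fin ltW.
exact: W2_refl.
Qed.

Lemma B_modulus s x y : 0 <= s <= T ->
  enorm (B s x (mu s) - B s y (mu s)) <= K * snorm (x - y).
Proof.
move=> sT; rewrite -lee_fin; apply: le_trans (B_reg x y sT (mu_P2 sT) (mu_P2 sT)) _.
rewrite EFinM lee_wpmul2l ?lee_fin ?(ltW K0)// -[leRHS]adde0 leeD2l//.
exact: W2_refl.
Qed.

End Coefficients.

Let within_sub a c a' c' (f : R -> 'cV[R]_d) : a' <= a -> c <= c' ->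
  {within `[a', c'], continuous f} -> {within `[a, c], continuous f}.
Proof.
move=> aa cc; apply: continuous_subspaceW => s; rewrite /= !in_itv/= => /andP[h1 h2].
by rewrite (le_trans aa h1) (le_trans h2 cc).
Qed.

Variables (t : R) (rt : r < t) (tT : t <= T).
Let t0 : 0 < t := lt_trans hr rt.
Let rt0 : 0 < r + t. Proof. by rewrite addr_gt0. Qed.
Notation S := (segment (r + t) d).

(** The origin of a stored path is time [t], so its restriction to [- r, 0] is the current
    segment. *)
Definition restrict_segment (z : S) : segment r d := seg r z 0.

Lemma restrict_segmentE z v : - r <= v <= 0 -> restrict_segment z v = z v.
Proof.
move=> vr; rewrite /restrict_segment segE0//; apply/within_enormP => s /andP[s1 s2] e e0.
have h := t0; have sr : - (r + t) <= s <= 0 by apply/andP; split; lra.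
have [de de0 H] := segment_enormP z sr e0; exists de => // s' /andP[s1' s2'].
by apply: H; apply/andP; split; lra.
Qed.

Lemma restrict_segment_le z z' :
  snorm (restrict_segment z - restrict_segment z') <= snorm (z - z').
Proof.
apply: (snorm_le (ltW hr)) => v /[dup] vr /andP[v1 v2]; have h := t0.
rewrite segmentD segmentN !restrict_segmentE//.
apply: le_trans (snorm_ge (ltW rt0) (z - z') (s := v) _); first by rewrite segmentD.
by apply/andP; split; lra.
Qed.

Variables (eta : segment r d) (deta : R -> 'cV[R]_d).
Hypothesis C1 : is_C1 eta deta.

(** The laws [mu s] of this solution are frozen into [bb], [BB] and [sg], after which the stored
    path [X'] meets the hypotheses of [path_harnack]. It then remains to compare [cost_bound] with
    [harnack_beta]. *)
Lemma solution_lip_harnack f p : 1 < p -> lip01 f ->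
  (\int[P]_w f (seg r (X ^~ w) t)) `^ p <=
  expR (p / (2 * (p - 1)) * harnack_beta sinv phi (12 * K ^+ 2) t eta deta) *
  \int[P]_w (f (seg r (X ^~ w) t + eta) `^ p).
Proof.
have [mu [M [cX adX lawX itoX eqX]]] := hX.
move=> p1 lf.
have rT : - r <= T by apply: (@le_trans _ _ 0); rewrite ?oppr_le0 ltW.
(* Extended by constants outside [- r, T], the paths are continuous on the whole line, as
   [law_measurable] requires. *)
pose Xc s w := X (clip (- r) T s) w.
have cXc w : pcont (Xc ^~ w) by exact: (pcont_clip rT (cX w)).
have segXc w s : 0 <= s <= T -> seg r (Xc ^~ w) s = seg r (X ^~ w) s.
  move=> /andP[s0 sT]; apply: segment_eq => v /[dup] vr /andP[v1 v2].
  rewrite segP// segE ?in_itv/= ?vr; last first.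
    by apply: within_sub (cX w) => //; lra.
  by rewrite /Xc clip_id//; apply/andP; split; lra.
have mu_P2 s : 0 <= s <= T -> P2 (mu s) by move=> /lawX[].
(* A value before time 0 is known at time 0: it is read off the adapted segment at time
   [Num.max 0 s]. *)
have evX s i : - r <= s <= T ->
    measurable_wrt (F (Num.max 0 s)) (fun w => X s w i 0).
  move=> /andP[s1 s2].
  have mT : 0 <= Num.max 0 s <= T by rewrite le_max lexx/= ge_max (ltW hT).
  have vr : - r <= s - Num.max 0 s <= 0.
    by case: (leP 0 s) => h; apply/andP; split; have := hr; lra.
  rewrite (_ : (fun w => _) = fun w => seg r (X ^~ w) (Num.max 0 s) (s - Num.max 0 s) i 0).
    exact: (measurable_wrt_comp (eval_measurable (ltW hr) _ i) (adX _ mT)).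
  by apply/funext => w; rewrite -segXc// segP// addrC subrK /Xc clip_id// s1.
have mXc s i : measurable_fun setT (fun w => Xc s w i 0).
  apply: (measurable_wrt_fun _ (evX _ i (clip_itv s rT))); apply: (filtration_measurable hF).
  by rewrite le_max lexx.
have mu_meas : measurable_fun setT (fun s => mu (clip 0 T s)).
  apply: (law_measurable hr (ltW hT) cXc mXc) => s A sT mA.
  have [[_ ->//] _] := lawX s sT; congr (P _).
  by apply/seteqP; split => w /=; rewrite segXc.
pose bb s x := b s x (mu s); pose BB s x := B s x (mu s).
have in_T s : 0 <= s <= t -> 0 <= s <= T by move=> /andP[-> h]; exact: le_trans tT.
have mb x i : pcont x -> measurable_fun `[0, t] (fun s => bb s (x s) i 0).
  exact: drift_b_measurable.
have mB x i : pcont x -> measurable_fun `[0, t] (fun s => BB s (seg r x s) i 0).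
  exact: drift_B_measurable.
have bN s x : 0 <= s <= t -> enorm (bb s x) <= Nd by move=> /in_T; exact: b_le.
have BN s x : 0 <= s <= t -> enorm (BB s x) <= Nd by move=> /in_T; exact: B_le.
have bphi s x y : 0 <= s <= t -> enorm (bb s x - bb s y) <= phi (enorm (x - y)).
  by move=> /in_T; exact: b_modulus.
have BK s x y : 0 <= s <= t -> enorm (BB s x - BB s y) <= K * snorm (x - y).
  by move=> /in_T; exact: B_modulus.
have [phi_ge0 phi_le _ _] := hphi.
have phi_cvg := dini_small hphi.
pose X' w : S := seg (r + t) (X ^~ w) t.
have X'E w s : - (r + t) <= s <= 0 -> X' w s = X (t + s) w.
  move=> sr; rewrite /X' segE ?in_itv/= ?sr//.
  by apply: within_sub (cX w) => //; lra.
have unX w s : - r <= s <= t -> unshift (X' w) s = X s w.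
  move=> /[dup] st /andP[s1 s2]; rewrite unshiftE// X'E; last by apply/andP; split; lra.
  by congr (X _ w); ring.
have segX w s : 0 <= s <= t -> seg r (unshift (X' w)) s = seg r (X ^~ w) s.
  move=> /[dup] st /andP[s1 s2]; rewrite -segXc ?in_T//.
  apply: segment_eq => v /[dup] vr /andP[v1 v2]; rewrite segP ?segP//; last exact: unshift_pcont.
  rewrite unX; last by apply/andP; split; lra.
  by rewrite /Xc clip_id//; apply/andP; split; have := tT; lra.
have mX s i : - (r + t) <= s <= 0 ->
    measurable_wrt (F (Num.max 0 (s + t))) (fun w => X' w s i 0).
  move=> /[dup] sr /andP[s1 s2].
  rewrite (_ : (fun w => _) = fun w => X (s + t) w i 0); last first.
    by apply/funext => w; rewrite X'E// addrC.
  by apply: evX; apply/andP; split; have := tT; lra.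
pose sg s := sigma s (mu s).
have msg i j : measurable_fun `[0, T] (fun s => sg s i j) by exact: sigma_law_measurable.
have usg s : 0 <= s <= T -> sg s \in unitmx.
  by move=> sT; apply: sigma_inv => //; exact: mu_P2.
have bsg s i j : 0 <= s <= T -> `|sg s i j| <= S0.
  by move=> sT; apply: le_trans (entry_le_opnorm _ _ _) _; apply: sigma_le => //; exact: mu_P2.
have isg s h : 0 <= s <= T -> enorm (invmx (sg s) *m h) <= sinv * enorm h.
  move=> sT; apply: le_trans (enorm_mulmx_le _ _) _; rewrite ler_wpM2r ?enorm_ge0//.
  by apply: sinv_le => //; exact: mu_P2.
pose nz lo hi w := noise lo hi M w.
have nz_shift lo hi a c h : 0 <= lo -> lo < hi -> hi <= t -> a < c ->
  [/\ measurable_wrt (F hi) (fun w => vramp (r + t) (nz lo hi w) a c),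
   indep_of P (F lo) (fun w => vramp (r + t) (nz lo hi w) a c) &
   shift_bound P (fun w => vramp (r + t) (nz lo hi w) a c) (vramp (r + t) h a c)
    (sinv ^+ 2 * enorm h ^+ 2 / (hi - lo))].
  move=> lo0 lohi hit ac; have hiT : hi <= T by exact: le_trans tT.
  have [h1 h2] := noise_shift rt0 hF hW lo0 lohi hiT msg usg bsg sinv0 isg itoX ac h.
  by split => //; exact: (noise_wrt rt0 hF lo0 lohi hiT itoX ac).
(* Subtracting the equation at [lo] from the equation at [hi] cancels the initial value. *)
have XE : {ae P, forall w, forall lo hi, 0 <= lo -> lo <= hi -> hi <= t ->
    unshift (X' w) hi - unshift (X' w) lo =
    drift bb BB (unshift (X' w)) (unshift (X' w)) lo hi + nz lo hi w}.
  apply: filterS eqX => w eqw lo hi lo0 lohi hit.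
  have hiT : 0 <= hi <= T by rewrite (le_trans lo0 lohi) (le_trans hit).
  have loT : 0 <= lo <= T by rewrite lo0 (le_trans lohi) ?(le_trans hit).
  have lor : - r <= lo by apply: le_trans lo0; rewrite oppr_le0 ltW.
  have loR : - r <= lo <= t by rewrite lor (le_trans lohi hit).
  have hiR : - r <= hi <= t by rewrite (le_trans lor lohi) hit.
  rewrite (unX w hi hiR) (unX w lo loR).
  have px := @unshift_pcont _ _ _ _ hr t0 (X' w).
  have bi i : bint `[0, hi] (fun s => bb s (X s w) i 0).
    split.
      apply: (@eq_measurable_fun _ _ R R `[0, hi]%classic (fun s => bb s (unshift (X' w) s) i 0)).
        move=> s; rewrite inE/= in_itv/= => /andP[s0 sh].
        by rewrite unX// (le_trans _ s0) ?(le_trans sh)// oppr_le0 ltW.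
      apply: measurable_funS (mb _ i px) => // s; rewrite /= !in_itv/= => /andP[-> sh].
      exact: le_trans hit.
    exists Nd => s; rewrite in_itv/= => /andP[s0 sh].
    by apply: le_trans (enorm_coord _ _) (bN _ _ _); rewrite s0 (le_trans sh).
  have Bi i : bint `[0, hi] (fun s => BB s (seg r (X ^~ w) s) i 0).
    split.
      apply: (@eq_measurable_fun _ _ R R `[0, hi]%classic (fun s => BB s (seg r (unshift (X' w)) s) i 0)).
        move=> s; rewrite inE/= in_itv/= => /andP[s0 sh].
        by rewrite segX// s0 (le_trans sh).
      apply: measurable_funS (mB _ i px) => // s; rewrite /= !in_itv/= => /andP[-> sh].
      exact: le_trans hit.
    exists Nd => s; rewrite in_itv/= => /andP[s0 sh].
    by apply: le_trans (enorm_coord _ _) (BN _ _ _); rewrite s0 (le_trans sh).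
  have subh : `[0, hi] `<=` (`[0, hi] : set R) by [].
  have subl : `]lo, hi] `<=` (`[0, hi] : set R).
    by move=> s; rewrite /= !in_itv/= => /andP[h1 ->]; rewrite (le_trans lo0 (ltW h1)).
  apply/matrixP => i j; rewrite !mxE (ord1 j) (eqw hi i hiT) (eqw lo i loT).
  have IBe (g : R -> R) : bint `[0, hi] g -> \int[lebesgue_measure]_(s in `[0, hi]) g s -
      \int[lebesgue_measure]_(s in `[0, lo]) g s = \int[lebesgue_measure]_(s in `]lo, hi]) g s.
    by move=> bg; apply: Rintegral_itvB; rewrite ?bnd_simp//; exact: (bint_int subh).
  have -> : \int[lebesgue_measure]_(s in `]lo, hi])
      drift_integrand bb BB (unshift (X' w)) (unshift (X' w)) s i 0 =
      \int[lebesgue_measure]_(s in `]lo, hi]) BB s (seg r (X ^~ w) s) i 0 +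
      \int[lebesgue_measure]_(s in `]lo, hi]) bb s (X s w) i 0.
    rewrite -(ID subl); [|exact: (bintS subl (Bi i))|exact: (bintS subl (bi i))].
    apply: eq_Rintegral => s; rewrite inE/= in_itv/= => /andP[h1 h2].
    have s0 : 0 <= s by exact: le_trans (ltW h1).
    rewrite /drift_integrand mxE addrC segX ?s0 ?(le_trans h2)// unX//.
    by rewrite (le_trans _ s0) ?(le_trans h2)// oppr_le0 ltW.
  rewrite -(IBe _ (Bi i)) -(IBe _ (bi i)) sumrB /bb /BB; ring.
(* [f] only looks at the last stretch of length [r], where [shift_path] equals [eta]. *)
pose f' (z : S) := f (restrict_segment z).
have lf' : lip01 f'.
  have [f01 [L L0 fL]] := lf; split => [z|]; first exact: f01.
  exists L => // z z'; apply: le_trans (fL _ _) _.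
  by rewrite ler_wpM2l// restrict_segment_le.
have X'res w : restrict_segment (X' w) = seg r (X ^~ w) t.
  apply: segment_eq => v /[dup] vr /andP[v1 v2]; rewrite restrict_segmentE//.
  have tt : 0 <= t <= T by rewrite tT (ltW t0).
  rewrite X'E; last by apply/andP; split; have := t0; lra.
  rewrite -segXc// segP// /Xc clip_id//; have := tT; have := rt; have := hr; move=> ? ? ?.
  by apply/andP; split; lra.
have X'eta w : restrict_segment (X' w + shift_path t eta) = seg r (X ^~ w) t + eta.
  apply: segment_eq => v vr; rewrite restrict_segmentE// !segmentD -X'res restrict_segmentE//.
  by rewrite (shift_path_end hr rt).
have := path_harnack hr t0 mb mB bN BN bphi BK phi_ge0 phi_le phi_cvg (ltW K0) hF mX nz_shift XE
  (@shift_path_past _ _ _ _ hr rt eta) (@shift_path_energy _ _ _ _ hr rt _ _ C1) p1 lf'.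
rewrite (_ : \int[P]_w f' (X' w) = \int[P]_w f (seg r (X ^~ w) t)); last first.
  by apply: eq_Rintegral => w _; rewrite /f' X'res.
rewrite (_ : \int[P]_w (f' (X' w + _) `^ p) = \int[P]_w (f (seg r (X ^~ w) t + eta) `^ p)); last first.
  by apply: eq_Rintegral => w _; rewrite /f' X'eta.
move=> /le_trans; apply; apply: ler_wpM2r; first by apply: Ege0 => w; exact: powR_ge0.
rewrite ler_expR; apply: ler_wpM2l.
  by rewrite divr_ge0 ?(ltW (lt_trans ltr01 p1))// mulr_ge0// subr_ge0 ltW.
rewrite /cost_bound /harnack_beta; apply: ler_wpM2l; first exact: sqr_ge0.
set g := snorm (shift_path t eta); set e := snorm eta.
have g0 : 0 <= g by apply: snorm_ge0; exact: ltW.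
have ge' : g <= e by exact: (shift_path_snorm hr rt).
have K1 : 1 <= K ^+ 2 by rewrite exprn_ege1// ltW.
have ph : phi (2 * g) <= phi (12 * K ^+ 2 * e).
  apply: phi_le; first by rewrite mulr_ge0.
  apply: ler_pM => //; lra.
have ph2 : phi (2 * g) ^+ 2 <= phi (12 * K ^+ 2 * e) ^+ 2.
  have pg0 : 0 <= phi (2 * g) by rewrite phi_ge0// mulr_ge0.
  by rewrite ler_sqr ?nnegrE// (le_trans pg0 ph).
have Kg : (K * (2 * g)) ^+ 2 <= 4 * K ^+ 2 * e ^+ 2.
  rewrite (_ : (K * (2 * g)) ^+ 2 = 4 * K ^+ 2 * g ^+ 2); last by ring.
  apply: ler_wpM2l; first by rewrite mulr_ge0// sqr_ge0.
  by rewrite ler_sqr// nnegrE (le_trans g0).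
set n2 := _ / (t - r); set I := Rintegral _ _ _.
have n20 : 0 <= n2 by rewrite divr_ge0 ?sqr_ge0// subr_ge0 ltW.
have I0 : 0 <= I by apply: Ige0 => s _; exact: sqr_ge0.
have C3 : 3 <= 12 * K ^+ 2 by lra.
rewrite !mulrDr.
have a1 : 3 * n2 <= 12 * K ^+ 2 * n2 by rewrite ler_wpM2r.
have a2 : 3 * I <= 12 * K ^+ 2 * I by rewrite ler_wpM2r.
have a3 : 3 * (t * phi (2 * g) ^+ 2) <= 12 * K ^+ 2 * t * phi (12 * K ^+ 2 * e) ^+ 2.
  rewrite -(mulrA (12 * K ^+ 2)); apply: ler_pM => //; first by rewrite mulr_ge0 ?sqr_ge0// ltW.
  by rewrite ler_wpM2l// ltW.
have a4 : 3 * (t * (K * (2 * g)) ^+ 2) <= 12 * K ^+ 2 * t * e ^+ 2.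
  rewrite (_ : 12 * K ^+ 2 * t * e ^+ 2 = 3 * (t * (4 * K ^+ 2 * e ^+ 2))); last by ring.
  by rewrite ler_wpM2l// ler_wpM2l// ltW.
by apply: lerD => //; apply: lerD => //; apply: lerD.
Qed.

End Equation.

Section Bounded_functions.
Context (R : realType) (dO : measure_display) (Omega : measurableType dO).
Context (P : probability Omega R).

(** Tangent of [ln] at the mean [m]: [ln y <= ln m - 1 + y / m]. *)
Lemma ln_jensen (Y : Omega -> R) (M : R) : measurable_fun setT Y ->
  (forall w, 1 <= Y w <= M) -> \int[P]_w ln (Y w) <= ln (\int[P]_w Y w).
Proof.
move=> mY Y1; have Y0 w : 0 < Y w by have /andP[h _] := Y1 w; exact: lt_le_trans h.
have bY : bdm Y.
  by apply: (@bdm_ge0 _ _ _ _ M) => // w; [exact: ltW|have /andP[] := Y1 w].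
have blY : bdm (fun w => ln (Y w)).
  apply: (@bdm_ge0 _ _ _ _ (ln M)) => [|w|w].
  - exact: (measurableT_comp (@measurable_ln R)).
  - by apply: ln_ge0; have /andP[] := Y1 w.
  - by have /andP[h1 h2] := Y1 w; rewrite ler_ln ?posrE// (lt_le_trans _ h2).
set m := \int[P]_w Y w.
have m1 : 1 <= m.
  rewrite -(Ecst P 1); apply: Ele => //; first exact: bdm_cst.
  by move=> w; have /andP[] := Y1 w.
have m0 : 0 < m by exact: lt_le_trans m1.
apply: (@le_trans _ _ (\int[P]_w ((ln m - 1) + m^-1 * Y w))).
  apply: Ele => // [|w].
    by apply: bdmD; [exact: bdm_cst|apply: bdmM => //; exact: bdm_cst].
  have ym : 0 < m^-1 * Y w by rewrite mulr_gt0 ?invr_gt0.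
  have -> : Y w = m * (m^-1 * Y w) by rewrite mulVKf// gt_eqF.
  rewrite lnM ?posrE// mulVKf ?gt_eqF// -addrA lerD2l addrC.
  by rewrite -(subrK 1 (m^-1 * Y w)) [in leLHS]addrC addrK; apply: le_ln1Dx; lra.
rewrite ED ?Ecst ?EZ//; first by rewrite mulVf ?gt_eqF// subrK.
  exact: bdm_cst.
by apply: bdmM => //; exact: bdm_cst.
Qed.

End Bounded_functions.

(** Both sides are homogeneous of degree [p] in [f], which is therefore rescaled into [0, 1]. *)
Lemma bounded_harnack (R : realType) (r : R) (d : nat) (dO : measure_display)
    (Omega : measurableType dO) (P : probability Omega R) (X Y : Omega -> segment r d)
    (p k : R) (f : segment r d -> R) : 0 < r -> 1 < p -> 0 <= k ->
  measurable_fun setT X -> measurable_fun setT Y ->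
  (forall v, lip01 v -> (\int[P]_w v (X w)) `^ p <= k * \int[P]_w (v (Y w) `^ p)) ->
  Bb_plus f -> (\int[P]_w f (X w)) `^ p <= k * \int[P]_w (f (Y w) `^ p).
Proof.
move=> r0 p1 k0 mX mY H [mf [M fM] f0]; have p0 : 0 <= p by rewrite ltW// (lt_trans _ p1).
pose m := `|M| + 1; have m0 : 0 < m by rewrite ltr_wpDl.
pose u x := m^-1 * f x.
have hu : unit_fun u.
  split; first exact: measurable_funM.
  move=> x; rewrite /u mulr_ge0 ?invr_ge0 ?(ltW m0)//= mulrC ler_pdivrMr// mul1r.
  by apply: le_trans (fM x) _; apply: le_trans (ler_norm M) _; rewrite lerDl.
have fE x : f x = m * u x by rewrite /u mulVKf// gt_eqF.
have := lip_to_unit_powR r0 p1 k0 mX mY H hu => Hu.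
have bX : bdm (fun w => u (X w)) by exact: unit_bdm.
have bY : bdm (fun w => u (Y w) `^ p) by exact: unit_powR_bdm.
have u0 x : 0 <= u x by have /andP[] := hu.2 x.
rewrite (_ : \int[P]_w f (X w) = m * \int[P]_w u (X w)); last first.
  by rewrite -EZ//; apply: eq_Rintegral => w _; rewrite fE.
rewrite (_ : \int[P]_w (f (Y w) `^ p) = m `^ p * \int[P]_w (u (Y w) `^ p)); last first.
  by rewrite -EZ//; apply: eq_Rintegral => w _; rewrite fE powRM// ltW.
rewrite powRM ?(ltW m0)//; last by apply: Ege0.
by rewrite mulrCA ler_wpM2l// powR_ge0.
Qed.

Theorem theorem2p3
    (R : realType) (d : nat) (r T : R)
    (dO : measure_display) (Omega : measurableType dO)
    (P : probability Omega R) (F : R -> set (set Omega))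
    (W : R -> Omega -> 'cV[R]_d)
    (sigma : R -> pprobability (segment r d) R -> 'M[R]_d)
    (b : R -> 'cV[R]_d -> pprobability (segment r d) R -> 'cV[R]_d)
    (B : R -> segment r d -> pprobability (segment r d) R -> 'cV[R]_d)
    (K : R) (phi : R -> R)
    (hd : (0 < d)%N) (hr : 0 < r) (hT : 0 < T)
    (hF : complete_filtration P F) (hW : brownian_motion P F W)
    (sigma_meas : forall i j,
       measurable_fun (`[0, T]%classic `*` @P2 R r d)
         (fun u : R * pprobability (segment r d) R => sigma u.1 u.2 i j))
    (sigma_inv : forall (t : R) mu, 0 <= t <= T -> P2 mu -> sigma t mu \in unitmx)
    (sigma_bnd :
       (unorm (`[0%R, T]%classic `*` @P2 R r d)
          (fun u => opnorm (sigma u.1 u.2)) +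
        unorm (`[0%R, T]%classic `*` @P2 R r d)
          (fun u => opnorm (invmx (sigma u.1 u.2))) < +oo)%E)
    (b_meas : forall i,
       measurable_fun (`[0, T]%classic `*` setT `*` setT)
         (fun u : R * borelV R d * pprobability (segment r d) R =>
            b u.1.1 u.1.2 u.2 i 0))
    (B_meas : forall i,
       measurable_fun (`[0, T]%classic `*` setT `*` setT)
         (fun u : R * segment r d * pprobability (segment r d) R =>
            B u.1.1 u.1.2 u.2 i 0))
    (bB_bnd :
       (unorm (`[0%R, T]%classic `*` setT `*` setT)
          (fun u => enorm (b u.1.1 u.1.2 u.2)) +
        unorm (`[0%R, T]%classic `*` setT `*` setT)
          (fun u => enorm (B u.1.1 u.1.2 u.2)) < +oo)%E)
    (hK : 1 < K) (hphi : dini_class phi)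
    (b_reg : forall (t : R) x y mu nu, 0 <= t <= T -> P2 mu -> P2 nu ->
       ((enorm (b t x mu - b t y nu))%:E <=
        (phi (enorm (x - y)))%:E + K%:E * W2 mu nu)%E)
    (B_reg : forall (t : R) xi xi' mu nu, 0 <= t <= T -> P2 mu -> P2 nu ->
       ((enorm (B t xi mu - B t xi' nu))%:E <=
        K%:E * ((snorm (xi - xi'))%:E + W2 mu nu))%E)
    (hwp : well_posed P F T W B b sigma) :
  let Pt := semigroup P F T W B b sigma in
  let sinv := fine (unorm (`[0%R, T]%classic `*` @P2 R r d)
                      (fun u => opnorm (invmx (sigma u.1 u.2)))) in
  exists2 C : R, 0 < C &
    (forall (p t : R) (mu0 : pprobability (segment r d) R)
        (eta : segment r d) (deta : R -> 'cV[R]_d) (f : segment r d -> R),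
      1 < p -> r < t <= T -> P2 mu0 -> is_C1 eta deta -> Bb_plus f ->
      Pt t f mu0 `^ p <=
      Pt t (fun xi => f (eta + xi) `^ p) mu0 *
      expR (p / (2 * (p - 1)) * harnack_beta sinv phi C t eta deta)) /\
    (forall (t : R) (mu0 : pprobability (segment r d) R)
        (eta : segment r d) (deta : R -> 'cV[R]_d) (f : segment r d -> R),
      r < t <= T -> P2 mu0 -> is_C1 eta deta -> Bb_plus f ->
      (forall xi, 1 <= f xi) ->
      Pt t (fun xi => ln (f xi)) mu0 <=
      ln (Pt t (fun xi => f (eta + xi)) mu0) +
      harnack_beta sinv phi C t eta deta).
Proof.
move=> Pt sinv.
pose D : set (R * pprobability (segment r d) R) := `[0%R, T]%classic `*` @P2 R r d.
pose Db : set (R * 'cV[R]_d * pprobability (segment r d) R) := `[0%R, T]%classic `*` setT `*` setT.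
pose DB : set (R * segment r d * pprobability (segment r d) R) := `[0%R, T]%classic `*` setT `*` setT.
pose C := 12 * K ^+ 2.
have C0 : 0 < C by rewrite mulr_gt0// exprn_gt0// (lt_trans ltr01 hK).
have T00 : `[0%R, T]%classic (0 : R) by rewrite /= in_itv/= lexx ltW.
have main (t : R) mu0 : r < t <= T -> P2 mu0 ->
    [/\ measurable_fun setT (fun w => seg r (sde_solution P F T W B b sigma mu0 ^~ w) t) &
     forall (p : R) (eta : segment r d) deta f, 1 < p -> is_C1 eta deta -> Bb_plus f ->
      Pt t f mu0 `^ p <= Pt t (fun xi => f (eta + xi) `^ p) mu0 *
        expR (p / (2 * (p - 1)) * harnack_beta sinv phi C t eta deta)].
  move=> /andP[rt tT] mu0P2.
  have [[X0 hX0] _] := hwp mu0 mu0P2.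
  (* Well-posedness provides a solution, so [xget] returns one and not the default path. *)
  have [hX _] : solution_from P F T W B b sigma mu0 (sde_solution P F T W B b sigma mu0).
    by rewrite /sde_solution; apply: xgetPex; exists X0.
  set X := sde_solution _ _ _ _ _ _ _ _ in hX *.
  have t0 : 0 < t := lt_trans hr rt.
  have mX : measurable_fun setT (fun w => seg r (X ^~ w) t).
    have [mu [M [_ adX _ _ _]]] := hX.
    apply: (measurable_wrt_fun (filtration_measurable hF (ltW t0))).
    by apply: adX; rewrite (ltW t0).
  split => // p eta deta f p1 C1 bf.
  have d0 : D (0, mu0) by split.
  have nS : (-oo < unorm D (fun u => opnorm (sigma u.1 u.2)))%E by exact: unorm_gtNy d0.
  have nI : (-oo < unorm D (fun u => opnorm (invmx (sigma u.1 u.2))))%E by exact: unorm_gtNy d0.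
  have sigma_le s mu : 0 <= s <= T -> P2 mu ->
      opnorm (sigma s mu) <= fine (unorm D (fun u => opnorm (sigma u.1 u.2))).
    move=> sT mP; apply: (@unorm_le _ _ D (fun u => opnorm (sigma u.1 u.2)) _ (s, mu) sigma_bnd nI).
    by split => //=; rewrite in_itv.
  have sinv_le s mu : 0 <= s <= T -> P2 mu -> opnorm (invmx (sigma s mu)) <= sinv.
    move=> sT mP; have bnd' := sigma_bnd; rewrite addeC in bnd'.
    apply: (@unorm_le _ _ D (fun u => opnorm (invmx (sigma u.1 u.2))) _ (s, mu) bnd' nS).
    by split => //=; rewrite in_itv.
  (* An operator norm dominates the absolute value of an entry, and an entry exists because
     [0 < d]. *)
  have sinv0 : 0 <= sinv.
    have T0 : 0 <= (0 : R) <= T by rewrite lexx ltW.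
    apply: le_trans (sinv_le _ _ T0 mu0P2).
    exact: le_trans (normr_ge0 _) (entry_le_opnorm _ (Ordinal hd) (Ordinal hd)).
  pose Nb := fine (unorm Db (fun u => enorm (b u.1.1 u.1.2 u.2))).
  pose NB := fine (unorm DB (fun u => enorm (B u.1.1 u.1.2 u.2))).
  have nb : (-oo < unorm Db (fun u => enorm (b u.1.1 u.1.2 u.2)))%E.
    by apply: (@unorm_gtNy _ _ _ _ ((0, 0), mu0)).
  have nB : (-oo < unorm DB (fun u => enorm (B u.1.1 u.1.2 u.2)))%E.
    by apply: (@unorm_gtNy _ _ _ _ ((0, 0), mu0)).
  have b_le s x mu : 0 <= s <= T -> enorm (b s x mu) <= Num.max Nb NB.
    move=> sT; rewrite le_max; apply/orP; left.
    apply: (@unorm_le _ _ Db (fun u => enorm (b u.1.1 u.1.2 u.2)) _ ((s, x), mu) bB_bnd nB).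
    by do 2!split => //=; rewrite in_itv.
  have B_le s x mu : 0 <= s <= T -> enorm (B s x mu) <= Num.max Nb NB.
    move=> sT; rewrite le_max; apply/orP; right; have bnd' := bB_bnd; rewrite addeC in bnd'.
    apply: (@unorm_le _ _ DB (fun u => enorm (B u.1.1 u.1.2 u.2)) _ ((s, x), mu) bnd' nb).
    by do 2!split => //=; rewrite in_itv.
  have mXe : measurable_fun setT (fun w => seg r (X ^~ w) t + eta) by apply: segmentD_measurable.
  have := bounded_harnack hr p1 (expR_ge0 _) mX mXe (fun v lv => solution_lip_harnack hr hT hF hW
    sigma_meas sigma_inv b_meas B_meas sigma_le sinv_le sinv0 b_le B_le hK hphi b_reg B_reg hX
    rt tT C1 p1 lv) bf.
  rewrite mulrC => /le_trans; apply; rewrite le_eqVlt; apply/orP; left; apply/eqP.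
  by congr (_ * _); apply: eq_Rintegral => w _; rewrite addrC.
exists C => //; split.
  by move=> p t mu0 eta deta f p1 rtT P2mu C1 bf; have [_] := main t mu0 rtT P2mu; exact.
move=> t mu0 eta deta f rtT P2mu C1 [mf [M fM] f0] f1.
have [mX H] := main t mu0 rtT P2mu.
have f00 x : 0 < f x by exact: lt_le_trans (f1 x).
pose g x := Num.sqrt (f x).
have gg x : g x ^+ 2 = f x by rewrite /g sqr_sqrtr.
have g1 x : 1 <= g x by rewrite -[1]sqrtr1 ler_sqrt.
have mg : measurable_fun setT g by exact: (measurableT_comp (continuous_measurable_fun (@sqrt_continuous R))).
have bg : Bb_plus g.
  split => //; last by move=> x; exact: sqrtr_ge0.
  by exists (Num.sqrt M) => x; rewrite ler_sqrt// (le_trans _ (fM x)).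
(* With exponent 2 the factor [p / (2 * (p - 1))] is 1, and the power on the right restores [f]. *)
have := H 2 eta deta g ltac:(by rewrite ltr1n) C1 bg.
rewrite (_ : 2 / (2 * (2 - 1)) = 1 :> R); last by field.
rewrite mul1r /Pt /semigroup.
set X := sde_solution _ _ _ _ _ _ _ _ in mX *; set bet := harnack_beta _ _ _ _ _ _.
have -> : \int[P]_w (g (eta + seg r (X ^~ w) t) `^ 2) = \int[P]_w f (eta + seg r (X ^~ w) t).
  by apply: eq_Rintegral => w _; rewrite powR_mulrn ?gg// sqrtr_ge0.
have mXe : measurable_fun setT (fun w => eta + seg r (X ^~ w) t) by apply: segmentD_measurable.
have ge1 (h : segment r d -> R) (Y : Omega -> segment r d) (M' : R) : measurable_fun setT h ->
    measurable_fun setT Y -> (forall x, 1 <= h x) -> (forall x, h x <= M') -> 1 <= \int[P]_w h (Y w).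
  move=> mh mY h1 hM; rewrite -(Ecst P 1); apply: Ele => //; first exact: bdm_cst.
  apply: (@bdm_ge0 _ _ _ _ M') => //; first exact: (measurableT_comp mh).
  by move=> w; exact: le_trans (h1 _).
have g_M x : g x <= Num.sqrt M by rewrite ler_sqrt// (le_trans _ (fM x)).
have Ig1 : 1 <= \int[P]_w g (seg r (X ^~ w) t) by exact: (ge1 g _ (Num.sqrt M)).
have If1 : 1 <= \int[P]_w f (eta + seg r (X ^~ w) t) by exact: (ge1 f _ M).
have Ig0 : 0 < \int[P]_w g (seg r (X ^~ w) t) by exact: lt_le_trans Ig1.
have If0 : 0 < \int[P]_w f (eta + seg r (X ^~ w) t) by exact: lt_le_trans If1.
rewrite powR_mulrn ?(ltW Ig0)// => Hg.
(* The logarithm of the power inequality; since [ln f] is twice [ln g], Jensen's inequality for [g]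
   then concludes. *)
have lng : ln (\int[P]_w g (seg r (X ^~ w) t)) *+ 2 <=
    ln (\int[P]_w f (eta + seg r (X ^~ w) t)) + bet.
  rewrite -lnXn// -[bet]expRK -lnM ?posrE ?expR_gt0//.
  by rewrite ler_ln ?posrE ?exprn_gt0 ?mulr_gt0 ?expR_gt0.
apply: le_trans lng.
have jen := @ln_jensen _ _ _ P (fun w => g (seg r (X ^~ w) t)) (Num.sqrt M).
have {}jen := jen (measurableT_comp mg mX) (fun w => ltac:(by rewrite g1 g_M)).
apply: (@le_trans _ _ ((\int[P]_w ln (g (seg r (X ^~ w) t))) *+ 2)); last by rewrite lerMn2r jen.
rewrite -mulr_natl -EZ; last first.
  apply: (@bdm_ge0 _ _ _ _ (ln (Num.sqrt M))) => [|w|w].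
  - by apply: (measurableT_comp (@measurable_ln R)); exact: (measurableT_comp mg).
  - exact: ln_ge0.
  - have h0 : 0 < g (seg r (X ^~ w) t) by exact: lt_le_trans (g1 _).
    by rewrite ler_ln ?posrE// (lt_le_trans h0).
rewrite le_eqVlt; apply/orP; left; apply/eqP; apply: eq_Rintegral => w _.
have h0 : 0 < g (seg r (X ^~ w) t) by exact: lt_le_trans (g1 _).
by rewrite -gg lnXn// mulr_natl.
Qed.
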